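(* Let $E\in\mathscr K$ with endpoints $l=\inf E$, $r=\sup E$, let $\mu$ be a fully supported Radon measure on $E$, and let $({\mathscr E},{\mathscr F})$ be the regular Dirichlet form on $L^2(E,\mu)$ of a quasidiffusion on $E$: \[ {\mathscr F}=\{f\in L^2(E,\mu)\cap H^1_e(E): f(j)=0 \text{ whenever } j\notin E \text{ and } |j|<\infty \text{ for } j=l \text{ or } r\}, \] \[ {\mathscr E}(f,g)=\frac12\int_E f'(x)g'(x)\,dx+\frac12\sum_{k\ge1}\frac{(f(b_k)-f(a_k))(g(b_k)-g(a_k))}{b_k-a_k}. \] Then a bilinear form $({\mathscr E}',{\mathscr F}')$ is a Fukushima subspace of $({\mathscr E},{\mathscr F})$ if and only if there is $\mathbf s\in\mathscr S$ such that \[ {\mathscr F}'=\{f\in L^2(E,\mu)\cap H^1_{e,\mathbf s}(E): f(j)=0 \text{ whenever } j\notin E \text{ and } |\mathbf s(j)|<\infty \text{ for } j=l \text{ or } r\}, \] \[ {\mathscr E}'(f,g)=\frac12\int_E \frac{df}{d\mathbf s}\frac{dg}{d\mathbf s}\,d\mathbf s+\frac12\sum_{k\ge1}\frac{(f(b_k)-f(a_k))(g(b_k)-g(a_k))}{\mathbf s(b_k)-\mathbf s(a_k)},\quad f,g\in{\mathscr F}'. \]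
   Context: $\mathscr K$ denotes the family of sets $E\subset\mathbb R$ such that $E\cup\{l,r\}$ is closed in $[-\infty,\infty]$, where $l=\inf E$, $r=\sup E$; assume $l<r$. $I$ is the interval with endpoints $l,r$ containing $l$ (resp. $r$) iff $l\in E$ (resp. $r\in E$); $I\setminus E=\bigcup_{k\ge1}(a_k,b_k)$ (disjoint open intervals). $H^1_e(E)$ is the set of restrictions to $E$ of absolutely continuous $f$ on $(l,r)$ with $f'\in L^2((l,r))$; $f(j)$ at an endpoint means the limit. For a continuous strictly increasing $\mathbf s$ on $E$, its extended scale function $\bar{\mathbf s}$ on $[l,r]$ equals $\mathbf s$ on $E$, is linear on each $(a_k,b_k)$ with $\bar{\mathbf s}(x)=\mathbf s(a_k)+\frac{\mathbf s(b_k)-\mathbf s(a_k)}{b_k-a_k}(x-a_k)$, and $\bar{\mathbf s}(l)=\lim_{x\downarrow l}\mathbf s(x)$, $\bar{\mathbf s}(r)=\lim_{x\uparrow r}\mathbf s(x)$. $d\bar{\mathbf s}$ is its Lebesgue–Stieltjes measure and $d\mathbf s$ its restriction to $E$. For $f\in C(I)$, $f\ll\bar{\mathbf s}$ means $f=g\circ\bar{\mathbf s}$ with $g$ absolutely continuous on $\bar{\mathbf s}(I)$, and $df/d\bar{\mathbf s}:=g'\circ\bar{\mathbf s}$. $H^1_{e,\mathbf s}(E)=\{f|_E: f\in C(I), f\ll\bar{\mathbf s}, df/d\bar{\mathbf s}\in L^2(I,d\bar{\mathbf s})\}$ and for $h=f|_E$, $dh/d\mathbf s:=(df/d\bar{\mathbf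 s})|_E$. $\mathscr S$ is the set of functions $\mathbf s=\bar{\mathbf s}|_E$ where $\bar{\mathbf s}$ (the extended scale function of $\mathbf s$) is strictly increasing and absolutely continuous with $\bar{\mathbf s}'\in\{0,1\}$ a.e. and $\bar{\mathbf s}'(x)=1$ for all $x\in I\setminus E$. A Fukushima subspace of $({\mathscr E},{\mathscr F})$ is a regular Dirichlet form $({\mathscr E}',{\mathscr F}')$ on $L^2(E,\mu)$ with ${\mathscr F}'\subset{\mathscr F}$ and ${\mathscr E}'={\mathscr E}$ on ${\mathscr F}'\times{\mathscr F}'$. *)

(* Defs.v *)
From HB Require Import structures.
From mathcomp Require Import all_boot all_order all_algebra.
From mathcomp Require Import all_classical all_reals all_analysis.
Import Order.TTheory GRing.Theory Num.Theory numFieldNormedType.Exports.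
Set Implicit Arguments. Unset Strict Implicit. Unset Printing Implicit Defensive.
Local Open Scope ring_scope.
Local Open Scope classical_set_scope.

Section QD.
Variable R : realType.
Implicit Types (E : set R) (f g : R -> R).

Notation Bmeasure := {measure set (measurableTypeR R) -> \bar R}.

Definition lend E : \bar R := ereal_inf [set x%:E | x in E].
Definition rend E : \bar R := ereal_sup [set x%:E | x in E].

Definition in_K E : Prop :=
  closed ([set x%:E | x in E] `|` [set lend E; rend E]) /\ (lend E < rend E)%E.

Definition oitv E : set R := [set x | (lend E < x%:E < rend E)%E].

(* I : endpoints l, r; contains l (resp. r) iff l (resp. r) belongs to E *)
Definition Itv E : set R := oitv E `|` E.

(* gaps (a_k,b_k): connected components of I \ E, encoded by their endpoints *)
Definition gaps E : set (R * R) :=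
  [set p | E p.1 /\ E p.2 /\ p.1 < p.2 /\ (forall x, p.1 < x < p.2 -> ~ E x)].

(* sum over k >= 1 of h(a_k,b_k) (an absolutely convergent series; the sum
   is taken as sum of positive parts minus sum of negative parts) *)
Definition gap_sum E (h : R * R -> R) : R :=
  fine (\esum_(p in gaps E) (Num.max (h p) 0)%:E)
  - fine (\esum_(p in gaps E) (Num.max (- h p) 0)%:E).

Definition lfilter (l : \bar R) : set_system R :=
  match l with EFin a => at_right a | _ => ninfty_nbhs R end.
Definition rfilter (r : \bar R) : set_system R :=
  match r with EFin b => at_left b | _ => pinfty_nbhs R end.

Definition ebar_in E (j : \bar R) : Prop := exists a, j = a%:E /\ E a.

Definition abs_cont_on (A : set R) f : Prop :=
  forall a b, a <= b -> `[a, b] `<=` A ->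
  forall e : R, 0 < e -> exists2 d : R, 0 < d &
    forall (n : nat) (u v : 'I_n -> R),
      (forall i, a <= u i /\ u i <= v i /\ v i <= b) ->
      (forall i j, i != j -> v i <= u j \/ v j <= u i) ->
      \sum_(i < n) (v i - u i) < d ->
      \sum_(i < n) `|f (v i) - f (u i)| < e.

Definition L2 (mu : Bmeasure) (A : set R) f : Prop :=
  measurable_fun A f /\ (\int[mu]_(x in A) ((f x) ^+ 2)%:E < +oo)%E.

Definition ae_eq (mu : Bmeasure) f g : Prop := {ae mu, forall x, f x = g x}.

Definition radon_full_support E (mu : Bmeasure) : Prop :=
  mu (~` E) = 0%E /\
  (forall K, compact K -> K `<=` E -> (mu K < +oo)%E) /\
  (forall (U : set R) x, open U -> U x -> E x -> (0 < mu (U `&` E))%E).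

(* fe is an admissible continuous representative: fe|_E is in H^1_e(E),
   L^2(E,mu), with the boundary conditions of F *)
Definition qd_rep E (mu : Bmeasure) fe : Prop :=
  {within Itv E, continuous fe} /\
  abs_cont_on (oitv E) fe /\
  lebesgue_measure.-integrable (oitv E) (fun x => ((derive1 fe x) ^+ 2)%:E) /\
  L2 mu setT fe /\
  ((~ ebar_in E (lend E)) -> (lend E \is a fin_num) -> fe @ lfilter (lend E) --> 0) /\
  ((~ ebar_in E (rend E)) -> (rend E \is a fin_num) -> fe @ rfilter (rend E) --> 0).

Definition qdF E (mu : Bmeasure) : set (R -> R) :=
  [set h | L2 mu setT h /\ exists fe, qd_rep E mu fe /\ ae_eq mu h fe].

Definition qd_formula E (fe ge : R -> R) : R :=
  2^-1 * fine (\int[lebesgue_measure]_(x in E) (derive1 fe x * derive1 ge x)%:E)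
  + 2^-1 * gap_sum E (fun p =>
      (fe p.2 - fe p.1) * (ge p.2 - ge p.1) / (p.2 - p.1)).

Definition qd_pick E (mu : Bmeasure) h : R -> R :=
  xget (fun _ => 0) [set fe | qd_rep E mu fe /\ ae_eq mu h fe].

Definition qdE E (mu : Bmeasure) h k : R :=
  qd_formula E (qd_pick E mu h) (qd_pick E mu k).

Definition L2dist2 (mu : Bmeasure) f g : R :=
  fine (\int[mu]_x ((f x - g x) ^+ 2)%:E).

Definition E1 (mu : Bmeasure) (Ef : (R -> R) -> (R -> R) -> R) f : R :=
  Ef f f + fine (\int[mu]_x ((f x) ^+ 2)%:E).

Definition Cc E f : Prop :=
  {within E, continuous f} /\
  exists K, compact K /\ K `<=` E /\ (forall x, E x -> ~ K x -> f x = 0).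

Definition regular_dirichlet_form E (mu : Bmeasure)
    (F : set (R -> R)) (Ef : (R -> R) -> (R -> R) -> R) : Prop :=
  (* F is a set of L^2(E,mu)-classes and Ef is defined on classes *)
  (forall f, F f -> L2 mu setT f) /\
  (forall f g, F f -> L2 mu setT g -> ae_eq mu f g -> F g) /\
  (forall f f' g g', F f -> F f' -> F g -> F g' -> ae_eq mu f f' -> ae_eq mu g g' ->
     Ef f g = Ef f' g') /\
  F (fun _ => 0) /\
  (forall f g, F f -> F g -> F (f \+ g)) /\
  (forall (c : R) f, F f -> F (fun x => c * f x)) /\
  (forall h, L2 mu setT h -> forall e : R, 0 < e ->
     exists2 f, F f & L2dist2 mu h f < e) /\
  (forall f g, F f -> F g -> Ef f g = Ef g f) /\
  (forall (c : R) f g h, F f -> F g -> F h ->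
     Ef (fun x => c * f x + g x) h = c * Ef f h + Ef g h) /\
  (forall f, F f -> 0 <= Ef f f) /\
  (forall u : nat -> R -> R, (forall n, F (u n)) ->
     (forall e : R, 0 < e -> exists N, forall m n, (N <= m)%N -> (N <= n)%N ->
        E1 mu Ef (u n \- u m) < e) ->
     exists2 f, F f & (fun n => E1 mu Ef (u n \- f)) @ \oo --> 0) /\
  (forall f, F f ->
     let v := fun x => Num.min (Num.max (f x) 0) 1 in F v /\ Ef v v <= Ef f f) /\
  (forall f, F f -> forall e : R, 0 < e ->
     exists2 g, F g /\ Cc E g & E1 mu Ef (f \- g) < e) /\
  (forall h, Cc E h -> forall e : R, 0 < e ->
     exists2 g, F g /\ Cc E g & forall x, E x -> `|h x - g x| < e).

Definition fukushima_subspace E (mu : Bmeasure)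
    (F : set (R -> R)) (Ef : (R -> R) -> (R -> R) -> R)
    (F' : set (R -> R)) (Ef' : (R -> R) -> (R -> R) -> R) : Prop :=
  regular_dirichlet_form E mu F' Ef' /\ F' `<=` F /\
  (forall f g, F' f -> F' g -> Ef' f g = Ef f g).

(* extended scale function sbar of s : E -> R (values of s off E irrelevant) *)
Definition sbar_l E (s : R -> R) : \bar R := ereal_inf [set (s x)%:E | x in E].
Definition sbar_r E (s : R -> R) : \bar R := ereal_sup [set (s x)%:E | x in E].

Definition sbar E (s : R -> R) (x : R) : R :=
  if pselect (E x) is left _ then s x
  else if pselect (oitv E x) is left _ then
    let a := sup [set y | E y /\ y < x] in
    let b := inf [set y | E y /\ x < y] in
    s a + (s b - s a) / (b - a) * (x - a)
  else if pselect (x%:E <= lend E)%E is left _ then fine (sbar_l E s)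
  else fine (sbar_r E s).

Definition in_S E (s : R -> R) : Prop :=
  {within E, continuous s} /\ {in E &, {mono s : x y / x < y}} /\
  {in Itv E &, {mono sbar E s : x y / x < y}} /\
  abs_cont_on (Itv E) (sbar E s) /\
  {ae lebesgue_measure, forall x, Itv E x ->
     derivable (sbar E s) x 1 /\ (derive1 (sbar E s) x = 0 \/ derive1 (sbar E s) x = 1)} /\
  (forall x, Itv E x -> ~ E x -> derivable (sbar E s) x 1 /\ derive1 (sbar E s) x = 1).

(* a cumulative function packaging a nondecreasing continuous h
   (identity otherwise; only used when h is nondecreasing and continuous) *)
Definition mk_cumul (h : R -> R) : cumulative R R :=
  match pselect ({homo h : x y / x <= y} /\ continuous h) with
  | left H => HB.pack_for (cumulative R R) h
       (isCumulative.Build R _ R h (proj1 H) (right_continuousW (proj2 H)))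
  | right _ => @idfun R
  end.

Definition dsbar E (s : R -> R) := lebesgue_stieltjes_measure (mk_cumul (sbar E s)).

(* (fe, g) is an admissible representative of the target space F'_s:
   fe in C(I), fe = g o sbar on I with g abs. continuous on sbar(I),
   dfe/dsbar = g' o sbar in L^2(I, d sbar), fe in L^2(E,mu), boundary conditions *)
Definition s_rep E (mu : Bmeasure) (s : R -> R) (p : (R -> R) * (R -> R)) : Prop :=
  let fe := p.1 in let g := p.2 in
  {within Itv E, continuous fe} /\
  abs_cont_on (sbar E s @` Itv E) g /\
  (forall x, Itv E x -> fe x = g (sbar E s x)) /\
  (dsbar E s).-integrable (Itv E) (fun x => ((derive1 g (sbar E s x)) ^+ 2)%:E) /\
  L2 mu setT fe /\
  ((~ ebar_in E (lend E)) -> (sbar_l E s \is a fin_num) -> fe @ lfilter (lend E) --> 0) /\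
  ((~ ebar_in E (rend E)) -> (sbar_r E s \is a fin_num) -> fe @ rfilter (rend E) --> 0).

Definition sF E (mu : Bmeasure) (s : R -> R) : set (R -> R) :=
  [set h | L2 mu setT h /\ exists p, s_rep E mu s p /\ ae_eq mu h p.1].

Definition s_pick E (mu : Bmeasure) (s : R -> R) h : (R -> R) * (R -> R) :=
  xget ((fun _ => 0), (fun _ => 0)) [set p | s_rep E mu s p /\ ae_eq mu h p.1].

Definition s_formula E (s : R -> R) (p q : (R -> R) * (R -> R)) : R :=
  2^-1 * fine (\int[dsbar E s]_(x in E)
                 (derive1 p.2 (sbar E s x) * derive1 q.2 (sbar E s x))%:E)
  + 2^-1 * gap_sum E (fun ab =>
      (p.1 ab.2 - p.1 ab.1) * (q.1 ab.2 - q.1 ab.1) / (s ab.2 - s ab.1)).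

Definition sE E (mu : Bmeasure) (s : R -> R) h k : R :=
  s_formula E s (s_pick E mu s h) (s_pick E mu s k).

End QD.

(* Main.v *)
Require Import Defs.
From HB Require Import structures.
From mathcomp Require Import all_boot all_order all_algebra.
From mathcomp Require Import all_classical all_reals all_analysis.
From mathcomp Require Import measurable_realfun ring lra.
Import Order.TTheory GRing.Theory Num.Theory numFieldNormedType.Exports.
Set Implicit Arguments. Unset Strict Implicit. Unset Printing Implicit Defensive.
Local Open Scope ring_scope.
Local Open Scope classical_set_scope.

(* For f on E and an increasing s, let Q_s(f) be the supremum over finite chains
   x_0 < ... < x_n in E of the sums of (f x_{i+1} - f x_i)^2 / (s x_{i+1} - s x_i).
   Integrating the squared derivative of the interpolation of f across the gaps shows
   that the form of the quasidiffusion is Q_id / 2; the image of E under s turns the form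
   attached to s into Q_s / 2.  In a Fukushima subspace, the increments f q - f p are
   represented with respect to Q_id on E `&` [p, q] by functions of the subspace, which
   fit together into one function s with Q_id(s; [p, q]) = s q - s p, and the subspace
   turns out to consist of all functions of finite Q_s.  Conversely, this identity says
   that the nonnegative form Q_s - Q_id vanishes at s, whence Q_s = Q_id where Q_s is
   finite.  For the extended scale S of s one has 0 <= S' <= 1, Q_id(s; [p, q]) is the
   integral of S'^2 and s q - s p that of S', so the identity means S' = 0 or 1 a.e. *)

(** * Chain energies *)

(** Chains involve only values on [E]. Their sums increase under refinement and are continuous for
    pointwise convergence, so semicontinuity, completeness and contraction follow from finite sums,
    and a change of scale merely relabels the chains. The hard inclusion is that of all functions of
    finite [Q_s] in a given subspace [F']. It rests on cutting at a zero: if a member of [F']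
    vanishes at a point [p] of [E], its part on the right of [p] is in [F'], by regularity and the
    Markov property. Members of [F'] can then be glued at points of [E]. On [[p, q]] the scale
    differs by a constant from a member of [F'], so interpolations affine in [s] along a chain lie
    in [F'] locally, and they exhaust the energy of a compactly supported function. At an end
    missing from [E] functions must vanish exactly when [s] is bounded there: otherwise cut-offs of
    arbitrarily small energy exist. Since [mu] has full support, a class has at most one continuous
    representative on [E], which permits arguments with values at points. *)

Section chains.
Context {R : realType}.
Implicit Types (s f g h u v : R -> R) (T : set R) (c p : seq R).

(** For [f = g] a term is the Dirichlet energy, with respect to [s], of the function that is affine
    in [s] between two consecutive points of the chain; two arguments give the polarised form. *)
Fixpoint csum_from s f g (x : R) p : R :=
  if p is y :: p' then
    (f y - f x) * (g y - g x) / (s y - s x) + csum_from s f g y p'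
  else 0.

Definition csum s f g c : R := if c is x :: p then csum_from s f g x p else 0.

Definition chain T c := sorted <%R c /\ (forall x, x \in c -> T x).

Definition increasing_on T s := forall x y, T x -> T y -> x < y -> s x < s y.

Lemma chain_cons T x p : chain T (x :: p) <->
  [/\ T x, chain T p & forall y, y \in p -> x < y].
Proof.
split=> [[sp Tp]|[Tx [sp Tp] xp]].
- split; first by apply: Tp; rewrite mem_head.
  + split; first exact: path_sorted sp.
    by move=> y yp; apply: Tp; rewrite in_cons yp orbT.
  + by move=> y yp; move: sp => /= /(order_path_min lt_trans)/allP/(_ y yp).
- split.
  + rewrite /= path_min_sorted //; exact/allP.
  + by move=> y; rewrite in_cons => /predU1P[->//|]; exact: Tp.
Qed.

Lemma chain_sub T T' c : T `<=` T' -> chain T c -> chain T' c.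
Proof. by move=> TT' [? Tc]; split=> // x /Tc/TT'. Qed.

Lemma chain1 T x : T x -> chain T [:: x].
Proof. by move=> Tx; split=> // y; rewrite inE => /eqP ->. Qed.

Lemma chain2 T x y : T x -> T y -> x < y -> chain T [:: x; y].
Proof.
move=> Tx Ty xy; apply/chain_cons; split=> //; first exact: chain1.
by move=> z; rewrite inE => /eqP ->.
Qed.

Lemma chain_ind T (P : seq R -> Prop) : P [::] -> (forall x, T x -> P [:: x]) ->
  (forall x y p, T x -> x < y -> chain T (y :: p) -> P (y :: p) -> P (x :: y :: p)) ->
  forall c, chain T c -> P c.
Proof.
move=> P0 P1 P2; elim=> // x [|y p] IH.
- by move=> /chain_cons[Tx _ _]; exact: P1.
- move=> /chain_cons[Tx cp xp]; apply: P2 => //; last exact: IH.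
  by apply: xp; rewrite mem_head.
Qed.

Definition chain_union c1 c2 := sort <=%R (undup (c1 ++ c2)).

Lemma mem_chain_union c1 c2 x : (x \in chain_union c1 c2) = (x \in c1) || (x \in c2).
Proof. by rewrite mem_sort mem_undup mem_cat. Qed.

Lemma chain_unionP T c1 c2 : chain T c1 -> chain T c2 -> chain T (chain_union c1 c2).
Proof.
move=> [_ T1] [_ T2]; split; first by rewrite sort_lt_sorted undup_uniq.
by move=> x; rewrite mem_chain_union => /orP[/T1|/T2].
Qed.

Lemma chain_union_l c1 c2 : {subset c1 <= chain_union c1 c2}.
Proof. by move=> x xc; rewrite mem_chain_union xc. Qed.

Lemma chain_union_r c1 c2 : {subset c2 <= chain_union c1 c2}.
Proof. by move=> x xc; rewrite mem_chain_union xc orbT. Qed.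

Lemma csum_cons2 s f g x y p : csum s f g (x :: y :: p) =
  (f y - f x) * (g y - g x) / (s y - s x) + csum s f g (y :: p).
Proof. by []. Qed.

Lemma csumC s f g c : csum s f g c = csum s g f c.
Proof.
case: c => // x p /=; elim: p x => //= y p IH x.
by rewrite IH [in LHS](mulrC (f y - f x)).
Qed.

Lemma csumDl s (a : R) f g h c :
  csum s (fun x => a * f x + g x) h c = a * csum s f h c + csum s g h c.
Proof.
case: c => [|x p] /=; first by rewrite mulr0 addr0.
elim: p x => /= [x|y p IH x]; first by rewrite mulr0 addr0.
rewrite IH; ring.
Qed.

Lemma eq_csum T s f g f' g' c : chain T c -> (forall x, T x -> f x = f' x) ->
  (forall x, T x -> g x = g' x) -> csum s f g c = csum s f' g' c.
Proof.
move=> cc ff gg; elim/chain_ind : cc => // x y p Tx xy /chain_cons[Ty _ _] IH.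
by rewrite !csum_cons2 IH !ff // !gg.
Qed.

Lemma ler_csum T s f g f' g' c : chain T c ->
  (forall x y, T x -> T y -> x < y ->
     (f y - f x) * (g y - g x) / (s y - s x) <= (f' y - f' x) * (g' y - g' x) / (s y - s x)) ->
  csum s f g c <= csum s f' g' c.
Proof.
move=> cc H; elim/chain_ind : cc => // x y p Tx xy /chain_cons[Ty _ _] IH.
by rewrite !csum_cons2 lerD // H.
Qed.

Lemma csum_ge0 T s f g c : increasing_on T s -> chain T c ->
  (forall x y, T x -> T y -> x < y -> 0 <= (f y - f x) * (g y - g x)) ->
  0 <= csum s f g c.
Proof.
move=> sT cc H; elim/chain_ind : cc => // x y p Tx xy /chain_cons[Ty _ _] IH.
by rewrite csum_cons2 addr_ge0 // divr_ge0 ?H // subr_ge0 ltW // sT.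
Qed.

Lemma csum_sqr_ge0 T s f c : increasing_on T s -> chain T c -> 0 <= csum s f f c.
Proof. by move=> sT cc; apply: csum_ge0 sT cc _ => *; rewrite -expr2 sqr_ge0. Qed.

(** Two-term Cauchy-Schwarz: the difference of the sides is a square over a positive number. It is
    the reason why inserting a point into a chain increases the sum. *)
Lemma titu (a b p q : R) : 0 < p -> 0 < q ->
  (a + b) * (a + b) / (p + q) <= a * a / p + b * b / q.
Proof.
move=> p0 q0; rewrite -subr_ge0.
have -> : a * a / p + b * b / q - (a + b) * (a + b) / (p + q) =
  (a * q - b * p) ^+ 2 / (p * q * (p + q)).
  by field; rewrite !gt_eqF // addr_gt0.
by rewrite divr_ge0 ?sqr_ge0 // !mulr_ge0 // ltW // addr_gt0.
Qed.

Lemma csum_insert T s f x y z p : increasing_on T s -> T x -> T y -> T z ->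
  x < y -> y < z -> csum s f f (x :: z :: p) <= csum s f f (x :: y :: z :: p).
Proof.
move=> sT Tx Ty Tz xy yz; rewrite !csum_cons2 addrA lerD2r.
have -> : f z - f x = (f y - f x) + (f z - f y) by ring.
have -> : s z - s x = (s y - s x) + (s z - s y) by ring.
by apply: titu; rewrite subr_gt0 sT.
Qed.

Lemma csum_tail T s f x p : increasing_on T s -> chain T (x :: p) ->
  csum s f f p <= csum s f f (x :: p).
Proof.
move=> sT; case: p => // y p /chain_cons[Tx /chain_cons[Ty _ _] xy].
by rewrite csum_cons2 lerDr divr_ge0 -?expr2 ?sqr_ge0 // subr_ge0 ltW // sT // xy // mem_head.
Qed.

Lemma chain_subset_cons T x p y q : chain T (x :: p) -> chain T (y :: q) ->
  {subset x :: p <= y :: q} ->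
  (x = y /\ {subset p <= q}) \/ (y < x /\ {subset x :: p <= q}).
Proof.
move=> /chain_cons[Tx cp xp] /chain_cons[Ty cq yq] sub.
have := sub x (mem_head _ _); rewrite in_cons => /predU1P[xy|xq].
- left; split=> // z zp; have := sub z; rewrite !in_cons zp orbT => /(_ isT).
  by case/predU1P => // zy; have := xp _ zp; rewrite zy xy ltxx.
- right; split; first exact: yq.
  move=> z; rewrite in_cons => /predU1P[->//|zp].
  have := sub z; rewrite !in_cons zp orbT => /(_ isT) /predU1P[zy|//].
  by have := lt_trans (yq _ xq) (xp _ zp); rewrite zy ltxx.
Qed.

(** Induction on the finer chain, comparing heads. If its head precedes that of the coarse chain,
    the head is dropped ([csum_tail]). If the heads agree, either the second points agree too, or
    the second point of the finer chain is first inserted into the coarse one ([csum_insert]). *)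
Lemma csum_le_subset T s f c c' : increasing_on T s -> chain T c -> chain T c' ->
  {subset c <= c'} -> csum s f f c <= csum s f f c'.
Proof.
move=> sT; elim: c' c => [|y q IH] c cc cc' sub.
  by case: c cc sub => // x p _ /(_ x); rewrite mem_head => /(_ isT).
case: c cc sub => [|x p] cc sub; first exact: csum_sqr_ge0 cc'.
have cq : chain T q by case/chain_cons : cc'.
have /chain_cons[Tx cp xp] := cc.
case: (chain_subset_cons cc cc' sub) => [[xy pq]|[yx xpq]]; last first.
  by apply: le_trans (csum_tail f sT cc'); exact: IH.
rewrite -xy in cc' *; case: p cc cp xp pq {sub} => [|z p] cc cp xp pq.
  exact: csum_sqr_ge0 cc'.
case: q IH cc' cq pq => [|w q] IH cc' cq pq.
  by have := pq z (mem_head _ _).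
have {}IH := IH _ _ cq.
have /chain_cons[_ _ xw] := cc'.
have /chain_cons[Tw _ wq] := cq; have /chain_cons[Tz _ zp] := cp.
have := pq z (mem_head _ _); rewrite in_cons => /predU1P[zw|/wq wz].
  by rewrite !csum_cons2 -zw lerD2l {2}zw IH.
have xw' : x < w by rewrite xw // mem_head.
apply: le_trans (csum_insert f p sT Tx Tw Tz xw' wz) _.
rewrite csum_cons2 [leRHS]csum_cons2 lerD2l IH //.
- apply/chain_cons; split=> // t; rewrite in_cons => /predU1P[->//|/zp].
  exact: lt_trans.
- by move=> t; rewrite in_cons => /predU1P[->|/pq//]; rewrite mem_head.
Qed.

End chains.

(** * The energy as a limit along refinement of chains *)

Section energy.
Context {R : realType}.
Implicit Types (s f g h u v : R -> R) (T : set R) (c p : seq R).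

Lemma ler_norm_sqr (a b : R) : `|a| <= `|b| -> a * a <= b * b.
Proof.
by move=> ab; rewrite -!expr2 -[a ^+ 2]real_normK ?num_real // -[b ^+ 2]real_normK ?num_real // lerXn2r ?nnegrE.
Qed.

(** Filter of the properties shared by all sufficiently fine finite chains. The energy is a limit,
    not a supremum, because off the diagonal the sums are not monotone under refinement and the
    energy has to be bilinear. *)
Definition refine T : set_system (seq R) :=
  [set A | exists2 c0, chain T c0 &
     forall c, chain T c -> {subset c0 <= c} -> A c].

Global Instance refine_proper T : ProperFilter (refine T).
Proof.
split; first by move=> [c0 cc /(_ c0 cc)]; apply.
split.
- by exists [::].
- move=> A B [c1 cc1 H1] [c2 cc2 H2]; exists (chain_union c1 c2); first exact: chain_unionP.
  move=> c cc sub; split.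
  + by apply: H1 => // x /(chain_union_l c2)/sub.
  + by apply: H2 => // x /(chain_union_r c1)/sub.
- by move=> A B AB [c0 cc0 H]; exists c0 => // c cc sub; apply/AB/H.
Qed.

Definition fin_energy s T f := exists M, forall c, chain T c -> csum s f f c <= M.

Definition energy s T f g : R := lim (csum s f g @ refine T).

Lemma refine_chain T : \forall c \near refine T, chain T c.
Proof. by exists [::]. Qed.

Lemma refine_sup T c0 : chain T c0 ->
  \forall c \near refine T, chain T c /\ {subset c0 <= c}.
Proof. by exists c0. Qed.

Section increasing.
Context {s} {T} (sT : increasing_on T s).

Lemma cvg_energy_diag f : fin_energy s T f ->
  csum s f f @ refine T --> sup [set csum s f f c | c in chain T].
Proof.
move=> [M HM]; set l := sup _.
have hs : has_sup [set csum s f f c | c in chain T].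
  split; first by exists (csum s f f [::]), [::].
  by exists M => _ [c cc <-]; exact: HM.
apply/cvgrPdist_lt => e e0.
have [_ [c0 cc0 <-] lc0] := sup_adherent e0 hs.
exists c0 => // c cc sub; rewrite /= ger0_norm; last first.
  by rewrite subr_ge0; apply: ub_le_sup; [exact: hs.2|exists c].
have := csum_le_subset f sT cc0 cc sub; rewrite -/l in lc0; lra.
Qed.

Lemma csum_quad (a : R) f g c : csum s (fun x => a * f x + g x) (fun x => a * f x + g x) c =
  a ^+ 2 * csum s f f c + 2 * a * csum s f g c + csum s g g c.
Proof.
rewrite csumDl csumC [X in _ + X]csumC !csumDl [csum s g f c]csumC; ring.
Qed.

Lemma fin_energyDl (a : R) f g : fin_energy s T f -> fin_energy s T g ->
  fin_energy s T (fun x => a * f x + g x).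
Proof.
move=> [M HM] [N HN]; exists (2 * a ^+ 2 * M + 2 * N) => c cc.
apply: (@le_trans _ _ (2 * a ^+ 2 * csum s f f c + 2 * csum s g g c)); last first.
  by rewrite lerD // ler_wpM2l ?HN ?HM // mulr_ge0 ?sqr_ge0.
have := csum_sqr_ge0 (fun x => (- a) * f x + g x) sT cc.
rewrite !csum_quad sqrrN; lra.
Qed.

Lemma fin_energy_le f g : fin_energy s T f ->
  (forall x y, T x -> T y -> x < y -> `|g y - g x| <= `|f y - f x|) ->
  fin_energy s T g.
Proof.
move=> [M HM] fg; exists M => c cc; apply: le_trans (HM c cc).
apply: ler_csum (cc) _ => x y Tx Ty xy.
by rewrite ler_wpM2r ?invr_ge0 ?subr_ge0 ?(ltW (sT _ _ _)) // ler_norm_sqr // fg.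
Qed.

Lemma eq_fin_energy f g : (forall x, T x -> f x = g x) -> fin_energy s T f -> fin_energy s T g.
Proof. by move=> fg; move/fin_energy_le; apply => x y Tx Ty _; rewrite !fg. Qed.

Lemma csum_cst (a : R) c : csum s (fun=> a) (fun=> a) c = 0.
Proof.
by case: c => //= x p; elim: p x => //= y p IH x; rewrite IH subrr !mul0r addr0.
Qed.

Lemma fin_energy_cst (a : R) : fin_energy s T (fun=> a).
Proof. by exists 0 => c cc; rewrite csum_cst. Qed.

Lemma fin_energyZ (a : R) f : fin_energy s T f -> fin_energy s T (fun x => a * f x).
Proof.
move=> ff; have := fin_energyDl a ff (fin_energy_cst 0).
by apply: eq_fin_energy => x _; rewrite addr0.
Qed.

Lemma fin_energyD f g : fin_energy s T f -> fin_energy s T g ->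
  fin_energy s T (fun x => f x + g x).
Proof.
move=> ff fg; have := fin_energyDl 1 ff fg.
by apply: eq_fin_energy => x _; rewrite mul1r.
Qed.

Lemma fin_energyB f g : fin_energy s T f -> fin_energy s T g ->
  fin_energy s T (fun x => f x - g x).
Proof.
move=> ff fg; have := fin_energyDl (-1) fg ff.
by apply: eq_fin_energy => x _; rewrite mulN1r addrC.
Qed.

(** Polarisation: an off-diagonal sum is a combination of three diagonal ones, each of which
    increases with the chain and so converges to its supremum. *)
Lemma cvg_energy f g : fin_energy s T f -> fin_energy s T g ->
  csum s f g @ refine T --> energy s T f g.
Proof.
move=> ff fg; suff : cvg (csum s f g @ refine T) by [].
have -> : csum s f g = (fun c => 2^-1 * (csum s (fun x => 1 * f x + g x) (fun x => 1 * f x + g x) c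
     - csum s f f c - csum s g g c)).
  by apply/funext => c; rewrite csum_quad; lra.
apply: is_cvgM; first exact: is_cvg_cst.
apply: is_cvgB; last by apply/cvg_ex; eexists; exact: cvg_energy_diag fg.
apply: is_cvgB; last by apply/cvg_ex; eexists; exact: cvg_energy_diag ff.
by apply/cvg_ex; eexists; apply: cvg_energy_diag; apply: fin_energyDl.
Qed.

Lemma energy_unique f g l : csum s f g @ refine T --> l -> energy s T f g = l.
Proof. exact: cvg_lim. Qed.

Lemma energy_near f g l : (\forall c \near refine T, csum s f g c = l) -> energy s T f g = l.
Proof. by move=> H; apply: energy_unique; apply: cvg_near_cst. Qed.

Lemma le_energy f g f' g' : fin_energy s T f -> fin_energy s T g ->
  fin_energy s T f' -> fin_energy s T g' ->
  (\forall c \near refine T, csum s f g c <= csum s f' g' c) ->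
  energy s T f g <= energy s T f' g'.
Proof.
move=> ff fg ff' fg' H; rewrite -subr_ge0.
have /(_ _) C := cvgB (cvg_energy ff' fg') (cvg_energy ff fg).
rewrite -(cvg_lim _ C) //; apply: limr_ge; first by apply/cvg_ex; eexists; exact: C.
by apply: filterS H => c; rewrite /= subr_ge0.
Qed.

Lemma energyE f : fin_energy s T f -> energy s T f f = sup [set csum s f f c | c in chain T].
Proof. by move=> /cvg_energy_diag/energy_unique. Qed.

Lemma csum_le_energy f c : fin_energy s T f -> chain T c -> csum s f f c <= energy s T f f.
Proof.
move=> ff cc; rewrite energyE //; apply: ub_le_sup; last by exists c.
by case: ff => M HM; exists M => _ [c' cc' <-]; exact: HM.
Qed.

Lemma energy_le f M : (forall c, chain T c -> csum s f f c <= M) -> energy s T f f <= M.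
Proof.
move=> H; rewrite energyE; last by exists M.
by apply: ge_sup; [exists (csum s f f [::]), [::]|move=> _ [c cc <-]; exact: H].
Qed.

Lemma energy_approx f e : fin_energy s T f -> 0 < e ->
  exists2 c, chain T c & energy s T f f - e < csum s f f c.
Proof.
move=> ff e0; rewrite energyE //.
have [|_ [c cc <-] ?] := @sup_adherent _ [set csum s f f c | c in chain T] _ e0; last by exists c.
split; first by exists (csum s f f [::]), [::].
by case: ff => M HM; exists M => _ [c' cc' <-]; exact: HM.
Qed.

Lemma energy_ge0 f : fin_energy s T f -> 0 <= energy s T f f.
Proof. by move=> ff; apply: (@csum_le_energy _ [::]). Qed.

Lemma energyC f g : energy s T f g = energy s T g f.
Proof. by rewrite /energy (_ : csum s f g = csum s g f) //; apply/funext => c; exact: csumC. Qed.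

Lemma energyDl (a : R) f g h : fin_energy s T f -> fin_energy s T g -> fin_energy s T h ->
  energy s T (fun x => a * f x + g x) h = a * energy s T f h + energy s T g h.
Proof.
move=> ff fg fh; apply: energy_unique.
have -> : csum s (fun x => a * f x + g x) h = (fun c => a * csum s f h c + csum s g h c).
  by apply/funext => c; rewrite csumDl.
by apply: cvgD; [apply: cvgM; [exact: cvg_cst|]|]; exact: cvg_energy.
Qed.

Lemma eq_energy f g f' g' : (forall x, T x -> f x = f' x) ->
  (forall x, T x -> g x = g' x) -> energy s T f g = energy s T f' g'.
Proof.
move=> ff gg; rewrite /energy; congr (lim _).
have E : \forall c \near refine T, csum s f g c = csum s f' g' c.
  by apply: filterS (refine_chain T) => c cc; apply: eq_csum cc _ _.
apply/seteqP; split=> A; rewrite /= /nbhs /= => HA.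
- by apply: filterS2 E HA => c /= ->.
- by apply: filterS2 E HA => c /= ->.
Qed.

Lemma energy_quad (a : R) f g : fin_energy s T f -> fin_energy s T g ->
  energy s T (fun x => a * f x + g x) (fun x => a * f x + g x) =
  a ^+ 2 * energy s T f f + 2 * a * energy s T f g + energy s T g g.
Proof.
move=> ff fg; have fh := fin_energyDl a ff fg.
rewrite energyDl // energyC [X in _ + X]energyC !energyDl // [energy s T g f]energyC; ring.
Qed.

Lemma energyD f g : fin_energy s T f -> fin_energy s T g ->
  energy s T (fun x => f x + g x) (fun x => f x + g x) =
  energy s T f f + 2 * energy s T f g + energy s T g g.
Proof.
move=> ff fg; rewrite -(@eq_energy (fun x => 1 * f x + g x) (fun x => 1 * f x + g x)); try by move=> x _; rewrite mul1r.
by rewrite energy_quad //; ring.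
Qed.

Lemma energyB f g : fin_energy s T f -> fin_energy s T g ->
  energy s T (fun x => f x - g x) (fun x => f x - g x) =
  energy s T f f - 2 * energy s T f g + energy s T g g.
Proof.
move=> ff fg; rewrite (_ : (fun x => f x - g x) = (fun x => (-1) * g x + f x)).
  by rewrite energy_quad // [energy s T g f]energyC; ring.
by apply/funext => x; rewrite mulN1r addrC.
Qed.

Lemma energyZ (a : R) f g : fin_energy s T f -> fin_energy s T g ->
  energy s T (fun x => a * f x) g = a * energy s T f g.
Proof.
move=> ff fg; have f0 := fin_energy_cst 0.
have E0 : energy s T (fun=> 0) g = 0.
  have := energyDl 1 f0 f0 fg.
  rewrite (_ : (fun _ => _) = (fun=> 0)); last by apply/funext => x; rewrite mulr0 addr0.
  lra.
rewrite -(@eq_energy (fun x => a * f x + 0) g); try by move=> x _; rewrite ?addr0.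
by rewrite energyDl // E0 addr0.
Qed.

Lemma energyZZ (a : R) f : fin_energy s T f ->
  energy s T (fun x => a * f x) (fun x => a * f x) = a ^+ 2 * energy s T f f.
Proof.
move=> ff; have fa := fin_energyZ a ff.
by rewrite energyZ // energyC energyZ // expr2 mulrA.
Qed.

Lemma energyD_le f g : fin_energy s T f -> fin_energy s T g ->
  energy s T (fun x => f x + g x) (fun x => f x + g x) <=
  2 * energy s T f f + 2 * energy s T g g.
Proof.
move=> ff fg; have := energy_ge0 (fin_energyB ff fg); rewrite energyB // energyD //; lra.
Qed.

Lemma energyB_le f g : fin_energy s T f -> fin_energy s T g ->
  energy s T (fun x => f x - g x) (fun x => f x - g x) <=
  2 * energy s T f f + 2 * energy s T g g.
Proof.
move=> ff fg; have := energy_ge0 (fin_energyD ff fg); rewrite energyB // energyD //; lra.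
Qed.

Lemma energy_CS f g : fin_energy s T f -> fin_energy s T g ->
  energy s T f g ^+ 2 <= energy s T f f * energy s T g g.
Proof.
move=> ff fg; have P a := energy_ge0 (fin_energyDl a ff fg).
have {}P a : 0 <= a ^+ 2 * energy s T f f + 2 * a * energy s T f g + energy s T g g.
  by rewrite -energy_quad.
have := energy_ge0 ff; move: P.
move: (energy s T f f) (energy s T f g) (energy s T g g) => p q r P p0.
have [p00|p1] := eqVneq p 0.
  rewrite p00 mul0r; have [->|q0] := eqVneq q 0; first by rewrite expr0n.
  (* With vanishing leading coefficient and nonzero [q], this argument gives the value [-1]. *)
  have := P (- (r + 1) / (2 * q)); rewrite p00.
  rewrite mulr0 add0r (_ : 2 * _ * _ = - (r + 1)); first by lra.
  by field.
have {}p1 : 0 < p by rewrite lt_neqAle eq_sym p1.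
have := P (- q / p); rewrite (_ : _ + _ + _ = (p * r - q ^+ 2) / p); last first.
  by field; rewrite gt_eqF.
by rewrite pmulr_lge0 ?invr_gt0 // subr_ge0.
Qed.

Lemma energy_contract f g : fin_energy s T f ->
  (forall x y, T x -> T y -> x < y -> `|g y - g x| <= `|f y - f x|) ->
  energy s T g g <= energy s T f f.
Proof.
move=> ff fg; apply: energy_le => c cc; apply: le_trans (csum_le_energy ff cc).
apply: ler_csum (cc) _ => x y Tx Ty xy.
by rewrite ler_wpM2r ?invr_ge0 ?subr_ge0 ?(ltW (sT _ _ _)) // ler_norm_sqr // fg.
Qed.

(** The square of an increment of [h] is at most the sum of the two other squares. This serves for
    minima, where neither function alone dominates the increments. *)
Lemma energy_max f g h : fin_energy s T f -> fin_energy s T g ->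
  (forall x y, T x -> T y -> x < y -> `|h y - h x| <= Num.max `|f y - f x| `|g y - g x|) ->
  fin_energy s T h /\ energy s T h h <= energy s T f f + energy s T g g.
Proof.
move=> ff fg H.
have C c : chain T c -> csum s h h c <= energy s T f f + energy s T g g.
  move=> cc; apply: le_trans (lerD (csum_le_energy ff cc) (csum_le_energy fg cc)).
  move: c cc; apply: (@chain_ind R T) => [|x _|x y p Tx xy /chain_cons[Ty _ _] IH]; rewrite ?addr0 //.
  rewrite !csum_cons2 addrACA lerD // -mulrDl ler_wpM2r ?invr_ge0 ?subr_ge0 ?(ltW (sT _ _ _)) //.
  have := H x y Tx Ty xy; rewrite le_max => /orP[] /ler_norm_sqr/le_trans; apply.
  + by rewrite lerDl -expr2 sqr_ge0.
  + by rewrite lerDr -expr2 sqr_ge0.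
by split; [eexists; exact: C|exact: energy_le].
Qed.

Definition comonotone u v := forall x y, T x -> T y -> x < y ->
  0 <= (u y - u x) * (v y - v x).

(** Increments of the same sign make the mixed sums nonnegative, so the energy is superadditive;
    they also bound each increment of [u] or [v] by that of [u + v], which gives finiteness. *)
Lemma comonotone_energy u v : fin_energy s T (fun x => u x + v x) -> comonotone u v ->
  [/\ fin_energy s T u, fin_energy s T v &
      energy s T u u + energy s T v v <= energy s T (fun x => u x + v x) (fun x => u x + v x)].
Proof.
move=> fuv uv.
have H x y : T x -> T y -> x < y -> `|u y - u x| <= `|u y + v y - (u x + v x)| /\
   `|v y - v x| <= `|u y + v y - (u x + v x)|.
  move=> Tx Ty xy; have := uv x y Tx Ty xy.
  rewrite (_ : u y + v y - (u x + v x) = (u y - u x) + (v y - v x)); last by ring.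
  move: (u y - u x) (v y - v x) => a b ab.
  by split; rewrite -ler_sqr ?nnegrE // !real_normK ?num_real //; nra.
have fu : fin_energy s T u by apply: fin_energy_le fuv _ => x y Tx Ty xy; exact: (H x y Tx Ty xy).1.
have fv : fin_energy s T v by apply: fin_energy_le fuv _ => x y Tx Ty xy; exact: (H x y Tx Ty xy).2.
split => //; rewrite energyD //; suff : 0 <= energy s T u v by lra.
rewrite (_ : 0 = energy s T (fun=> 0) (fun=> 0)); last first.
  by apply/esym/energy_near; apply: nearW => c; rewrite csum_cst.
apply: le_energy => //; try exact: fin_energy_cst.
apply: filterS (refine_chain T) => c cc; apply: ler_csum (cc) _ => x y Tx Ty xy.
by rewrite !subrr mul0r mul0r divr_ge0 ?uv // subr_ge0 ltW // sT.
Qed.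

Lemma cvg_csum c (f_ : nat -> R -> R) f : chain T c ->
  (forall x, T x -> f_ n x @[n --> \oo] --> f x) ->
  csum s (f_ n) (f_ n) c @[n --> \oo] --> csum s f f c.
Proof.
move=> cc H; move: c cc; apply: (@chain_ind R T) => [|x _|x y p Tx xy /chain_cons[Ty _ _] IH]; try exact: cvg_cst.
apply: cvgD => //; apply: cvgM; last exact: cvg_cst.
by apply: cvgM; apply: cvgB; exact: H.
Qed.

(** A sum over one chain depends on finitely many values, hence passes to pointwise limits; the
    energy is a supremum of such sums. *)
Lemma energy_lsc (f_ : nat -> R -> R) f M : (forall x, T x -> f_ n x @[n --> \oo] --> f x) ->
  (\forall n \near \oo, fin_energy s T (f_ n) /\ energy s T (f_ n) (f_ n) <= M) ->
  fin_energy s T f /\ energy s T f f <= M.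
Proof.
move=> H HM; have C c : chain T c -> csum s f f c <= M.
  move=> cc; have C := cvg_csum cc H; rewrite -(cvg_lim _ C) //.
  apply: limr_le; first by apply/cvg_ex; eexists; exact: C.
  by apply: filterS HM => n [fn fM]; apply: le_trans fM; exact: csum_le_energy.
by split; [exists M|exact: energy_le].
Qed.

(** Pointwise convergence becomes convergence in energy: one chain that nearly exhausts the energy
    of [f] forces the energy of [u_ n] to be nearly as large in the end, and superadditivity leaves
    almost nothing for [f - u_ n]. *)
Lemma comonotone_approx (u_ : nat -> R -> R) f : fin_energy s T f ->
  (forall n, comonotone (u_ n) (fun x => f x - u_ n x)) ->
  (forall x, T x -> u_ n x @[n --> \oo] --> f x) ->
  energy s T (fun x => f x - u_ n x) (fun x => f x - u_ n x) @[n --> \oo] --> 0.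
Proof.
move=> ff cu uf; apply/cvgrPdist_lt => e e0.
have e2 : 0 < e / 2 by rewrite divr_gt0.
have [c cc ec] := energy_approx ff e2.
move/cvgrPdist_lt : (cvg_csum cc uf) => /(_ _ e2); apply: filterS => n.
have fuE : (fun x => u_ n x + (f x - u_ n x)) = f by apply/funext => x; rewrite subrKC.
have := @comonotone_energy (u_ n) (fun x => f x - u_ n x); rewrite fuE => /(_ ff (cu n))[fu fv le].
have := csum_le_energy fu cc; have := energy_ge0 fv.
rewrite sub0r normrN => ev0; rewrite (ger0_norm ev0) ltr_norml => ? /andP[? ?]; lra.
Qed.

End increasing.

Lemma increasing_sub T T' s : T' `<=` T -> increasing_on T s -> increasing_on T' s.
Proof. by move=> TT sT x y /TT ? /TT; exact: sT. Qed.

Lemma fin_energy_sub T T' s f : T' `<=` T -> fin_energy s T f -> fin_energy s T' f.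
Proof. by move=> TT' [M HM]; exists M => c cc; apply: HM; exact: chain_sub cc. Qed.

Lemma energy_sub T T' s f : increasing_on T s -> T' `<=` T -> fin_energy s T f ->
  energy s T' f f <= energy s T f f.
Proof.
move=> sT TT' ff; apply: energy_le; first exact: increasing_sub sT.
by move=> c cc; apply: csum_le_energy => //; exact: chain_sub cc.
Qed.

End energy.

(** * Locality: cutting the energy at points of the set *)

Section cuts.
Context {R : realType}.
Implicit Types (s f g h u v : R -> R) (T : set R) (c p : seq R).

Definition lo T (d : R) := T `&` [set x | x <= d].
Definition hi T (d : R) := T `&` [set x | d <= x].
Definition cut T (a b : R) := T `&` [set x | a <= x <= b].

Lemma lo_sub T d : lo T d `<=` T. Proof. by move=> x []. Qed.
Lemma hi_sub T d : hi T d `<=` T. Proof. by move=> x []. Qed.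
Lemma cut_sub T a b : cut T a b `<=` T. Proof. by move=> x []. Qed.

Lemma hi_lo T a b : hi (lo T b) a = cut T a b.
Proof. by apply/seteqP; split=> x /=; rewrite /cut /=; [case=> -[Tx ->] ->|case=> Tx /andP[]]. Qed.

Lemma lo_cut T a b d : d <= b -> lo (cut T a b) d = cut T a d.
Proof.
move=> db; apply/seteqP; split=> x [].
- by move=> [Tx /= /andP[ax _]] xd; split=> //=; rewrite ax.
- by move=> Tx /= /andP[ax xd]; split=> //; split=> //=; rewrite ax (le_trans xd).
Qed.

Lemma hi_cut T a b d : a <= d -> hi (cut T a b) d = cut T d b.
Proof.
move=> ad; apply/seteqP; split=> x [].
- by move=> [Tx /= /andP[_ xb]] dx; split=> //=; rewrite xb dx.
- by move=> Tx /= /andP[dx xb]; split=> //; split=> //=; rewrite xb (le_trans ad).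
Qed.

Lemma cut_cut T a b a' b' : a <= a' -> b' <= b -> cut (cut T a b) a' b' = cut T a' b'.
Proof.
move=> aa bb; apply/seteqP; split=> x [].
- by move=> [].
- by move=> Tx /= /andP[ax xb]; split=> //; [split=> //=|]; rewrite /= ?ax ?xb ?(le_trans aa) ?(le_trans xb).
Qed.

Lemma cut_subset T a b a' b' : a' <= a -> b <= b' -> cut T a b `<=` cut T a' b'.
Proof. by move=> aa bb x [Tx /= /andP[ax xb]]; split=> //=; rewrite (le_trans aa) ?(le_trans xb). Qed.

Lemma csum_split T s f g d c : chain T c -> d \in c ->
  csum s f g c = csum s f g [seq x <- c | x <= d] + csum s f g [seq x <- c | d <= x].
Proof.
move: c; apply: (@chain_ind R T) => // [x _|x y p Tx xy cp IH].
  by rewrite inE => /eqP ->; rewrite /= lexx /= addr0.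
rewrite in_cons => /predU1P[->|dp].
  have xp z : z \in y :: p -> x < z.
    rewrite in_cons => /predU1P[->//|zp]; move/chain_cons : cp => [_ _ /(_ _ zp)]; exact: lt_trans.
  rewrite /= lexx lt_geF // (ltW xy) /=.
  rewrite (_ : [seq z <- p | z <= x] = [::]) ?add0r; last first.
    by apply/eqP/negPn; rewrite -has_filter; apply/hasPn => z zp; rewrite -ltNge xp // in_cons zp orbT.
  rewrite (_ : [seq z <- p | x <= z] = p) //.
  by apply/all_filterP/allP => z zp; rewrite ltW // xp // in_cons zp orbT.
have yd : y <= d.
  by move: dp; rewrite in_cons => /predU1P[->//|dp]; move/chain_cons : cp => [_ _ /(_ _ dp)/ltW].
have xd := lt_le_trans xy yd.
by rewrite csum_cons2 IH // /= (ltW xd) yd (lt_geF xd) /= addrA.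
Qed.

Lemma chain_filter_lo T d c : chain T c -> chain (lo T d) [seq x <- c | x <= d].
Proof.
move=> [sc Tc]; split; first exact: lt_sorted_filter.
by move=> x; rewrite mem_filter => /andP[xd /Tc].
Qed.

Lemma chain_filter_hi T d c : chain T c -> chain (hi T d) [seq x <- c | d <= x].
Proof.
move=> [sc Tc]; split; first exact: lt_sorted_filter.
by move=> x; rewrite mem_filter => /andP[xd /Tc].
Qed.

Lemma refine_lo T d : [seq x <- c | x <= d] @[c --> refine T] --> refine (lo T d).
Proof.
move=> A [c0 cc0 H]; exists c0; first exact: chain_sub (@lo_sub T d) cc0.
move=> c cc sub; apply: H; first exact: chain_filter_lo.
by move=> x xc; rewrite mem_filter sub // andbT; case: cc0 => _ /(_ _ xc) [].
Qed.

Lemma refine_hi T d : [seq x <- c | d <= x] @[c --> refine T] --> refine (hi T d).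
Proof.
move=> A [c0 cc0 H]; exists c0; first exact: chain_sub (@hi_sub T d) cc0.
move=> c cc sub; apply: H; first exact: chain_filter_hi.
by move=> x xc; rewrite mem_filter sub // andbT; case: cc0 => _ /(_ _ xc) [].
Qed.

(** Fine chains contain [d], and such a chain splits at [d] into a chain of each half; the two
    filtering maps carry [refine T] to the filters of the halves. *)
Lemma energy_split T s f g d : increasing_on T s -> T d ->
  fin_energy s T f -> fin_energy s T g ->
  energy s T f g = energy s (lo T d) f g + energy s (hi T d) f g.
Proof.
move=> sT Td ff fg; apply: energy_unique.
have Cl := cvg_energy (increasing_sub (@lo_sub T d) sT)
  (fin_energy_sub (@lo_sub T d) ff) (fin_energy_sub (@lo_sub T d) fg).
have Ch := cvg_energy (increasing_sub (@hi_sub T d) sT)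
  (fin_energy_sub (@hi_sub T d) ff) (fin_energy_sub (@hi_sub T d) fg).
have /(_ _) C := cvgD (cvg_comp _ _ (@refine_lo T d) Cl) (cvg_comp _ _ (@refine_hi T d) Ch).
apply: cvg_trans C; apply: near_eq_cvg.
apply: filterS (refine_sup (chain1 Td)) => c [cc dc] /=.
by rewrite (csum_split _ _ _ cc (dc _ (mem_head _ _))).
Qed.

Lemma fin_energy_glue T s f d : increasing_on T s -> T d ->
  fin_energy s (lo T d) f -> fin_energy s (hi T d) f -> fin_energy s T f.
Proof.
move=> sT Td [M HM] [N HN]; exists (M + N) => c cc.
have cd := chain_unionP cc (chain1 Td).
apply: le_trans (csum_le_subset f sT cc cd (chain_union_l _)) _.
rewrite (csum_split _ _ _ cd (chain_union_r c (mem_head d [::]))).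
by rewrite lerD ?HM ?HN //; [exact: chain_filter_lo|exact: chain_filter_hi].
Qed.

Lemma chain_last_ge T x p : chain T (x :: p) -> forall y, y \in x :: p -> x <= y <= last x p.
Proof.
move=> cc y yp.
have xy : x <= y.
  by move: yp; rewrite in_cons => /predU1P[->//|yp]; case/chain_cons : cc => _ _ /(_ _ yp)/ltW.
rewrite xy /=; case: cc => /= {xy} H _; elim: p x H y yp => [|z p IH] x /=.
  by move=> _ y; rewrite inE => /eqP ->.
move=> /andP[xz zp] y; rewrite in_cons => /predU1P[->|]; last exact: IH.
by apply: le_trans (ltW xz) (IH z zp z _); rewrite mem_head.
Qed.

Lemma csum_telescope T s f x p : increasing_on T s -> chain T (x :: p) ->
  csum s f s (x :: p) = f (last x p) - f x.
Proof.
move=> sT; elim: p x => [|y p IH] x; first by rewrite /= subrr.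
move=> /chain_cons[Tx cp xp]; have /chain_cons[Ty _ _] := cp.
rewrite csum_cons2 IH // mulfK /=; first by ring.
by rewrite subr_eq0 gt_eqF // sT // xp // mem_head.
Qed.

(** Reproducing property: against [s] each term loses its denominator and the sum telescopes, so in
    the form of [s] the scale itself represents the increment over [[a, b]]. *)
Lemma energy_scale T s f a b : increasing_on (cut T a b) s -> T a -> T b -> a <= b ->
  energy s (cut T a b) f s = f b - f a.
Proof.
move=> sT Ta Tb ab; apply: energy_near.
have ca : chain (cut T a b) [:: a] by apply: chain1; rewrite /cut /= lexx.
have cb : chain (cut T a b) [:: b] by apply: chain1; rewrite /cut /= lexx ab.
apply: filterS2 (refine_sup ca) (refine_sup cb) => c [cc ac] [_ bc].
have {}ac : a \in c by rewrite ac // mem_head.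
have {}bc : b \in c by rewrite bc // mem_head.
case: c cc ac bc => // x p cc ac bc.
rewrite (csum_telescope _ sT cc).
have /andP[xa _] := chain_last_ge cc ac; have /andP[_ bl] := chain_last_ge cc bc.
have [_ /= /andP[ax _]] : cut T a b x by case: cc => _; apply; rewrite mem_head.
have [_ /= /andP[_ lb]] : cut T a b (last x p) by case: cc => _; apply; rewrite mem_last.
by congr (f _ - f _); apply/eqP; rewrite eq_le ?bl ?lb ?ax ?xa.
Qed.

Lemma fin_energy_scale T s a b : increasing_on (cut T a b) s -> T a -> T b -> a <= b ->
  fin_energy s (cut T a b) s.
Proof.
move=> sT Ta Tb ab; exists (s b - s a) => -[_|x p cc].
  by rewrite subr_ge0; move: ab; rewrite le_eqVlt => /predU1P[->//|ab];
     apply/ltW/sT => //; rewrite /cut /= lexx ltW.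
rewrite (csum_telescope _ sT cc) lerB //.
- have cl : cut T a b (last x p) by case: cc => _; apply; rewrite mem_last.
  have [_ /= /andP[_]] := cl; rewrite le_eqVlt => /predU1P[->//|lb].
  by apply/ltW/sT => //; rewrite /cut /= lexx ab.
- have cl : cut T a b x by case: cc => _; apply; rewrite mem_head.
  have [_ /= /andP[]] := cl; rewrite le_eqVlt => /predU1P[->//|lb] _.
  by apply/ltW/sT => //; rewrite /cut /= lexx ab.
Qed.

Lemma increment_le T s f x y : increasing_on T s -> fin_energy s (cut T x y) f ->
  T x -> T y -> x <= y -> (f y - f x) ^+ 2 <= (s y - s x) * energy s (cut T x y) f f.
Proof.
move=> sT ff Tx Ty; rewrite le_eqVlt => /predU1P[->|xy].
  by rewrite !subrr expr0n mul0r.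
have sc := increasing_sub (@cut_sub T x y) sT.
have cc : chain (cut T x y) [:: x; y] by apply: chain2; rewrite /cut //= lexx (ltW xy).
have := csum_le_energy sc ff cc; rewrite /= addr0 -expr2 ler_pdivrMr 1?mulrC //.
by rewrite subr_gt0 sT.
Qed.

Lemma increment_le_energy T s f x y : increasing_on T s -> fin_energy s T f ->
  T x -> T y -> x <= y -> (f y - f x) ^+ 2 <= (s y - s x) * energy s T f f.
Proof.
move=> sT ff Tx Ty xy; have sc := @cut_sub T x y.
apply: le_trans (increment_le sT (fin_energy_sub sc ff) Tx Ty xy) _.
apply: ler_wpM2l; last exact: energy_sub.
by rewrite subr_ge0; move: xy; rewrite le_eqVlt => /predU1P[->//|xy]; exact/ltW/sT.
Qed.

Lemma energy_cst0 T s f g (a : R) : (forall x, T x -> f x = a) -> energy s T f g = 0.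
Proof.
move=> fa; apply: energy_near; apply: filterS (refine_chain T).
apply: (@chain_ind R T) => // x y p Tx xy /chain_cons[Ty _ _] IH.
by rewrite csum_cons2 IH !fa // subrr !mul0r addr0.
Qed.

Lemma energy0_cst T s f : increasing_on T s -> fin_energy s T f -> energy s T f f = 0 ->
  forall x y, T x -> T y -> f x = f y.
Proof.
move=> sT ff f0.
suff H x y : T x -> T y -> x <= y -> f x = f y.
  by move=> x y Tx Ty; have [xy|/ltW yx] := leP x y; [|apply/esym]; exact: H.
move=> Tx Ty xy; have := increment_le_energy sT ff Tx Ty xy.
rewrite f0 mulr0 => H; apply/esym/eqP; rewrite -subr_eq0 -sqrf_eq0 eq_le H sqr_ge0 //.
Qed.

(** A chain that nearly attains the energy lies between its first and last points. *)
Lemma energy_cut_approx T s f e : T !=set0 -> increasing_on T s -> fin_energy s T f -> 0 < e ->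
  exists a b, [/\ T a, T b, a <= b & energy s T f f - e < energy s (cut T a b) f f].
Proof.
move=> [x0 Tx0] sT ff e0; have [c cc ec] := energy_approx sT ff e0.
have fc a b := fin_energy_sub (@cut_sub T a b) ff.
case: c cc ec => [_|x p cc ec].
  rewrite /= => ec; exists x0, x0; split=> //.
  apply: lt_le_trans ec (energy_ge0 (increasing_sub (@cut_sub _ _ _) sT) (fc x0 x0)).
have Tc y : y \in x :: p -> T y by case: cc => _; apply.
exists x, (last x p); split; [exact: Tc (mem_head _ _)|exact: Tc (mem_last _ _)| |].
  by have /andP[_] := chain_last_ge cc (mem_head _ _).
apply: lt_le_trans ec (csum_le_energy (increasing_sub (@cut_sub _ _ _) sT) (fc _ _) _).
by split; [case: cc|move=> y yp; split; [exact: Tc|exact: chain_last_ge cc _ yp]].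
Qed.

Lemma energy_cut3 T s f g a b : increasing_on T s -> T a -> T b -> a <= b ->
  fin_energy s T f -> fin_energy s T g ->
  energy s T f g = energy s (lo T a) f g + energy s (cut T a b) f g + energy s (hi T b) f g.
Proof.
move=> sT Ta Tb ab ff fg; rewrite (energy_split sT Tb) //; congr (_ + _).
have sl := @lo_sub T b.
rewrite (energy_split (d := a) (increasing_sub sl sT)) ?hi_lo //; try exact: fin_energy_sub sl _.
congr (energy s _ f g + _); apply/seteqP; split=> x; first by case=> -[? _].
by case=> Tx xa; split=> //; split=> //=; exact: le_trans xa ab.
Qed.

End cuts.

(** * Sets whose holes are gaps *)

Section gapped_sets.
Context {R : realType}.
Implicit Types (T E : set R).

(** The consequence of [in_K] on which the proof works. It speaks of what lies between two points of
    the set, and therefore passes to the image under a scale and to pieces cut between two points,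
    where the energy arguments are applied again. *)
Definition gapped T := (exists a b, [/\ T a, T b & a < b]) /\
  forall a x b, T a -> T b -> a < x -> x < b -> ~ T x ->
    exists c d, [/\ gaps T (c, d), c < x & x < d].

Lemma in_K_open E a x b : in_K E -> E a -> E b -> a < x -> x < b -> ~ E x ->
  exists2 e : R, 0 < e & forall y, E y -> e <= `|x - y|.
Proof.
move=> [cE _] Ea Eb ax xb nEx.
have := closed_openC cE; rewrite openE => /(_ x%:E) /=.
have nC : (~` ([set x%:E | x in E] `|` [set lend E; rend E])) x%:E.
  move=> [[y Ey [yx]]|[lx|rx]].
  - by apply: nEx; rewrite -yx.
  - have : (lend E <= a%:E)%E by apply: ereal_inf_lbound; exists a.
    by rewrite -lx lee_fin leNgt ax.
  - have : (b%:E <= rend E)%E by apply: ereal_sup_ubound; exists b.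
    by rewrite -rx lee_fin leNgt xb.
move=> /(_ nC); rewrite /interior /= => /nbhs_EFin /nbhs_ballP[e /= e0 He].
exists e => // y Ey; rewrite leNgt; apply/negP => xy.
by apply: (He y xy); left; exists y.
Qed.

(** The gap around a missing point runs from the supremum of the points on its left to the infimum
    of those on its right; both are in [E], since a missing point between points of [E] has a ball
    free of [E] around it ([in_K_open]). *)
Lemma in_K_gapped E : in_K E -> gapped E.
Proof.
move=> HE; split.
  have [_ lr] := HE.
  have [a Ea] : E !=set0.
    apply/set0P/eqP => E0; move: lr; rewrite /lend /rend E0 image_set0.
    by rewrite ereal_inf0 ereal_sup0 ltNge leNye.
  have [[b [Eb ba]]|H] := pselect (exists b, E b /\ b != a).
    by have [ab|ab|ab] := ltgtP a b; [exists a, b|exists b, a|rewrite ab eqxx in ba].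
  have Ea1 : E = [set a].
    apply/seteqP; split=> x /=; last by move=> ->.
    by move=> Ex; apply: contrapT => xa; apply: H; exists x; split => //; apply/eqP.
  by move: lr; rewrite /lend /rend Ea1 image_set1 ereal_inf1 ereal_sup1 ltxx.
move=> a x b Ea Eb ax xb nEx.
pose L := [set y | E y /\ y < x]; pose U := [set y | E y /\ x < y].
have hL : has_sup L by split; [exists a|exists x => y [_ /ltW]].
have hU : has_inf U by split; [exists b|exists x => y [_ /ltW]].
have aL : a <= sup L by apply: ub_le_sup => //; exact: hL.2.
have Lx : sup L <= x by apply: ge_sup; [exact: hL.1|move=> y [_ /ltW]].
have Ub : inf U <= b by apply: ge_inf => //; exact: hU.2.
have xU : x <= inf U by apply: lb_le_inf; [exact: hU.1|move=> y [_ /ltW]].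
have EL : E (sup L).
  apply: contrapT => nE; have aL' : a < sup L.
    by rewrite lt_neqAle aL andbT; apply/eqP => H; apply: nE; rewrite -H.
  have [e e0 He] := in_K_open HE Ea Eb aL' (le_lt_trans Lx xb) nE.
  have [y Ly yL] := sup_adherent e0 hL; have := He y Ly.1.
  by rewrite ger0_norm ?subr_ge0 ?(ub_le_sup hL.2) //; lra.
have EU : E (inf U).
  apply: contrapT => nE; have Ub' : inf U < b.
    by rewrite lt_neqAle Ub andbT; apply/eqP => H; apply: nE; rewrite H.
  have [e e0 He] := in_K_open HE Ea Eb (lt_le_trans ax xU) Ub' nE.
  have [y Uy yU] := inf_adherent e0 hU; have := He y Uy.1.
  by rewrite ler0_norm ?subr_le0 ?(ge_inf hU.2) //; lra.
have Lx' : sup L < x.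
  by rewrite lt_neqAle Lx andbT; apply/eqP => H; apply: nEx; rewrite -H.
have xU' : x < inf U.
  by rewrite lt_neqAle xU andbT; apply/eqP => H; apply: nEx; rewrite H.
exists (sup L), (inf U); split=> //; do 3?[split=> //=]; first exact: lt_trans xU'.
move=> y /andP[Ly yU] Ey; have [yx|xy|yx] := ltgtP y x.
- by have := ub_le_sup hL.2 (conj Ey yx); rewrite leNgt Ly.
- by have := ge_inf hU.2 (conj Ey xy); rewrite leNgt yU.
- by apply: nEx; rewrite -yx.
Qed.

Lemma gap_sup T c d x : gaps T (c, d) -> c < x -> x < d -> sup [set y | T y /\ y < x] = c.
Proof.
move=> [/= Tc [Td [cd nT]]] cx xd; apply/eqP; rewrite eq_le; apply/andP; split.
- apply: ge_sup; first by exists c.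
  by move=> y [Ty yx]; rewrite leNgt; apply/negP => cy; apply: (nT y) => //; rewrite cy (lt_trans yx).
- by apply: ub_le_sup; [exists x => y [_ /ltW]|].
Qed.

Lemma gap_inf T c d x : gaps T (c, d) -> c < x -> x < d -> inf [set y | T y /\ x < y] = d.
Proof.
move=> [/= Tc [Td [cd nT]]] cx xd; apply/eqP; rewrite eq_le; apply/andP; split.
- by apply: ge_inf; [exists x => y [_ /ltW]|].
- apply: lb_le_inf; first by exists d.
  by move=> y [Ty yx]; rewrite leNgt; apply/negP => cy; apply: (nT y) => //; rewrite cy (lt_trans _ yx).
Qed.

Section gapped.
Context {T} (gT : gapped T).

Lemma gapped_ex : T !=set0.
Proof. by case: gT => -[a [b [Ta _ _]]] _; exists a. Qed.

Lemma closed_cut a b : T a -> T b -> closed (cut T a b).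
Proof.
move=> Ta Tb; rewrite -[cut T a b]setCK; apply: open_closedC; rewrite openE => x nx.
rewrite /interior; have [xa|ax] := ltP x a.
  by apply: filterS (lt_nbhsl xa) => y ya [_ /= /andP[]]; rewrite leNgt ya.
have [bx|xb] := ltP b x.
  by apply: filterS (lt_nbhsr bx) => y ya [_ /= /andP[_]]; rewrite leNgt ya.
have nTx : ~ T x by move=> Tx; apply: nx; split=> //=; rewrite ax.
have ax' : a < x by rewrite lt_neqAle ax andbT; apply/eqP => H; apply: nTx; rewrite -H.
have xb' : x < b by rewrite lt_neqAle xb andbT; apply/eqP => H; apply: nTx; rewrite H.
have [c [d [[_ [_ [_ nT]]] cx xd]]] := gT.2 _ _ _ Ta Tb ax' xb' nTx.
apply: filterS2 (lt_nbhsr cx) (lt_nbhsl xd) => y cy yd [Ty _].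
by apply: (nT y) => //=; rewrite cy.
Qed.

Lemma compact_cut a b : T a -> T b -> compact (cut T a b).
Proof.
move=> Ta Tb; apply: (subclosed_compact (closed_cut Ta Tb) (@segment_compact _ a b)).
by move=> x [_ /=]; rewrite in_itv.
Qed.

End gapped.

Lemma cofinal_seq T : T !=set0 -> exists b : nat -> R,
  [/\ forall n, T (b n), {homo b : m n / (m <= n)%N >-> m <= n} &
      forall x, T x -> exists n, x <= b n].
Proof.
move=> [x0 Tx0].
have [[m [Tm mT]]|nm] := pselect (exists m, T m /\ forall x, T x -> x <= m).
  by exists (fun=> m); split=> // x Tx; exists 0%N; exact: mT.
(* Without a maximum, for each rational that is at most some point of [T] such a point is picked,
   and running maxima make the sequence monotone; [x0] is the default for rationals above [T]. *)
pose q n : R := if unpickle n is Some r then ratr r else 0.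
pose b0 n := xget x0 [set y | T y /\ q n <= y].
have Tb0 n : T (b0 n) by rewrite /b0; case: xgetP => // y _ [].
pose b := fix b n := if n is n'.+1 then Num.max (b n') (b0 n) else b0 0%N.
have bS n : b n <= b n.+1 by rewrite /= le_max lexx.
have b0b n : b0 n <= b n by case: n => // n; rewrite /= le_max lexx orbT.
exists b; split.
- by elim=> [|n IH] /=; [exact: Tb0|case: leP => _].
- by apply: homo_leq => //; exact: le_trans.
- move=> x Tx; have [y Ty xy] : exists2 y, T y & x < y.
    apply: contrapT => H; apply: nm; exists x; split=> // y Ty.
    by rewrite leNgt; apply/negP => xy; apply: H; exists y.
  have [r] := rat_in_itvoo xy; rewrite in_itv /= => /andP[xr ry].
  exists (pickle r); apply: le_trans (b0b _); rewrite /b0; case: xgetP => [z _ []|].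
    by rewrite /q pickleK => _ /(le_trans _); apply; exact: ltW.
  by move=> /(_ y); rewrite /q pickleK => /(_ (conj Ty (ltW ry))).
Qed.

Lemma coinitial_seq T : T !=set0 -> exists a : nat -> R,
  [/\ forall n, T (a n), {homo a : m n / (m <= n)%N >-> n <= m} &
      forall x, T x -> exists n, a n <= x].
Proof.
move=> [x Tx].
have [|b [Tb b_nd b_cof]] := @cofinal_seq [set - x | x in T]; first by exists (- x), x.
exists (fun n => - b n); split.
- by move=> n; have [y Ty <-] := Tb n; rewrite opprK.
- by move=> m n mn; rewrite lerN2 b_nd.
- by move=> y Ty; have [|n yb] := b_cof (- y); [exists y|exists n; rewrite lerNl].
Qed.

Lemma exhaust_seq T : T !=set0 -> exists a b : nat -> R,
  [/\ forall n, T (a n) /\ T (b n), forall n, a n <= b n,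
      {homo a : m n / (m <= n)%N >-> n <= m}, {homo b : m n / (m <= n)%N >-> m <= n} &
      forall x, T x -> \forall n \near \oo, a n <= x <= b n].
Proof.
move=> /[dup] T0 [x0 Tx0]; have [b [Tb b_nd b_cof]] := cofinal_seq T0.
have [a [Ta a_ni a_coi]] := coinitial_seq T0.
exists (fun n => Num.min (a n) x0), (fun n => Num.max (b n) x0); split.
- by move=> n; case: (leP (a n)) => _; case: (leP (b n)) => _.
- by move=> n; rewrite ge_min !le_max lexx !orbT.
- by move=> m n mn; rewrite le_min !ge_min a_ni // lexx orbT.
- by move=> m n mn; rewrite ge_max !le_max b_nd // lexx orbT.
- move=> x Tx; have [m mx] := a_coi _ Tx; have [n xn] := b_cof _ Tx.
  exists (maxn m n) => //= k; rewrite /= geq_max => /andP[mk nk].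
  by rewrite ge_min le_max (le_trans (a_ni _ _ mk)) //= (le_trans xn) ?b_nd.
Qed.

Lemma gapped_measurable T : gapped T -> measurable (T : set (measurableTypeR R)).
Proof.
move=> gT; have [a [b [Tab ab _ _ abT]]] := exhaust_seq (gapped_ex gT).
have -> : T = \bigcup_n cut T (a n) (b n).
  apply/seteqP; split=> [x Tx|x [n _ []//]].
  by have [n _ /(_ n (leqnn _))] := abT _ Tx; exists n.
apply: bigcup_measurable => n _; apply: closed_measurable.
exact: closed_cut gT _ _ (Tab n).1 (Tab n).2.
Qed.

End gapped_sets.

(** * Form domains *)

Section square_integrable.
Context {R : realType} (mu : {measure set (measurableTypeR R) -> \bar R}).
Context {D : set R} (mD : measurable (D : set (measurableTypeR R))).
Implicit Types f g : R -> R.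

Definition nrm2 (A : set R) f : R := fine (\int[mu]_(x in A) ((f x) ^+ 2)%:E).

Lemma measurable_sqr f : measurable_fun D f -> measurable_fun D (fun x => ((f x) ^+ 2)%:E).
Proof. by move=> mf; apply/measurable_EFinP; exact: measurable_funX. Qed.

Lemma sqr_EFin_ge0 f x : D x -> (0 <= ((f x) ^+ 2)%:E)%E.
Proof. by rewrite lee_fin sqr_ge0. Qed.

Lemma nrm2E f : L2 mu D f -> (\int[mu]_(x in D) ((f x) ^+ 2)%:E = (nrm2 D f)%:E)%E.
Proof.
move=> [_ oo]; rewrite fineK // ge0_fin_numE //.
by apply: integral_ge0 => x _; rewrite lee_fin sqr_ge0.
Qed.

Lemma nrm2_ge0 f : 0 <= nrm2 D f.
Proof. by apply/fine_ge0/integral_ge0 => x _; rewrite lee_fin sqr_ge0. Qed.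

Lemma eq_nrm2 f g : {in D, f =1 g} -> nrm2 D f = nrm2 D g.
Proof. by move=> fg; rewrite /nrm2; congr fine; apply: eq_integral => x /fg ->. Qed.

Lemma eq_L2 f g : {in D, f =1 g} -> L2 mu D f -> L2 mu D g.
Proof.
move=> fg [mf foo]; split; first exact: eq_measurable_fun mf.
by rewrite (_ : integral _ _ _ = \int[mu]_(x in D) ((f x) ^+ 2)%:E)%E //; apply: eq_integral => x /fg ->.
Qed.

Lemma L2_le_gen f g (c : R) : measurable_fun D g -> 0 <= c -> L2 mu D f ->
  (forall x, D x -> (g x) ^+ 2 <= c * (f x) ^+ 2) -> L2 mu D g /\ nrm2 D g <= c * nrm2 D f.
Proof.
move=> mg c0 Lf gf; have [mf _] := Lf.
have le : (\int[mu]_(x in D) ((g x) ^+ 2)%:E <= (c * nrm2 D f)%:E)%E.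
  rewrite EFinM -nrm2E // -ge0_integralZl_EFin //; last exact: measurable_sqr.
    apply: ge0_le_integral => //; [exact: sqr_EFin_ge0|exact: measurable_sqr|].
    by apply: measurable_funeM; exact: measurable_sqr.
  exact: sqr_EFin_ge0.
have Lg : L2 mu D g by split=> //; apply: le_lt_trans le (ltry _).
by split=> //; rewrite -lee_fin -nrm2E.
Qed.

Lemma L2_le f g : measurable_fun D g -> L2 mu D f ->
  (forall x, D x -> `|g x| <= `|f x|) -> L2 mu D g /\ nrm2 D g <= nrm2 D f.
Proof.
move=> mg Lf gf; rewrite -[X in _ <= X]mul1r; apply: L2_le_gen => // x Dx.
by rewrite mul1r !expr2; apply: ler_norm_sqr; exact: gf.
Qed.

Lemma L2_0 : L2 mu D (fun=> 0).
Proof.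
split; first exact: measurable_cst.
by under eq_integral do rewrite expr0n /=; rewrite integral0.
Qed.

Lemma nrm2_0 : nrm2 D (fun=> 0) = 0.
Proof. by rewrite /nrm2; under eq_integral do rewrite expr0n /=; rewrite integral0. Qed.

Lemma L2D_gen f g : L2 mu D f -> L2 mu D g -> L2 mu D (fun x => f x + g x) /\
  nrm2 D (fun x => f x + g x) <= 2 * nrm2 D f + 2 * nrm2 D g.
Proof.
move=> Lf Lg; have [mf _] := Lf; have [mg _] := Lg.
have mfg : measurable_fun D (fun x => f x + g x) by exact: measurable_funD.
have le : (\int[mu]_(x in D) ((f x + g x) ^+ 2)%:E <= (2 * nrm2 D f + 2 * nrm2 D g)%:E)%E.
  rewrite EFinD !EFinM -!nrm2E // -!ge0_integralZl_EFin //;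
    try (exact: measurable_sqr); try (exact: sqr_EFin_ge0).
  rewrite -ge0_integralD //; try (by apply: measurable_funeM; exact: measurable_sqr);
    try (by move=> x _; rewrite -EFinM lee_fin mulr_ge0 ?sqr_ge0).
  apply: ge0_le_integral => //; [exact: sqr_EFin_ge0|exact: measurable_sqr| |].
    by apply: emeasurable_funD; apply: measurable_funeM; exact: measurable_sqr.
  move=> x _; rewrite -!EFinM -EFinD lee_fin.
  have := sqr_ge0 (f x - g x); nra.
have Lfg : L2 mu D (fun x => f x + g x) by split=> //; apply: le_lt_trans le (ltry _).
by split=> //; rewrite -lee_fin -nrm2E.
Qed.

Lemma L2D f g : L2 mu D f -> L2 mu D g -> L2 mu D (fun x => f x + g x).
Proof. by move=> ? ?; apply: (L2D_gen _ _).1. Qed.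

Lemma L2Z (c : R) f : L2 mu D f -> L2 mu D (fun x => c * f x) /\
  nrm2 D (fun x => c * f x) <= c ^+ 2 * nrm2 D f.
Proof.
move=> Lf; apply: L2_le_gen => //; [|exact: sqr_ge0|by move=> x _; rewrite exprMn].
by apply: measurable_funM => //; exact: Lf.1.
Qed.

Lemma L2N f : L2 mu D f -> L2 mu D (fun x => - f x) /\ nrm2 D (fun x => - f x) <= nrm2 D f.
Proof. by move=> Lf; apply: L2_le => //; [apply: measurableT_comp => //; exact: Lf.1|move=> x _; rewrite normrN]. Qed.

Lemma L2B f g : L2 mu D f -> L2 mu D g -> L2 mu D (fun x => f x - g x).
Proof. by move=> Lf Lg; exact: L2D Lf (L2N Lg).1. Qed.

Lemma nrm2D_le f g : L2 mu D f -> L2 mu D g ->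
  nrm2 D (fun x => f x + g x) <= 2 * nrm2 D f + 2 * nrm2 D g.
Proof. by move=> ? ?; apply: (L2D_gen _ _).2. Qed.

Lemma nrm2B_le f g : L2 mu D f -> L2 mu D g ->
  nrm2 D (fun x => f x - g x) <= 2 * nrm2 D f + 2 * nrm2 D g.
Proof.
move=> Lf Lg; apply: le_trans (nrm2D_le Lf (L2N Lg).1) _.
by rewrite lerD2l ler_wpM2l // (L2N Lg).2.
Qed.

Lemma nrm2_distC f g : nrm2 D (fun x => f x - g x) = nrm2 D (fun x => g x - f x).
Proof.
by rewrite /nrm2; congr fine; apply: eq_integral => x _; rewrite -sqrrN opprB.
Qed.

Lemma nrm2_dominated (u_ : nat -> R -> R) f g : (forall n, measurable_fun D (u_ n)) ->
  L2 mu D g -> (forall n x, D x -> `|f x - u_ n x| <= `|g x|) ->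
  (forall x, D x -> u_ n x @[n --> \oo] --> f x) ->
  nrm2 D (fun x => f x - u_ n x) @[n --> \oo] --> 0.
Proof.
move=> mu_ Lg le uf; have mf : measurable_fun D f by exact: measurable_fun_cvg uf.
have mfu n : measurable_fun D (fun x => f x - u_ n x) by exact: measurable_funB.
have [| | | | | _ _] := @dominated_convergence _ _ _ mu D mD
  (fun n x => ((f x - u_ n x) ^+ 2)%:E) (cst 0%E) (fun x => ((g x) ^+ 2)%:E).
- by move=> n; exact: measurable_sqr.
- exact: measurable_cst.
- apply: aeW => x Dx; rewrite -[0%E]/(0%:E); apply: cvg_EFin; first exact: nearW.
  rewrite [X in _ --> X](_ : 0 = (f x - f x) ^+ 2); last by rewrite subrr expr0n.
  under [X in X @ _ --> _]funext do rewrite /= expr2.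
  rewrite expr2; by apply: cvgM; apply: cvgB; [exact: cvg_cst|exact: uf|exact: cvg_cst|exact: uf].
- apply/integrableP; split; first by apply: measurable_sqr; exact: Lg.1.
  under eq_integral do rewrite gee0_abs ?lee_fin ?sqr_ge0 //.
  exact: Lg.2.
- apply: aeW => x n Dx; rewrite gee0_abs ?lee_fin ?sqr_ge0 //.
  by rewrite !expr2; apply: ler_norm_sqr; exact: le.
- rewrite integral_cst // mul0e.
  by move=> /fine_cvgP [_].
Qed.

Lemma nrm2_fatou (u_ : nat -> R -> R) f M : (forall n, L2 mu D (u_ n)) ->
  (\forall n \near \oo, nrm2 D (u_ n) <= M) ->
  (forall x, D x -> u_ n x @[n --> \oo] --> f x) ->
  L2 mu D f /\ nrm2 D f <= M.
Proof.
move=> Lu [N _ uM] uf.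
have mf : measurable_fun D f by apply: measurable_fun_cvg uf => n; exact: (Lu n).1.
(* The shift by [N] makes the bound hold for every term of the sequence. *)
have := @fatou _ _ _ mu D mD (fun n x => ((u_ (n + N)%N x) ^+ 2)%:E).
move=> /(_ (fun n => measurable_sqr (Lu _).1))/(_ (fun n x => @sqr_EFin_ge0 (u_ (n + N)%N) x)).
have -> : (\int[mu]_(x in D) limn_einf (fun n => ((u_ (n + N)%N x) ^+ 2)%:E) =
  \int[mu]_(x in D) ((f x) ^+ 2)%:E)%E.
  apply: eq_integral => x /[!inE] Dx.
  have C : ((u_ (n + N)%N x) ^+ 2)%:E @[n --> \oo] --> ((f x) ^+ 2)%:E.
    apply: cvg_EFin; first exact: nearW.
    under [X in X @ _ --> _]funext do rewrite /= expr2.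
    by rewrite expr2; apply: cvgM; have := uf x Dx; rewrite -(cvg_shiftn N).
  by rewrite is_cvg_limn_einfE; [exact: cvg_lim|apply/cvg_ex; eexists; exact: C].
move=> le1; have le : (\int[mu]_(x in D) ((f x) ^+ 2)%:E <= M%:E)%E.
  apply: le_trans le1 _; rewrite limn_einf_lim; apply: lime_le; first exact: is_cvg_einfs.
  apply: nearW => n; apply: le_trans (_ : _ <= \int[mu]_(x in D) ((u_ (n + N)%N x) ^+ 2)%:E)%E _.
    by apply: ereal_inf_lbound; exists n => //=.
  by rewrite nrm2E // lee_fin uM //= leq_addl.
have Lf : L2 mu D f by split => //; apply: le_lt_trans le (ltry _).
by split=> //; rewrite -lee_fin -nrm2E.
Qed.

End square_integrable.

(** * Continuity on a subset of the line *)

Section continuity_on.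
Context {R : realType}.
Implicit Types (E : set R) (f : R -> R).

Lemma continuous_onP E f : {within E, continuous f} <->
  forall x, E x -> forall e : R, 0 < e -> exists2 d : R, 0 < d &
    forall y, E y -> `|x - y| < d -> `|f x - f y| < e.
Proof.
rewrite continuous_subspace_in; split=> H x.
- move=> Ex e e0; have := H x; rewrite inE => /(_ Ex) /cvgrPdist_lt /(_ e e0) H1.
  have : within E (nbhs x) [set t | `|f x - f t| < e] by rewrite nbhs_subspace_in.
  by move=> /nbhs_ballP[d /= d0 dH]; exists d => // y Ey xy; apply: (dH y).
- rewrite inE => Ex; apply/cvgrPdist_lt => e e0.
  have : within E (nbhs x) [set t | `|f x - f t| < e].
    have [d d0 dH] := H x Ex e e0.
    by apply/nbhs_ballP; exists d => //= y xy Ey; exact: dH.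
  by rewrite nbhs_subspace_in.
Qed.

Lemma continuous_on_measurable E f : measurable (E : set (measurableTypeR R)) ->
  {within E, continuous f} -> measurable_fun (E : set (measurableTypeR R)) f.
Proof. exact: subspace_continuous_measurable_fun. Qed.

End continuity_on.

(** * Form domains attached to a slow scale *)

Section form_domain.
Context {R : realType}.
Implicit Types (s f g h u v : R -> R) (E T : set R).
Notation Bmeasure := {measure set (measurableTypeR R) -> \bar R}.

(** Strict monotonicity with Lipschitz constant 1. The Lipschitz bound makes functions of finite
    [s]-energy continuous for the usual distance, and makes the sums for [s] dominate those for
    [id]. *)
Definition slow E s := forall x y, E x -> E y -> x < y -> 0 < s y - s x <= y - x.

Lemma slow_increasing E s : slow E s -> increasing_on E s.
Proof. by move=> sE x y Ex Ey /(sE _ _ Ex Ey)/andP[]; rewrite subr_gt0. Qed.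

Lemma slow_id E : slow E id.
Proof. by move=> x y _ _ xy; rewrite subr_gt0 xy lexx. Qed.

Lemma slow_sub E E' s : E' `<=` E -> slow E s -> slow E' s.
Proof. by move=> sub sE x y /sub ? /sub; exact: sE. Qed.

Lemma slow_dist E s x y : slow E s -> E x -> E y -> `|s x - s y| <= `|x - y|.
Proof.
move=> sE Ex Ey; have [xy|yx|->] := ltgtP x y; last by rewrite !subrr.
- by have /andP[s0 sxy] := sE _ _ Ex Ey xy; rewrite distrC [leRHS]distrC !gtr0_norm ?subr_gt0 // -subr_gt0.
- by have /andP[s0 sxy] := sE _ _ Ey Ex yx; rewrite !gtr0_norm ?subr_gt0 // -subr_gt0.
Qed.

Lemma energy_holder E s f x y : increasing_on E s -> fin_energy s E f -> E x -> E y ->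
  (f x - f y) ^+ 2 <= `|s x - s y| * energy s E f f.
Proof.
move=> sE ff; wlog xy : x y / x <= y => [H Ex Ey|Ex Ey].
  by have [xy|/ltW yx] := leP x y; [|rewrite -sqrrN opprB distrC]; exact: H.
have sxy : s x <= s y.
  by move: xy; rewrite le_eqVlt => /predU1P[->//|xy]; exact/ltW/sE.
by rewrite -sqrrN opprB distrC ger0_norm ?subr_ge0 //; exact: increment_le_energy.
Qed.

Lemma fin_energy_continuous E s f : slow E s -> fin_energy s E f -> {within E, continuous f}.
Proof.
move=> sE ff; have iE := slow_increasing sE; apply/continuous_onP => x Ex e e0.
set Q := energy s E f f; have Q0 : 0 <= Q by exact: energy_ge0.
exists (e ^+ 2 / (Q + 1)) => [|y Ey xy]; first by rewrite divr_gt0 ?exprn_gt0 // ltr_wpDl.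
rewrite -ltr_sqr ?nnegrE // ?(ltW e0) // real_normK ?num_real //.
apply: le_lt_trans (energy_holder iE ff Ex Ey) _; rewrite -/Q.
rewrite ltr_pdivlMr ?ltr_wpDl // in xy; apply: le_lt_trans xy.
have := slow_dist sE Ex Ey; have := normr_ge0 (x - y); have := normr_ge0 (s x - s y); nra.
Qed.

Section ends.
Variable c : R.

(** The sign [c] treats both ends at once: [c = 1] is the right end, [c = -1] the left one. The
    function tends to 0 along [E] towards that end. *)
Definition vanish E f := forall e : R, 0 < e ->
  exists2 p, E p & forall x, E x -> c * p <= c * x -> `|f x| < e.

(** The end is missing from [E], as no point of [E] is extreme on that side, and an increasing [s]
    has a finite limit there. *)
Definition end_bounded E s := (forall x, E x -> exists2 y, E y & c * x < c * y) /\
  exists M, forall x, E x -> c * s x <= M.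

Lemma vanishD E f g : vanish E f -> vanish E g -> vanish E (fun x => f x + g x).
Proof.
move=> vf vg e e0; have e2 : 0 < e / 2 by rewrite divr_gt0.
have [p Ep pf] := vf _ e2; have [q Eq qg] := vg _ e2.
wlog pq : f g p Ep pf q Eq qg vf vg / c * p <= c * q => [H|].
  have [pq|/ltW qp] := leP (c * p) (c * q); first exact: (H f g p _ _ q).
  by have [r Er H2] := H g f q Eq qg p Ep pf vg vf qp; exists r => // x Ex rx; rewrite addrC; exact: H2.
exists q => // x Ex qx; apply: le_lt_trans (ler_normD _ _) _.
by have := qg x Ex qx; have := pf x Ex (le_trans pq qx); lra.
Qed.

Lemma vanish_le E f g : vanish E f -> (forall x, E x -> `|g x| <= `|f x|) -> vanish E g.
Proof.
move=> vf gf e e0; have [p Ep pf] := vf e e0; exists p => // x Ex px.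
by apply: le_lt_trans (gf x Ex) _; exact: pf.
Qed.

Lemma vanishZ E (a : R) f : vanish E f -> vanish E (fun x => a * f x).
Proof.
move=> vf e e0; have a1 : 0 < `|a| + 1 by rewrite ltr_wpDl.
have [p Ep pf] := vf (e / (`|a| + 1)) (divr_gt0 e0 a1).
exists p => // x Ex px; have := pf x Ex px; rewrite ltr_pdivlMr // normrM.
have := normr_ge0 (f x); nra.
Qed.

Lemma vanish_lim E p0 (u_ : nat -> R -> R) f : E p0 -> (forall n, vanish E (u_ n)) ->
  (forall e : R, 0 < e -> exists n, forall x, E x -> c * p0 <= c * x -> `|f x - u_ n x| <= e) ->
  vanish E f.
Proof.
move=> Ep0 vu uf e e0; have e2 : 0 < e / 2 by rewrite divr_gt0.
have [n nf] := uf _ e2; have [p Ep pu] := vu n _ e2.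
have H x : E x -> c * p0 <= c * x -> c * p <= c * x -> `|f x| < e.
  move=> Ex p0x px; have := nf x Ex p0x; have := pu x Ex px.
  have := ler_normD (f x - u_ n x) (u_ n x); rewrite subrK; lra.
have [pp|/ltW pp] := leP (c * p0) (c * p).
- by exists p => // x Ex px; apply: H => //; exact: le_trans px.
- by exists p0 => // x Ex px; apply: H => //; exact: le_trans px.
Qed.

End ends.

Definition end_cond E s f := forall b : bool, end_bounded ((-1) ^+ b) E s -> vanish ((-1) ^+ b) E f.

Variable mu : Bmeasure.

Definition form_dom s E f := [/\ fin_energy s E f, L2 mu E f & end_cond E s f].

Definition nrm1 s E f : R := energy s E f f + nrm2 mu E f.

Context {E : set R} (gE : gapped E) {s : R -> R} (sE : slow E s).
Let iE := slow_increasing sE.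
Let mE : measurable (E : set (measurableTypeR R)) := gapped_measurable gE.

Lemma form_domD f g : form_dom s E f -> form_dom s E g -> form_dom s E (fun x => f x + g x).
Proof.
move=> [ff Lf vf] [fg Lg vg]; split.
- exact: fin_energyD.
- exact: L2D.
- by move=> b H; apply: vanishD; [exact: vf|exact: vg].
Qed.

Lemma form_domZ (a : R) f : form_dom s E f -> form_dom s E (fun x => a * f x).
Proof.
move=> [ff Lf vf]; split.
- exact: fin_energyZ.
- exact: (L2Z _ _ _).1.
- by move=> b H; apply: vanishZ; exact: vf.
Qed.

Lemma form_domB f g : form_dom s E f -> form_dom s E g -> form_dom s E (fun x => f x - g x).
Proof.
move=> df dg; have := form_domD df (form_domZ (-1) dg).
by rewrite (_ : (fun x => f x + -1 * g x) = (fun x => f x - g x)) //; apply/funext => x; rewrite mulN1r.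
Qed.

Lemma form_dom0 : form_dom s E (fun=> 0).
Proof.
split; [exact: fin_energy_cst|exact: L2_0|].
move=> b _ e e0; have [p Ep] := gapped_ex gE.
by exists p => // x _ _; rewrite normr0.
Qed.

Lemma eq_form_dom f g : (forall x, E x -> f x = g x) -> form_dom s E f -> form_dom s E g.
Proof.
move=> fg [ff Lf vf]; split; first exact: eq_fin_energy ff.
- by apply: eq_L2 Lf => x; rewrite inE => /fg.
- by move=> b /vf v; apply: vanish_le v _ => x Ex; rewrite fg.
Qed.

Lemma eq_nrm1 f g : (forall x, E x -> f x = g x) -> nrm1 s E f = nrm1 s E g.
Proof.
move=> fg; rewrite /nrm1 (eq_energy fg fg); congr (_ + _).
by apply: eq_nrm2 => x; rewrite inE => /fg.
Qed.

Lemma form_dom_contract f g : form_dom s E f ->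
  (forall x, E x -> `|g x| <= `|f x|) ->
  (forall x y, E x -> E y -> x < y -> `|g y - g x| <= `|f y - f x|) ->
  form_dom s E g.
Proof.
move=> [ff Lf vf] gf dgf; have fg := fin_energy_le iE ff dgf; split=> //.
- apply: (L2_le mE _ Lf gf).1.
  by apply: continuous_on_measurable mE _; exact: fin_energy_continuous fg.
- by move=> b /vf v; exact: vanish_le v gf.
Qed.

Lemma nrm1_ge0 f : fin_energy s E f -> 0 <= nrm1 s E f.
Proof. by move=> ff; rewrite addr_ge0 ?nrm2_ge0 ?energy_ge0. Qed.

Lemma nrm1D_le f g : form_dom s E f -> form_dom s E g ->
  nrm1 s E (fun x => f x + g x) <= 2 * nrm1 s E f + 2 * nrm1 s E g.
Proof.
move=> [ff Lf vf] [fg Lg vg]; have := energyD_le iE ff fg; have := nrm2D_le mE Lf Lg.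
rewrite /nrm1; lra.
Qed.

Lemma nrm1B_le f g : form_dom s E f -> form_dom s E g ->
  nrm1 s E (fun x => f x - g x) <= 2 * nrm1 s E f + 2 * nrm1 s E g.
Proof.
move=> [ff Lf vf] [fg Lg vg]; have := energyB_le iE ff fg; have := nrm2B_le mE Lf Lg.
rewrite /nrm1; lra.
Qed.

Lemma nrm1Z_le (a : R) f : form_dom s E f -> nrm1 s E (fun x => a * f x) <= a ^+ 2 * nrm1 s E f.
Proof.
move=> [ff Lf vf]; rewrite /nrm1 energyZZ // mulrDr lerD2l; exact: (L2Z _ _ _).2.
Qed.

Lemma nrm1_distC f g : form_dom s E f -> form_dom s E g ->
  nrm1 s E (fun x => f x - g x) = nrm1 s E (fun x => g x - f x).
Proof.
move=> [ff Lf vf] [fg Lg vg]; rewrite /nrm1 nrm2_distC !energyB //; congr (_ + _).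
by rewrite [energy s E g f]energyC; ring.
Qed.

(** Both truncations used later, clamping at a large height and removing the part below a small
    height, are comonotone with their remainders; energies then converge by [comonotone_approx] and
    the [L2] norms by domination. *)
Lemma form_dom_approx (u_ : nat -> R -> R) f : form_dom s E f ->
  (forall n, comonotone (T := E) (u_ n) (fun x => f x - u_ n x)) ->
  (forall n x, E x -> `|u_ n x| <= `|f x|) ->
  (forall n x, E x -> `|f x - u_ n x| <= `|f x|) ->
  (forall x, E x -> u_ n x @[n --> \oo] --> f x) ->
  (forall n, form_dom s E (u_ n)) /\
  nrm1 s E (fun x => f x - u_ n x) @[n --> \oo] --> 0.
Proof.
move=> df cu uf ruf cvg; have [ff Lf vf] := df.
have fu n : form_dom s E (u_ n).
  apply: form_dom_contract df (uf n) _ => x y Ex Ey xy.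
  have := cu n x y Ex Ey xy.
  rewrite (_ : f y - f x = (u_ n y - u_ n x) + ((f y - u_ n y) - (f x - u_ n x))); last by ring.
  move: (u_ n y - u_ n x) ((f y - u_ n y) - (f x - u_ n x)) => a b ab.
  by rewrite -ler_sqr ?nnegrE // !real_normK ?num_real //; nra.
split=> //; rewrite -[0]addr0; apply: cvgD; first exact: comonotone_approx.
apply: nrm2_dominated Lf _ _ => // n; have [fn Ln vn] := fu n; exact: Ln.1.
Qed.

End form_domain.

(** * Truncation of real numbers *)

Section truncation.
Context {R : realType}.
Implicit Types (x y c t : R).

Definition clamp c x : R := Num.max (- c) (Num.min x c).

Lemma clamp_mono c x y : 0 <= c -> x <= y ->
  clamp c x <= clamp c y /\ x - clamp c x <= y - clamp c y.
Proof.
move=> c0 xy; rewrite /clamp.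
by case: (leP x c) => xc; case: (leP y c) => yc;
  rewrite ?(le_max, ge_max) /Num.max; split; repeat case: ifP => //; lra.
Qed.

(** Both [clamp c] and its complement are nondecreasing in the argument. *)
Lemma clamp_comono c x y : 0 <= c ->
  0 <= (clamp c y - clamp c x) * ((y - clamp c y) - (x - clamp c x)).
Proof.
move=> c0; have [xy|/ltW yx] := leP x y.
- have [? ?] := clamp_mono c0 xy; apply: mulr_ge0; lra.
- have [? ?] := clamp_mono c0 yx; rewrite -mulrNN; apply: mulr_ge0; lra.
Qed.

Lemma clampP c x : 0 <= c ->
  [\/ clamp c x = x /\ `|x| <= c, clamp c x = c /\ c <= x | clamp c x = - c /\ x <= - c].
Proof.
move=> c0; rewrite /clamp; case: (leP x c) => xc; last first.
  by apply: Or32; split; [apply/max_idPr; lra|exact: ltW].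
case: (leP (- c) x) => cx; last by apply: Or33; split=> //; exact: ltW.
by apply: Or31; split=> //; rewrite ler_norml cx.
Qed.

Lemma clamp_norm c x : 0 <= c -> `|clamp c x| <= `|x| /\ `|x - clamp c x| <= `|x|.
Proof.
move=> c0; have [[-> _]|[-> cx]|[-> xc]] := clampP x c0.
- by rewrite subrr normr0.
- by have := le_trans c0 cx => x0; rewrite !ger0_norm ?subr_ge0 //; lra.
- have x0 : x <= 0 by lra.
  by rewrite normrN (ger0_norm c0) !ler0_norm //; lra.
Qed.

Lemma clamp_le c x : 0 <= c -> `|clamp c x| <= c.
Proof.
by move=> c0; have [[-> //]|[-> _]|[-> _]] := clampP x c0; rewrite ?normrN ger0_norm.
Qed.

Lemma cvg_clamp x : clamp n%:R x @[n --> \oo] --> x.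
Proof.
apply: cvg_near_cst; near=> n.
have xn : `|x| <= n%:R by near: n; exact: nbhs_infty_ger.
by have [[-> //]|[-> ?]|[-> ?]] := clampP x (ler0n R n); move: xn; rewrite ler_norml => /andP[]; lra.
Unshelve. all: by end_near. Qed.

Lemma cvg_clamp0 x : x - clamp n.+1%:R^-1 x @[n --> \oo] --> x.
Proof.
rewrite -[X in _ --> X]subr0; apply: cvgB; first exact: cvg_cst.
apply/norm_cvg0P; apply: (@squeeze_cvgr _ _ _ _ (fun=> 0) (fun n => n.+1%:R^-1)).
- by apply: nearW => n; rewrite normr_ge0 clamp_le.
- exact: cvg_cst.
- exact: cvg_harmonic.
Qed.

Lemma pos_part_lip x y : `|Num.max y 0 - Num.max x 0| <= `|y - x|.
Proof.
wlog xy : x y / x <= y => [H|].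
  by have [xy|/ltW yx] := leP x y; [|rewrite distrC [leRHS]distrC]; exact: H.
rewrite [leRHS]ger0_norm ?subr_ge0 // ger0_norm; last first.
  by rewrite subr_ge0 ge_max !le_max xy lexx orbT.
by case: (leP y 0); case: (leP x 0); lra.
Qed.

Lemma min_lip x y x' y' : `|Num.min x y - Num.min x' y'| <= Num.max `|x - x'| `|y - y'|.
Proof.
rewrite le_max; case: (leP x y) => xy; case: (leP x' y') => xy'.
- by rewrite lexx.
- have [h|h] := leP (x - y') 0; apply/orP.
  + by left; rewrite !ler0_norm; lra.
  + by right; rewrite !ger0_norm; lra.
- have [h|h] := leP (y - x') 0; apply/orP.
  + by right; rewrite !ler0_norm; lra.
  + by left; rewrite !ger0_norm; lra.
- by rewrite lexx orbT.
Qed.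

Definition clamp01 t : R := Num.max 0 (Num.min t 1).

Lemma clamp01_ge0 t : 0 <= clamp01 t. Proof. by rewrite le_max lexx. Qed.
Lemma clamp01_le1 t : clamp01 t <= 1. Proof. by rewrite ge_max ler01 ge_min lexx orbT. Qed.

Lemma clamp01_lip t t' : t <= t' -> 0 <= clamp01 t' - clamp01 t <= t' - t.
Proof.
move=> tt; rewrite /clamp01; case: (leP t 1) => ?; case: (leP t' 1) => ?.
all: rewrite /Num.max; repeat case: ifP; lra.
Qed.

Lemma clamp01_1 t : 1 <= t -> clamp01 t = 1.
Proof. by move=> t1; rewrite /clamp01 min_r //; apply/max_idPr. Qed.

Lemma clamp01_0 t : t <= 0 -> clamp01 t = 0.
Proof. by move=> t1; rewrite /clamp01; apply/max_idPl; rewrite ge_min t1. Qed.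

End truncation.

(** * Continuity of point evaluation *)

Section evaluation.
Context {R : realType} {mu : {measure set (measurableTypeR R) -> \bar R}} {E : set R}.
Context (gE : gapped E) (Hmu : radon_full_support E mu).
Let mE : measurable (E : set (measurableTypeR R)) := gapped_measurable gE.

(** For [y] in [E] at distance less than 1 from [x] one has [(f x - f y) ^+ 2 <= Q], hence
    [f y ^+ 2 >= f x ^+ 2 / 2 - Q]; integration over that ball, which has positive measure, bounds
    [f x ^+ 2] by the norm. *)
Lemma form_dom_eval s x : slow E s -> E x -> exists2 C : R, 0 < C &
  forall f, form_dom mu s E f -> f x ^+ 2 <= C * nrm1 mu s E f.
Proof.
move=> sE Ex; have iE := slow_increasing sE; have [_ [_ fullE]] := Hmu.
pose U := ball x (1 : R).
have V0 : (0 < mu (U `&` E))%E by apply: (fullE U x) => //; [exact: ball_open|exact: ballxx].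
(* Any positive lower bound of the mass will do; the mass itself may be infinite. *)
have [m m0 mV] : exists2 m : R, 0 < m & (m%:E <= mu (U `&` E))%E.
  move: V0; case: (mu (U `&` E)) => [r|_|//]; first by rewrite lte_fin => r0; exists r.
  by exists 1 => //; rewrite leey.
exists (2 + 2 / m) => [|f [ff Lf vf]]; first by rewrite ltr_pwDl // divr_ge0 // ltW.
set Q := energy s E f f; set N := nrm2 mu E f.
have Q0 : 0 <= Q by exact: energy_ge0.
have N0 : 0 <= N by exact: nrm2_ge0.
have le y : (U `&` E) y -> f x ^+ 2 / 2 - Q <= f y ^+ 2.
  move=> [Uy Ey]; have := energy_holder iE ff Ex Ey; rewrite -/Q.
  have := slow_dist sE Ex Ey; move: Uy; rewrite /U /ball /= => Uy.
  have := sqr_ge0 (f x - 2 * f y); have := normr_ge0 (s x - s y).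
  move: `|s x - s y| => d; nra.
have Kle : (f x ^+ 2 / 2 - Q) * m <= N.
  have [K0|K0] := leP (f x ^+ 2 / 2 - Q) 0; first by apply: le_trans N0; nra.
  rewrite -lee_fin -nrm2E //.
  have mU : measurable (U : set (measurableTypeR R)) by apply: open_measurable; exact: ball_open.
  have mUE : measurable (U `&` E : set (measurableTypeR R)) by exact: measurableI.
  apply: (@le_trans _ _ (\int[mu]_(y in U `&` E) ((f y) ^+ 2)%:E)%E).
    apply: (@le_trans _ _ (\int[mu]_(y in U `&` E) (f x ^+ 2 / 2 - Q)%:E)%E).
      by rewrite integral_cst // EFinM lee_wpmul2l // lee_fin ltW.
    apply: ge0_le_integral => //.
    + by move=> y _; rewrite lee_fin ltW.
    + apply: measurable_funS (mE) (@subIsetr _ _ _) _; exact: measurable_sqr Lf.1.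
  apply: ge0_subset_integral => //; first exact: measurable_sqr Lf.1.
  by move=> y _; rewrite lee_fin sqr_ge0.
rewrite -/N /nrm1 -/Q -/N.
have : f x ^+ 2 / 2 - Q <= N / m by rewrite ler_pdivlMr.
have : 0 <= Q / m by rewrite divr_ge0 // ltW.
rewrite mulrDl mulrDr -!mulrA [m^-1 * _]mulrC; lra.
Qed.

End evaluation.

(** * Functions of small slope and compact support *)

Section cutoff.
Context {R : realType}.
Implicit Types (s f g : R -> R) (E T : set R).

(** Bounding one factor of each squared increment by the slope condition leaves the increments of
    [al] divided by [L]; these telescope, and [al] ranges over an interval of length 1. *)
Lemma monotone_energy T s (al : R -> R) (L : R) : increasing_on T s -> 0 < L ->
  (forall x, T x -> 0 <= al x <= 1) ->
  (forall x y, T x -> T y -> x < y -> 0 <= al y - al x <= (s y - s x) / L) ->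
  fin_energy s T al /\ energy s T al al <= L^-1.
Proof.
move=> sT L0 al01 slope.
have C c : chain T c -> csum s al al c <= L^-1.
  case: c => [_|x p cc]; first by rewrite invr_ge0 ltW.
  have Tx : T x by apply: cc.2; rewrite mem_head.
  have Tl : T (last x p) by apply: cc.2; rewrite mem_last.
  apply: (@le_trans _ _ ((al (last x p) - al x) / L)); last first.
    have := al01 _ Tx; have := al01 _ Tl => /andP[? ?] /andP[? ?].
    by rewrite ler_pdivrMr // mulVf ?gt_eqF //; lra.
  move: cc {Tx Tl}; elim: p x => [|y p IH] x cc; first by rewrite /= subrr mul0r.
  have /chain_cons[Tx cp xp] := cc; have /chain_cons[Ty _ _] := cp.
  have xy : x < y by rewrite xp // mem_head.
  rewrite csum_cons2; apply: le_trans (lerD _ (IH y cp)) _; first exact: lexx.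
  rewrite /= [X in _ <= X](_ : _ = (al y - al x) / L + (al (last y p) - al y) / L); last by ring.
  rewrite lerD2r; have /andP[d0 dL] := slope x y Tx Ty xy.
  have s0 : 0 < s y - s x by rewrite subr_gt0 sT.
  rewrite ler_pdivrMr // -mulrA ler_wpM2l //.
  by rewrite mulrC.
by split; [eexists; exact: C|exact: energy_le].
Qed.

(** Compact support in [E], expressed by two points of [E] so that the energy can be cut there. *)
Definition csupp E f := exists a b, [/\ E a, E b, a <= b &
  forall x, E x -> ~ (a <= x <= b) -> f x = 0].

Lemma csuppP E f : gapped E ->
  (exists2 p, E p & forall x, E x -> p < x -> f x = 0) ->
  (exists2 p, E p & forall x, E x -> x < p -> f x = 0) -> csupp E f.
Proof.
move=> gE [p Ep pf] [q Eq qf]; exists (Num.min p q), (Num.max p q); split.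
- by case: leP.
- by case: leP.
- by rewrite ge_min !le_max lexx.
- move=> x Ex /negP; rewrite negb_and -!ltNge lt_min gt_max => /orP[/andP[_]|/andP[+ _]].
  + exact: qf.
  + exact: pf.
Qed.

End cutoff.

(** * Cut-off of bounded nonnegative functions *)

Section compact_support.
Context {R : realType} {mu : {measure set (measurableTypeR R) -> \bar R}} {E : set R}.
Context (gE : gapped E) {s : R -> R} (sE : slow E s).
Implicit Types (f g : R -> R).
Let iE := slow_increasing sE.
Let mE : measurable (E : set (measurableTypeR R)) := gapped_measurable gE.
Notation form_dom := (form_dom mu s E).
Notation nrm1 := (nrm1 mu s E).

Lemma fin_energy_measurable f : fin_energy s E f -> measurable_fun (E : set (measurableTypeR R)) f.
Proof.
by move=> ff; apply: continuous_on_measurable mE _; exact: fin_energy_continuous ff.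
Qed.

Lemma form_dom_dominated f g : form_dom f -> fin_energy s E g ->
  (forall x, E x -> `|g x| <= `|f x|) -> form_dom g.
Proof.
move=> [ff Lf vf] fg gf; split=> //; first by apply: (L2_le mE _ Lf gf).1; exact: fin_energy_measurable.
by move=> b /vf v; exact: vanish_le v gf.
Qed.

Lemma fin_energy_pos_part f : fin_energy s E f -> fin_energy s E (fun x => Num.max (f x) 0).
Proof. by move=> ff; apply: (fin_energy_le iE ff) => x y _ _ _; exact: pos_part_lip. Qed.

Lemma form_dom_pos_part f : form_dom f -> form_dom (fun x => Num.max (f x) 0).
Proof.
move=> df; have [ff _ _] := df; apply: form_dom_dominated df (fin_energy_pos_part ff) _ => x _.
by case: (leP (f x) 0) => //; rewrite normr0.
Qed.

(** Here [al] climbs from 0 to 1 over the [s]-length [L] that ends at [a], and [ga] over the one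
    that starts at [b]; [chi] is 1 on [[a, b]] and 0 at [s]-distance [L] outside. *)
Let al a L x := clamp01 (1 + (s x - s a) / L).
Let ga b L x := clamp01 ((s x - s b) / L).
Let chi a b L x := Num.min (al a L x) (1 - ga b L x).

Lemma mul_invr_le (p q : R) : 0 < q -> p <= 0 -> p / q <= 0.
Proof. by move=> q0 p0; rewrite pmulr_lle0 ?invr_gt0. Qed.

Let chi_fin a b L : 0 < L ->
  fin_energy s E (chi a b L) /\ energy s E (chi a b L) (chi a b L) <= 2 / L.
Proof.
move=> L0.
have H t x y : E x -> E y -> x < y -> 0 <= clamp01 (t + s y / L) - clamp01 (t + s x / L) <= (s y - s x) / L.
  move=> Ex Ey xy; have /ltW sxy := iE Ex Ey xy.
  have : t + s x / L <= t + s y / L by rewrite lerD2l ler_wpM2r // invr_ge0 ltW.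
  by move/clamp01_lip; rewrite (_ : t + _ - (t + _) = (s y - s x) / L) //; ring.
have alE : al a L = (fun x => clamp01 ((1 - s a / L) + s x / L)).
  by apply/funext => x; rewrite /al; congr clamp01; ring.
have gaE : ga b L = (fun x => clamp01 (- (s b / L) + s x / L)).
  by apply/funext => x; rewrite /ga; congr clamp01; ring.
have [fa qa] : fin_energy s E (al a L) /\ energy s E (al a L) (al a L) <= L^-1.
  apply: monotone_energy => // [x _|]; first by rewrite clamp01_ge0 clamp01_le1.
  by rewrite alE => x y; exact: H.
have [fg qg] : fin_energy s E (ga b L) /\ energy s E (ga b L) (ga b L) <= L^-1.
  apply: monotone_energy => // [x _|]; first by rewrite clamp01_ge0 clamp01_le1.
  by rewrite gaE => x y; exact: H.
have [|fc qc] := @energy_max _ _ _ iE (al a L) (ga b L) (chi a b L) fa fg; last first.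
  by split=> //; apply: le_trans qc _; apply: le_trans (lerD qa qg) _; lra.
move=> x y Ex Ey xy; apply: le_trans (min_lip _ _ _ _) _.
by rewrite (_ : 1 - ga b L y - (1 - ga b L x) = - (ga b L y - ga b L x)) ?normrN //; ring.
Qed.

(** Outside [[a n, b n]] the energy of [f] is small, and [M * X n] costs little energy because its
    slopes are spread over a long [s]-interval. At a missing end where [s] is bounded there is no
    room for this, but there [f] already vanishes by hypothesis. *)
Lemma cutoff_dense f (M e : R) : form_dom f -> 0 < M -> 0 < e ->
  (forall x, E x -> 0 <= f x <= M) ->
  (forall b : bool, end_bounded ((-1) ^+ b) E s -> exists2 p, E p &
      forall x, E x -> (-1) ^+ b * p <= (-1) ^+ b * x -> f x = 0) ->
  exists g, [/\ form_dom g, csupp E g & nrm1 (fun x => f x - g x) < e].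
Proof.
move=> df M0 e0 fM fend; have [ff Lf vf] := df.
have [a0 [b0 [Ea0 Eb0 ab0 ab0P]]] := energy_cut_approx (gapped_ex gE) iE ff (divr_gt0 e0 (ltr0n _ 8)).
have [a [b [Eab ab a_ni b_nd exh]]] := exhaust_seq (gapped_ex gE).
(* With this length the energy of [M * X n] is at most [2 * M ^+ 2 / L = e / 8], which matches the
   threshold for [f]; the factors 2 of [energyB_le] then give [e / 2]. *)
pose L := 16 * M ^+ 2 / e; have L0 : 0 < L by rewrite divr_gt0 ?mulr_gt0 ?exprn_gt0.
pose X n := chi (a n) (b n) L; pose h n x := Num.min (f x) (M * X n x).
have X01 n x : 0 <= X n x <= 1.
  rewrite le_min ge_min clamp01_ge0 clamp01_le1 subr_ge0 clamp01_le1 //.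
have X1 n x : E x -> a n <= x <= b n -> X n x = 1.
  move=> Ex /andP[ax xb]; rewrite /X /chi.
  have sax : s (a n) <= s x by move: ax; rewrite le_eqVlt => /predU1P[->//|?]; apply/ltW/iE => //; exact: (Eab n).1.
  have sxb : s x <= s (b n) by move: xb; rewrite le_eqVlt => /predU1P[->//|?]; apply/ltW/iE => //; exact: (Eab n).2.
  have -> : al (a n) L x = 1 by rewrite /al clamp01_1 // lerDl divr_ge0 ?subr_ge0 // ltW.
  have -> : ga (b n) L x = 0 by rewrite /ga clamp01_0 // mul_invr_le // subr_le0.
  by rewrite subr0 minxx.
have h0 n x : E x -> 0 <= h n x <= f x.
  move=> Ex; have /andP[f0 _] := fM x Ex; have /andP[X0 _] := X01 n x.
  by rewrite le_min f0 ge_min lexx mulr_ge0 // ltW.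
have fX n : fin_energy s E (fun x => M * X n x) by apply: fin_energyZ => //; exact: (chi_fin _ _ L0).1.
have fh n : fin_energy s E (h n).
  by apply: (energy_max iE ff (fX n) _).1 => x y Ex Ey xy; exact: min_lip.
have dh n : form_dom (h n).
  apply: form_dom_dominated df (fh n) _ => x Ex.
  by have /andP[? ?] := h0 n x Ex; have /andP[? ?] := fM x Ex; rewrite !ger0_norm.
have eQ n : a n <= a0 -> b0 <= b n -> energy s E (fun x => f x - h n x) (fun x => f x - h n x) <= e / 2.
  move=> aa bb; pose u x := f x - h n x; have [Ea Eb] := Eab n.
  have uE : u = (fun x => Num.max (f x - M * X n x) 0).
    by apply/funext => x; rewrite /u /h; case: (leP (f x)) => ?; case: leP; lra.
  have fu : fin_energy s E u by exact: fin_energyB.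
  rewrite -/u (energy_cut3 iE Ea Eb (ab n) fu fu).
  rewrite (@energy_cst0 _ (cut E (a n) (b n)) _ _ _ 0) ?addr0; last first.
    move=> x [Ex /= abx]; rewrite uE X1 // mulr1; apply/max_idPr.
    by have /andP[? ?] := fM x Ex; lra.
  have sub1 := @lo_sub _ E (a n); have sub2 := @hi_sub _ E (b n).
  have fB := fin_energyB iE ff (fX n).
  have uP T' : T' `<=` E -> energy s T' u u <= 2 * energy s T' f f +
      2 * energy s T' (fun x => M * X n x) (fun x => M * X n x).
    move=> sub; have iT := increasing_sub sub iE.
    apply: le_trans (energyB_le iT (fin_energy_sub sub ff) (fin_energy_sub sub (fX n))).
    apply: energy_contract => //; first exact: fin_energy_sub sub fB.
    by move=> x y _ _ _; rewrite uE; exact: pos_part_lip.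
  apply: le_trans (lerD (uP _ sub1) (uP _ sub2)) _.
  have := energy_cut3 iE Ea Eb (ab n) ff ff; have := energy_cut3 iE Ea Eb (ab n) (fX n) (fX n).
  have := energy_ge0 (increasing_sub (@cut_sub _ E (a n) (b n)) iE) (fin_energy_sub (@cut_sub _ E (a n) (b n)) (fX n)).
  have := energy_sub (increasing_sub (@cut_sub _ E (a n) (b n)) iE) (cut_subset aa bb) (fin_energy_sub (@cut_sub _ E (a n) (b n)) ff).
  have : energy s E (fun x => M * X n x) (fun x => M * X n x) <= e / 8.
    rewrite energyZZ //; last exact: (chi_fin _ _ L0).1.
    apply: le_trans (ler_wpM2l (sqr_ge0 M) (chi_fin _ _ L0).2) _.
    by rewrite /L le_eqVlt; apply/orP; left; apply/eqP; field; rewrite !gt_eqF.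
  move: ab0P; lra.
have cvN : nrm2 mu E (fun x => f x - h n x) @[n --> \oo] --> 0.
  apply: nrm2_dominated Lf _ _ => //.
  + by move=> n; exact: fin_energy_measurable.
  + move=> n x Ex; have /andP[? ?] := h0 n x Ex; have /andP[? ?] := fM x Ex; rewrite !ger0_norm //; lra.
  + move=> x Ex; apply: cvg_near_cst; apply: filterS (exh x Ex) => n abx.
    by rewrite /h X1 // mulr1 min_l //; have /andP[] := fM x Ex.
have [n [hn an bn]] : exists n, [/\ nrm2 mu E (fun x => f x - h n x) < e / 2, a n <= a0 & b0 <= b n].
  have e2 : 0 < e / 2 by rewrite divr_gt0.
  move/cvgrPdist_lt/(_ _ e2) : cvN => N1.
  have [n _ /(_ n (leqnn n))[[hn /andP[an _]] /andP[_ bn]]] := filterI (filterI N1 (exh _ Ea0)) (exh _ Eb0).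
  by exists n; split=> //; move: hn; rewrite /= sub0r normrN ger0_norm // nrm2_ge0.
exists (h n); split=> //; last first.
  by have := lerD (eQ n an bn) (ltW hn); have := eQ n an bn; move: hn => hn1 h1 _; rewrite [e]splitr; exact: ler_ltD.
have [Ea Eb] := Eab n.
apply: csuppP gE _ _.
(* Three cases at the right end: [E] has a maximum; [s] is bounded, and [f] vanishes; [s] is
   unbounded, and [chi] reaches 0 at a point of [E]. *)
- have [[p [Ep pmax]]|nmax] := pselect (exists p, E p /\ forall x, E x -> x <= p).
    by exists p => // x /pmax; rewrite leNgt => /negP.
  have op : forall x, E x -> exists2 y, E y & (-1) ^+ false * x < (-1) ^+ false * y.
    move=> x Ex; apply: contrapT => H; apply: nmax; exists x; split=> // y Ey.
    by rewrite leNgt; apply/negP => xy; apply: H; exists y => //; rewrite !mul1r.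
  have [bd|nbd] := pselect (exists M, forall x, E x -> (-1) ^+ false * s x <= M).
    have [p Ep pf] := fend false (conj op bd); exists p => // x Ex px.
    have fx : f x = 0 by apply: pf => //; rewrite !mul1r ltW.
    by have := h0 n x Ex; rewrite fx => /andP[? ?]; apply/eqP; rewrite eq_le; apply/andP.
  have [q Eq sq] : exists2 q, E q & s (b n) + L <= s q.
    apply: contrapT => H; apply: nbd; exists (s (b n) + L) => x Ex; rewrite mul1r leNgt.
    by apply/negP => /ltW ?; apply: H; exists x.
  exists q => // x Ex qx; rewrite /h /X /chi (_ : ga (b n) L x = 1); last first.
    rewrite /ga clamp01_1 // ler_pdivlMr // mul1r; have := iE Eq Ex qx; lra.
  rewrite subrr (min_r (x := al _ _ _)) ?mulr0 ?clamp01_ge0 //.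
  by apply/min_idPr; have /andP[] := fM x Ex.
- have [[p [Ep pmax]]|nmax] := pselect (exists p, E p /\ forall x, E x -> p <= x).
    by exists p => // x /pmax; rewrite leNgt => /negP.
  have op : forall x, E x -> exists2 y, E y & (-1) ^+ true * x < (-1) ^+ true * y.
    move=> x Ex; apply: contrapT => H; apply: nmax; exists x; split=> // y Ey.
    by rewrite leNgt; apply/negP => xy; apply: H; exists y => //; rewrite !mulN1r ltrN2.
  have [bd|nbd] := pselect (exists M, forall x, E x -> (-1) ^+ true * s x <= M).
    have [p Ep pf] := fend true (conj op bd); exists p => // x Ex px.
    have fx : f x = 0 by apply: pf => //; rewrite !mulN1r lerN2 ltW.
    by have := h0 n x Ex; rewrite fx => /andP[? ?]; apply/eqP; rewrite eq_le; apply/andP.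
  have [q Eq sq] : exists2 q, E q & s q <= s (a n) - L.
    apply: contrapT => H; apply: nbd; exists (- (s (a n) - L)) => x Ex; rewrite mulN1r lerN2 leNgt.
    by apply/negP => /ltW ?; apply: H; exists x.
  exists q => // x Ex qx; rewrite /h /X /chi (_ : al (a n) L x = 0); last first.
    rewrite /al clamp01_0 // -lerBrDl sub0r ler_pdivrMr // mulN1r; have := iE Ex Eq qx; lra.
  rewrite (min_l (x := 0)) ?mulr0 ?subr_ge0 ?clamp01_le1 //.
  by apply/min_idPr; have /andP[] := fM x Ex.
Qed.

End compact_support.

(** * Density of compactly supported functions *)

Section density.
Context {R : realType} {mu : {measure set (measurableTypeR R) -> \bar R}} {E : set R}.
Context (gE : gapped E) {s : R -> R} (sE : slow E s).
Implicit Types (f g h : R -> R).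
Let iE := slow_increasing sE.
Let mE : measurable (E : set (measurableTypeR R)) := gapped_measurable gE.
Notation form_dom := (form_dom mu s E).
Notation nrm1 := (nrm1 mu s E).

Lemma nrm1_triangle f g h : form_dom f -> form_dom g -> form_dom h ->
  nrm1 (fun x => f x - h x) <= 2 * nrm1 (fun x => f x - g x) + 2 * nrm1 (fun x => g x - h x).
Proof.
move=> df dg dh; have := nrm1D_le gE sE (form_domB gE sE df dg) (form_domB gE sE dg dh).
by rewrite (_ : (fun x => f x - g x + (g x - h x)) = (fun x => f x - h x)) //; apply/funext => x; ring.
Qed.

Lemma csupp_common f g : csupp E f -> csupp E g -> exists a b, [/\ E a, E b, a <= b &
  forall x, E x -> ~ (a <= x <= b) -> f x = 0 /\ g x = 0].
Proof.
move=> [a [b [Ea Eb ab fab]]] [c [d [Ec Ed cd gcd]]].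
exists (Num.min a c), (Num.max b d); split.
- by case: leP.
- by case: leP.
- by rewrite ge_min !le_max ab.
- move=> x Ex nx; split; [apply: fab => //|apply: gcd => //] => /andP[h1 h2]; apply: nx.
  + by rewrite ge_min h1 le_max h2.
  + by rewrite ge_min h1 le_max h2 !orbT.
Qed.

Lemma csuppB f g : csupp E f -> csupp E g -> csupp E (fun x => f x - g x).
Proof.
move=> sf sg; have [a [b [Ea Eb ab H]]] := csupp_common sf sg; exists a, b; split=> // x Ex nx.
by have [-> ->] := H x Ex nx; rewrite subrr.
Qed.

Let dense f := forall e : R, 0 < e ->
  exists g, [/\ form_dom g, csupp E g & nrm1 (fun x => f x - g x) < e].

Let dense_lim f (u_ : nat -> R -> R) : form_dom f -> (forall n, form_dom (u_ n)) ->
  nrm1 (fun x => f x - u_ n x) @[n --> \oo] --> 0 -> (forall n, dense (u_ n)) -> dense f.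
Proof.
move=> df du uf H e e0; have e4 : 0 < e / 4 by rewrite divr_gt0.
move/cvgrPdist_lt/(_ _ e4) : uf => [n _ /(_ n (leqnn n))] /=.
rewrite sub0r normrN ger0_norm; last by apply: nrm1_ge0 => //; have [] := form_domB gE sE df (du n).
move=> nf; have [g [dg sg ng]] := H n _ e4; exists g; split=> //.
apply: le_lt_trans (nrm1_triangle df (du n) dg) _; lra.
Qed.

(** The part of [f] above height [1 / n.+1] vanishes near every bounded end, because [f] tends to 0
    there; so [cutoff_dense] applies to it. *)
Let dense_bounded f M : 0 < M -> form_dom f -> (forall x, E x -> 0 <= f x <= M) -> dense f.
Proof.
move=> M0 df fM.
have inv0 n : 0 <= (n.+1%:R : R)^-1 by rewrite invr_ge0.
have [||||du cv] := @form_dom_approx _ mu E gE s sE (fun n x => f x - clamp n.+1%:R^-1 (f x)) f df.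
- move=> n x y _ _ _; rewrite !subKr mulrC; exact: clamp_comono.
- by move=> n x _; exact: (clamp_norm _ (inv0 n)).2.
- by move=> n x _; rewrite subKr; exact: (clamp_norm _ (inv0 n)).1.
- by move=> x _; exact: cvg_clamp0.
apply: (dense_lim df du cv) => n e e0.
have fc x : E x -> 0 <= f x - clamp n.+1%:R^-1 (f x) <= M.
  move=> Ex; have /andP[f0 f1] := fM x Ex.
  move: (inv0 n); move: (n.+1%:R^-1) => i i0.
  by have [[-> ?]|[-> ?]|[-> ?]] := clampP (f x) i0; apply/andP; split; lra.
apply: (cutoff_dense gE sE (du n) M0 e0 fc) => b bd; have [_ _ vf] := df.
have i0 : 0 < (n.+1%:R : R)^-1 by rewrite invr_gt0.
have [p Ep pf] := vf b bd _ i0; exists p => // x Ex px; have := pf x Ex px.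
have [[-> ?]|[-> ?]|[-> ?]] := clampP (f x) (inv0 n); rewrite ?subrr //.
  by rewrite ltNge (le_trans _ (ler_norm _)).
by rewrite ltNge -normrN (le_trans _ (ler_norm _)) // lerNr.
Qed.

Let dense_nonneg f : form_dom f -> (forall x, E x -> 0 <= f x) -> dense f.
Proof.
move=> df f0.
have [||||du cv] := @form_dom_approx _ mu E gE s sE (fun n x => clamp n%:R (f x)) f df.
- by move=> n x y _ _ _; exact: clamp_comono.
- by move=> n x _; exact: (clamp_norm _ (ler0n _ n)).1.
- by move=> n x _; exact: (clamp_norm _ (ler0n _ n)).2.
- by move=> x _; exact: cvg_clamp.
apply: (dense_lim df du cv) => n; apply: (@dense_bounded _ n.+1%:R) => // x Ex.
have := f0 x Ex; have := ler0n R n; rewrite -natr1.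
by have [[-> /ler_normlP[]]|[-> ?]|[-> ?]] := clampP (f x) (ler0n R n); lra.
Qed.

Lemma csupp_dense f : form_dom f -> dense f.
Proof.
move=> df e e0; have e4 : 0 < e / 4 by rewrite divr_gt0.
have dp := form_dom_pos_part gE sE df.
have dN : form_dom (fun x => - f x).
  have := form_domZ gE sE (-1) df; rewrite (_ : (fun x => _) = (fun x => - f x)) //.
  by apply/funext => x; rewrite mulN1r.
have dn := form_dom_pos_part gE sE dN.
have [|g [dg sg ng]] := dense_nonneg dp _ e4; first by move=> x _; rewrite le_max lexx orbT.
have [|h [dh sh nh]] := dense_nonneg dn _ e4; first by move=> x _; rewrite le_max lexx orbT.
exists (fun x => g x - h x); split; [exact: form_domB|exact: csuppB|].
have E1 : (fun x => f x - (g x - h x)) =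
  (fun x => (Num.max (f x) 0 - g x) - (Num.max (- f x) 0 - h x)).
  by apply/funext => x; case: (leP (f x) 0); case: (leP (- f x) 0); lra.
rewrite E1; apply: le_lt_trans (nrm1B_le gE sE (form_domB gE sE dp dg) (form_domB gE sE dn dh)) _; lra.
Qed.

End density.

(** * Completeness of the form domain *)

Section completeness.
Context {R : realType} {mu : {measure set (measurableTypeR R) -> \bar R}} {E : set R}.
Context (gE : gapped E) (Hmu : radon_full_support E mu).
Context {s : R -> R} (sE : slow E s).
Implicit Types (f g h : R -> R).
Let iE := slow_increasing sE.
Let mE : measurable (E : set (measurableTypeR R)) := gapped_measurable gE.
Notation form_dom := (form_dom mu s E).
Notation nrm1 := (nrm1 mu s E).

Lemma increasing_on_le x y : E x -> E y -> x <= y -> s x <= s y.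
Proof. by move=> Ex Ey; rewrite le_eqVlt => /predU1P[->//|xy]; exact/ltW/iE. Qed.

(** Between [p] and a bounded end the [s]-distances stay below a constant, so the energy and the
    value at [p] control [g] uniformly there. Convergence in energy and at [p] therefore preserves
    vanishing at the end. *)
Lemma end_bounded_sup (b : bool) p : end_bounded ((-1) ^+ b) E s -> E p ->
  exists2 K : R, 0 < K & forall g, fin_energy s E g -> forall x, E x ->
    (-1) ^+ b * p <= (-1) ^+ b * x -> g x ^+ 2 <= 2 * g p ^+ 2 + K * energy s E g g.
Proof.
move=> [_ [M HM]] Ep; exists (2 * `|M - (-1) ^+ b * s p| + 1) => [|g fg x Ex px].
  by rewrite ltr_wpDl // mulr_ge0.
have D : `|s x - s p| <= `|M - (-1) ^+ b * s p|.
  move: (HM x Ex) px; case: (b); [rewrite !mulN1r|rewrite !mul1r] => sM px.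
  - rewrite lerN2 in px; have sxp := increasing_on_le Ex Ep px.
    by rewrite ler0_norm ?subr_le0 // ger0_norm; lra.
  - have sxp := increasing_on_le Ep Ex px.
    by rewrite ger0_norm ?subr_ge0 // ger0_norm; lra.
have := energy_holder iE fg Ex Ep; have := energy_ge0 iE fg.
have := ler_wpM2r (energy_ge0 iE fg) D; have := sqr_ge0 (g x - 2 * g p).
move: (energy s E g g) `|s x - s p| `|M - _| => Q d k.
rewrite !expr2 => ? ? ? ?; nra.
Qed.

Lemma vanish_energy_lim (b : bool) p (u_ : nat -> R -> R) f : end_bounded ((-1) ^+ b) E s -> E p ->
  fin_energy s E f -> (forall n, fin_energy s E (u_ n)) ->
  (forall n, vanish ((-1) ^+ b) E (u_ n)) ->
  energy s E (fun x => f x - u_ n x) (fun x => f x - u_ n x) @[n --> \oo] --> 0 ->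
  u_ n p @[n --> \oo] --> f p -> vanish ((-1) ^+ b) E f.
Proof.
move=> bd Ep ff fu vu cu pu; apply: (vanish_lim Ep vu) => e e0.
have [K K0 HK] := end_bounded_sup bd Ep.
have e1 : 0 < e ^+ 2 / (2 * K) by rewrite divr_gt0 ?exprn_gt0 ?mulr_gt0.
have e2 : 0 < e / 2 by rewrite divr_gt0.
move/cvgrPdist_lt/(_ _ e1) : cu => A; move/cvgrPdist_lt/(_ _ e2) : pu => B.
have [n _ /(_ n (leqnn n))[/= + Bn]] := filterI A B.
have fd := fin_energyB iE ff (fu n).
rewrite sub0r normrN ger0_norm ?energy_ge0 // => An; exists n => x Ex px.
have := HK _ fd x Ex px; move: An; rewrite ltr_pdivlMr ?mulr_gt0 // => An.
move: Bn => /ltW; rewrite -ler_sqr ?nnegrE ?(ltW e2) // real_normK ?num_real // => Bn H.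
rewrite -ler_sqr ?nnegrE ?(ltW e0) // real_normK ?num_real //; nra.
Qed.

Lemma form_dom_cvg_at (u_ : nat -> R -> R) f x : E x -> (forall n, form_dom (fun x => f x - u_ n x)) ->
  nrm1 (fun x => f x - u_ n x) @[n --> \oo] --> 0 -> u_ n x @[n --> \oo] --> f x.
Proof.
move=> Ex du cu; have [C C0 HC] := form_dom_eval gE Hmu sE Ex.
apply/cvgrPdist_lt => e e0; have e1 : 0 < e ^+ 2 / C by rewrite divr_gt0 ?exprn_gt0.
move/cvgrPdist_lt/(_ _ e1) : cu; apply: filterS => n.
have [fn _ _] := du n; rewrite sub0r normrN ger0_norm ?nrm1_ge0 // ltr_pdivlMr // => H.
rewrite -ltr_sqr ?nnegrE ?(ltW e0) // real_normK ?num_real //.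
by apply: le_lt_trans (HC _ (du n)) _; rewrite mulrC.
Qed.

(** Point evaluations are bounded, so a Cauchy sequence converges pointwise on [E]; semicontinuity
    of the energy and Fatou's lemma, applied to [u_ n - u_ m] as [m] grows, give convergence in norm
    to that limit. *)
Lemma form_dom_complete (u_ : nat -> R -> R) : (forall n, form_dom (u_ n)) ->
  (forall e : R, 0 < e -> exists N, forall m n, (N <= m)%N -> (N <= n)%N ->
     nrm1 (fun x => u_ n x - u_ m x) < e) ->
  exists2 f, form_dom f & nrm1 (fun x => f x - u_ n x) @[n --> \oo] --> 0.
Proof.
move=> du cauchy.
have cvx x : E x -> cvgn (fun n => u_ n x).
  move=> Ex; have [C C0 HC] := form_dom_eval gE Hmu sE Ex.
  apply/cauchy_cvgP/cauchy_exP => e e0; have e1 : 0 < e ^+ 2 / C by rewrite divr_gt0 ?exprn_gt0.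
  have [N HN] := cauchy _ e1; exists (u_ N x); exists N => // n /= Nn.
  rewrite /ball /= -ltr_sqr ?nnegrE ?(ltW e0) // real_normK ?num_real //.
  have := HN n N Nn (leqnn N); rewrite ltr_pdivlMr // mulrC.
  by apply: le_lt_trans; apply: HC; exact: form_domB.
pose f x := lim (u_ n x @[n --> \oo]).
have uf x : E x -> u_ n x @[n --> \oo] --> f x by exact: cvx.
have key (e : R) : 0 < e -> exists N, forall n, (N <= n)%N ->
    [/\ fin_energy s E (fun x => u_ n x - f x), L2 mu E (fun x => u_ n x - f x),
        energy s E (fun x => u_ n x - f x) (fun x => u_ n x - f x) <= e &
        nrm2 mu E (fun x => u_ n x - f x) <= e].
  move=> e0; have [N HN] := cauchy _ e0; exists N => n Nn.
  have cv x : E x -> u_ n x - u_ m x @[m --> \oo] --> u_ n x - f x.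
    by move=> Ex; apply: cvgB; [exact: cvg_cst|exact: uf].
  have dB m : form_dom (fun x => u_ n x - u_ m x) by exact: form_domB.
  have [|ff fe] := energy_lsc iE (M := e) cv.
  - exists N => // m /= Nm; have [fm _ _] := dB m; split=> //.
    by apply: le_trans (ltW (HN m n Nm Nn)); rewrite /nrm1 lerDl nrm2_ge0.
  - have [|||Lf Le] := @nrm2_fatou _ mu E mE (fun m x => u_ n x - u_ m x) (fun x => u_ n x - f x) e.
    + by move=> m; have [] := dB m.
    + exists N => // m /= Nm; have [fm _ _] := dB m.
      by apply: le_trans (ltW (HN m n Nm Nn)); rewrite /nrm1 lerDr energy_ge0.
    + exact: cv.
    + by split.
have fuE n : (fun x => u_ n x - (u_ n x - f x)) = f by apply/funext => x; rewrite subKr.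
have [N0 HN0] := key 1 ltr01; have [fN LN _ _] := HN0 N0 (leqnn _).
have [fuN LuN _] := du N0.
have ff : fin_energy s E f by rewrite -(fuE N0); exact: fin_energyB.
have Lf : L2 mu E f by rewrite -(fuE N0); exact: L2B.
have cvE (e : R) : 0 < e -> \forall n \near \oo,
    energy s E (fun x => f x - u_ n x) (fun x => f x - u_ n x) < e /\
    nrm2 mu E (fun x => f x - u_ n x) < e.
  move=> e0; have e2 : 0 < e / 2 by rewrite divr_gt0.
  have [N HN] := key _ e2; exists N => // n /= Nn; have [_ _ h1 h2] := HN n Nn.
  have [fun_ _ _] := du n; rewrite nrm2_distC energyB // [energy s E f (u_ n)]energyC.
  by move: h1; rewrite energyB // => h1; split; lra.
have df : form_dom f.
  split=> // b bd; have [p Ep] := gapped_ex gE.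
  apply: (@vanish_energy_lim b p u_) => //; [by move=> n; have [] := du n| | |exact: uf].
    by move=> n; have [_ _ v] := du n; exact: v.
  apply/cvgrPdist_lt => e e0; apply: filterS (cvE e e0) => n [h _].
  by have [fun_ _ _] := du n; rewrite sub0r normrN ger0_norm ?energy_ge0 //; exact: fin_energyB.
exists f => //; apply/cvgrPdist_lt => e e0; have e2 : 0 < e / 2 by rewrite divr_gt0.
apply: filterS (cvE _ e2) => n [h1 h2]; rewrite sub0r normrN ger0_norm; last first.
  by apply: nrm1_ge0 => //; have [] := form_domB gE sE df (du n).
by rewrite [e]splitr; exact: ltrD.
Qed.

End completeness.

(** * Fukushima subspaces and isometric scales *)

Section almost_everywhere.
Context {d} {T : measurableType d} {R : realType} (nu : {measure set T -> \bar R}).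

Lemma aeS (P Q : T -> Prop) : (forall x, P x -> Q x) ->
  {ae nu, forall x, P x} -> {ae nu, forall x, Q x}.
Proof. by move=> PQ; apply: negligibleS => x /= nQ /PQ. Qed.

Lemma aeS2 (P Q S : T -> Prop) : (forall x, P x -> Q x -> S x) ->
  {ae nu, forall x, P x} -> {ae nu, forall x, Q x} -> {ae nu, forall x, S x}.
Proof.
move=> PQS p q; apply: negligibleS (negligibleU p q) => x /= nS.
by apply/not_andP => -[Px Qx]; apply: nS; exact: PQS.
Qed.

End almost_everywhere.

(** * Classes modulo the measure and their representatives *)

Section representation.
Context {R : realType} {mu : {measure set (measurableTypeR R) -> \bar R}} {E : set R}.
Context (gE : gapped E) (Hmu : radon_full_support E mu).
Implicit Types (s f g h k : R -> R).
Let mE : measurable (E : set (measurableTypeR R)) := gapped_measurable gE.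

Definition on_E f (x : R) : R := if x \in E then f x else 0.

Lemma on_E_in f x : E x -> on_E f x = f x.
Proof. by move=> Ex; rewrite /on_E mem_set. Qed.

Lemma null_compl : mu.-negligible (~` E).
Proof. by exists (~` E); split=> //; [exact: measurableC|have [] := Hmu]. Qed.

Lemma aeq_E f g : (forall x, E x -> f x = g x) -> Defs.ae_eq mu f g.
Proof.
by move=> fg; apply: negligibleS null_compl => x /= nfg Ex; apply: nfg; exact: fg.
Qed.

Lemma aeq_on_E f : Defs.ae_eq mu (on_E f) f.
Proof. by apply: aeq_E => x; exact: on_E_in. Qed.

Lemma aeq_sym f g : Defs.ae_eq mu f g -> Defs.ae_eq mu g f.
Proof. by apply: aeS => x ->. Qed.

Lemma aeq_trans f g h : Defs.ae_eq mu f g -> Defs.ae_eq mu g h -> Defs.ae_eq mu f h.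
Proof. by apply: aeS2 => x -> ->. Qed.

Lemma aeq_op (op : R -> R -> R) f g f' g' : Defs.ae_eq mu f f' -> Defs.ae_eq mu g g' ->
  Defs.ae_eq mu (fun x => op (f x) (g x)) (fun x => op (f' x) (g' x)).
Proof. by apply: aeS2 => x -> ->. Qed.

(** Full support: if the two functions differed at a point of [E], they would differ on a relative
    neighbourhood, which has positive measure. *)
Lemma aeq_continuous f g : {within E, continuous f} -> {within E, continuous g} ->
  Defs.ae_eq mu f g -> forall x, E x -> f x = g x.
Proof.
move=> /continuous_onP cf /continuous_onP cg [A [mA A0 sub]] x Ex; apply: contrapT => fg.
have d0 : 0 < `|f x - g x| / 2 by rewrite divr_gt0 // normr_gt0 subr_eq0; apply/eqP.
have [df df0 fd] := cf x Ex _ d0; have [dg dg0 gd] := cg x Ex _ d0.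
pose U := ball x (Num.min df dg).
have U0 : 0 < Num.min df dg by rewrite lt_min df0.
have oU : open U by exact: ball_open.
have Ux : U x by exact: ballxx.
have := Hmu.2.2 U x oU Ux Ex; rewrite ltNge => /negP; apply.
rewrite -A0; apply: le_measure; rewrite ?inE //.
  by apply: measurableI => //; apply: open_measurable; exact: ball_open.
move=> y [Uy Ey]; apply: sub => /= fgy.
move: Uy; rewrite /U /ball /= lt_min => /andP[/(fd y Ey) h1 /(gd y Ey) h2].
have := ler_normD (f x - f y) (f y - g x); rewrite addrA subrK (distrC (f y) (g x)); move: h2; rewrite -fgy; lra.
Qed.

Lemma L2_setT_E f : L2 mu setT f -> L2 mu E f.
Proof.
move=> [mf oo]; split; first exact: measurable_funS mf.
apply: le_lt_trans oo; apply: ge0_subset_integral => //.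
- exact: measurable_sqr.
- by move=> x _; rewrite lee_fin sqr_ge0.
Qed.

Lemma integral_sqr_on_E f : (\int[mu]_(x in setT) ((on_E f x) ^+ 2)%:E = \int[mu]_(x in E) ((f x) ^+ 2)%:E)%E.
Proof.
rewrite [RHS]integral_mkcond; apply: eq_integral => x _; rewrite /on_E patchE.
by case: ifP => // _; rewrite expr0n.
Qed.

Lemma L2_on_E f : L2 mu E f -> L2 mu setT (on_E f).
Proof.
move=> [mf oo]; split; last by rewrite integral_sqr_on_E.
have -> : on_E f = f \_ E by apply/funext => x; rewrite /on_E patchE.
exact/(measurable_restrictT f mE).
Qed.

Lemma integral_sqr_ae f g : measurable_fun setT f -> measurable_fun setT g -> Defs.ae_eq mu f g ->
  (\int[mu]_x ((f x) ^+ 2)%:E = \int[mu]_x ((g x) ^+ 2)%:E)%E.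
Proof.
move=> mf mg fg; apply: ae_eq_integral => //; try exact: measurable_sqr.
by apply: aeS fg => x /= -> _.
Qed.

Lemma L2_ae f g : measurable_fun setT g -> L2 mu setT f -> Defs.ae_eq mu f g -> L2 mu setT g.
Proof. by move=> mg [mf oo] fg; split=> //; rewrite -(integral_sqr_ae mf). Qed.

Lemma nrm2_setT f g : L2 mu setT f -> L2 mu E g -> Defs.ae_eq mu f g ->
  fine (\int[mu]_x ((f x) ^+ 2)%:E) = nrm2 mu E g.
Proof.
move=> Lf Lg fg; rewrite /nrm2 -integral_sqr_on_E; congr fine.
apply: integral_sqr_ae Lf.1 (L2_on_E Lg).1 _.
exact: aeq_trans fg (aeq_sym (aeq_on_E g)).
Qed.

Definition form_class s : set (R -> R) :=
  [set h | L2 mu setT h /\ exists f, form_dom mu s E f /\ Defs.ae_eq mu h f].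

(** Interface between forms on functions on the line, taken modulo [mu], and energies, which see
    only [E]. Both the quasidiffusion and the form of a scale are brought to this shape once. *)
Definition represents s (F : set (R -> R)) (Ef : (R -> R) -> (R -> R) -> R) :=
  F = form_class s /\
  forall h k f g, F h -> F k -> form_dom mu s E f -> form_dom mu s E g ->
    Defs.ae_eq mu h f -> Defs.ae_eq mu k g -> Ef h k = 2^-1 * energy s E f g.

Lemma form_class_on_E s f : form_dom mu s E f -> form_class s (on_E f).
Proof.
by move=> df; have [_ Lf _] := df; split; [exact: L2_on_E|exists f; split=> //; exact: aeq_on_E].
Qed.

Lemma Cc_csupp f g : Cc E f -> (forall x, E x -> f x = g x) -> csupp E g.
Proof.
move=> [_ [K [cK [KE f0]]]] fg.
have [[x0 Kx0]|K0] := pselect (K !=set0); last first.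
  have [p Ep] := gapped_ex gE; exists p, p; split=> // x Ex _; rewrite -fg // f0 // => Kx.
  by apply: K0; exists x.
have cid : {within K, continuous (@id R)} by apply: continuous_subspaceT => ?; exact: cvg_id.
have K0 : K !=set0 by exists x0.
have [a aK amin] := compact_EVT_min K0 cK cid; have [b bK bmax] := compact_EVT_max K0 cK cid.
exists a, b; split; [exact/KE/set_mem|exact/KE/set_mem|exact: amin|].
move=> x Ex nx; rewrite -fg // f0 // => Kx; apply: nx.
by rewrite amin ?bmax ?inE.
Qed.

Lemma csupp_Cc f : {within E, continuous f} -> csupp E f -> Cc E f.
Proof.
move=> cf [a [b [Ea Eb ab f0]]]; split=> //; exists (cut E a b); split; first exact: compact_cut.
by split=> [x []//|x Ex nx]; apply: f0 => // ?; exact: nx.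
Qed.

End representation.

(** What a Fukushima subspace provides, stated for continuous representatives on [E]. The norm of
    [id] occurs in [rich_closed] and [rich_dense] because the subspace carries the form of the
    quasidiffusion, so that its own completeness is completeness for that norm. *)
Record rich_domain {R : realType} (mu : {measure set (measurableTypeR R) -> \bar R})
    (E : set R) (A : set (R -> R)) : Prop := RichDomain {
  rich_dom : forall f, A f -> form_dom mu id E f;
  rich_lin : forall (a : R) f g, A f -> A g -> A (fun x => a * f x + g x);
  rich_eq : forall f g, (forall x, E x -> f x = g x) -> A f -> A g;
  rich_closed : forall (u_ : nat -> R -> R) f, (forall n, A (u_ n)) -> form_dom mu id E f ->
    nrm1 mu id E (fun x => f x - u_ n x) @[n --> \oo] --> 0 -> A f;
  rich_clamp01 : forall f, A f -> A (fun x => clamp01 (f x));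
  rich_dense : forall f (e : R), A f -> 0 < e ->
    exists g, [/\ A g, csupp E g & nrm1 mu id E (fun x => f x - g x) < e];
  rich_uniform : forall h (e : R), {within E, continuous h} -> csupp E h -> 0 < e ->
    exists g, [/\ A g, csupp E g & forall x, E x -> `|h x - g x| < e] }.

(** * A Fukushima subspace gives a rich domain *)

Section fukushima_rich.
Context {R : realType} {mu : {measure set (measurableTypeR R) -> \bar R}} {E : set R}.
Context (gE : gapped E) (Hmu : radon_full_support E mu).
Context {F0 : set (R -> R)} {Ef0 : (R -> R) -> (R -> R) -> R}.
Context (rep0 : represents (mu := mu) (E := E) id F0 Ef0).
Context {F' : set (R -> R)} {Ef' : (R -> R) -> (R -> R) -> R}.
Context (fuk : fukushima_subspace E mu F0 Ef0 F' Ef').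
Implicit Types (f g h : R -> R).
Let mE : measurable (E : set (measurableTypeR R)) := gapped_measurable gE.
Let sid := @slow_id R E.

Definition sub_dom : set (R -> R) := [set f | form_dom mu id E f /\ F' (on_E (E := E) f)].

Lemma sub_class h : F' h -> L2 mu setT h. Proof. by case: fuk => -[H _] _; exact: H. Qed.

Lemma sub_class_ae h k : F' h -> L2 mu setT k -> Defs.ae_eq mu h k -> F' k.
Proof. by case: fuk => -[_ [H _]] _; exact: H. Qed.

Lemma sub_dom_rep h f : F' h -> form_dom mu id E f -> Defs.ae_eq mu h f -> sub_dom f.
Proof.
move=> F'h df hf; split=> //; apply: sub_class_ae F'h _ _.
  by apply: (L2_on_E gE); have [] := df.
exact: aeq_trans hf (aeq_sym (aeq_on_E gE Hmu f)).
Qed.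

Lemma sub_dom_ex h : F' h -> exists f, sub_dom f /\ Defs.ae_eq mu h f.
Proof.
move=> F'h; have [_ [sub _]] := fuk; have := sub _ F'h; rewrite rep0.1.
by move=> [_ [f [df hf]]]; exists f; split=> //; exact: sub_dom_rep hf.
Qed.

Lemma sub_form h k f g : F' h -> F' k -> form_dom mu id E f -> form_dom mu id E g ->
  Defs.ae_eq mu h f -> Defs.ae_eq mu k g -> Ef' h k = 2^-1 * energy id E f g.
Proof.
move=> F'h F'k df dg hf kg; have [_ [sub eqE]] := fuk.
by rewrite eqE //; apply: rep0.2 => //; exact: sub.
Qed.

Lemma sub_E1 h f : F' h -> form_dom mu id E f -> Defs.ae_eq mu h f ->
  E1 mu Ef' h = 2^-1 * energy id E f f + nrm2 mu E f.
Proof.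
move=> F'h df hf; rewrite /E1 (sub_form F'h F'h df df hf hf); congr (_ + _).
by apply: (nrm2_setT gE Hmu) hf; [exact: sub_class|have [] := df].
Qed.

Lemma sub_class_lin (a : R) h k : F' h -> F' k -> F' (fun x => a * h x + k x).
Proof.
move=> F'h F'k; have [[_ [_ [_ [_ [HD [HZ _]]]]]] _] := fuk.
by apply: HD => //; exact: HZ.
Qed.

(** For closedness, completeness of the subspace supplies some limit, a class with a representative
    [g]; both [f] and [g] are limits of [u_] in norm, so they agree at each point of [E] by
    continuity of evaluation. *)
Lemma sub_dom_rich : rich_domain mu E sub_dom.
Proof.
have linae (a : R) h k f g : Defs.ae_eq mu h f -> Defs.ae_eq mu k g ->
  Defs.ae_eq mu (fun x => a * h x + k x) (fun x => a * f x + g x).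
  by move=> hf kg; apply: (aeq_op (fun p q => a * p + q)) hf kg.
have dlin (a : R) f g : form_dom mu id E f -> form_dom mu id E g -> form_dom mu id E (fun x => a * f x + g x).
  by move=> df dg; exact: (form_domD gE sid (form_domZ gE sid a df) dg).
have aeE f := aeq_on_E gE Hmu f.
split.
- by move=> f [].
- move=> a f g [df F'f] [dg F'g]; apply: sub_dom_rep (sub_class_lin a F'f F'g) (dlin _ _ _ df dg) _.
  exact: linae.
- move=> f g fg [df F'f]; apply: sub_dom_rep F'f (eq_form_dom sid fg df) _.
  by apply: aeq_trans (aeE f) _; exact: (aeq_E gE Hmu).
- move=> u_ f Au df cu.
  have subE1 h k f1 g1 : F' h -> F' k -> Defs.ae_eq mu h f1 -> Defs.ae_eq mu k g1 ->
      form_dom mu id E f1 -> form_dom mu id E g1 ->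
      E1 mu Ef' (h \- k) = 2^-1 * energy id E (fun x => f1 x - g1 x) (fun x => f1 x - g1 x) +
        nrm2 mu E (fun x => f1 x - g1 x).
    move=> F'h F'k hf kg df1 dg1; apply: sub_E1.
    + rewrite (_ : h \- k = (fun x => (-1) * k x + h x)); first exact: sub_class_lin.
      by apply/funext => x /=; rewrite mulN1r addrC.
    + exact: form_domB.
    + exact: (aeq_op (fun p q => p - q)).
  have [[_ [_ [_ [_ [_ [_ [_ [_ [_ [_ [complete _]]]]]]]]]]] _] := fuk.
  have du n : form_dom mu id E (u_ n) by have [] := Au n.
  have iid := slow_increasing sid.
  (* The form is half the energy, so its norm and [nrm1] agree up to a factor 2. *)
  have half_le g : form_dom mu id E g -> 2^-1 * energy id E g g + nrm2 mu E g <= nrm1 mu id E g /\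
      nrm1 mu id E g <= 2 * (2^-1 * energy id E g g + nrm2 mu E g).
    move=> [fg _ _]; have := energy_ge0 iid fg; have := @nrm2_ge0 _ mu E g.
    by rewrite /nrm1 => ? ?; split; lra.
  have nf k : 0 <= nrm1 mu id E (fun x => f x - u_ k x).
    by apply: nrm1_ge0 => //; have [] := form_domB gE sid df (du k).
  have [n|e e0|h F'h cvh] := complete (fun n => on_E (E := E) (u_ n)).
  + by have [] := Au n.
  + have e4 : 0 < e / 4 by rewrite divr_gt0.
    move/cvgrPdist_lt/(_ _ e4) : cu => [N _ HN]; exists N => m n Nm Nn.
    rewrite (subE1 _ _ _ _ (Au n).2 (Au m).2 (aeE _) (aeE _) (du n) (du m)).
    apply: le_lt_trans (half_le _ (form_domB gE sid (du n) (du m))).1 _.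
    apply: le_lt_trans (nrm1_triangle gE sid (du n) df (du m)) _.
    have := HN n Nn; have := HN m Nm; rewrite /= !sub0r !normrN.
    rewrite !ger0_norm //.
    rewrite (nrm1_distC sid df (du n)); lra.
  + have [g [Ag hg]] := sub_dom_ex F'h; have [dg _] := Ag.
    suff fg : forall x, E x -> g x = f x.
      apply: sub_dom_rep F'h df _; apply: aeq_trans hg _; exact: (aeq_E gE Hmu).
    move=> x Ex; have [C C0 HC] := form_dom_eval gE Hmu sid Ex.
    have dgf := form_domB gE sid dg df.
    apply/eqP; rewrite -subr_eq0 -sqrf_eq0 eq_le sqr_ge0 andbT.
    apply: le_trans (HC _ dgf) _; rewrite pmulr_rle0 //.
    (* The triangle inequality doubles both errors, and the one measured with the halved energy
       doubles again: [2 * (e / 6) + 4 * (e / 6) = e]. *)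
    apply/ler_addgt0Pl => e e0; rewrite addr0; have e6 : 0 < e / 6 by rewrite divr_gt0.
    move/cvgrPdist_lt/(_ _ e6) : cu => A; move/cvgrPdist_lt/(_ _ e6) : cvh => B.
    have [n _ /(_ n (leqnn n))[/=]] := filterI A B; rewrite !sub0r !normrN.
    rewrite (subE1 _ _ _ _ (Au n).2 F'h (aeE _) hg (du n) dg).
    rewrite (ger0_norm (nf n)) => An; rewrite ger0_norm; last first.
      rewrite addr_ge0 ?nrm2_ge0 // mulr_ge0 // energy_ge0 //.
      by have [] := form_domB gE sid (du n) dg.
    move=> Bn; apply: le_trans (nrm1_triangle gE sid dg (du n) df) _.
    rewrite (nrm1_distC sid dg (du n)) (nrm1_distC sid (du n) df).
    have := (half_le _ (form_domB gE sid (du n) dg)).2; lra.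
- move=> f [df F'f].
  have [[_ [_ [_ [_ [_ [_ [_ [_ [_ [_ [_ [markov _]]]]]]]]]]]] _] := fuk.
  have [F'v _] := markov _ F'f; apply: sub_dom_rep F'v _ _.
    apply: (form_dom_contract gE sid df) => [x _|x y _ _ _].
    + have := clamp01_ge0 (f x) => ?; rewrite ger0_norm //; have [f0|f0] := leP (f x) 0.
        by rewrite clamp01_0.
      by rewrite /clamp01 ge_max normr_ge0 /= ge_min ler_norm.
    + wlog xy : x y / f x <= f y => [H|].
        by have [xy|/ltW yx] := leP (f x) (f y); [|rewrite distrC [leRHS]distrC]; exact: H.
      by have /andP[h1 h2] := clamp01_lip xy; rewrite ger0_norm // ger0_norm // subr_ge0.
  have := aeE f; apply: aeS => x ->; rewrite /clamp01 (maxC (f x)).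
  by case: (leP 0 (f x)) => ?; case: (leP (f x) 1) => ?; rewrite /Num.max /Num.min; repeat case: ifP; lra.
- move=> f e [df F'f] e0; have e2 : 0 < e / 2 by rewrite divr_gt0.
  have [[_ [_ [_ [_ [_ [_ [_ [_ [_ [_ [_ [_ [dense _]]]]]]]]]]]]] _] := fuk.
  have [h [F'h Ch] fh] := dense _ F'f _ e2.
  have [g [Ag hg]] := sub_dom_ex F'h; have [dg _] := Ag.
  have cg : {within E, continuous g} by have [fg _ _] := dg; exact: fin_energy_continuous fg.
  have hgE := aeq_continuous gE Hmu Ch.1 cg hg.
  exists g; split=> //; first exact: Cc_csupp Ch hgE.
  have -> : nrm1 mu id E (fun x => f x - g x) = 2 * (2^-1 * energy id E (fun x => f x - g x) (fun x => f x - g x) + nrm2 mu E (fun x => f x - g x)) - nrm2 mu E (fun x => f x - g x).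
    by rewrite /nrm1; lra.
  have := @nrm2_ge0 _ mu E (fun x => f x - g x); move: fh; rewrite (@sub_E1 _ (fun x => f x - g x)).
  + lra.
  + rewrite (_ : _ \- h = (fun x => (-1) * h x + on_E (E := E) f x)); first exact: sub_class_lin.
    by apply/funext => x /=; rewrite mulN1r addrC.
  + exact: form_domB.
  + by apply: (aeq_op (fun p q => p - q)) => //; exact: aeE.
- move=> h e ch sh e0.
  have [[_ [_ [_ [_ [_ [_ [_ [_ [_ [_ [_ [_ [_ unif]]]]]]]]]]]]] _] := fuk.
  have [k [F'k Ck] hk] := unif h (csupp_Cc gE ch sh) _ e0.
  have [g [Ag kg]] := sub_dom_ex F'k; have [dg _] := Ag.
  have cg : {within E, continuous g} by have [fg _ _] := dg; exact: fin_energy_continuous fg.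
  have kgE := aeq_continuous gE Hmu Ck.1 cg kg.
  exists g; split=> //; first exact: Cc_csupp Ck kgE.
  by move=> x Ex; rewrite -kgE // hk.
Qed.

End fukushima_rich.

(** * Lipschitz bumps *)

Section lipschitz.
Context {R : realType}.
Implicit Types (E : set R) (k : R -> R).

Definition lip (L : R) k := forall x y, `|k x - k y| <= L * `|x - y|.

Lemma lip_continuous E L k : lip L k -> {within E, continuous k}.
Proof.
move=> kL; apply/continuous_onP => x Ex e e0.
have L1 : 0 < `|L| + 1 by rewrite ltr_wpDl.
exists (e / (`|L| + 1)) => [|y Ey xy]; first exact: divr_gt0.
apply: le_lt_trans (kL x y) _; move: xy; rewrite ltr_pdivlMr // => xy.
have := ler_norm L; have := normr_ge0 (x - y); nra.
Qed.

Lemma lip_min L k k' : lip L k -> lip L k' -> lip L (fun x => Num.min (k x) (k' x)).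
Proof. by move=> kL kL' x y; apply: le_trans (min_lip _ _ _ _) _; rewrite ge_max kL kL'. Qed.

Lemma lip_le L L' k : L <= L' -> lip L k -> lip L' k.
Proof. by move=> LL kL x y; apply: le_trans (kL x y) _; rewrite ler_wpM2r. Qed.

Lemma lip_clamp01 (a b : R) : lip `|a| (fun x => clamp01 (a * x + b)).
Proof.
move=> x y; rewrite -normrM mulrBr.
have -> : a * x - a * y = (a * x + b) - (a * y + b) by ring.
move: (a * x + b) (a * y + b) => t t'; wlog tt : t t' / t <= t' => [H|].
  by have [?|/ltW ?] := leP t t'; [|rewrite distrC [leRHS]distrC]; exact: H.
by have /andP[h1 h2] := clamp01_lip tt; rewrite distrC [leRHS]distrC !ger0_norm // (le_trans h1).
Qed.

Lemma lip_cst (a : R) : lip 0 (fun=> a).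
Proof. by move=> x y; rewrite subrr normr0 mul0r. Qed.

(** On each side the bump descends linearly to 0 at some point of [E] beyond [[a, b]]; if there is
    none, the endpoint is extreme in [E] and the constant 1 serves on that side. *)
Lemma tent_ex E a b : E a -> E b -> a <= b -> exists k L,
  [/\ 0 <= L, lip L k, csupp E k, forall x, 0 <= k x <= 1 & forall x, a <= x <= b -> k x = 1].
Proof.
move=> Ea Eb ab.
have [k1 [L1 [p Ep [L10 k1L k1s k101 k11]]]] : exists k L, exists2 p, E p &
    [/\ 0 <= L, lip L k, forall x, E x -> p < x -> k x = 0, forall x, 0 <= k x <= 1 &
        forall x, x <= b -> k x = 1].
  have [[p [Ep bp]]|H] := pselect (exists p, E p /\ b < p).
    have d0 : 0 < p - b by rewrite subr_gt0.
    exists (fun x => clamp01 (- (p - b)^-1 * x + p / (p - b))), `|- (p - b)^-1|, p => //.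
    have kE x : - (p - b)^-1 * x + p / (p - b) = (p - x) / (p - b) by ring.
    split=> //; first exact: lip_clamp01.
    - move=> x _ px; rewrite kE clamp01_0 //; apply: mul_invr_le => //; lra.
    - by move=> x; rewrite clamp01_ge0 clamp01_le1.
    - by move=> x xb; rewrite kE clamp01_1 // ler_pdivlMr // mul1r; lra.
  exists (fun=> 1), 0, b => //; split=> //; first exact: lip_cst.
  - by move=> x Ex bx; case: H; exists x.
  - by move=> _; rewrite ler01 lexx.
have [k2 [L2 [q Eq [L20 k2L k2s k201 k21]]]] : exists k L, exists2 p, E p &
    [/\ 0 <= L, lip L k, forall x, E x -> x < p -> k x = 0, forall x, 0 <= k x <= 1 &
        forall x, a <= x -> k x = 1].
  have [[q [Eq qa]]|H] := pselect (exists p, E p /\ p < a).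
    have d0 : 0 < a - q by rewrite subr_gt0.
    exists (fun x => clamp01 ((a - q)^-1 * x + (- q / (a - q)))), `|(a - q)^-1|, q => //.
    have kE x : (a - q)^-1 * x + (- q / (a - q)) = (x - q) / (a - q) by ring.
    split=> //; first exact: lip_clamp01.
    - move=> x _ px; rewrite kE clamp01_0 //; apply: mul_invr_le => //; lra.
    - by move=> x; rewrite clamp01_ge0 clamp01_le1.
    - by move=> x xb; rewrite kE clamp01_1 // ler_pdivlMr // mul1r; lra.
  exists (fun=> 1), 0, a => //; split=> //; first exact: lip_cst.
  - by move=> x Ex bx; case: H; exists x.
  - by move=> _; rewrite ler01 lexx.
exists (fun x => Num.min (k1 x) (k2 x)), (L1 + L2); split.
- exact: addr_ge0.
- by apply: lip_min; apply: lip_le; [|exact: k1L| |exact: k2L]; rewrite ?lerDl ?lerDr.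
- exists (Num.min p q), (Num.max p q); split.
  + by case: leP.
  + by case: leP.
  + by rewrite ge_min !le_max lexx.
  + move=> x Ex /negP; rewrite negb_and -!ltNge lt_min gt_max.
    have /andP[h1 _] := k101 x; have /andP[h2 _] := k201 x.
    by move=> /orP[/andP[_ /(k2s _ Ex)->]|/andP[/(k1s _ Ex)-> _]]; [rewrite min_r|rewrite min_l].
- move=> x; have /andP[h1 h1'] := k101 x; have /andP[h2 _] := k201 x.
  by rewrite le_min h1 h2 ge_min h1'.
- by move=> x /andP[ax xb]; rewrite k11 // k21 // minxx.
Qed.

End lipschitz.

(** * Lattice operations and gluing in a rich domain *)

Section rich_lattice.
Context {R : realType} {mu : {measure set (measurableTypeR R) -> \bar R}} {E : set R}.
Context (gE : gapped E) (Hmu : radon_full_support E mu).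
Context {A : set (R -> R)} (rA : rich_domain mu E A).
Implicit Types (f g h : R -> R).
Let mE : measurable (E : set (measurableTypeR R)) := gapped_measurable gE.
Let sid := @slow_id R E.
Let iid := slow_increasing sid.
Notation Q := (energy id).
Let Adom := rich_dom rA.
Let Aeq := rich_eq rA.

Lemma rich0 : A (fun=> 0).
Proof.
have [|||g [Ag _ _]] := rich_uniform rA (h := fun=> 0) (e := 1).
- exact/lip_continuous/lip_cst.
- by have [p Ep] := gapped_ex gE; exists p, p; split.
- exact: ltr01.
by apply: Aeq (rich_lin rA (-1) Ag Ag) => x _; rewrite mulN1r addNr.
Qed.

Lemma richZ (a : R) f : A f -> A (fun x => a * f x).
Proof. by move=> Af; apply: Aeq (rich_lin rA a Af rich0) => x _; rewrite addr0. Qed.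

Lemma richD f g : A f -> A g -> A (fun x => f x + g x).
Proof. by move=> Af Ag; apply: Aeq (rich_lin rA 1 Af Ag) => x _; rewrite mul1r. Qed.

Lemma richB f g : A f -> A g -> A (fun x => f x - g x).
Proof. by move=> Af Ag; apply: Aeq (rich_lin rA (-1) Ag Af) => x _; rewrite mulN1r addrC. Qed.

Lemma rich_clampc (c : R) f : 0 < c -> A f -> A (fun x => Num.max 0 (Num.min (f x) c)).
Proof.
move=> c0 Af; apply: Aeq (richZ c (rich_clamp01 rA (richZ c^-1 Af))) => x _.
rewrite /clamp01 maxr_pMr ?ltW // mulr0 minr_pMr ?ltW // mulr1 mulrA divff ?gt_eqF // mul1r //.
Qed.

(** Scaling the Markov property gives truncation between 0 and any height; letting the height grow
    removes the upper bound, by closedness. *)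
Lemma rich_pos f : A f -> A (fun x => Num.max (f x) 0).
Proof.
move=> Af; have dp := form_dom_pos_part gE sid (Adom Af).
have [||||du cv] := @form_dom_approx _ mu E gE id sid (fun n x => clamp n.+1%:R (Num.max (f x) 0)) _ dp.
- by move=> n x y _ _ _; exact: clamp_comono.
- by move=> n x _; exact: (clamp_norm _ (ler0n _ _)).1.
- by move=> n x _; exact: (clamp_norm _ (ler0n _ _)).2.
- by move=> x _; have := @cvg_clamp R (Num.max (f x) 0); rewrite -cvg_shiftS.
apply: (rich_closed rA) dp cv => n.
have n0 : 0 < n.+1%:R :> R by [].
apply: Aeq (rich_clampc n0 Af) => x _; rewrite /clamp.
move: (n.+1%:R) n0 => c c0.
by rewrite /Num.max /Num.min; repeat case: ifP; lra.
Qed.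

Lemma rich_min f g : A f -> A g -> A (fun x => Num.min (f x) (g x)).
Proof.
move=> Af Ag; apply: Aeq (richB Af (rich_pos (richB Af Ag))) => x _.
by case: (leP (f x)) => ?; case: leP; lra.
Qed.

Lemma rich_shrink (c : R) f : 0 < c -> A f -> A (fun x => Num.max (f x - c) 0).
Proof.
move=> c0 Af; apply: Aeq (richB (rich_pos Af) (rich_clampc c0 Af)) => x _.
by rewrite /Num.max /Num.min; repeat case: ifP; lra.
Qed.

(** A uniform approximation of a bump within [1/3] exceeds [2/3] where the bump is 1; subtracting
    [1/3], multiplying by 3 and truncating by the Markov property gives exactly 1 there. *)
Lemma rich_urysohn a b : E a -> E b -> a <= b ->
  exists chi, [/\ A chi, csupp E chi & forall x, E x -> a <= x <= b -> chi x = 1].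
Proof.
move=> Ea Eb ab; have [k [L [L0 kL ks k01 k1]]] := tent_ex Ea Eb ab.
have e3 : 0 < 3^-1 :> R by rewrite invr_gt0.
have [g [Ag sg kg]] := rich_uniform rA (lip_continuous kL) ks e3.
exists (fun x => clamp01 (3 * Num.max (g x - 3^-1) 0)); split.
- exact: rich_clamp01 rA _ (richZ 3 (rich_shrink e3 Ag)).
- have [p [q [Ep Eq pq g0]]] := sg; exists p, q; split=> // x Ex nx.
  by rewrite g0 // sub0r (max_r (x := - _)) ?mulr0 ?clamp01_0 // oppr_le0 ltW.
- move=> x Ex abx; have := kg x Ex; rewrite k1 // ltr_norml => /andP[h1 h2].
  by rewrite clamp01_1 // max_l; lra.
Qed.

Lemma rich_separate p q : E p -> E q -> p < q ->
  exists th, [/\ A th, th p = 0 & th q = 1].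
Proof.
move=> Ep Eq pq; have [k [L [L0 kL ks k01 k1]]] := tent_ex Ep Eq (ltW pq).
have d0 : 0 < q - p by rewrite subr_gt0.
pose h x := Num.min (k x) (clamp01 ((q - p)^-1 * x + (- p / (q - p)))).
have hE x : (q - p)^-1 * x + (- p / (q - p)) = (x - p) / (q - p) by ring.
have hL : lip (L + `|(q - p)^-1|) h.
  by apply: lip_min; apply: lip_le; [|exact: kL| |exact: lip_clamp01]; rewrite ?lerDl ?lerDr.
have hs : csupp E h.
  have [a [b [Ea Eb ab k0]]] := ks; exists a, b; split=> // x Ex nx; rewrite /h k0 //.
  by rewrite min_l // clamp01_ge0.
have e3 : 0 < 3^-1 :> R by rewrite invr_gt0.
have [g [Ag sg kg]] := rich_uniform rA (lip_continuous hL) hs e3.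
exists (fun x => clamp01 (3 * Num.max (g x - 3^-1) 0)); split.
- exact: rich_clamp01 rA _ (richZ 3 (rich_shrink e3 Ag)).
- have := kg p Ep; rewrite /h hE subrr mul0r clamp01_0 // min_r; last by have /andP[] := k01 p.
  rewrite ltr_norml => /andP[h1 h2].
  by rewrite (max_r (x := g p - _)) ?mulr0 ?clamp01_0 //; lra.
- have := kg q Eq; rewrite /h hE divff ?gt_eqF // clamp01_1 // k1 ?lexx ?(ltW pq) // minxx.
  rewrite ltr_norml => /andP[h1 h2].
  by rewrite clamp01_1 // max_l; lra.
Qed.

Definition right_of (p : R) f x : R := if p <= x then f x else 0.

(** The energy splits at [p]; the left half contributes 0 and the right half is unchanged, so
    cutting at a zero does not increase the norm. *)
Lemma form_dom_right_of s p f : slow E s -> E p -> form_dom mu s E f -> f p = 0 ->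
  form_dom mu s E (right_of p f) /\ nrm1 mu s E (right_of p f) <= nrm1 mu s E f.
Proof.
move=> sE Ep df fp; have [ff Lf vf] := df; have iE := slow_increasing sE.
have rlo x : lo E p x -> right_of p f x = 0.
  move=> [Ex /= xp]; rewrite /right_of; case: ifP => // px.
  by rewrite (_ : x = p) //; apply/eqP; rewrite eq_le xp px.
have rhi x : hi E p x -> right_of p f x = f x by move=> [Ex /= px]; rewrite /right_of px.
have fr : fin_energy s E (right_of p f).
  apply: (fin_energy_glue iE Ep).
  - have iL := increasing_sub (@lo_sub _ E p) iE.
    by apply: eq_fin_energy iL _ _ _ (fin_energy_cst 0) => x /rlo ->.
  - have iL := increasing_sub (@hi_sub _ E p) iE.
    by apply: eq_fin_energy iL _ _ _ (fin_energy_sub (@hi_sub _ E p) ff) => x /rhi ->.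
have rle x : E x -> `|right_of p f x| <= `|f x|.
  by move=> _; rewrite /right_of; case: ifP => // _; rewrite normr0.
have dr := form_dom_dominated gE sE df fr rle; split=> //; apply: lerD.
- rewrite (energy_split iE Ep fr fr) (energy_cst0 _ _ rlo) add0r (eq_energy rhi rhi).
  by apply: energy_sub => //; exact: hi_sub.
- by have [_ Lr _] := dr; apply: (L2_le mE Lr.1 Lf rle).2.
Qed.

(* On the right of p, (f - eps)^+ is the minimum of itself and a large multiple of a function
   of A that vanishes on the left of p. *)
Let rich_right_nonneg p f eps : E p -> A f -> csupp E f -> f p = 0 -> (forall x, E x -> 0 <= f x) ->
  0 < eps -> A (right_of p (fun x => Num.max (f x - eps) 0)).
Proof.
move=> Ep Af [a [b [Ea Eb ab f0]]] fp fge e0.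
have [ff _ _] := Adom Af.
have /continuous_onP/(_ p Ep _ e0)[d d0 fd] := fin_energy_continuous sid ff.
pose M := Num.sqrt ((`|a - p| + `|b - p|) * Q E f f) + 1.
have Q0 := energy_ge0 iid ff.
have fM x : E x -> f x <= M.
  move=> Ex; have [abx|abx] := pselect (a <= x <= b); last first.
    by rewrite f0 // addr_ge0 // sqrtr_ge0.
  have := energy_holder iid ff Ex Ep; rewrite fp subr0 => h.
  apply: (@le_trans _ _ (Num.sqrt ((`|a - p| + `|b - p|) * Q E f f))); last by rewrite lerDl.
  rewrite -(ger0_norm (fge x Ex)) -sqrtr_sqr ler_wsqrtr //; apply: le_trans h _.
  rewrite ler_wpM2r //; case/andP: abx => ax xb.
  have := ler_norm (a - p); have := ler_norm (b - p).
  have := ler_norm (- (a - p)); have := ler_norm (- (b - p)); rewrite !normrN ler_norml => ? ? ? ?.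
  by apply/andP; split; have := normr_ge0 (a - p); have := normr_ge0 (b - p); lra.
have M0 : 0 < M by rewrite ltr_wpDl // sqrtr_ge0.
have [k [L [L0 kL ks k01 k1]]] := tent_ex Ea Eb ab.
pose h x := Num.min (k x) (clamp01 (d^-1 * x + (- p / d))).
have hE x : d^-1 * x + (- p / d) = (x - p) / d by ring.
have hL : lip (L + `|d^-1|) h.
  by apply: lip_min; apply: lip_le; [|exact: kL| |exact: lip_clamp01]; rewrite ?lerDl ?lerDr.
have hs : csupp E h.
  have [a1 [b1 [Ea1 Eb1 ab1 k0]]] := ks; exists a1, b1; split=> // x Ex nx; rewrite /h k0 //.
  by rewrite min_l // clamp01_ge0.
have e3 : 0 < 3^-1 :> R by rewrite invr_gt0.
have [g [Ag sg kg]] := rich_uniform rA (lip_continuous hL) hs e3.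
pose psi x := Num.max (g x - 3^-1) 0.
have Apsi : A (fun x => (3 * M) * psi x) by exact: richZ (rich_shrink e3 Ag).
apply: Aeq (rich_min (rich_shrink e0 Af) Apsi) => x Ex; rewrite /right_of.
have psi0 : 0 <= psi x by rewrite le_max lexx orbT.
have f0' : 0 <= Num.max (f x - eps) 0 by rewrite le_max lexx orbT.
have [px|xp] := leP p x; last first.
  rewrite (_ : psi x = 0) ?mulr0 ?min_r //; apply/max_idPr.
  have := kg x Ex; rewrite /h hE clamp01_0; last by apply: mul_invr_le => //; lra.
  rewrite min_r; last by have /andP[] := k01 x.
  by rewrite ltr_norml => /andP[? ?]; lra.
have [xd|dx] := ltP x (p + d).
  have : `|f p - f x| < eps by apply: fd => //; rewrite distrC ger0_norm; lra.
  rewrite fp sub0r normrN ger0_norm ?fge // => fxe.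
  have -> : Num.max (f x - eps) 0 = 0 by apply/max_idPr; lra.
  by rewrite min_l // mulr_ge0 // mulr_ge0 // ltW.
have [abx|abx] := pselect (a <= x <= b); last first.
  have -> : Num.max (f x - eps) 0 = 0 by apply/max_idPr; rewrite f0 //; lra.
  by rewrite min_l // mulr_ge0 // mulr_ge0 // ltW.
rewrite min_l // ge_max; apply/andP; split; last by rewrite mulr_ge0 // mulr_ge0 // ltW.
have : 3^-1 <= psi x.
  rewrite le_max; apply/orP; left.
  have := kg x Ex; rewrite /h hE k1 // clamp01_1 ?minxx; last by rewrite ler_pdivlMr // mul1r; lra.
  by rewrite ltr_norml => /andP[? ?]; lra.
have := fM x Ex; nra.
Qed.

(** For nonnegative [g] the truncations of [g - 1 / n.+1] at 0 tend to [g] in norm, and cutting at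
    [p] does not increase norms, so the cut functions converge as well. The general case takes
    positive and negative parts. *)
Let rich_right_csupp p f : E p -> A f -> csupp E f -> f p = 0 -> A (right_of p f).
Proof.
move=> Ep Af sf fp.
have pos g : A g -> csupp E g -> g p = 0 -> (forall x, E x -> 0 <= g x) -> A (right_of p g).
  move=> Ag sg gp g0; have dg := Adom Ag.
  have inv0 n : 0 < (n.+1%:R : R)^-1 by rewrite invr_gt0.
  have [||||du cv] := @form_dom_approx _ mu E gE id sid (fun n x => g x - clamp n.+1%:R^-1 (g x)) g dg.
  - move=> n x y _ _ _; rewrite !subKr mulrC; apply: clamp_comono; exact: ltW.
  - by move=> n x _; exact: (clamp_norm _ (ltW (inv0 n))).2.
  - by move=> n x _; rewrite subKr; exact: (clamp_norm _ (ltW (inv0 n))).1.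
  - by move=> x _; exact: cvg_clamp0.
  have [dr _] := form_dom_right_of sid Ep dg gp.
  have gE' n x : E x -> g x - clamp n.+1%:R^-1 (g x) = Num.max (g x - n.+1%:R^-1) 0.
    move=> /g0; rewrite /clamp; move: (n.+1%:R^-1) (inv0 n) (g x) => i i0 t t0.
    by rewrite /Num.max /Num.min; repeat case: ifP; lra.
  apply: (rich_closed rA (u_ := fun n => right_of p (fun x => Num.max (g x - n.+1%:R^-1) 0))) dr _.
    by move=> n; exact: rich_right_nonneg.
  apply: (squeeze_cvgr _ (cvg_cst 0) cv); apply: nearW => n.
  have dgu := form_domB gE sid dg (du n).
  have [|h1 h2] := form_dom_right_of sid Ep dgu.
    by rewrite subKr gp /clamp min_l ?(ltW (inv0 n)) // max_r // oppr_le0 ltW.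
  rewrite (@eq_nrm1 _ mu E id _ (right_of p (fun x => g x - (g x - clamp n.+1%:R^-1 (g x))))); last first.
    by move=> x Ex; rewrite /right_of; case: ifP; rewrite ?subrr // -gE'.
  by rewrite h2 andbT; apply: nrm1_ge0 => //; have [] := h1.
have [a [b [Ea Eb ab f0]]] := sf.
have Ap := rich_pos Af; have An := rich_pos (richZ (-1) Af).
have P1 := pos _ Ap; have P2 := pos _ An.
apply: Aeq (richB (P1 _ _ _) (P2 _ _ _)) => [x Ex| | | | | |].
- rewrite /right_of; case: ifP; rewrite ?subrr // mulN1r.
  by case: (leP (f x) 0); case: (leP (- f x) 0); lra.
- by exists a, b; split=> // x Ex nx; rewrite f0 // maxxx.
- by rewrite fp maxxx.
- by move=> x _; rewrite le_max lexx orbT.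
- by exists a, b; split=> // x Ex nx; rewrite f0 // mulr0 maxxx.
- by rewrite fp mulr0 maxxx.
- by move=> x _; rewrite le_max lexx orbT.
Qed.

Lemma rich_right_of p f : E p -> A f -> f p = 0 -> A (right_of p f).
Proof.
move=> Ep Af fp; have df := Adom Af.
have [chi [Achi schi chi1]] := rich_urysohn Ep Ep (lexx p).
have chip : chi p = 1 by apply: chi1 => //; rewrite lexx.
have inv0 n : 0 < (n.+1%:R : R)^-1 by rewrite invr_gt0.
have /choice[u_ uP] : forall n, exists g, [/\ A g, csupp E g & nrm1 mu id E (fun x => f x - g x) < n.+1%:R^-1].
  by move=> n; exact: rich_dense rA _ _ Af (inv0 n).
(* The approximations need not vanish at [p]. The correction achieves it at the cost of
   [u_ n p ^+ 2 <= C / n.+1] times the norm of [chi], because [f p = 0] and evaluation at [p] is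
   bounded. *)
pose v n x := u_ n x - u_ n p * chi x.
have dchi := Adom Achi.
have Av n : A (v n) by have [Au _ _] := uP n; exact: richB Au (richZ _ Achi).
have du n : form_dom mu id E (u_ n) by have [/Adom] := uP n.
have [dr _] := form_dom_right_of sid Ep df fp.
apply: (rich_closed rA (u_ := fun n => right_of p (v n))) dr _.
  move=> n; have [Au su _] := uP n; apply: rich_right_csupp => //.
  - apply: csuppB su _; have [a [b [? ? ? c0]]] := schi.
    by exists a, b; split=> // x Ex nx; rewrite c0 // mulr0.
  - by rewrite /v chip mulr1 subrr.
have [C C0 HC] := form_dom_eval gE Hmu sid Ep.
pose K := 2 + 2 * (C * nrm1 mu id E chi).
have K0 : 0 <= nrm1 mu id E chi by apply: nrm1_ge0 => //; have [] := dchi.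
apply: (squeeze_cvgr (f := fun=> 0) (h := fun n => K * n.+1%:R^-1)).
- apply: nearW => n; have dv := form_domB gE sid df (Adom (Av n)).
  have dfu := form_domB gE sid df (du n).
  have [|h1 h2] := form_dom_right_of sid Ep dv; first by rewrite /v chip mulr1 subrr fp subr0.
  rewrite (@eq_nrm1 _ mu E id _ (right_of p (fun x => f x - v n x))); last first.
    by move=> x Ex; rewrite /right_of; case: ifP; rewrite ?subrr.
  apply/andP; split; first by apply: nrm1_ge0 => //; have [] := h1.
  apply: le_trans h2 _.
  rewrite (@eq_nrm1 _ mu E id _ (fun x => (f x - u_ n x) + u_ n p * chi x)); last first.
    by move=> x _; rewrite /v; ring.
  apply: le_trans (nrm1D_le gE sid dfu (form_domZ gE sid (u_ n p) dchi)) _.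
  have := nrm1Z_le gE sid (u_ n p) dchi; have [_ _ un] := uP n.
  have := HC _ dfu; rewrite fp sub0r sqrrN => hp.
  have : u_ n p ^+ 2 * nrm1 mu id E chi <= C * n.+1%:R^-1 * nrm1 mu id E chi.
    by rewrite ler_wpM2r // (le_trans hp) // ler_pM2l // ltW.
  rewrite /K; move: un; move: (n.+1%:R^-1) (nrm1 mu id E (fun x => f x - u_ n x)) (nrm1 mu id E chi) (nrm1 mu id E (fun x => u_ n p * chi x)) (u_ n p ^+ 2) => i N1 N2 N3 N4; lra.
- exact: cvg_cst.
- rewrite -[X in _ --> X](mulr0 K); apply: cvgM; [exact: cvg_cst|exact: cvg_harmonic].
Qed.

Lemma rich_glue p f g : E p -> A f -> A g -> f p = g p ->
  A (fun x => if p <= x then g x else f x).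
Proof.
move=> Ep Af Ag fg; have Agf := richB Ag Af.
have := rich_right_of Ep Agf; rewrite fg subrr => /(_ erefl) Ar.
by apply: Aeq (richD Af Ar) => x _; rewrite /right_of; case: ifP => _; rewrite ?addr0 ?subrKC.
Qed.

End rich_lattice.

(** * The scale of a rich domain *)

Section rich_scale.
Context {R : realType} {mu : {measure set (measurableTypeR R) -> \bar R}} {E : set R}.
Context (gE : gapped E) (Hmu : radon_full_support E mu).
Context {A : set (R -> R)} (rA : rich_domain mu E A).
Implicit Types (f g h w : R -> R).
Let mE : measurable (E : set (measurableTypeR R)) := gapped_measurable gE.
Let sid := @slow_id R E.
Let iid := slow_increasing sid.
Notation Q := (energy id).
Let Adom := rich_dom rA.
Let Aeq := rich_eq rA.

Lemma csupp_end_cond s f : csupp E f -> end_cond E s f.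
Proof.
move=> [a [b [Ea Eb ab f0]]] [] [op _] e e0.
- have [p Ep pa] := op a Ea; exists p => // x Ex px.
  rewrite !mulN1r in px pa; rewrite f0 ?normr0 // => /andP[h1 h2]; lra.
- have [p Ep pb] := op b Eb; exists p => // x Ex px.
  rewrite !mul1r in px pb; rewrite f0 ?normr0 // => /andP[h1 h2]; lra.
Qed.

Lemma energy_outside s p q w : increasing_on E s -> E p -> E q -> p <= q -> fin_energy s E w ->
  w p = 0 -> w q = 0 -> (forall x, E x -> ~ (p <= x <= q) -> w x = 0) ->
  energy s E w w = energy s (cut E p q) w w.
Proof.
move=> iE Ep Eq pq fw wp wq w0; rewrite (energy_cut3 iE Ep Eq pq fw fw).
have -> : energy s (lo E p) w w = 0.
  apply: (@energy_cst0 _ _ _ _ _ 0) => x [Ex /= xp]; have [->//|xp'] := eqVneq x p.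
  by apply: w0 => // /andP[px _]; move: xp'; rewrite eq_le xp px.
have -> : energy s (hi E q) w w = 0.
  apply: (@energy_cst0 _ _ _ _ _ 0) => x [Ex /= xp]; have [->//|xp'] := eqVneq x q.
  by apply: w0 => // /andP[_ px]; move: xp'; rewrite eq_le xp px.
by rewrite add0r addr0.
Qed.

(** Since [w] vanishes at [p], the bound for increments gives [w x ^+ 2 <= (q - p) * Q E w w] on
    [[p, q]], whose part in [E] is compact and so has finite measure. *)
Lemma poincare p q : E p -> E q -> p <= q -> exists2 K : R, 0 < K &
  forall w, fin_energy id E w -> w p = 0 -> (forall x, E x -> ~ (p <= x <= q) -> w x = 0) ->
    form_dom mu id E w /\ nrm1 mu id E w <= K * Q E w w.
Proof.
move=> Ep Eq pq.
have muf : (mu (cut E p q) < +oo)%E by apply: Hmu.2.1; [exact: compact_cut|exact: cut_sub].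
have mc : measurable (cut E p q : set (measurableTypeR R)).
  by apply: closed_measurable; exact: closed_cut.
have muE : mu (cut E p q) = (fine (mu (cut E p q)))%:E by rewrite fineK // ge0_fin_numE.
have m0 : 0 <= fine (mu (cut E p q)) by exact: fine_ge0.
exists (1 + (q - p) * fine (mu (cut E p q))) => [|w fw wp w0].
  by rewrite ltr_pwDl // mulr_ge0 // subr_ge0.
have Q0 := energy_ge0 iid fw.
have wle x : E x -> w x ^+ 2 <= (q - p) * Q E w w.
  move=> Ex; have [/andP[px xq]|nx] := pselect (p <= x <= q); last first.
    by rewrite w0 // expr0n /= mulr_ge0 // subr_ge0.
  have := energy_holder iid fw Ex Ep; rewrite wp subr0 ger0_norm ?subr_ge0 // => h.
  by apply: le_trans h _; rewrite ler_wpM2r // lerD2r.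
have mw := fin_energy_measurable gE sid fw.
have le : (\int[mu]_(x in E) ((w x) ^+ 2)%:E <= ((q - p) * Q E w w * fine (mu (cut E p q)))%:E)%E.
  rewrite (_ : integral _ _ _ = \int[mu]_(x in cut E p q) ((w x) ^+ 2)%:E)%E; last first.
    rewrite [LHS]integral_mkcond [RHS]integral_mkcond; apply: eq_integral => x _; rewrite !patchE.
    case: ifPn => [/set_mem Ex|nE]; last by rewrite memNset // => -[] /mem_set; rewrite (negbTE nE).
    case: ifPn => // /negP nc; rewrite w0 ?expr0n // => pxq; apply: nc; exact/mem_set.
  apply: (@le_trans _ _ (\int[mu]_(x in cut E p q) ((q - p) * Q E w w)%:E)%E).
    apply: ge0_le_integral => //.
    - by move=> x _; rewrite lee_fin sqr_ge0.
    - by apply: measurable_sqr; apply: measurable_funS mw => //; exact: cut_sub.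
    - by move=> x [Ex _]; rewrite lee_fin wle.
  by rewrite integral_cst // muE -EFinM.
have Lw : L2 mu E w by split=> //; apply: le_lt_trans le (ltry _).
split; first by split=> //; apply: csupp_end_cond; exists p, q; split.
rewrite /nrm1 mulrDl mul1r lerD2l -lee_fin -nrm2E //; apply: le_trans le _.
by rewrite lee_fin mulrAC.
Qed.

Definition restrict_to (p q : R) f x : R := if p <= x <= q then f x else 0.

Lemma rich_restrict p q f : E p -> E q -> p <= q -> A f -> f p = 0 -> f q = 0 ->
  A (restrict_to p q f).
Proof.
move=> Ep Eq pq Af fp fq; have A1 := rich_right_of gE Hmu rA Ep Af fp.
have A2 := rich_right_of gE Hmu rA Eq A1; rewrite /right_of pq fq in A2.
have A3 := richB rA A1 (A2 erefl).
apply: Aeq A3 => x Ex; rewrite /right_of /restrict_to.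
have [qx|xq] := leP q x; have [px|xp] := leP p x; rewrite ?subrr ?subr0 //=.
- by case: (leP x q) => // xq; rewrite (_ : x = q) //; apply/eqP; rewrite eq_le xq.
- by rewrite (ltW xq).
Qed.

(** First-variation principle. The test value [- b / (a + 1)] covers the case [a = 0]. *)
Lemma quad_ge0_lin0 (a b : R) : (forall t : R, 0 <= t ^+ 2 * a + 2 * t * b) -> b = 0.
Proof.
move=> H; apply/eqP; apply: contraT => b0.
have a0 : 0 <= a by have := H 1; have := H (-1); lra.
have a1 : 0 < a + 1 by lra.
have := H (- b / (a + 1)).
have -> : (- b / (a + 1)) ^+ 2 * a + 2 * (- b / (a + 1)) * b = - (b ^+ 2 * (a + 2)) / (a + 1) ^+ 2.
  by field; rewrite gt_eqF.
rewrite leNgt mulNr oppr_lt0 divr_gt0 ?exprn_gt0 // mulr_gt0 //; last by lra.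
by rewrite exprn_even_gt0.
Qed.

(** Direct method: the energy on [[p, q]] is minimised over functions of [A] with values 0 at [p]
    and 1 at [q]. The parallelogram law makes a minimising sequence Cauchy in energy, and in norm by
    the Poincaré inequality once its varying part is restricted to [[p, q]]. Orthogonality is the
    vanishing of the first variation. *)
Lemma rich_harmonic p q : E p -> E q -> p < q -> exists sg, [/\ A sg, sg p = 0, sg q = 1 &
  forall w, A w -> w p = 0 -> w q = 0 -> Q (cut E p q) sg w = 0].
Proof.
move=> Ep Eq pq; have [th [Ath thp thq]] := rich_separate gE rA Ep Eq pq.
have iC := increasing_sub (@cut_sub _ E p q) iid.
have fA f : A f -> fin_energy id E f by move=> /Adom[].
have fC f : A f -> fin_energy id (cut E p q) f by move=> /fA; exact: fin_energy_sub (@cut_sub _ E p q).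
pose W w := [/\ A w, w p = 0 & w q = 0].
pose J w := Q (cut E p q) (fun x => th x + w x) (fun x => th x + w x).
have AthD w : A w -> A (fun x => th x + w x) by move=> Aw; exact: (richD rA).
have J0 w : W w -> 0 <= J w by move=> [Aw _ _]; apply: (energy_ge0 iC); apply: fC; exact: AthD.
pose S := [set J w | w in W].
have W0 : W (fun=> 0) by split=> //; exact: (rich0 gE rA).
have hS : has_inf S by split; [exists (J (fun=> 0)), (fun=> 0)|exists 0 => _ [w Ww <-]; exact: J0].
pose m := inf S.
have mJ w : W w -> m <= J w by move=> Ww; apply: ge_inf; [exact: hS.2|exists w].
have /choice[w_ wP] : forall n, exists w, [/\ W w, forall x, E x -> ~ (p <= x <= q) -> w x = 0 &
    J w < m + n.+1%:R^-1].
  move=> n; have n0 : 0 < (n.+1%:R : R)^-1 by rewrite invr_gt0.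
  have [_ [w [Aw wp wq] <-] wm] := inf_adherent n0 hS.
  exists (restrict_to p q w); split.
  - split; first by apply: rich_restrict => //; exact: ltW.
    + by rewrite /restrict_to lexx (ltW pq).
    + by rewrite /restrict_to lexx (ltW pq).
  - by move=> x _ /negP nx; rewrite /restrict_to (negbTE nx).
  - rewrite /J (@eq_energy _ _ _ _ _ (fun x => th x + w x) (fun x => th x + w x)) //;
      by move=> x [_ /= pxq]; rewrite /restrict_to pxq.
have Aw n : A (w_ n) by have [[]] := wP n.
have [K K0 HK] := poincare Ep Eq (ltW pq).
have par n k : Q E (fun x => w_ n x - w_ k x) (fun x => w_ n x - w_ k x) <= 2 / n.+1%:R + 2 / k.+1%:R.
  have [[_ np nq] n0 nJ] := wP n; have [[_ kp kq] k0 kJ] := wP k.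
  have AB := richB rA (Aw n) (Aw k).
  rewrite (energy_outside iid Ep Eq (ltW pq) (fA _ AB)) ?np ?kp ?nq ?kq ?subrr //; last first.
    by move=> x Ex nx; rewrite n0 // k0 // subrr.
  have fn := fC _ (AthD _ (Aw n)); have fk := fC _ (AthD _ (Aw k)).
  have := energyB iC fn fk; have := energyD iC fn fk.
  rewrite -/(J (w_ n)) -/(J (w_ k)).
  have -> : (fun x => th x + w_ n x + (th x + w_ k x)) =
    (fun x => 2 * (th x + 2^-1 * (w_ n x + w_ k x))) by apply/funext => x; lra.
  have -> : (fun x => th x + w_ n x - (th x + w_ k x)) = (fun x => w_ n x - w_ k x).
    by apply/funext => x; ring.
  (* The midpoint is admissible, so [J] is at least [m] there; this is the lower bound in the
     parallelogram law. *)
  have WW : W (fun x => 2^-1 * (w_ n x + w_ k x)).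
    by split; rewrite ?np ?kp ?nq ?kq ?addr0 ?mulr0 //; apply: (richZ gE rA); exact: (richD rA).
  have [AWW _ _] := WW; rewrite (energyZZ iC _ (fC _ (AthD _ AWW))).
  have := mJ _ WW; rewrite /J; move: nJ kJ; rewrite /J.
  move: (n.+1%:R^-1) (k.+1%:R^-1) => i j; lra.
have [e e0|w dw cw] := form_dom_complete gE Hmu sid (fun n => Adom (Aw n)).
  have : 0 < e / (8 * K) by rewrite divr_gt0 // mulr_gt0.
  move=> d0; have [N _ HN] := (cvgrPdist_lt _ _).1 (@cvg_harmonic R) _ d0.
  have HN' n : (N <= n)%N -> n.+1%:R^-1 < e / (8 * K).
    by move=> Nn; have := HN n Nn; rewrite sub0r normrN ger0_norm // invr_ge0.
  exists N => k n Nk Nn.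
  have [[_ np nq] n0 nJ] := wP n; have [[_ kp kq] k0 kJ] := wP k.
  have [||_ le] := HK _ (fA _ (richB rA (Aw n) (Aw k))).
  - by rewrite np kp subrr.
  - by move=> x Ex nx; rewrite n0 // k0 // subrr.
  apply: le_lt_trans le _; apply: le_lt_trans (ler_wpM2l (ltW K0) (par n k)) _.
  have := HN' n Nn; have := HN' k Nk; rewrite !ltr_pdivlMr ?mulr_gt0 //.
  move: (n.+1%:R^-1) (k.+1%:R^-1) => i j; rewrite -(ltr_pM2l (ltr0n R 8)); nra.
have Aw' : A w by apply: (rich_closed rA) Aw dw cw.
have cvw x : E x -> w_ n x @[n --> \oo] --> w x.
  by move=> Ex; apply: (form_dom_cvg_at gE Hmu sid Ex) cw => n; exact: form_domB dw (Adom (Aw n)).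
have w0 x : E x -> (forall n, w_ n x = 0) -> w x = 0.
  move=> Ex H; rewrite -(cvg_lim _ (cvw x Ex)) // (_ : (fun n => w_ n x) = (fun=> 0)) ?lim_cst //.
  exact/funext.
have wp : w p = 0 by apply: w0 => // n; have [[_ ->]] := wP n.
have wq : w q = 0 by apply: w0 => // n; have [[_ _ ->]] := wP n.
have Jw : J w <= m.
  apply/ler_addgt0Pl => e e0; rewrite addrC.
  apply: (@energy_lsc _ _ _ iC (fun n x => th x + w_ n x) _ _ _ _).2.
  - by move=> x [Ex _]; apply: cvgD; [exact: cvg_cst|exact: cvw].
  - have [N _ HN] := (cvgrPdist_lt _ _).1 (@cvg_harmonic R) _ e0.
    exists N => // n /= Nn; split; first by apply: fC; exact: AthD.
    have [_ _ nJ] := wP n; apply: ltW; apply: lt_trans nJ _; rewrite ltrD2l.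
    by have := HN n Nn; rewrite sub0r normrN ger0_norm // invr_ge0.
exists (fun x => th x + w x); split; [exact: AthD|by rewrite thp wp addr0|by rewrite thq wq addr0|].
move=> v Av vp vq; rewrite energyC; apply: (@quad_ge0_lin0 (Q (cut E p q) v v)) => t.
have Wt : W (fun x => t * v x + w x).
  by split; rewrite ?vp ?vq ?wp ?wq ?mulr0 ?addr0 //; exact: rich_lin rA _ _ _ Av Aw'.
have := le_trans Jw (mJ _ Wt); rewrite /J.
have -> : (fun x => th x + (t * v x + w x)) = (fun x => t * v x + (th x + w x)).
  by apply/funext => x; ring.
rewrite (energy_quad iC _ (fC _ Av) (fC _ (AthD _ Aw'))); lra.
Qed.

Definition dual (p q : R) (sg : R -> R) := A sg /\
  forall f, A f -> Q (cut E p q) sg f = f q - f p.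

(** On [[p, q]] each [f] equals [f p + (f q - f p) * sg] up to a function that vanishes at [p] and
    [q] and is orthogonal to [sg]; dividing [sg] by its energy turns the pairing into the increment.
    The energy is positive because [sg] has increment 1. *)
Lemma rich_dual p q : E p -> E q -> p < q -> exists sg, dual p q sg.
Proof.
move=> Ep Eq pq; have [sg [Asg sgp sgq H]] := rich_harmonic Ep Eq pq.
have iC := increasing_sub (@cut_sub _ E p q) iid.
have fC f : A f -> fin_energy id (cut E p q) f.
  by move=> /Adom[ff _ _]; exact: fin_energy_sub (@cut_sub _ E p q) ff.
have [chi [Achi _ chi1]] := rich_urysohn gE rA Ep Eq (ltW pq).
pose q0 := Q (cut E p q) sg sg.
have q00 : 0 < q0.
  have := increment_le iid (fC _ Asg) Ep Eq (ltW pq).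
  rewrite sgp sgq subr0 expr1n -/q0 => h; rewrite ltNge; apply/negP => h'.
  have : 0 < q - p by rewrite subr_gt0.
  nra.
exists (fun x => q0^-1 * sg x); split=> [|f Af]; first exact: (richZ gE rA).
rewrite (energyZ iC _ (fC _ Asg) (fC _ Af)) energyC.
pose w x := f x - (f p * chi x + (f q - f p) * sg x).
have Aw : A w by apply: (richB rA) => //; exact: (richD rA (richZ gE rA _ Achi) (richZ gE rA _ Asg)).
have chip : chi p = 1 by apply: chi1; rewrite ?lexx ?(ltW pq).
have chiq : chi q = 1 by apply: chi1; rewrite ?lexx ?(ltW pq).
have wp : w p = 0 by rewrite /w sgp chip; ring.
have wq : w q = 0 by rewrite /w sgq chiq; ring.
rewrite (@eq_energy _ _ _ f sg (fun x => (f q - f p) * sg x + (1 * w x + f p)) sg) //; last first.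
  by move=> x [Ex /= pxq]; rewrite /w chi1 //; ring.
have fcst := @fin_energy_cst _ id (cut E p q) (f p).
rewrite (energyDl iC) //; [|exact: fC|apply: (fin_energyDl iC) => //; exact: fC|exact: fC].
rewrite (energyDl iC) //; [|exact: fC|exact: fC].
rewrite (@energy_cst0 _ _ _ (fun=> f p) _ (f p)) // energyC.
rewrite (H w) // -/q0 mulr0 !addr0 mulrCA mulVf ?mulr1 // gt_eqF //.
Qed.

(** The stopped function varies only inside [[c, d]] and has increment [f d - f c] over [[p, q]], so
    that testing a representation over [[p, q]] with it yields one over [[c, d]]. *)
Lemma rich_stop p c d q f : E p -> E c -> E d -> E q -> p <= c -> c < d -> d <= q -> A f ->
  exists f', [/\ A f', forall x, E x -> p <= x <= c -> f' x = 0,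
    forall x, E x -> c <= x <= d -> f' x = f x - f c &
    forall x, E x -> d <= x <= q -> f' x = f d - f c].
Proof.
move=> Ep Ec Ed Eq pc cd dq Af; have pq : p <= q by lra.
have [chi [Achi _ chi1]] := rich_urysohn gE rA Ep Eq pq.
have chi1' x : E x -> p <= x -> x <= q -> chi x = 1 by move=> Ex px xq; apply: chi1; rewrite ?px.
pose f1 x := f x - f c * chi x.
have Af1 : A f1 by apply: (richB rA) => //; exact: (richZ gE rA).
have f1c : f1 c = 0 by rewrite /f1 chi1' //; lra.
have A2 := rich_right_of gE Hmu rA Ec Af1 f1c.
have f2d : right_of c f1 d = (f d - f c) * chi d.
  by rewrite /right_of (ltW cd) /f1 !chi1' //; lra.
have A3 := rich_glue gE Hmu rA Ed A2 (richZ gE rA (f d - f c) Achi) f2d.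
eexists; split; [exact: A3| | |] => x Ex /andP[h1 h2] /=.
- rewrite /right_of leNgt (le_lt_trans h2 cd) /=; case: ifP => // cx.
  by rewrite (_ : x = c) //; apply/eqP; rewrite eq_le h2.
- case: ifP => dx; last by rewrite /right_of h1 /f1 chi1' ?mulr1 //; lra.
  by rewrite (_ : x = d) ?chi1' ?mulr1 //; [lra|apply/eqP; rewrite eq_le h2].
- by rewrite h1 chi1' ?mulr1 //; lra.
Qed.

Lemma dual_sub p q c d sg : E p -> E c -> E d -> E q -> p <= c -> c < d -> d <= q ->
  dual p q sg -> dual c d sg.
Proof.
move=> Ep Ec Ed Eq pc cd dq [Asg H]; split=> // f Af.
have [f' [Af' f1 f2 f3]] := rich_stop Ep Ec Ed Eq pc cd dq Af.
have := H _ Af'; rewrite (f3 q) ?lexx ?dq // (f1 p) ?lexx // subr0 => <-.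
have sC := @cut_sub _ E p q; have iC := increasing_sub sC iid.
have fC g : A g -> fin_energy id (cut E p q) g by move=> /Adom[gg _ _]; exact: fin_energy_sub sC gg.
have Cc : cut E p q c by split=> //=; rewrite pc; lra.
have Cd : cut E p q d by split=> //=; rewrite dq andbT; lra.
rewrite (energy_cut3 iC Cc Cd (ltW cd) (fC _ Asg) (fC _ Af')).
have -> : Q (lo (cut E p q) c) sg f' = 0.
  rewrite energyC; apply: (@energy_cst0 _ _ _ f' _ 0) => x [[Ex /= /andP[px _]] xc].
  by apply: f1 => //; rewrite px.
have -> : Q (hi (cut E p q) d) sg f' = 0.
  rewrite energyC; apply: (@energy_cst0 _ _ _ f' _ (f d - f c)) => x [[Ex /= /andP[_ xq]] dx].
  by apply: f3 => //; rewrite dx.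
rewrite add0r addr0 cut_cut // [LHS]energyC [RHS]energyC.
rewrite (@eq_energy _ _ _ f' sg (fun x => 1 * f x + (- f c)) sg) //; last first.
  by move=> x [Ex cxd]; rewrite f2 // mul1r.
have fD g : A g -> fin_energy id (cut E c d) g.
  by move=> /Adom[gg _ _]; exact: fin_energy_sub (@cut_sub _ E c d) gg.
have fc0 := @fin_energy_cst _ id (cut E c d) (- f c).
rewrite (energyDl (increasing_sub (@cut_sub _ E c d) iid) 1 (fD _ Af) fc0 (fD _ Asg)) mul1r.
by rewrite (@energy_cst0 _ _ _ (fun=> - f c) _ (- f c)) ?addr0.
Qed.

(** By [dual_sub] the increments [D] of the representing functions are additive over adjacent
    intervals, so they are the increments of one function, normalised at a base point [e0]. Since
    [D] is the energy of the representing function, it is positive because [A] separates points, and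
    the bound [D x y ^+ 2 <= (y - x) * D x y] makes it at most [y - x]. *)
Lemma scale_exists : exists s, slow E s /\ forall p q, E p -> E q -> p < q ->
  exists sg, dual p q sg /\ forall x, cut E p q x -> s x - s p = sg x - sg p.
Proof.
pose sg p q := xget (fun=> 0) [set u | dual p q u].
have sgP p q : E p -> E q -> p < q -> dual p q (sg p q).
  by move=> Ep Eq pq; have [u du] := rich_dual Ep Eq pq; rewrite /sg; case: xgetP => [v _ dv //|/(_ u)].
pose D p q := sg p q q - sg p q p.
have DE p q u : E p -> E q -> p < q -> dual p q u -> u q - u p = D p q.
  move=> Ep Eq pq [Au Hu]; have [As Hs] := sgP _ _ Ep Eq pq.
  by rewrite /D -Hs // -Hu // energyC.
have Dsub p q c d : E p -> E c -> E d -> E q -> p <= c -> c < d -> d <= q ->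
    sg p q d - sg p q c = D c d.
  move=> Ep Ec Ed Eq pc cd dq; apply: DE => //.
  by apply: (dual_sub Ep Ec Ed Eq) => //; apply: sgP => //; lra.
have Dadd p c q : E p -> E c -> E q -> p < c -> c < q -> D p q = D p c + D c q.
  move=> Ep Ec Eq pc cq; rewrite -(Dsub p q p c) // ?(ltW cq) // -(Dsub p q c q) ?(ltW pc) //.
  by rewrite /D; ring.
have [e0 Ee0] := gapped_ex gE.
pose s x := if e0 < x then D e0 x else if x < e0 then - D x e0 else 0.
have sD x y : E x -> E y -> x < y -> s y - s x = D x y.
  move=> Ex Ey xy; rewrite /s.
  have [ex|xe|exE] := ltgtP e0 x; have [ey|ye|eyE] := ltgtP e0 y; try lra.
  - by rewrite (Dadd e0 x y) //; ring.
  - by rewrite (Dadd x e0 y) //; ring.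
  - by rewrite (Dadd x y e0) //; ring.
  - by rewrite -eyE; ring.
  - by rewrite exE subr0.
exists s; split.
- move=> x y Ex Ey xy; rewrite sD //.
  have [As Hs] := sgP _ _ Ex Ey xy.
  have iC := increasing_sub (@cut_sub _ E x y) iid.
  have fs : fin_energy id (cut E x y) (sg x y).
    by have [ff _ _] := Adom As; exact: fin_energy_sub (@cut_sub _ E x y) ff.
  have DQ : Q (cut E x y) (sg x y) (sg x y) = D x y by rewrite Hs.
  have D0 : 0 <= D x y by rewrite -DQ; exact: energy_ge0.
  have D1 : D x y != 0.
    apply/eqP => D00; have [th [Ath thx thy]] := rich_separate gE rA Ex Ey xy.
    have := Hs _ Ath; rewrite thx thy subr0.
    rewrite (@energy_cst0 _ _ _ (sg x y) _ (sg x y x)); first by lra.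
    move=> z Cz; apply: (energy0_cst iC fs _) => //; first by rewrite DQ.
    by split=> //=; rewrite lexx (ltW xy).
  have D2 : 0 < D x y by rewrite lt_neqAle eq_sym D1.
  rewrite D2 /=; have := increment_le iid fs Ex Ey (ltW xy); rewrite DQ -/(D x y).
  by rewrite expr2 ler_pM2r.
- move=> p q Ep Eq pq; exists (sg p q); split; first exact: sgP.
  move=> x [Ex /= /andP[]]; rewrite le_eqVlt => /predU1P[->|px] xq; first by rewrite !subrr.
  by rewrite sD // (Dsub p q p x).
Qed.

End rich_scale.

(** * Isometric scales *)

Section isometric_scales.
Context {R : realType} {mu : {measure set (measurableTypeR R) -> \bar R}} {E : set R}.
Context (gE : gapped E).
Implicit Types (s f g h w : R -> R).
Let mE : measurable (E : set (measurableTypeR R)) := gapped_measurable gE.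
Let sid := @slow_id R E.
Let iid := slow_increasing sid.
Notation Q := (energy id).

Definition isometric_scale s := slow E s /\
  forall p q, E p -> E q -> p < q -> Q (cut E p q) s s = s q - s p.

Lemma csum_id_le T s f c : slow T s -> chain T c -> csum id f f c <= csum s f f c.
Proof.
move=> sT; move: c; apply: (@chain_ind R T) => // x y p Tx xy /chain_cons[Ty _ _] IH.
rewrite !csum_cons2 lerD // ler_wpM2l -?expr2 ?sqr_ge0 //.
have /andP[s0 sxy] := sT x y Tx Ty xy.
by rewrite lef_pV2 ?posrE // subr_gt0.
Qed.

Lemma energy_id_le T s f : slow T s -> fin_energy s T f ->
  fin_energy id T f /\ Q T f f <= energy s T f f.
Proof.
move=> sT ff; have iT := slow_increasing sT.
have C c : chain T c -> csum id f f c <= energy s T f f.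
  by move=> cc; apply: le_trans (csum_id_le f sT cc) _; exact: csum_le_energy.
split; first by eexists; exact: C.
by apply: energy_le => //; exact: (slow_increasing (@slow_id R T)).
Qed.

Lemma slow_le s x y : slow E s -> E x -> E y -> x <= y -> 0 <= s y - s x <= y - x.
Proof.
move=> sE Ex Ey; rewrite le_eqVlt => /predU1P[->|xy]; first by rewrite !subrr lexx.
by have /andP[/ltW ->] := sE x y Ex Ey xy.
Qed.

(** The boundary condition is inherited: a slow scale is bounded at every finite end, so [f]
    vanishes at such an end already by the condition for [s]. *)
Lemma form_dom_id s f : slow E s -> form_dom mu s E f ->
  form_dom mu id E f /\ nrm1 mu id E f <= nrm1 mu s E f.
Proof.
move=> sE [ff Lf vf]; have [f1 f2] := energy_id_le sE ff; split; last by rewrite lerD2r.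
split=> // b [op [M HM]]; apply: vf; split=> //; have [p Ep] := gapped_ex gE.
exists (`|M| + `|p| + `|s p|) => x Ex.
have := HM x Ex; have := ler_norm M; have := normr_ge0 M.
have := ler_norm p; have := ler_norm (- p); have := ler_norm (s p); have := ler_norm (- s p).
rewrite !normrN; have [xp|/ltW px] := leP x p.
- have /andP[h1 h2] := slow_le sE Ex Ep xp.
  by case: (b); rewrite ?mulN1r ?mul1r ?mulN1r ?mul1r; lra.
- have /andP[h1 h2] := slow_le sE Ep Ex px.
  by case: (b); rewrite ?mulN1r ?mul1r ?mulN1r ?mul1r; lra.
Qed.

(** By locality the right-hand sides over the links of a chain, divided by the increments of [s],
    add up to at most the energy of [f] on [E]. *)
Lemma energy_local_le s f : slow E s -> fin_energy id E f ->
  (forall x y, E x -> E y -> x < y -> (f y - f x) ^+ 2 <= (s y - s x) * Q (cut E x y) f f) ->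
  fin_energy s E f /\ energy s E f f <= Q E f f.
Proof.
move=> sE ff H; have iE := slow_increasing sE.
have fC a b := fin_energy_sub (@cut_sub _ E a b) ff.
have iC a b := increasing_sub (@cut_sub _ E a b) iid.
have C x p : chain E (x :: p) -> csum s f f (x :: p) <= Q (cut E x (last x p)) f f.
  elim: p x => [|y p IH] x cc; first by apply: (energy_ge0 (iC _ _)).
  have /chain_cons[Ex cp xp] := cc; have /chain_cons[Ey _ _] := cp.
  have xy : x < y by rewrite xp // mem_head.
  have /andP[_ yl] := chain_last_ge cp (mem_head _ _).
  rewrite csum_cons2 /=.
  have Cy : cut E x (last y p) y by split=> //=; rewrite (ltW xy).
  rewrite (energy_split (iC _ _) Cy (fC _ _) (fC _ _)) lo_cut // hi_cut ?(ltW xy) //.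
  apply: lerD; last exact: IH.
  by rewrite ler_pdivrMr ?subr_gt0 ?iE // [leRHS]mulrC -expr2; exact: H.
have C' c : chain E c -> csum s f f c <= Q E f f.
  case: c => [_|x p cc]; first exact: energy_ge0.
  by apply: le_trans (C x p cc) _; apply: energy_sub => //; exact: cut_sub.
by split; [eexists; exact: C'|exact: energy_le].
Qed.

(* Q_s - Q_id is a nonnegative form vanishing at s, so Q_id(f, s) = Q_s(f, s). *)
Lemma isometric_increment s p q f : isometric_scale s -> E p -> E q -> p < q -> fin_energy s E f ->
  Q (cut E p q) f s = f q - f p.
Proof.
move=> [sE Hs] Ep Eq pq ff; have iE := slow_increasing sE.
have sC := @cut_sub _ E p q; have iC := increasing_sub sC iE.
have slC := slow_sub sC sE; have idC := increasing_sub sC iid.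
have fC := fin_energy_sub sC ff.
have fs := fin_energy_scale iC Ep Eq (ltW pq).
have [fC' _] := energy_id_le slC fC; have [fs' _] := energy_id_le slC fs.
have E1 := energy_scale f iC Ep Eq (ltW pq); have E2 := energy_scale s iC Ep Eq (ltW pq).
suff : energy s (cut E p q) s f - Q (cut E p q) s f = 0.
  by rewrite ![energy _ _ s f]energyC E1; lra.
apply: (@quad_ge0_lin0 _ (energy s (cut E p q) f f - Q (cut E p q) f f)) => t.
have [_] := energy_id_le slC (fin_energyDl iC t fC fs).
rewrite !energy_quad // E2 Hs // ![energy _ _ s f]energyC; lra.
Qed.

(** Cauchy-Schwarz against [s] on each link: the increment of [f] is its pairing with [s], whose own
    energy is the increment of [s]. This is the hypothesis of [energy_local_le]. *)
Lemma isometric_energy_le s f : isometric_scale s -> fin_energy s E f ->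
  energy s E f f = Q E f f.
Proof.
move=> Hs ff; have [sE Hss] := Hs; have [f1 f2] := energy_id_le sE ff.
apply/eqP; rewrite eq_le f2 andbT; apply: (energy_local_le sE f1 _).2 => x y Ex Ey xy.
have sC := @cut_sub _ E x y; have fC := fin_energy_sub sC f1.
have fs := fin_energy_scale (increasing_sub sC (slow_increasing sE)) Ex Ey (ltW xy).
have [fs' _] := energy_id_le (slow_sub sC sE) fs.
have := energy_CS (increasing_sub sC iid) fC fs'.
by rewrite (isometric_increment Hs) // Hss // mulrC.
Qed.

Lemma energy_polar s f g : slow E s -> (forall h, fin_energy s E h -> energy s E h h = Q E h h) ->
  fin_energy s E f -> fin_energy s E g -> energy s E f g = Q E f g.
Proof.
move=> sE H ff fg; have iE := slow_increasing sE.
have [f1 _] := energy_id_le sE ff; have [g1 _] := energy_id_le sE fg.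
have := H _ (fin_energyD iE ff fg); rewrite !energyD // !H //; lra.
Qed.

Lemma isometric_energy s f g : isometric_scale s -> fin_energy s E f -> fin_energy s E g ->
  energy s E f g = Q E f g.
Proof. by move=> Hs; apply: energy_polar (Hs.1) _ => h; exact: isometric_energy_le. Qed.

End isometric_scales.

(** * The rich domain is the form domain of its scale *)

Section rich_form_domain.
Context {R : realType} {mu : {measure set (measurableTypeR R) -> \bar R}} {E : set R}.
Context (gE : gapped E) (Hmu : radon_full_support E mu).
Context {A : set (R -> R)} (rA : rich_domain mu E A).
Context {s : R -> R} (sE : slow E s).
Hypothesis s_dual : forall p q, E p -> E q -> p < q ->
  exists sg, dual (E := E) (A := A) p q sg /\ forall x, cut E p q x -> s x - s p = sg x - sg p.
Implicit Types (f g h w : R -> R).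
Let mE : measurable (E : set (measurableTypeR R)) := gapped_measurable gE.
Let sid := @slow_id R E.
Let iid := slow_increasing sid.
Let iE := slow_increasing sE.
Notation Q := (energy id).
Let Adom := rich_dom rA.
Let Aeq := rich_eq rA.

Let fA f : A f -> fin_energy id E f. Proof. by move=> /Adom[]. Qed.
Let fC p q f : A f -> fin_energy id (cut E p q) f.
Proof. by move=> /fA; exact: fin_energy_sub (@cut_sub _ E p q). Qed.

(** On [[p, q]] the scale is a representing function plus a constant, so it represents increments
    too; tested against that representing function it yields the energy identity. *)
Lemma dual_scale p q : E p -> E q -> p < q ->
  [/\ fin_energy id (cut E p q) s, Q (cut E p q) s s = s q - s p &
      forall f, A f -> Q (cut E p q) s f = f q - f p].
Proof.
move=> Ep Eq pq; have [sg [[Asg Hsg] ssg]] := s_dual Ep Eq pq.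
have iC := increasing_sub (@cut_sub _ E p q) iid.
pose k := s p - sg p; have fk := @fin_energy_cst _ id (cut E p q) k.
have sE' x : cut E p q x -> 1 * sg x + k = s x by move=> Cx; have := ssg x Cx; rewrite /k; lra.
have fs1 := fin_energyDl iC 1 (fC p q Asg) fk.
have key f : fin_energy id (cut E p q) f -> Q (cut E p q) s f = Q (cut E p q) sg f.
  move=> ff; rewrite -(@eq_energy _ _ _ _ f s f sE') // (energyDl iC 1 (fC p q Asg) fk ff) mul1r.
  by rewrite (@energy_cst0 _ _ _ (fun=> k) _ k) ?addr0.
have fs : fin_energy id (cut E p q) s by apply: eq_fin_energy iC _ _ sE' fs1.
split=> // [|f Af]; last by rewrite key ?Hsg //; exact: fC.
have Cq : cut E p q q by split=> //=; rewrite lexx (ltW pq).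
by rewrite key // energyC key ?Hsg //; [have := ssg q Cq; lra|exact: fC].
Qed.

Lemma dual_isometric : isometric_scale (E := E) s.
Proof. by split=> // p q Ep Eq pq; have [] := dual_scale Ep Eq pq. Qed.

Lemma rich_fin_energy f : A f -> fin_energy s E f /\ energy s E f f <= Q E f f.
Proof.
move=> Af; apply: (energy_local_le sE (fA Af)) => x y Ex Ey xy.
have [fs ss Hs] := dual_scale Ex Ey xy.
by have := energy_CS (increasing_sub (@cut_sub _ E x y) iid) fs (fC x y Af); rewrite ss Hs.
Qed.

(** For the end condition, [f] is approximated in norm by compactly supported members of [A]. On [A]
    the [s]-energy is at most the energy for [id], so the convergence also holds in [s]-energy,
    which preserves vanishing at bounded ends. *)
Lemma rich_form_dom f : A f -> form_dom mu s E f.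
Proof.
move=> Af; have df := Adom Af; have [ff Lf _] := df; have [fs fsle] := rich_fin_energy Af.
split=> // b bd; have [p Ep] := gapped_ex gE.
have inv0 n : 0 < (n.+1%:R : R)^-1 by rewrite invr_gt0.
have /choice[u_ uP] : forall n, exists g, [/\ A g, csupp E g & nrm1 mu id E (fun x => f x - g x) < n.+1%:R^-1].
  by move=> n; exact: rich_dense rA _ _ Af (inv0 n).
have du n : form_dom mu id E (fun x => f x - u_ n x).
  by have [Au _ _] := uP n; exact: Adom (richB rA Af Au).
have cv : nrm1 mu id E (fun x => f x - u_ n x) @[n --> \oo] --> 0.
  apply: (squeeze_cvgr _ (cvg_cst 0) (@cvg_harmonic R)); apply: nearW => n.
  have [_ _ /ltW ->] := uP n; rewrite andbT; apply: nrm1_ge0 => //.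
  by have [] := du n.
apply: (@vanish_energy_lim _ _ s sE b p u_) => //.
- by move=> n; have [Au _ _] := uP n; have [] := rich_fin_energy Au.
- by move=> n; have [_ su _] := uP n; apply: (csupp_end_cond (s := s) su).
- apply: (squeeze_cvgr _ (cvg_cst 0) cv); apply: nearW => n.
  have [Au _ _] := uP n; have [h1 h2] := rich_fin_energy (richB rA Af Au).
  by rewrite (energy_ge0 iE h1) /=; apply: le_trans h2 _; rewrite lerDl nrm2_ge0.
- exact: (form_dom_cvg_at gE Hmu sid Ep du cv).
Qed.

(** Interpolation of [w] that is affine in [s], and not in the coordinate, between the points of the
    chain: functions of this kind are known to lie in [A] locally. *)
Fixpoint interp w (x : R) (p : seq R) (t : R) : R :=
  if p is y :: p' then
    if t <= y then w x + (w y - w x) / (s y - s x) * (s t - s x) else interp w y p' t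
  else w x.

Lemma interp_head w x p : chain E (x :: p) -> interp w x p x = w x.
Proof.
case: p => //= y p /chain_cons[_ _ xp]; rewrite (ltW (xp y _)) ?mem_head //.
by rewrite subrr mulr0 addr0.
Qed.

Lemma interp_last w x p : chain E (x :: p) -> interp w x p (last x p) = w (last x p).
Proof.
elim: p x => [|y p IH] x cc; first by rewrite interp_head.
have /chain_cons[Ex cp xp] := cc; have /chain_cons[Ey _ _] := cp.
have /andP[_ yl] := chain_last_ge cp (mem_head _ _).
rewrite /=; case: ifP => [ly|_]; last exact: IH.
have -> : last y p = y by apply/eqP; rewrite eq_le yl ly.
rewrite divfK; first by ring.
by rewrite subr_eq0 gt_eqF // iE // xp // mem_head.
Qed.

(** On a link the interpolation is a multiple of a representing function plus a constant, the latter
    realised in [A] by a multiple of a function equal to 1 on the link; the links are joined by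
    [rich_glue]. *)
Lemma rich_interp w x p : chain E (x :: p) ->
  exists u, A u /\ forall t, cut E x (last x p) t -> u t = interp w x p t.
Proof.
elim: p x => [|y p IH] x cc.
  have Ex : E x by apply: cc.2; rewrite mem_head.
  have [chi [Achi _ chi1]] := rich_urysohn gE rA Ex Ex (lexx x).
  exists (fun t => w x * chi t); split; first exact: (richZ gE rA).
  by move=> t [Et xt]; rewrite chi1 // mulr1.
have /chain_cons[Ex cp xp] := cc; have /chain_cons[Ey _ _] := cp.
have xy : x < y by rewrite xp // mem_head.
have /andP[_ yl] := chain_last_ge cp (mem_head _ _).
have [u [Au uE]] := IH y cp.
have [sg [[Asg _] ssg]] := s_dual Ex Ey xy.
have [chi [Achi _ chi1]] := rich_urysohn gE rA Ex Ey (ltW xy).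
pose k := (w y - w x) / (s y - s x).
pose v t := k * sg t + (w x - k * sg x) * chi t.
have Av : A v by apply: (rich_lin rA) => //; exact: (richZ gE rA).
have vE t : cut E x y t -> v t = w x + k * (s t - s x).
  by move=> Ct; rewrite (ssg t Ct) /v chi1; [ring|case: Ct|case: Ct].
have s0 : s y - s x != 0 by rewrite subr_eq0 gt_eqF // iE.
have vy : v y = w y.
  by rewrite vE /k ?divfK //; [ring|split=> //=; rewrite lexx (ltW xy)].
have uy : u y = w y by rewrite uE ?interp_head //; split=> //=; rewrite lexx.
exists (fun t => if y <= t then u t else v t); split.
  by apply: (rich_glue gE Hmu rA Ey Av Au); rewrite vy uy.
move=> t [Et /= /andP[xt tl]]; have [yt|ty] := leP y t; have [ty'|yt'] := leP t y.
- have -> : t = y by apply/eqP; rewrite eq_le yt ty'.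
  by rewrite uy /= divfK //; ring.
- by rewrite uE //; split=> //=; rewrite yt.
- by rewrite vE //; split=> //=; rewrite xt.
- by move: (lt_trans ty yt'); rewrite ltxx.
Qed.

(** Pythagoras: on each link the interpolation is the projection of [w], since pairing with [s]
    gives the increment ([energy_scale]). The error is what the chain misses of the energy of
    [w]. *)
Lemma interp_energy w x p u : chain E (x :: p) -> fin_energy s E w -> fin_energy s E u ->
  (forall t, cut E x (last x p) t -> u t = interp w x p t) ->
  energy s (cut E x (last x p)) (fun t => w t - u t) (fun t => w t - u t) =
  energy s (cut E x (last x p)) w w - csum s w w (x :: p).
Proof.
move=> cc fw fu; have fwu := fin_energyB iE fw fu.
have iC a b := increasing_sub (@cut_sub _ E a b) iE.
have fCs f a b := @fin_energy_sub _ _ _ s f (@cut_sub _ E a b).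
elim: p x cc => [|y p IH] x cc uE.
  have eqx t : cut E x x t -> t = x by move=> [_ /= H]; apply/eqP; rewrite eq_le andbC.
  have -> : energy s (cut E x x) (fun t => w t - u t) (fun t => w t - u t) = 0.
    by apply: (@energy_cst0 _ _ _ _ _ (w x - u x)) => t /eqx ->.
  have -> : energy s (cut E x x) w w = 0.
    by apply: (@energy_cst0 _ _ _ _ _ (w x)) => t /eqx ->.
  by rewrite /= subr0.
have /chain_cons[Ex cp xp] := cc; have /chain_cons[Ey _ _] := cp.
have xy : x < y by rewrite xp // mem_head.
have /andP[_ yl] := chain_last_ge cp (mem_head _ _).
have Cy : cut E x (last y p) y by split=> //=; rewrite (ltW xy).
rewrite csum_cons2 /= in uE *.
rewrite !(energy_split (iC _ _) Cy) //; try exact: fCs.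
rewrite !lo_cut // !hi_cut ?(ltW xy) // IH //; last first.
  move=> t [Et /= /andP[yt tl]]; rewrite uE; last by split=> //=; rewrite tl andbT; lra.
  case: ifP => // ty; have -> : t = y by apply/eqP; rewrite eq_le yt ty.
  rewrite interp_head // divfK; first by ring.
  by rewrite subr_eq0 gt_eqF // iE.
set k := (w y - w x) / (s y - s x).
have s0 : s y - s x != 0 by rewrite subr_eq0 gt_eqF // iE.
have fs := fin_energy_scale (iC x y) Ex Ey (ltW xy).
have fx := @fin_energy_cst _ s (cut E x y) (k * s x - w x).
have fwx := fCs w x y fw.
rewrite (@eq_energy _ _ _ _ _ (fun t => (- k) * s t + (1 * w t + (k * s x - w x)))
    (fun t => (- k) * s t + (1 * w t + (k * s x - w x)))); first last.
- by move=> t [Et /= /andP[xt ty]]; rewrite uE ?ty ?/k; [ring|split=> //=; rewrite xt (le_trans ty)].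
- by move=> t [Et /= /andP[xt ty]]; rewrite uE ?ty ?/k; [ring|split=> //=; rewrite xt (le_trans ty)].
have E0 h : energy s (cut E x y) h (fun=> k * s x - w x) = 0.
  by rewrite energyC; apply: (@energy_cst0 _ _ _ _ _ (k * s x - w x)).
have E1 : energy s (cut E x y) s (fun t => 1 * w t + (k * s x - w x)) = w y - w x.
  by rewrite energyC (energy_scale _ (iC x y) Ex Ey (ltW xy)); ring.
have E2 := energy_scale s (iC x y) Ex Ey (ltW xy).
have f1 := fin_energyDl (iC x y) 1 fwx fx.
rewrite (energy_quad (iC x y) _ fs f1) (energy_quad (iC x y) _ fwx fx) !E0 E1 E2.
have -> : (w y - w x) * (w y - w x) / (s y - s x) = k ^+ 2 * (s y - s x).
  by rewrite /k; field.
have -> : w y - w x = k * (s y - s x) by rewrite /k divfK.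
rewrite -[csum_from _ _ _ _ _]/(csum s w w (y :: p)); ring.
Qed.

(** Chains from [p] to [q] that nearly exhaust the energy of [w] give interpolations in [A] close to
    [w] in [s]-energy; the Poincaré inequality turns this into convergence in norm, for which [A] is
    closed. *)
Lemma rich_of_outside w p q : E p -> E q -> p < q -> fin_energy s E w -> w p = 0 -> w q = 0 ->
  (forall x, E x -> ~ (p <= x <= q) -> w x = 0) -> A w.
Proof.
move=> Ep Eq pq fw wp wq w0; have pq' := ltW pq.
have [K K0 HK] := poincare gE Hmu Ep Eq pq'.
have iC a b := increasing_sub (@cut_sub _ E a b) iE.
have fwC := fin_energy_sub (@cut_sub _ E p q) fw.
have inv0 n : 0 < (n.+1%:R : R)^-1 by rewrite invr_gt0.
have [dw _] := HK _ (energy_id_le sE fw).1 wp w0.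
have /choice[v_ vP] : forall n, exists v, [/\ A v, v p = 0, v q = 0,
    forall x, E x -> ~ (p <= x <= q) -> v x = 0 &
    energy s E (fun x => w x - v x) (fun x => w x - v x) <= n.+1%:R^-1].
  move=> n; have [c0 cc0 Hc0] := energy_approx (iC p q) fwC (inv0 n).
  have Cp : cut E p q p by split=> //=; rewrite lexx.
  have Cq : cut E p q q by split=> //=; rewrite lexx pq'.
  have cpq := chain2 Cp Cq pq.
  pose c := chain_union c0 [:: p; q].
  have cc : chain (cut E p q) c by exact: chain_unionP.
  have Hc : energy s (cut E p q) w w - n.+1%:R^-1 < csum s w w c.
    by apply: lt_le_trans Hc0 _; apply: (csum_le_subset w (iC p q) cc0 cc); exact: chain_union_l.
  have pc : p \in c by apply: chain_union_r; rewrite mem_head.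
  have qc : q \in c by apply: chain_union_r; rewrite !inE eqxx orbT.
  move: pc qc cc Hc; case: c => [//|x l] pc qc cc Hc.
  have /andP[xp _] := chain_last_ge cc pc; have /andP[_ ql] := chain_last_ge cc qc.
  have [_ /= /andP[px _]] : cut E p q x by apply: cc.2; rewrite mem_head.
  have [_ /= /andP[_ lq]] : cut E p q (last x l) by apply: cc.2; rewrite mem_last.
  have xE : x = p by apply/eqP; rewrite eq_le xp px.
  have lE : last x l = q by apply/eqP; rewrite eq_le ql lq.
  have ccE : chain E (x :: l) by apply: chain_sub cc; exact: cut_sub.
  have [u [Au uE]] := rich_interp w ccE.
  rewrite lE xE in uE.
  have up : u p = 0.
    rewrite uE; last by split=> //=; rewrite lexx.
    by rewrite -[X in interp _ _ _ X]xE -xE interp_head // xE.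
  have uq : u q = 0.
    rewrite uE; last by split=> //=; rewrite lexx andbT.
    by rewrite -xE -lE interp_last // lE.
  have [fu _] := rich_fin_energy Au.
  have H := interp_energy ccE fw fu; rewrite lE xE in H; have {}H := H uE.
  exists (restrict_to p q u); split.
  - by apply: (rich_restrict gE Hmu rA).
  - by rewrite /restrict_to lexx pq'.
  - by rewrite /restrict_to lexx pq'.
  - by move=> y Ey /negP ny; rewrite /restrict_to (negbTE ny).
  - have Ar := rich_restrict gE Hmu rA Ep Eq pq' Au up uq.
    have [fr _] := rich_fin_energy Ar.
    have r0 y : E y -> ~ (p <= y <= q) -> w y - restrict_to p q u y = 0.
      by move=> Ey ny; rewrite w0 // /restrict_to; move/negP : ny => /negbTE ->; rewrite subrr.
    rewrite (energy_outside iE Ep Eq pq' (fin_energyB iE fw fr)) //; last 2 first.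
    + by rewrite wp /restrict_to lexx pq' up subrr.
    + by rewrite wq /restrict_to lexx pq' uq subrr.
    rewrite (@eq_energy _ _ _ _ _ (fun t => w t - u t) (fun t => w t - u t)).
    + by rewrite H; move: Hc; rewrite xE ltrBlDr => Hc; rewrite lerBlDl ltW.
    + by move=> t [_ /= ptq]; rewrite /restrict_to ptq.
    + by move=> t [_ /= ptq]; rewrite /restrict_to ptq.
apply: (rich_closed rA (u_ := v_)) dw _; first by move=> n; have [] := vP n.
apply: (squeeze_cvgr (f := fun=> 0) (h := fun n => K * n.+1%:R^-1)).
- apply: nearW => n; have [Av vp vq v0 vle] := vP n.
  have [fv _] := rich_fin_energy Av; have fwv := fin_energyB iE fw fv.
  have [f1 f2] := energy_id_le sE fwv.
  have [||[f3 _ _] le] := HK _ f1.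
  + by rewrite wp vp subrr.
  + by move=> x Ex nx; rewrite w0 // v0 // subrr.
  rewrite nrm1_ge0 //=; apply: le_trans le _; rewrite ler_pM2l //; exact: le_trans f2 vle.
- exact: cvg_cst.
- rewrite -[X in _ --> X](mulr0 K); apply: cvgM; [exact: cvg_cst|exact: cvg_harmonic].
Qed.

(** From [g] one subtracts a function of [A] with the same values at [p] and [q] that vanishes
    outside [[p, q]], and [rich_of_outside] applies. Such a function exists because at each of the
    two points either [g] vanishes and one may cut, or the point is extreme in [E] and nothing lies
    beyond. *)
Let rich_of_csupp g : form_dom mu s E g -> csupp E g -> A g.
Proof.
move=> [fg _ _] [a [b [Ea Eb ab g0]]].
have [p [Ep pa pg]] : exists p, [/\ E p, p <= a & g p = 0 \/ forall x, E x -> p <= x].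
  have [[p [Ep pa]]|H] := pselect (exists p, E p /\ p < a).
    exists p; split=> //; [exact: ltW|left; apply: g0 => // /andP[]].
    by rewrite leNgt pa.
  exists a; split=> //; right=> x Ex; rewrite leNgt; apply/negP => xa; apply: H; by exists x.
have [q [Eq bq qg]] : exists q, [/\ E q, b <= q & g q = 0 \/ forall x, E x -> x <= q].
  have [[q [Eq qb]]|H] := pselect (exists q, E q /\ b < q).
    exists q; split=> //; [exact: ltW|left; apply: g0 => // /andP[_]].
    by rewrite leNgt qb.
  exists b; split=> //; right=> x Ex; rewrite leNgt; apply/negP => xa; apply: H; by exists x.
have pq' : p <= q by lra.
have gpq x : E x -> ~ (p <= x <= q) -> g x = 0.
  by move=> Ex nx; apply: g0 => // /andP[ax xb]; apply: nx; apply/andP; split; lra.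
have [pqE|pq] : p = q \/ p < q by move: pq'; rewrite le_eqVlt => /predU1P.
  have g0' x : E x -> g x = 0.
    move=> Ex; have [h|h] := pselect (p <= x <= q); last exact: gpq.
    have -> : x = p by move: h; rewrite -pqE => /andP[h1 h2]; apply/eqP; rewrite eq_le h1 h2.
    case: pg => // pmin; case: qg => [|qmax]; first by rewrite pqE.
    have [[u [v [Eu Ev uv]]] _] := gE.
    by have := pmin u Eu; have := qmax v Ev; rewrite -pqE; lra.
  by apply: Aeq (rich0 gE rA) => x /g0' ->.
have [chi [Achi _ chi1]] := rich_urysohn gE rA Ep Eq pq'.
have [th [Ath thp thq]] := rich_separate gE rA Ep Eq pq.
pose f0 x := (g q - g p) * th x + g p * chi x.
have Af0 : A f0 by apply: (rich_lin rA) => //; exact: (richZ gE rA).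
have f0p : f0 p = g p by rewrite /f0 thp chi1 ?lexx //; ring.
have f0q : f0 q = g q by rewrite /f0 thq chi1 ?lexx ?pq' //; ring.
have [f1 [Af1 f1pq f1out]] : exists f1, [/\ A f1, forall x, E x -> p <= x -> f1 x = f0 x &
    forall x, E x -> x < p -> f1 x = 0].
  case: pg => [gp|pmin].
    exists (right_of p f0); split.
    - by apply: (rich_right_of gE Hmu rA) => //; rewrite f0p.
    - by move=> x _ px; rewrite /right_of px.
    - by move=> x _ px; rewrite /right_of leNgt px.
  by exists f0; split=> // x Ex; rewrite ltNge pmin.
have [f2 [Af2 f2pq f2out]] : exists f2, [/\ A f2, forall x, E x -> p <= x <= q -> f2 x = f0 x &
    forall x, E x -> ~ (p <= x <= q) -> f2 x = 0].
  case: qg => [gq|qmax].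
    have f1q : f1 q = 0 by rewrite f1pq // f0q.
    exists (fun x => f1 x - right_of q f1 x); split.
    - by apply: (richB rA Af1); exact: (rich_right_of gE Hmu rA).
    - move=> x Ex /andP[px xq]; rewrite f1pq // /right_of; case: ifP => qx; last by rewrite subr0.
      have -> : x = q by apply/eqP; rewrite eq_le xq qx.
      by rewrite f1q subr0.
    - move=> x Ex /negP; rewrite negb_and -!ltNge /right_of => /orP[xp|qx].
        by rewrite f1out // leNgt (lt_trans xp pq) subr0.
      by rewrite (ltW qx) subrr.
  exists f1; split=> //; first by move=> x Ex /andP[px _]; exact: f1pq.
  by move=> x Ex /negP; rewrite qmax // andbT -ltNge; exact: f1out.
have [ff2 _] := rich_fin_energy Af2.
have Aw : A (fun x => g x - f2 x).
  apply: (rich_of_outside Ep Eq pq (fin_energyB iE fg ff2)).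
  - by rewrite f2pq ?f0p ?subrr // lexx.
  - by rewrite f2pq ?f0q ?subrr // lexx andbT.
  - by move=> x Ex nx; rewrite gpq // f2out // subrr.
by apply: Aeq (richD rA Aw Af2) => x _; rewrite subrK.
Qed.

Lemma form_dom_rich f : form_dom mu s E f -> A f.
Proof.
move=> df; have inv0 n : 0 < (n.+1%:R : R)^-1 by rewrite invr_gt0.
have /choice[u_ uP] : forall n, exists g, [/\ form_dom mu s E g, csupp E g &
    nrm1 mu s E (fun x => f x - g x) < n.+1%:R^-1].
  by move=> n; exact: (csupp_dense gE sE df (inv0 n)).
apply: (rich_closed rA (u_ := u_)).
- by move=> n; have [du su _] := uP n; exact: rich_of_csupp.
- exact: (form_dom_id gE sE df).1.
- apply: (squeeze_cvgr _ (cvg_cst 0) (@cvg_harmonic R)); apply: nearW => n.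
  have [du _ nu] := uP n; have [h1 h2] := form_dom_id gE sE (form_domB gE sE df du).
  by rewrite (le_trans h2 (ltW nu)) andbT nrm1_ge0 //; have [] := h1.
Qed.

End rich_form_domain.

(** * Uniform density of the form domain *)

Section uniform_density.
Context {R : realType} {mu : {measure set (measurableTypeR R) -> \bar R}} {E : set R}.
Context (gE : gapped E) (Hmu : radon_full_support E mu) {s : R -> R} (sE : slow E s).
Implicit Types (f g h : R -> R).
Let iE := slow_increasing sE.

(** Either a point of [E] lies strictly between [x] and [x + d] and gives the bound, or this
    interval lies in a gap whose right endpoint gives it, or no point of [E] is that far to the
    right. *)
Let gap_right x d : E x -> 0 < d -> exists2 dl : R, 0 < dl &
  forall y, E y -> x + d <= y -> dl <= s y - s x.
Proof.
move=> Ex d0.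
have [[z [Ez xz zd]]|H] := pselect (exists z, [/\ E z, x < z & z < x + d]).
  exists (s z - s x); first by rewrite subr_gt0 iE.
  by move=> y Ey xy; rewrite lerD2r; apply: (increasing_on_le sE) => //; lra.
have [[y1 [Ey1 xy1]]|H1] := pselect (exists y, E y /\ x + d <= y); last first.
  by exists 1 => // y Ey xy; exfalso; apply: H1; exists y.
have nEt : ~ E (x + d / 2) by move=> Et; apply: H; exists (x + d / 2); split=> //; lra.
have t1 : x < x + d / 2 by lra.
have t2 : x + d / 2 < y1 by lra.
have [c [d' [[/= Ec [Ed' [cd nE]]] ct td]]] := gE.2 _ _ _ Ex Ey1 t1 t2 nEt.
have xd' : x < d' by lra.
exists (s d' - s x); first by rewrite subr_gt0 iE.
move=> y Ey xy; rewrite lerD2r; apply: (increasing_on_le sE) => //.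
rewrite leNgt; apply/negP => yd; apply: (nE y) => //; apply/andP; split=> //.
rewrite ltNge; apply/negP => yc; apply: H; exists c; split=> //; lra.
Qed.

Let gap_left x d : E x -> 0 < d -> exists2 dl : R, 0 < dl &
  forall y, E y -> y <= x - d -> dl <= s x - s y.
Proof.
move=> Ex d0.
have [[z [Ez xz zd]]|H] := pselect (exists z, [/\ E z, x - d < z & z < x]).
  exists (s x - s z); first by rewrite subr_gt0 iE.
  by move=> y Ey xy; rewrite lerD2l lerN2; apply: (increasing_on_le sE) => //; lra.
have [[y1 [Ey1 xy1]]|H1] := pselect (exists y, E y /\ y <= x - d); last first.
  by exists 1 => // y Ey xy; exfalso; apply: H1; exists y.
have nEt : ~ E (x - d / 2) by move=> Et; apply: H; exists (x - d / 2); split=> //; lra.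
have t1 : y1 < x - d / 2 by lra.
have t2 : x - d / 2 < x by lra.
have [c [d' [[/= Ec [Ed' [cd nE]]] ct td]]] := gE.2 _ _ _ Ey1 Ex t1 t2 nEt.
have xd' : c < x by lra.
exists (s x - s c); first by rewrite subr_gt0 iE.
move=> y Ey xy; rewrite lerD2l lerN2; apply: (increasing_on_le sE) => //.
rewrite leNgt; apply/negP => yd; apply: (nE y) => //; apply/andP; split=> //.
rewrite ltNge; apply/negP => yc; apply: H; exists d'; split=> //; lra.
Qed.

(** Continuity of the inverse of [s] at [s x]. The scale may be very flat, so [dl] depends on
    [x]. *)
Lemma scale_separated x d : E x -> 0 < d -> exists2 dl : R, 0 < dl &
  forall y, E y -> `|s x - s y| < dl -> `|x - y| < d.
Proof.
move=> Ex d0; have [dr dr0 Hr] := gap_right Ex d0; have [dl dl0 Hl] := gap_left Ex d0.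
exists (Num.min dr dl); first by rewrite lt_min dr0.
move=> y Ey; rewrite lt_min => /andP[h1 h2]; rewrite ltNge; apply/negP.
rewrite ler_normr => /orP[h|h].
- by have := Hl y Ey; have := ler_norm (s x - s y); lra.
- by have := Hr y Ey; have := ler_norm (- (s x - s y)); rewrite normrN; lra.
Qed.

(** Uniform continuity for the distance [|s x - s y|]: locally it comes from [scale_separated], and
    compactness of the support makes it uniform. *)
Lemma csupp_scale_uniform h e : {within E, continuous h} -> csupp E h -> 0 < e ->
  exists n : nat, forall x y, E x -> E y -> `|s x - s y| < n.+1%:R^-1 -> `|h x - h y| < e.
Proof.
move=> /continuous_onP ch [a [b [Ea Eb ab h0]]] e0.
have cK := compact_cut gE Ea Eb.
have e2 : 0 < e / 2 by rewrite divr_gt0.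
have [] := (compact_near_coveringP _).1 cK nat \oo
  (fun n x' => E x' -> forall y, E y -> `|s x' - s y| < n.+1%:R^-1 -> `|h x' - h y| < e).
- move=> x [Ex _]; have [d d0 hd] := ch x Ex _ e2.
  have [dl dl0 sd] := scale_separated Ex d0.
  have dl2 : 0 < dl / 2 by rewrite divr_gt0.
  have [N _ HN] := (cvgrPdist_lt _ _).1 (@cvg_harmonic R) _ dl2.
  exists (ball x (Num.min d (dl / 2)), [set n | (N <= n)%N]).
    by split; [apply: nbhsx_ballx; rewrite lt_min d0|exists N].
  move=> [x' n] [/= + Nn] Ex' y Ey sxy; rewrite /ball /= lt_min => /andP[xd xdl].
  have := HN n Nn; rewrite /= sub0r normrN ger0_norm ?invr_ge0 // => nd.
  have h1 := hd x' Ex' xd; have := slow_dist sE Ex Ex'.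
  have := ler_normD (s x - s x') (s x' - s y); rewrite addrA subrK => h2 h3.
  have sxy2 := lt_trans sxy nd; have sxy3 : `|s x - s y| < dl by clear nd sxy; lra.
  have h5 := hd y Ey (sd y Ey sxy3).
  have := ler_normD (h x' - h x) (h x - h y); rewrite addrA subrK (distrC (h x') (h x)); lra.
- move=> n _ Hn; exists n => x y Ex Ey sxy.
  have [Hx|nx] := pselect (a <= x <= b); first exact: (Hn n (leqnn n) x (conj Ex Hx)).
  have [Hy|ny] := pselect (a <= y <= b).
    by rewrite distrC; apply: (Hn n (leqnn n) y (conj Ey Hy)) => //; rewrite distrC.
  by rewrite !h0 // subrr normr0.
Qed.

Lemma csupp_bounded h : {within E, continuous h} -> csupp E h ->
  exists2 M : R, 0 < M & forall x, E x -> `|h x| <= M.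
Proof.
move=> ch [a [b [Ea Eb ab h0]]].
have cK := compact_cut gE Ea Eb.
have ne : cut E a b !=set0 by exists a; split=> //=; rewrite lexx.
have chK : {within cut E a b, continuous h} by apply: continuous_subspaceW ch; exact: cut_sub.
have [x1 _ H1] := compact_EVT_max ne cK chK; have [x2 _ H2] := compact_EVT_min ne cK chK.
exists (`|h x1| + `|h x2| + 1) => [|x Ex]; first by rewrite ltr_wpDl // addr_ge0.
have [abx|nx] := pselect (a <= x <= b); last first.
  by rewrite h0 // normr0 !addr_ge0.
have /mem_set xK : cut E a b x by split.
have := H1 x xK; have := H2 x xK; rewrite ler_norml.
have := ler_norm (h x1); have := ler_norm (- h x2); have := normr_ge0 (h x1); have := normr_ge0 (h x2).
by rewrite normrN => ? ? ? ? ? ?; apply/andP; split; lra.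
Qed.

(** The support is widened to points of [E] at which [h] vanishes, unless an endpoint is already
    extreme in [E]. In both cases [h] is constant from the new points outwards, and finite energy
    can be glued there. *)
Lemma csupp_margin h : csupp E h -> exists p q, [/\ E p, E q, p <= q,
    forall x, E x -> ~ (p <= x <= q) -> h x = 0 &
    (h p = 0 \/ forall x, E x -> p <= x) /\ (h q = 0 \/ forall x, E x -> x <= q)].
Proof.
move=> [a [b [Ea Eb ab g0]]].
have [p [Ep pa pg]] : exists p, [/\ E p, p <= a & h p = 0 \/ forall x, E x -> p <= x].
  have [[p [Ep pa]]|H] := pselect (exists p, E p /\ p < a).
    exists p; split=> //; [exact: ltW|left; apply: g0 => // /andP[]].
    by rewrite leNgt pa.
  exists a; split=> //; right=> x Ex; rewrite leNgt; apply/negP => xa; apply: H; by exists x.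
have [q [Eq bq qg]] : exists q, [/\ E q, b <= q & h q = 0 \/ forall x, E x -> x <= q].
  have [[q [Eq qb]]|H] := pselect (exists q, E q /\ b < q).
    exists q; split=> //; [exact: ltW|left; apply: g0 => // /andP[_]].
    by rewrite leNgt qb.
  exists b; split=> //; right=> x Ex; rewrite leNgt; apply/negP => xa; apply: H; by exists x.
exists p, q; split=> //; first by lra.
by move=> x Ex nx; apply: g0 => // /andP[ax xb]; apply: nx; apply/andP; split; lra.
Qed.

Lemma csupp_L2 g : {within E, continuous g} -> csupp E g -> L2 mu E g.
Proof.
move=> cg sg; have [p [q [Ep Eq pq g0]]] := sg.
have mE := gapped_measurable gE.
have mg := continuous_on_measurable mE cg.
have [M M0 gM] := csupp_bounded cg sg.
have muf : (mu (cut E p q) < +oo)%E by apply: Hmu.2.1; [exact: compact_cut|exact: cut_sub].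
have mc : measurable (cut E p q : set (measurableTypeR R)).
  by apply: closed_measurable; exact: closed_cut.
split=> //; rewrite (_ : integral _ _ _ = \int[mu]_(x in cut E p q) ((g x) ^+ 2)%:E)%E; last first.
  rewrite [LHS]integral_mkcond [RHS]integral_mkcond; apply: eq_integral => x _; rewrite !patchE.
  case: ifPn => [/set_mem Ex|nE]; last by rewrite memNset // => -[] /mem_set; rewrite (negbTE nE).
  case: ifPn => // /negP nc; rewrite g0 ?expr0n // => pxq; apply: nc; exact/mem_set.
apply: (@le_lt_trans _ _ (\int[mu]_(x in cut E p q) (M ^+ 2)%:E)%E).
  apply: ge0_le_integral => //.
  - by move=> x _; rewrite lee_fin sqr_ge0.
  - apply: measurable_sqr; apply: measurable_funS mg => //; exact: cut_sub.
  - move=> x [Ex _]; rewrite lee_fin -[g x ^+ 2]real_normK ?num_real // lerXn2r ?nnegrE ?gM //.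
    exact: ltW.
rewrite integral_cst //.
have -> : mu (cut E p q) = (fine (mu (cut E p q)))%:E by rewrite fineK // ge0_fin_numE.
by rewrite -EFinM ltry.
Qed.

Lemma scale_lipschitz_form_dom g (n : R) : 0 <= n -> csupp E g ->
  (forall x y, E x -> E y -> `|g x - g y| <= n * `|s x - s y|) -> form_dom mu s E g.
Proof.
move=> n0 sg gL; have [p [q [Ep Eq pq g0 [gp gq]]]] := csupp_margin sg.
have gcst T' a : T' `<=` E -> (forall x, T' x -> g x = a) -> fin_energy s T' g.
  move=> sub H; apply: eq_fin_energy (increasing_sub sub iE) _ _ _ (fin_energy_cst a).
  by move=> x /H ->.
have fg : fin_energy s E g.
  apply: (fin_energy_glue iE Eq).
    apply: (fin_energy_glue (d := p) (increasing_sub (@lo_sub _ E q) iE)); first by split.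
    - apply: (gcst _ (g p)) => [x [[]//]|x [[Ex _] /= xp]].
      case: gp => [gp|pm]; last by congr g; apply/eqP; rewrite eq_le xp pm.
      have [->//|xp'] := eqVneq x p; rewrite gp g0 // => /andP[px _].
      by move: xp'; rewrite eq_le xp px.
    - rewrite hi_lo; have iC := increasing_sub (@cut_sub _ E p q) iE.
      apply: (fin_energy_le iC (fin_energyZ iC n (fin_energy_scale iC Ep Eq pq))).
      by move=> x y [Ex _] [Ey _] _; rewrite -mulrBr normrM (ger0_norm n0); exact: gL.
  apply: (gcst _ (g q)) => [x []//|x [Ex /= xp]].
  case: gq => [gp'|pm]; last by congr g; apply/eqP; rewrite eq_le xp pm.
  have [->//|xp'] := eqVneq x q; rewrite gp' g0 // => /andP[_ px].
  by move: xp'; rewrite eq_le xp px.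
split=> //; last exact: csupp_end_cond.
exact: csupp_L2 (fin_energy_continuous sE fg) sg.
Qed.

(* inf-convolution of h with n |s x - s y| *)
Lemma scale_lipschitz_approx h e : {within E, continuous h} -> csupp E h ->
  (forall x, E x -> 0 <= h x) -> 0 < e ->
  exists g, form_dom mu s E g /\ forall x, E x -> 0 <= g x <= h x /\ h x - g x < e.
Proof.
move=> ch sh h0 e0; have [M M0 hM] := csupp_bounded ch sh.
have e2 : 0 < e / 2 by rewrite divr_gt0.
have [k hk] := csupp_scale_uniform ch sh e2.
pose n := M * k.+1%:R; have n0 : 0 < n by rewrite mulr_gt0.
pose S x := [set h y + n * `|s x - s y| | y in E].
have lbS x : lbound (S x) 0.
  by move=> _ [y Ey <-]; rewrite addr_ge0 ?h0 // mulr_ge0 // ltW.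
have neS x : S x !=set0 by have [y Ey] := gapped_ex gE; exists (h y + n * `|s x - s y|), y.
pose g x := inf (S x).
have gS x y : E y -> g x <= h y + n * `|s x - s y|.
  by move=> Ey; apply: ge_inf; [exists 0; exact: lbS|exists y].
have gle x : E x -> g x <= h x by move=> Ex; have := gS x x Ex; rewrite subrr normr0 mulr0 addr0.
have g0 x : 0 <= g x by apply: lb_le_inf.
have gL x y : g x <= g y + n * `|s x - s y|.
  rewrite -lerBlDr; apply: lb_le_inf => // _ [z Ez <-]; rewrite lerBlDr.
  apply: le_trans (gS x z Ez) _; rewrite -addrA lerD2l -mulrDr ler_wpM2l ?(ltW n0) //.
  by have := ler_normD (s x - s y) (s y - s z); rewrite addrA subrK => h1; lra.
exists g; split.
- apply: (@scale_lipschitz_form_dom _ n (ltW n0)) => [|x y Ex Ey].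
    have [a [b [Ea Eb ab hz]]] := sh; exists a, b; split=> // x Ex nx.
    by apply/eqP; rewrite eq_le g0 andbT -(hz x Ex nx) gle.
  by rewrite ler_norml; have := gL x y; have := gL y x; rewrite (distrC (s y)) => ? ?; apply/andP; split; lra.
- move=> x Ex; rewrite g0 gle //; split=> //.
  suff : h x - e / 2 <= g x by lra.
  apply: lb_le_inf => // _ [y Ey <-].
  have [sxy|sxy] := ltP `|s x - s y| k.+1%:R^-1.
    have := hk x y Ex Ey sxy; rewrite ltr_norml => /andP[_ h1].
    have : 0 <= n * `|s x - s y| by rewrite mulr_ge0 // ltW.
    lra.
  have : M <= n * `|s x - s y|.
    rewrite /n -mulrA ler_peMr ?(ltW M0) //.
    by rewrite mulrC -ler_pdivrMr ?div1r.
  by have := hM x Ex; have := h0 y Ey; have := ler_norm (h x); lra.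
Qed.

End uniform_density.

Lemma eq_indic {T : Type} {R : pzRingType} (A B : set T) x : (A x <-> B x) -> \1_A x = \1_B x :> R.
Proof. by move=> AB; rewrite !indicE; congr (_%:R); rewrite (_ : (x \in A) = (x \in B)) //; apply/idP/idP; rewrite !inE => /AB. Qed.

(** * Density of the form domain among square-integrable functions *)

Section L2_density.
Context {R : realType} {mu : {measure set (measurableTypeR R) -> \bar R}} {E : set R}.
Context (gE : gapped E) (Hmu : radon_full_support E mu) {s : R -> R} (sE : slow E s).
Implicit Types (f g h k : R -> R).
Let mE : measurable (E : set (measurableTypeR R)) := gapped_measurable gE.

Definition L2_approx h := L2 mu E h /\ forall e : R, 0 < e ->
  exists2 f, form_dom mu s E f & nrm2 mu E (fun x => h x - f x) < e.

Let form_L2 f : form_dom mu s E f -> L2 mu E f. Proof. by case. Qed.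

Lemma L2_approx_lim h (u_ : nat -> R -> R) : L2 mu E h -> (forall n, L2_approx (u_ n)) ->
  nrm2 mu E (fun x => h x - u_ n x) @[n --> \oo] --> 0 -> L2_approx h.
Proof.
move=> Lh Du cu; split=> // e e0; have e4 : 0 < e / 4 by rewrite divr_gt0.
move/cvgrPdist_lt/(_ _ e4) : cu => [n _ /(_ n (leqnn n))] /=.
rewrite sub0r normrN ger0_norm ?nrm2_ge0 // => hn.
have [Lu /(_ _ e4)[f df fn]] := Du n; exists f => //.
have := nrm2D_le mE (L2B mE Lh Lu) (L2B mE Lu (form_L2 df)).
rewrite (_ : (fun x => h x - u_ n x + (u_ n x - f x)) = (fun x => h x - f x)); first by lra.
by apply/funext => x; ring.
Qed.

Lemma L2_approx_lin (a : R) h k : L2_approx h -> L2_approx k -> L2_approx (fun x => a * h x + k x).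
Proof.
move=> [Lh Dh] [Lk Dk]; split; first exact: (L2D mE (L2Z mE a Lh).1 Lk).
move=> e e0; have a1 : 0 < 4 * (a ^+ 2 + 1) by rewrite mulr_gt0 // ltr_wpDl // sqr_ge0.
have [f df hf] := Dh _ (divr_gt0 e0 a1); have [g dg kg] := Dk _ (divr_gt0 e0 (ltr0n _ 4)).
exists (fun x => a * f x + g x); first exact: (form_domD gE sE (form_domZ gE sE a df) dg).
have Lhf := L2B mE Lh (form_L2 df); have Lkg := L2B mE Lk (form_L2 dg).
have := nrm2D_le mE (L2Z mE a Lhf).1 Lkg; have := (L2Z mE a Lhf).2.
rewrite (_ : (fun x => a * (h x - f x) + (k x - g x)) = (fun x => a * h x + k x - (a * f x + g x))); last first.
  by apply/funext => x; ring.
have := nrm2_ge0 mu (D := E) (fun x => h x - f x).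
move: hf; rewrite ltr_pdivlMr //; have := sqr_ge0 a; nra.
Qed.

Lemma L2_approx_dominated h k (u_ : nat -> R -> R) : L2 mu E k -> (forall n, L2_approx (u_ n)) ->
  (forall n x, E x -> `|h x - u_ n x| <= `|k x|) ->
  (forall x, E x -> u_ n x @[n --> \oo] --> h x) -> L2_approx h.
Proof.
move=> Lk Du hu uh; have mu_ n : measurable_fun (E : set (measurableTypeR R)) (u_ n) by have [[]] := Du n.
have mh : measurable_fun (E : set (measurableTypeR R)) h by exact: measurable_fun_cvg uh.
have Lh : L2 mu E h.
  have [L0 _] := Du 0%N; have Lhu : L2 mu E (fun x => h x - u_ 0%N x).
    by apply: (L2_le mE _ Lk (hu 0%N)).1; exact: (measurable_funB mh (mu_ 0%N)).
  by apply: eq_L2 (L2D mE Lhu L0) => x _; rewrite subrK.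
by apply: (L2_approx_lim Lh Du); exact: (nrm2_dominated mE mu_ Lk hu uh).
Qed.

Lemma eq_L2_approx h k : (forall x, E x -> h x = k x) -> L2_approx h -> L2_approx k.
Proof.
move=> hk [Lh Dh]; split=> [|e /Dh[f df hf]]; first by apply: eq_L2 Lh => x; rewrite inE => /hk.
by exists f => //; rewrite (@eq_nrm2 _ _ _ _ (fun x => h x - f x)) // => x /[!inE] /hk ->.
Qed.

Lemma L2_approx_continuous h : {within E, continuous h} -> csupp E h ->
  (forall x, E x -> 0 <= h x) -> L2_approx h.
Proof.
move=> ch sh h0; have Lh := csupp_L2 gE Hmu ch sh.
have inv0 n : 0 < (n.+1%:R : R)^-1 by rewrite invr_gt0.
have /choice[u_ uP] : forall n, exists g, form_dom mu s E g /\
    forall x, E x -> 0 <= g x <= h x /\ h x - g x < n.+1%:R^-1.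
  by move=> n; exact: (scale_lipschitz_approx gE Hmu sE ch sh h0 (inv0 n)).
apply: (L2_approx_dominated (u_ := u_) Lh).
- move=> n; have [du _] := uP n; split; first exact: form_L2.
  move=> e e0; exists (u_ n) => //; rewrite (@eq_nrm2 _ _ _ _ (fun=> 0)) ?nrm2_0 //.
  by move=> x _; rewrite subrr.
- move=> n x Ex; have [_ /(_ x Ex)[/andP[u0 uh] _]] := uP n.
  by have := h0 x Ex; rewrite !ger0_norm ?subr_ge0 //; lra.
- move=> x Ex; apply/cvgrPdist_lt => e e0.
  have [N _ HN] := (cvgrPdist_lt _ _).1 (@cvg_harmonic R) _ e0.
  exists N => // n /= Nn; have [_ /(_ x Ex)[/andP[u0 uh] hu]] := uP n.
  rewrite ger0_norm ?subr_ge0 //; apply: lt_trans hu _.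
  by have := HN n Nn; rewrite sub0r normrN ger0_norm ?invr_ge0.
Qed.

Lemma cvg_clamp01_pos (t : R) : 0 < t -> \forall n \near \oo, clamp01 (n%:R * t) = 1.
Proof.
move=> t0; near=> n; rewrite clamp01_1 // -ler_pdivrMr // div1r.
by near: n; exact: nbhs_infty_ger.
Unshelve. all: by end_near. Qed.

Lemma cvg_clamp01_neg (t : R) : t < 0 -> \forall n \near \oo, clamp01 (1 + n%:R * t) = 0.
Proof.
move=> t0; near=> n; rewrite clamp01_0 //.
have : (- t)^-1 <= n%:R by near: n; exact: nbhs_infty_ger.
by rewrite -[_^-1]mul1r ler_pdivrMr ?oppr_gt0 // mulrN; lra.
Unshelve. all: by end_near. Qed.

Section segment.
Variables (a b : R).
Hypotheses (Ea : E a) (Eb : E b) (ab : a <= b).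
Let C := cut E a b.

Let ind (B : set R) (x : R) : R := \1_(B `&` C) x.

Let tent_L2 : exists k L, [/\ [/\ 0 <= L, lip L k & csupp E k], L2 mu E k,
  forall x, 0 <= k x <= 1 & forall x, a <= x <= b -> k x = 1].
Proof.
have [k [L [L0 kL ks k01 k1]]] := tent_ex Ea Eb ab; exists k, L; split=> //.
exact: (csupp_L2 gE Hmu (lip_continuous kL) ks).
Qed.

Let ind_le k B x : (forall x, 0 <= k x <= 1) -> (forall x, a <= x <= b -> k x = 1) ->
  0 <= ind B x <= k x.
Proof.
move=> k01 k1; rewrite /ind indicE; case: (boolP (x \in B `&` C)) => [|_] /=.
  by rewrite inE => -[_ [_ abx]]; rewrite k1 // ler01 lexx.
by rewrite lexx /=; have /andP[] := k01 x.
Qed.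

(** The indicator is a dominated pointwise limit of Lipschitz functions with steep ramps at [a], [b]
    and [c], kept below a fixed bump [k] that serves as the dominating function. *)
Let ind_ray c : L2_approx (ind `]-oo, c[).
Proof.
have [k [L [[L0 kL ks] Lk k01 k1]]] := tent_L2.
pose u n x := Num.min (Num.min (k x) (clamp01 ((- n%:R) * x + n%:R * c)))
  (Num.min (clamp01 (n%:R * x + (1 - n%:R * a))) (clamp01 ((- n%:R) * x + (1 + n%:R * b)))).
have E1 n x : - n%:R * x + n%:R * c = n%:R * (c - x) :> R by ring.
have E2 n x : n%:R * x + (1 - n%:R * a) = 1 + n%:R * (x - a) :> R by ring.
have E3 n x : - n%:R * x + (1 + n%:R * b) = 1 + n%:R * (b - x) :> R by ring.
have u0 n x : 0 <= u n x <= k x.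
  have /andP[k0 k1'] := k01 x; rewrite /u !le_min !clamp01_ge0 k0 /=.
  by rewrite !ge_min lexx.
apply: (L2_approx_dominated (u_ := u) Lk).
- move=> n; apply: L2_approx_continuous.
  + apply: (@lip_continuous _ _ (L + n%:R)).
    have nn : `|- n%:R| = n%:R :> R by rewrite normrN normr_nat.
    have nn' : `|n%:R| = n%:R :> R by rewrite normr_nat.
    apply: lip_min; apply: lip_min.
    * by apply: lip_le kL; rewrite lerDl.
    * by apply: lip_le (lip_clamp01 _ _); rewrite nn lerDr.
    * by apply: lip_le (lip_clamp01 _ _); rewrite nn' lerDr.
    * by apply: lip_le (lip_clamp01 _ _); rewrite nn lerDr.
  + have [p [q [Ep Eq pq k0]]] := ks; exists p, q; split=> // x Ex nx.
    by have := u0 n x; rewrite k0 // => /andP[? ?]; apply/eqP; rewrite eq_le; apply/andP.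
  + by move=> x _; have /andP[] := u0 n x.
- move=> n x Ex; have /andP[i0 ik] := ind_le `]-oo, c[ x k01 k1; have /andP[v0 vk] := u0 n x.
  by have /andP[k0 _] := k01 x; rewrite (ger0_norm k0) ler_norml; apply/andP; split; lra.
- move=> x Ex; apply: cvg_near_cst; rewrite /ind indicE.
  have k0 : 0 <= k x by have /andP[] := k01 x.
  have z (t1 t2 t3 : R) : 0 <= t1 -> 0 <= t2 -> 0 <= t3 ->
    [/\ Num.min (Num.min t1 0) (Num.min t2 t3) = 0, Num.min (Num.min t1 t2) (Num.min 0 t3) = 0 &
        Num.min (Num.min t1 t2) (Num.min t3 0) = 0].
    by move=> h1 h2 h3; split; apply/eqP; rewrite eq_le !le_min !ge_min !h1 ?h2 ?h3 !lexx ?orbT.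
  have [xa|ax] := ltP x a.
    rewrite memNset; last by move=> [_ [_ /= /andP[]]]; rewrite leNgt xa.
    have xa' : x - a < 0 by lra.
    apply: filterS (cvg_clamp01_neg xa') => n; rewrite /u E2 => ->.
    by have [_ -> _] := z (k x) (clamp01 (- n%:R * x + n%:R * c)) (clamp01 (- n%:R * x + (1 + n%:R * b))) k0 (clamp01_ge0 _) (clamp01_ge0 _).
  have [bx|xb] := ltP b x.
    rewrite memNset; last by move=> [_ [_ /= /andP[_]]]; rewrite leNgt bx.
    have xa' : b - x < 0 by lra.
    apply: filterS (cvg_clamp01_neg xa') => n; rewrite /u E3 => ->.
    by have [_ _ ->] := z (k x) (clamp01 (- n%:R * x + n%:R * c)) (clamp01 (n%:R * x + (1 - n%:R * a))) k0 (clamp01_ge0 _) (clamp01_ge0 _).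
  have c1 n : clamp01 (1 + n%:R * (x - a)) = 1 by rewrite clamp01_1 // lerDl mulr_ge0 // subr_ge0.
  have c2 n : clamp01 (1 + n%:R * (b - x)) = 1 by rewrite clamp01_1 // lerDl mulr_ge0 // subr_ge0.
  have kx : k x = 1 by apply: k1; rewrite ax.
  have [xc|cx] := ltP x c.
    rewrite mem_set; last by split; [rewrite /= in_itv|split=> //=; rewrite ax].
    have xc' : 0 < c - x by lra.
    apply: filterS (cvg_clamp01_pos xc') => n; rewrite /u E1 E2 E3 => ->.
    by rewrite c1 c2 kx !minxx.
  rewrite memNset; last by move=> [+ _]; rewrite /= in_itv /= ltNge cx.
  apply: nearW => n; rewrite /u E1 E2 E3 c1 c2 kx clamp01_0; last first.
    by rewrite mulr_ge0_le0 // subr_le0.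
  by rewrite minxx (min_r (x := 1) (y := 0)) // min_l.
Qed.

Let ind_ex B : exists2 k, L2 mu E k & forall x, 0 <= ind B x <= k x.
Proof.
have [k [L [_ Lk k01 k1]]] := tent_L2; exists k => // x; exact: ind_le.
Qed.

Let ind_setT : L2_approx (ind setT).
Proof.
apply: eq_L2_approx (ind_ray (b + 1)) => x Ex; apply: eq_indic; split=> [[_ Cx]|[_ Cx]]; split=> //.
by rewrite /= in_itv /=; case: Cx => _ /= /andP[_ xb]; lra.
Qed.

(** Dynkin's argument: open rays are stable under intersection and generate the Borel sets;
    complements are taken within [C] by subtracting from [ind setT]. *)
Let ind_measurable B : measurable (B : set (measurableTypeR R)) -> L2_approx (ind B).
Proof.
move=> mB.
pose P (B : set R) := L2_approx (ind B).
apply: (@dynkin_induction _ (measurableTypeR R) (RGenInftyO.G (R := R)) P) => //.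
- exact: RGenInftyO.measurableE.
- move=> _ _ [x ->] [y ->]; exists (Num.min x y); apply/seteqP; split=> z /=; rewrite !in_itv /=.
  + by rewrite lt_min => -[-> ->].
  + by rewrite lt_min => /andP[].
- by move=> _ [x ->]; exact: ind_ray.
- move=> S _ PS; apply: eq_L2_approx (L2_approx_lin (-1) PS ind_setT) => x Ex.
  rewrite /ind !indicE setTI; have [Cx|nC] := pselect (C x); last first.
    by rewrite !memNset ?mulr0 ?addr0 //; case.
  rewrite (mem_set Cx); have [Sx|nS] := pselect (S x).
    by rewrite mem_set // memNset ?mulr1 ?addNr //; case.
  by rewrite memNset ?(mem_set (A := ~` S `&` C)) ?mulr0 ?add0r //; case.
- move=> F mF tF PF; have [k Lk kF] := ind_ex (\bigcup_k F k).
  pose U n := [set x | exists2 j, (j < n)%N & F j x].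
  have PU n : P (U n).
    elim: n => [|n IH].
      apply: eq_L2_approx (L2_approx_lin (-1) ind_setT ind_setT) => x Ex.
      by rewrite mulN1r addNr /ind indicE memNset // => -[[]].
    apply: eq_L2_approx (L2_approx_lin 1 IH (PF n)) => x Ex; rewrite mul1r /ind !indicE.
    have [Cx|nC] := pselect (C x); last by rewrite !memNset ?addr0 //; case.
    have [Fx|nF] := pselect (F n x).
      rewrite [in X in _ + X]mem_set // [in RHS]mem_set; last by split=> //; exists n.
      rewrite memNset ?add0r // => -[[j jn Fj] _].
      by move: jn; rewrite (tF j n I I (ex_intro _ x (conj Fj Fx))) ltnn.
    rewrite [in X in _ + X]memNset ?addr0; last by case.
    rewrite -!indicE; apply: eq_indic; split=> -[[j jn Fj] _]; split=> //; exists j => //.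
    + exact: ltnW.
    + by move: jn; rewrite ltnS leq_eqVlt => /predU1P[jE|//]; rewrite jE in Fj.
  apply: (L2_approx_dominated (u_ := fun n => ind (U n)) Lk PU).
  + move=> n x Ex; have /andP[h1 h2] := kF x; rewrite (ger0_norm (le_trans h1 h2)).
    have : 0 <= ind (U n) x <= ind (\bigcup_k F k) x.
      rewrite /ind !indicE ler0n /= ler_nat; case: (boolP (x \in U n `&` C)) => // /set_mem [[j jn Fj] Cx].
      by rewrite mem_set //; split=> //; exists j.
    by move=> /andP[h3 h4]; rewrite ger0_norm; lra.
  + move=> x Ex; apply: cvg_near_cst; have [[[m _ Fm] Cx]|nx] := pselect ((\bigcup_k F k `&` C) x).
      exists m.+1 => // n /= mn; rewrite /ind !indicE !mem_set //; split=> //; last by exists m.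
      by exists m.
    apply: nearW => n; rewrite /ind !indicE !memNset // => -[[j jn Fj] Cx].
    by apply: nx; split=> //; exists j.
- by have := mB; rewrite RGenInftyO.measurableE.
Qed.

(** For [0 < i] and [0 <= t], the greatest multiple of [i] not above [t], capped at [m * i], written
    as a sum of indicators of superlevel sets so that linearity applies. *)
Definition staircase (i : R) (m : nat) (t : R) : R :=
  \sum_(j < m) i * (j.+1%:R * i <= t)%R%:R.

Lemma staircaseP i m t : 0 < i -> 0 <= t ->
  (m%:R * i <= t -> staircase i m t = m%:R * i) /\
  (t <= m%:R * i -> t - i <= staircase i m t <= t).
Proof.
move=> i0 t0; elim: m => [|m [IH1 IH2]].
  rewrite /staircase big_ord0 mul0r; split=> // h; apply/andP; split; lra.
have E1 : staircase i m.+1 t = staircase i m t + i * (m.+1%:R * i <= t)%R%:R.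
  by rewrite /staircase big_ord_recr.
have E2 : m.+1%:R * i = m%:R * i + i by rewrite -natr1 mulrDl mul1r.
rewrite E1; split=> [h|h].
- by rewrite h mulr1 IH1 ?E2 //; move: h; rewrite E2; lra.
- have [h'|h'] := leP (m.+1%:R * i) t.
    have tE : t = m.+1%:R * i by apply/eqP; rewrite eq_le h h'.
    rewrite mulr1 IH1; last by move: h'; rewrite E2; lra.
    by rewrite tE E2; apply/andP; split; lra.
  rewrite mulr0 addr0; have [h2|h2] := leP (m%:R * i) t; last exact/IH2/ltW.
  by rewrite IH1 //; move: h'; rewrite E2 => h'; apply/andP; split; lra.
Qed.

Lemma staircase_approx h i m : measurable_fun (E : set (measurableTypeR R)) h ->
  L2_approx (fun x => staircase i m (h x) * \1_C x).
Proof.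
move=> mh; elim: m => [|m IH].
  apply: eq_L2_approx (L2_approx_lin (-1) ind_setT ind_setT) => x Ex.
  by rewrite mulN1r addNr /staircase big_ord0 mul0r.
have mB : measurable (E `&` h @^-1` `[m.+1%:R * i, +oo[ : set (measurableTypeR R)).
  exact: mh.
apply: eq_L2_approx (L2_approx_lin i (ind_measurable mB) IH) => x Ex.
rewrite /staircase big_ord_recr /= mulrDl addrC; congr (_ + _); rewrite -mulrA; congr (_ * _).
rewrite /ind !indicE; have [Cx|nC] := pselect (C x); last by rewrite !memNset ?mulr0 //; case.
rewrite (mem_set Cx) mulr1; case: (boolP (m.+1%:R * i <= h x)) => hx.
- by rewrite mem_set //; split=> //; split=> //=; rewrite in_itv /= andbT.
- by rewrite memNset // => -[[_ /=]]; rewrite in_itv /= andbT (negbTE hx).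
Qed.

End segment.

Let L2_approx_nonneg h : L2 mu E h -> (forall x, E x -> 0 <= h x) -> L2_approx h.
Proof.
move=> Lh h0; have [a [b [Eab ab _ _ exh]]] := exhaust_seq (gapped_ex gE).
have inv0 n : 0 < (n.+1%:R : R)^-1 by rewrite invr_gt0.
(* With steps of height [1 / n.+1] and [n.+1 * n.+1] of them, the mesh tends to 0 while the cap
   [n.+1] tends to infinity. *)
pose u n x := staircase n.+1%:R^-1 (n.+1 * n.+1)%N (h x) * \1_(cut E (a n) (b n)) x.
have mE' n : (n.+1 * n.+1)%:R * n.+1%:R^-1 = n.+1%:R :> R by rewrite natrM mulfK.
have st n x : E x -> 0 <= staircase n.+1%:R^-1 (n.+1 * n.+1)%N (h x) <= h x.
  move=> Ex; have [H1 H2] := staircaseP (n.+1 * n.+1) (inv0 n) (h0 x Ex).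
  have s0 : 0 <= staircase n.+1%:R^-1 (n.+1 * n.+1) (h x).
    by apply: sumr_ge0 => j _; rewrite mulr_ge0 // ltW.
  rewrite s0 /=; have [h1|h1] := leP ((n.+1 * n.+1)%:R * n.+1%:R^-1) (h x).
    by rewrite H1.
  by have /andP[] := H2 (ltW h1).
apply: (L2_approx_dominated (u_ := u) Lh).
- by move=> n; apply: staircase_approx; [exact: (Eab n).1|exact: (Eab n).2|exact: ab|exact: Lh.1].
- move=> n x Ex; have /andP[s0 sh] := st n x Ex; rewrite /u indicE.
  by case: (_ \in _); rewrite ?mulr1 ?mulr0 ?subr0 // !ger0_norm ?h0 //; lra.
- move=> x Ex; apply/cvgrPdist_lt => e e0.
  have [N _ HN] := (cvgrPdist_lt _ _).1 (@cvg_harmonic R) _ e0.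
  near=> n.
  have abx : a n <= x <= b n by near: n; exact: exh.
  have Nn : (N <= n)%N by near: n; exists N.
  have hn : h x <= n.+1%:R.
    by apply: (@le_trans _ _ n%:R); [near: n; exact: nbhs_infty_ger|rewrite ler_nat].
  have [_ H2] := staircaseP (n.+1 * n.+1) (inv0 n) (h0 x Ex).
  rewrite mE' in H2; have /andP[h1 h2] := H2 hn.
  rewrite /u indicE mem_set ?mulr1; last by split.
  have := HN n Nn; rewrite /= sub0r normrN ger0_norm ?invr_ge0 // => ne.
  rewrite ger0_norm ?subr_ge0 //; apply: le_lt_trans ne; rewrite lerBlDr addrC -lerBlDr.
Unshelve. all: by end_near. Qed.

Lemma form_dom_L2_dense h (e : R) : L2 mu E h -> 0 < e ->
  exists2 f, form_dom mu s E f & nrm2 mu E (fun x => h x - f x) < e.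
Proof.
move=> Lh e0; suff [_ H] : L2_approx h by exact: H.
have mm g : measurable_fun (E : set (measurableTypeR R)) g ->
    measurable_fun (E : set (measurableTypeR R)) (fun x => Num.max (g x) 0).
  by move=> mg; apply: measurable_maxr => //; exact: measurable_cst.
have part g : L2 mu E g -> L2_approx (fun x => Num.max (g x) 0).
  move=> Lg; apply: L2_approx_nonneg => [|x _]; last by rewrite le_max lexx orbT.
  apply: (L2_le mE (mm _ Lg.1) Lg _).1 => x _.
  by case: (leP (g x) 0) => //; rewrite normr0.
apply: eq_L2_approx (L2_approx_lin (-1) (part _ (L2N mE Lh).1) (part _ Lh)) => x _.
by case: (leP (- h x) 0); case: (leP (h x) 0); lra.
Qed.

End L2_density.

(** * Fukushima subspaces correspond to isometric scales *)

Section abstract_theorem.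
Context {R : realType} {mu : {measure set (measurableTypeR R) -> \bar R}} {E : set R}.
Context (gE : gapped E) (Hmu : radon_full_support E mu).
Context {F0 : set (R -> R)} {Ef0 : (R -> R) -> (R -> R) -> R}.
Context (rep0 : represents (mu := mu) (E := E) id F0 Ef0).
Implicit Types (s f g h : R -> R).
Let mE : measurable (E : set (measurableTypeR R)) := gapped_measurable gE.

Lemma fukushima_scale F' Ef' : fukushima_subspace E mu F0 Ef0 F' Ef' ->
  exists s, isometric_scale (E := E) s /\ represents (mu := mu) (E := E) s F' Ef'.
Proof.
move=> fuk; have rA := sub_dom_rich gE Hmu rep0 fuk.
have [s [sE s_dual]] := scale_exists gE Hmu rA.
have iso := dual_isometric rA sE s_dual.
have dom_sub f : form_dom mu s E f -> sub_dom (mu := mu) (E := E) (F' := F') f.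
  exact: (form_dom_rich gE Hmu rA sE s_dual).
exists s; split=> //; split.
- apply/seteqP; split=> h.
  + move=> F'h; split; first exact: (sub_class fuk F'h).
    have [f [Af hf]] := sub_dom_ex gE Hmu rep0 fuk F'h.
    by exists f; split=> //; exact: (rich_form_dom gE Hmu rA sE s_dual Af).
  + move=> [Lh [f [df hf]]]; have [_ F'f] := dom_sub _ df.
    apply: (sub_class_ae fuk F'f Lh); apply: aeq_trans (aeq_on_E gE Hmu f) _.
    exact: aeq_sym.
- move=> h k f g F'h F'k df dg hf kg.
  have [df0 _] := dom_sub _ df; have [dg0 _] := dom_sub _ dg.
  rewrite (sub_form rep0 fuk F'h F'k df0 dg0 hf kg).
  by have [ff _ _] := df; have [fg _ _] := dg; rewrite (isometric_energy iso).
Qed.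

Section backward.
Context {s} (iso : isometric_scale (E := E) s) {F : set (R -> R)} {Ef : (R -> R) -> (R -> R) -> R}.
Context (rep : represents (mu := mu) (E := E) s F Ef).
Let sE := iso.1.
Let iE := slow_increasing sE.

Let aeE f := aeq_on_E gE Hmu f.

Let FP h : F h <-> L2 mu setT h /\ exists f, form_dom mu s E f /\ Defs.ae_eq mu h f.
Proof. by rewrite rep.1. Qed.

Let F_L2 h : F h -> L2 mu setT h. Proof. by move=> /FP[]. Qed.

Let F_ex h : F h -> exists f, form_dom mu s E f /\ Defs.ae_eq mu h f.
Proof. by move=> /FP[]. Qed.

Let F_on_E f : form_dom mu s E f -> F (on_E (E := E) f).
Proof. by move=> df; rewrite rep.1; exact: form_class_on_E. Qed.

Let rep_E1 h f : F h -> form_dom mu s E f -> Defs.ae_eq mu h f ->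
  E1 mu Ef h = 2^-1 * energy s E f f + nrm2 mu E f.
Proof.
move=> Fh df hf; rewrite /E1 (rep.2 _ _ _ _ Fh Fh df df hf hf); congr (_ + _).
by apply: (nrm2_setT gE Hmu) hf; [exact: F_L2|have [] := df].
Qed.

Let F_lin (a : R) h k : F h -> F k -> F (fun x => a * h x + k x).
Proof.
move=> /FP[Lh [f [df hf]]] /FP[Lk [g [dg kg]]]; apply/FP; split.
  exact: (L2D measurableT (L2Z measurableT a Lh).1 Lk).
exists (fun x => a * f x + g x); split; first exact: (form_domD gE sE (form_domZ gE sE a df) dg).
exact: (aeq_op (fun p q => a * p + q) hf kg).
Qed.

Let F_ae h k : F h -> L2 mu setT k -> Defs.ae_eq mu h k -> F k.
Proof.
move=> /FP[_ [f [df hf]]] Lk hk; apply/FP; split=> //; exists f; split=> //.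
exact: aeq_trans (aeq_sym hk) hf.
Qed.

Let F_sub h k : F h -> F k -> F (h \- k).
Proof.
move=> Fh Fk; rewrite (_ : h \- k = (fun x => (-1) * k x + h x)); first exact: F_lin.
by apply/funext => x /=; rewrite mulN1r addrC.
Qed.

Let nrm1_half f : form_dom mu s E f ->
  2^-1 * energy s E f f + nrm2 mu E f <= nrm1 mu s E f /\
  nrm1 mu s E f <= 2 * (2^-1 * energy s E f f + nrm2 mu E f).
Proof.
move=> [fg _ _]; have := energy_ge0 iE fg; have := @nrm2_ge0 _ mu E f.
by rewrite /nrm1 => ? ?; split; lra.
Qed.

Let continuous_on_E f : form_dom mu s E f -> {within E, continuous (on_E (E := E) f)}.
Proof.
move=> [ff _ _]; have /continuous_onP cf := fin_energy_continuous sE ff.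
apply/continuous_onP => x Ex e e0; have [d d0 H] := cf x Ex e e0.
by exists d => // y Ey xy; rewrite !on_E_in //; exact: H.
Qed.

Let csupp_on_E f : csupp E f -> csupp E (on_E (E := E) f).
Proof.
by move=> [a [b [Ea Eb ab f0]]]; exists a, b; split=> // x Ex nx; rewrite on_E_in // f0.
Qed.

(** The axioms are carried from the form domain to classes by [on_E]. The Markov property is
    contraction of increments, closedness is [form_dom_complete], and the density axioms come from
    [form_dom_L2_dense], [csupp_dense] and [scale_lipschitz_approx]. *)
Lemma represents_regular : regular_dirichlet_form E mu F Ef.
Proof.
split; first exact: F_L2.
split; first by move=> f g; exact: F_ae.
split.
  move=> h h' k k' Fh Fh' Fk Fk' hh kk; have [f [df hf]] := F_ex Fh; have [g [dg kg]] := F_ex Fk.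
  rewrite (rep.2 _ _ _ _ Fh Fk df dg hf kg) (rep.2 _ _ _ _ Fh' Fk' df dg) //.
  - exact: aeq_trans (aeq_sym hh) hf.
  - exact: aeq_trans (aeq_sym kk) kg.
split.
  apply/FP; split; first exact: L2_0.
  by exists (fun=> 0); split; [exact: form_dom0|exact: (aeq_E gE Hmu)].
split.
  move=> f g Ff Fg; rewrite (_ : f \+ g = (fun x => 1 * f x + g x)); first exact: F_lin.
  by apply/funext => x /=; rewrite mul1r.
split.
  move=> c f Ff; have F0' : F (fun=> 0).
    rewrite (_ : (fun=> 0) = f \- f); first exact: F_sub.
    by apply/funext => x /=; rewrite subrr.
  rewrite (_ : (fun x => c * f x) = (fun x => c * f x + 0)); first exact: F_lin.
  by apply/funext => x; rewrite addr0.
split.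
  move=> h Lh e e0; have LhE := L2_setT_E gE Lh.
  have [f df hf] := form_dom_L2_dense gE Hmu sE LhE e0.
  exists (on_E (E := E) f); first exact: F_on_E.
  have [_ Lf _] := df; apply: le_lt_trans hf; rewrite /L2dist2.
  rewrite -(nrm2_setT gE Hmu (f := fun x => h x - on_E (E := E) f x)) //.
  - exact: (L2B measurableT Lh (L2_on_E gE Lf)).
  - exact: (L2B mE LhE Lf).
  - apply: (aeq_op (fun p q => p - q)); [exact: (aeq_E gE Hmu)|exact: aeE].
split.
  move=> h k Fh Fk; have [f [df hf]] := F_ex Fh; have [g [dg kg]] := F_ex Fk.
  by rewrite (rep.2 _ _ _ _ Fh Fk df dg hf kg) (rep.2 _ _ _ _ Fk Fh dg df kg hf) energyC.
split.
  move=> c f g h Ff Fg Fh; have [f1 [df ff1]] := F_ex Ff; have [g1 [dg gg1]] := F_ex Fg.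
  have [h1 [dh hh1]] := F_ex Fh; have Flin := F_lin c Ff Fg.
  have dl := form_domD gE sE (form_domZ gE sE c df) dg.
  have al := aeq_op (fun p q => c * p + q) ff1 gg1.
  rewrite (rep.2 _ _ _ _ Flin Fh dl dh al hh1).
  rewrite (rep.2 _ _ _ _ Ff Fh df dh ff1 hh1) (rep.2 _ _ _ _ Fg Fh dg dh gg1 hh1).
  have [f2 _ _] := df; have [g2 _ _] := dg; have [h2 _ _] := dh.
  by rewrite energyDl //; ring.
split.
  move=> f Ff; have [f1 [df ff1]] := F_ex Ff; rewrite (rep.2 _ _ _ _ Ff Ff df df ff1 ff1).
  by have [f2 _ _] := df; rewrite mulr_ge0 // energy_ge0.
split.
  move=> u Fu cauchy.
  have /choice[f_ fP] : forall n, exists f, form_dom mu s E f /\ Defs.ae_eq mu (u n) f.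
    by move=> n; exact: F_ex.
  have dfB n m := form_domB gE sE (fP n).1 (fP m).1.
  have aeB n m := aeq_op (fun p q => p - q) (fP n).2 (fP m).2.
  have [|e e0|f df cf] := form_dom_complete gE Hmu sE (u_ := f_); first by move=> n; exact: (fP n).1.
    have e2 : 0 < e / 2 by rewrite divr_gt0.
    have [N HN] := cauchy _ e2; exists N => m n Nm Nn.
    have := HN m n Nm Nn; rewrite (rep_E1 (F_sub (Fu n) (Fu m)) (dfB n m) (aeB n m)).
    have := (nrm1_half (dfB n m)).2; lra.
  exists (on_E (E := E) f); first exact: F_on_E.
  apply: (squeeze_cvgr _ (cvg_cst 0) cf); apply: nearW => n.
  have dfn := form_domB gE sE (fP n).1 df.
  rewrite (rep_E1 (F_sub (Fu n) (F_on_E df)) dfn); last first.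
    exact: (aeq_op (fun p q => p - q) (fP n).2 (aeE f)).
  rewrite (nrm1_distC sE df (fP n).1) (nrm1_half dfn).1 andbT.
  by have [ff _ _] := dfn; rewrite addr_ge0 ?nrm2_ge0 // mulr_ge0 // energy_ge0.
split.
  move=> h Fh; have [f [df hf]] := F_ex Fh; have [ff Lf _] := df.
  have lip01 x y : `|clamp01 (f y) - clamp01 (f x)| <= `|f y - f x|.
    by have := @lip_clamp01 R 1 0 (f y) (f x); rewrite !mul1r !addr0 normr1 mul1r.
  have dc : form_dom mu s E (fun x => clamp01 (f x)).
    apply: (form_dom_contract gE sE df) => [x _|x y _ _ _]; last exact: lip01.
    rewrite (ger0_norm (clamp01_ge0 _)); have [f0|f0] := leP (f x) 0; first by rewrite clamp01_0.
    by rewrite /clamp01 ge_max normr_ge0 /= ge_min ler_norm.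
  have hv : Defs.ae_eq mu (fun x => Num.min (Num.max (h x) 0) 1) (fun x => clamp01 (f x)).
    apply: aeS hf => x ->; rewrite /clamp01 (maxC (f x)).
    by case: (leP 0 (f x)) => ?; case: (leP (f x) 1) => ?; rewrite /Num.max /Num.min; repeat case: ifP; lra.
  have Fv : F (fun x => Num.min (Num.max (h x) 0) 1).
    apply: (F_ae (F_on_E dc)) => [|]; last exact: aeq_trans (aeE _) (aeq_sym hv).
    have Lh := F_L2 Fh; apply: (L2_le measurableT _ Lh _).1.
      apply: measurable_minr; last exact: measurable_cst.
      by apply: measurable_maxr; [exact: Lh.1|exact: measurable_cst].
    move=> x _; rewrite ger0_norm; last by rewrite le_min le_max lexx orbT ler01.
    by rewrite ge_min ge_max ler_norm normr_ge0.
  split=> //; rewrite (rep.2 _ _ _ _ Fv Fv dc dc hv hv) (rep.2 _ _ _ _ Fh Fh df df hf hf).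
  by rewrite ler_pM2l ?invr_gt0 //; apply: energy_contract => // x y _ _ _; exact: lip01.
split.
  move=> h Fh e e0; have [f [df hf]] := F_ex Fh.
  have [g [dg sg fg]] := csupp_dense gE sE df e0.
  exists (on_E (E := E) g).
    by split; [exact: F_on_E|apply: (csupp_Cc gE); [exact: continuous_on_E|exact: csupp_on_E]].
  have dfg := form_domB gE sE df dg.
  rewrite (rep_E1 (F_sub Fh (F_on_E dg)) dfg); last exact: (aeq_op (fun p q => p - q) hf (aeE g)).
  exact: le_lt_trans (nrm1_half dfg).1 fg.
move=> h Ch e e0; have e2 : 0 < e / 2 by rewrite divr_gt0.
have sh : csupp E h by apply: (Cc_csupp gE Ch).
(* The inf-convolution takes a nonnegative function, hence positive and negative parts, each
   approximated within [e / 2]. *)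
have part (sg : bool) : exists g, [/\ form_dom mu s E g, csupp E g &
    forall x, E x -> `|Num.max ((-1) ^+ sg * h x) 0 - g x| < e / 2].
  have ch : {within E, continuous (fun x => Num.max ((-1) ^+ sg * h x) 0)}.
    have /continuous_onP cf := Ch.1; apply/continuous_onP => x Ex d d0.
    have [r r0 H] := cf x Ex d d0; exists r => // y Ey xy.
    by apply: le_lt_trans (pos_part_lip _ _) _; rewrite -mulrBr normrMsign; exact: H.
  have [a [b [Ea Eb ab h0]]] := sh.
  have sp : csupp E (fun x => Num.max ((-1) ^+ sg * h x) 0).
    by exists a, b; split=> // x Ex nx; rewrite h0 // mulr0 maxxx.
  have [|g [dg gP]] := scale_lipschitz_approx gE Hmu sE ch sp _ e2.
    by move=> x _; rewrite le_max lexx orbT.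
  exists g; split=> //.
  - exists a, b; split=> // x Ex nx; have [/andP[g0 gh] _] := gP x Ex.
    by move: gh; rewrite h0 // mulr0 maxxx => gh; apply/eqP; rewrite eq_le gh g0.
  - by move=> x Ex; have [/andP[g0 gh] hg] := gP x Ex; rewrite ger0_norm ?subr_ge0.
have [g1 [dg1 sg1 H1]] := part false; have [g2 [dg2 sg2 H2]] := part true.
have dg := form_domB gE sE dg1 dg2.
exists (on_E (E := E) (fun x => g1 x - g2 x)).
  split; [exact: F_on_E|apply: (csupp_Cc gE); first exact: continuous_on_E].
  exact/csupp_on_E/csuppB.
move=> x Ex; rewrite on_E_in //; have := H1 x Ex; have := H2 x Ex; rewrite mulN1r mul1r => h2 h1.
have hE : h x - (g1 x - g2 x) = (Num.max (h x) 0 - g1 x) - (Num.max (- h x) 0 - g2 x).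
  by case: (leP (h x) 0); case: (leP (- h x) 0); lra.
rewrite hE; apply: le_lt_trans (ler_normB _ _) _; lra.
Qed.

Lemma scale_fukushima : fukushima_subspace E mu F0 Ef0 F Ef.
Proof.
split; first exact: represents_regular.
have sub h : F h -> F0 h.
  move=> /FP[Lh [f [df hf]]]; rewrite rep0.1; split=> //; exists f; split=> //.
  by have [] := form_dom_id gE sE df.
split=> // h k Fh Fk; have [f [df hf]] := F_ex Fh; have [g [dg kg]] := F_ex Fk.
rewrite (rep.2 _ _ _ _ Fh Fk df dg hf kg).
have [df0 _] := form_dom_id gE sE df; have [dg0 _] := form_dom_id gE sE dg.
rewrite (rep0.2 _ _ _ _ (sub _ Fh) (sub _ Fk) df0 dg0 hf kg).
by have [ff _ _] := df; have [fg _ _] := dg; rewrite (isometric_energy iso).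
Qed.

End backward.
End abstract_theorem.

(** * Absolutely continuous functions *)

Section interval_families.
Context {R : realType}.
Implicit Types (f : R -> R) (l : seq (R * R)).

(** Consecutive intervals as a list, so that induction and concatenation are available; degenerate
    ones are allowed, as in [abs_cont_on]. *)
Fixpoint fam (x : R) l (b : R) : Prop :=
  if l is p :: l' then [/\ x <= p.1, p.1 <= p.2 & fam p.2 l' b] else x <= b.

Definition len l : R := \sum_(p <- l) (p.2 - p.1).
Definition var f l : R := \sum_(p <- l) `|f p.2 - f p.1|.

Lemma fam_le x l b : fam x l b -> x <= b.
Proof.
elim: l x => //= p l IH x [xp pp /IH pb]; exact: le_trans (le_trans xp pp) pb.
Qed.

Lemma fam_weaken x x' l b b' : fam x l b -> x' <= x -> b <= b' -> fam x' l b'.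
Proof.
elim: l x x' => /= [|p l IH] x x'; first by move=> xb x'x bb; lra.
by move=> [xp pp pl] x'x bb; split=> //; [exact: le_trans xp|exact: IH pl _ bb].
Qed.

Lemma fam_cat x l1 c l2 b : fam x l1 c -> fam c l2 b -> fam x (l1 ++ l2) b.
Proof.
elim: l1 x => /= [|p l IH] x; first by move=> xc cb; exact: fam_weaken cb xc (lexx _).
by move=> [xp pp pl] cb; split=> //; exact: IH.
Qed.

Lemma len_cat l1 l2 : len (l1 ++ l2) = len l1 + len l2. Proof. exact: big_cat. Qed.
Lemma var_cat f l1 l2 : var f (l1 ++ l2) = var f l1 + var f l2. Proof. exact: big_cat. Qed.

Lemma len_cons p l : len (p :: l) = (p.2 - p.1) + len l. Proof. exact: big_cons. Qed.
Lemma var_cons f p l : var f (p :: l) = `|f p.2 - f p.1| + var f l. Proof. exact: big_cons. Qed.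
Lemma len_nil : len [::] = 0. Proof. exact: big_nil. Qed.
Lemma var_nil f : var f [::] = 0. Proof. exact: big_nil. Qed.

Lemma fam_bound x l b : fam x l b -> forall p, p \in l -> [/\ x <= p.1, p.1 <= p.2 & p.2 <= b].
Proof.
elim: l x => //= q l IH x [xq qq ql] p; rewrite in_cons => /predU1P[->|pl].
  by split=> //; exact: fam_le ql.
by have [h1 h2 h3] := IH _ ql _ pl; split=> //; lra.
Qed.

Lemma fam_pairwise x l b : fam x l b -> pairwise (fun p q : R * R => p.2 <= q.1) l.
Proof.
elim: l x => //= q l IH x [xq qq ql]; rewrite (IH _ ql) andbT; apply/allP => p pl.
by have [] := fam_bound ql pl.
Qed.

Lemma fam_of_pairwise x l b : x <= b -> (forall p, p \in l -> [/\ x <= p.1, p.1 <= p.2 & p.2 <= b]) ->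
  pairwise (fun p q : R * R => p.2 <= q.1) l -> fam x l b.
Proof.
elim: l x => //= p l IH x xb H /andP[/allP pl pw].
have [h1 h2 h3] := H p (mem_head _ _); split=> //; apply: IH => // q ql.
by have [_ ? ?] := H q (@mem_behead _ (p :: l) q ql); split=> //; exact: pl.
Qed.

Lemma fam_split f x l b c : fam x l b -> x <= c -> c <= b ->
  exists l1 l2, [/\ fam x l1 c, fam c l2 b, len l1 + len l2 = len l & var f l <= var f l1 + var f l2].
Proof.
elim: l x => /= [|p l IH] x.
  by move=> xb xc cb; exists [::], [::]; split=> //; rewrite ?len_nil ?var_nil addr0.
move=> [xp pp pl] xc cb; have [cp|pc] := leP c p.1.
  by exists [::], (p :: l); split; rewrite ?len_nil ?var_nil ?add0r.
have [p2c|cp2] := leP p.2 c.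
  have [l1 [l2 [f1 f2 e1 v1]]] := IH _ pl p2c cb.
  exists (p :: l1), l2; split=> //; first by rewrite !len_cons -e1 addrA.
  by rewrite !var_cons -addrA lerD2l.
exists [:: (p.1, c)], ((c, p.2) :: l); split=> /=.
- by split=> //; exact: ltW.
- by split=> //; exact: ltW.
- by rewrite !len_cons len_nil /=; ring.
- rewrite !var_cons var_nil addr0 addrA lerD2r /=.
  by have := ler_normD (f p.2 - f c) (f c - f p.1); rewrite addrA subrK; lra.
Qed.

Lemma fam_len x l b : fam x l b -> len l <= b - x.
Proof.
elim: l x => /= [|p l IH] x; first by rewrite len_nil subr_ge0.
by move=> [h1 h2 /IH]; rewrite len_cons; lra.
Qed.

Definition ac_list f a b := forall e : R, 0 < e -> exists2 d : R, 0 < d &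
  forall l, fam a l b -> len l < d -> var f l < e.

Lemma abs_cont_onP (A : set R) f : abs_cont_on A f <->
  forall a b, a <= b -> `[a, b] `<=` A -> ac_list f a b.
Proof.
split=> H a b ab abA e e0; have [d d0 Hd] := H a b ab abA e e0; exists d => //.
- move=> l fl ld; pose n := size l.
  have E (F : R * R -> R) : \sum_(i < n) F (nth (0, 0) l i) = \sum_(p <- l) F p.
    by rewrite (big_nth (0, 0)) big_mkord.
  pose u (i : 'I_n) := (nth (0, 0) l i).1; pose v (i : 'I_n) := (nth (0, 0) l i).2.
  rewrite /var -(E (fun p => `|f p.2 - f p.1|)); apply: (Hd n u v).
  + by move=> i; have [] := fam_bound fl (mem_nth (0, 0) (ltn_ord i)).
  + have /(pairwiseP (0, 0)) P := fam_pairwise fl.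
    move=> i j; rewrite neq_ltn => /orP[ij|ji]; [left|right].
    * by apply: (P i j); rewrite ?inE.
    * by apply: (P j i); rewrite ?inE.
  + by rewrite (E (fun p => p.2 - p.1)).
- move=> n u v uv dis luv.
  pose p (i : 'I_n) := (u i, v i).
  (* Sorting by [u + v], and not by [u], also places correctly a degenerate interval that sits at an
     endpoint of another one. *)
  pose key (i : 'I_n) := u i + v i.
  pose st := sort (relpre key <=%R) (index_enum 'I_n).
  have pst : perm_eq st (index_enum 'I_n) by rewrite perm_sort.
  have E (F : R * R -> R) : \sum_(i < n) F (p i) = \sum_(q <- map p st) F q.
    by rewrite big_map; apply/esym/perm_big.
  have key_total : total (relpre key <=%R) by move=> i j; exact: le_total.
  have key_trans : transitive (relpre key <=%R) by move=> i j k; exact: le_trans.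
  have ust : uniq st by rewrite sort_uniq index_enum_uniq.
  have pwk : pairwise (relpre key <=%R) st.
    by rewrite -sorted_pairwise //; exact: sort_sorted.
  have pw : pairwise (fun q r : R * R => q.2 <= r.1) (map p st).
    rewrite pairwise_map; move: ust pwk; rewrite uniq_pairwise => U W.
    have : pairwise (fun i j => (i != j) && (key i <= key j)) st by rewrite pairwise_relI U.
    apply: sub_pairwise => i j /andP[ij]; rewrite /key /relpre /=.
    have [_ [ui vi]] := uv i; have [_ [uj vj]] := uv j.
    by case: (dis i j ij) => //; lra.
  have fl : fam a (map p st) b.
    apply: fam_of_pairwise => // _ /mapP[i _ ->] /=; have [h1 [h2 h3]] := uv i; split=> //.
  rewrite (E (fun q => `|f q.2 - f q.1|)); apply: Hd fl _.
  by rewrite /len -(E (fun q => q.2 - q.1)).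
Qed.

Definition nd_on f a b := forall x y, a <= x -> x <= y -> y <= b -> f x <= f y.

Section variation.
Variables (f : R -> R) (a b : R).
Hypotheses (ab : a <= b) (acf : ac_list f a b).

Let TV x y := sup [set var f l | l in [set l | fam x l y]].

(** Absolute continuity for the bound 1 controls the variation on intervals shorter than [d];
    [[x, y]] is covered by finitely many steps of length [d / 2]. *)
Let var_ub x y : a <= x -> x <= y -> y <= b -> exists M, forall l, fam x l y -> var f l <= M.
Proof.
move=> ax xy yb; have [d d0 Hd] := acf ltr01.
have short x' y' l : a <= x' -> y' <= b -> y' - x' < d -> fam x' l y' -> var f l <= 1.
  move=> ax1 yb1 xy1 fl; apply/ltW/Hd; first exact: fam_weaken fl ax1 yb1.
  exact: le_lt_trans (fam_len fl) xy1.
have H n x' y' : a <= x' -> x' <= y' -> y' <= b -> y' - x' <= n%:R * (d / 2) ->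
    forall l, fam x' l y' -> var f l <= n%:R + 1.
  elim: n x' => [|n IH] x' ax' xy' yb' hn l fl.
    rewrite add0r; apply: (short x' y') => //; apply: le_lt_trans hn _; lra.
  have [small|big] := ltP (y' - x') d.
    by have := short x' y' l ax' yb' small fl; have := ler0n R n.+1; lra.
  have c1 : x' <= x' + d / 2 by lra.
  have c2 : x' + d / 2 <= y' by lra.
  have [l1 [l2 [f1 f2 _ v12]]] := fam_split f fl c1 c2.
  have h1 : var f l1 <= 1 by apply: (short x' (x' + d / 2)) => //; lra.
  have h2 : var f l2 <= n%:R + 1.
    apply: (IH (x' + d / 2)) => //; first by lra.
    by move: hn; rewrite -natr1 mulrDl mul1r; lra.
  by rewrite -natr1; lra.
have d2 : 0 < d / 2 by rewrite divr_gt0.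
have [n hn] : exists n : nat, y - x <= n%:R * (d / 2).
  exists (Num.truncn ((y - x) / (d / 2))).+1.
  by rewrite -ler_pdivrMr //; apply/ltW; rewrite truncnS_gt.
by exists (n%:R + 1); exact: H.
Qed.

Let TV_sup x y : a <= x -> x <= y -> y <= b -> has_sup [set var f l | l in [set l | fam x l y]].
Proof.
move=> ax xy yb; split; first by exists (var f [::]), [::].
by have [M HM] := var_ub ax xy yb; exists M => _ [l /= fl <-]; exact: HM.
Qed.

Let TV_ub x y l : a <= x -> y <= b -> fam x l y -> var f l <= TV x y.
Proof.
move=> ax yb fl; apply: ub_le_sup; last by exists l.
exact: (TV_sup ax (fam_le fl) yb).2.
Qed.

Let TV_split x c y : a <= x -> x <= c -> c <= y -> y <= b -> TV x y = TV x c + TV c y.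
Proof.
move=> ax xc cy yb; have xy := le_trans xc cy; have ac := le_trans ax xc; have cb := le_trans cy yb.
apply/eqP; rewrite eq_le; apply/andP; split.
- apply: ge_sup; first exact: (TV_sup ax xy yb).1.
  move=> _ [l /= fl <-]; have [l1 [l2 [f1 f2 _ v12]]] := fam_split f fl xc cy.
  by apply: le_trans v12 _; rewrite lerD // TV_ub.
- rewrite -lerBrDr; apply: ge_sup; first exact: (TV_sup ax xc cb).1.
  move=> _ [l1 /= f1 <-]; rewrite lerBrDr addrC -lerBrDr.
  apply: ge_sup; first exact: (TV_sup ac cy yb).1.
  move=> _ [l2 /= f2 <-]; rewrite lerBrDr addrC -var_cat.
  by apply: TV_ub => //; exact: fam_cat f1 f2.
Qed.

Let TV_ge x y : a <= x -> x <= y -> y <= b -> `|f y - f x| <= TV x y.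
Proof.
move=> ax xy yb; have : fam x [:: (x, y)] y by split=> //=; rewrite lexx.
by move/(TV_ub ax yb); rewrite var_cons var_nil addr0.
Qed.

(** Each interval is replaced by a family inside it that nearly attains its variation. The total
    length does not grow, so the total variation inherits absolute continuity. *)
Let TV_approx l x : fam x l b -> a <= x -> forall e, 0 < e -> exists l', [/\ fam x l' b,
  len l' <= len l & \sum_(p <- l) TV p.1 p.2 <= var f l' + e].
Proof.
elim: l x => [|[u v] l IH] x /=.
  by move=> xb ax e e0; exists [::]; split=> //; rewrite big_nil var_nil add0r ltW.
move=> [xu uv vl] ax e e0; have e2 : 0 < e / 2 by rewrite divr_gt0.
have av : a <= v by lra.
have au : a <= u by lra.
have vb := fam_le vl.
have [l2 [f2 n2 s2]] := IH _ vl av _ e2.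
have [_ [l1 /= f1 <-] v1] := sup_adherent e2 (TV_sup au uv vb).
exists (l1 ++ l2); split.
- by apply: fam_cat f2; apply: fam_weaken f1 xu (lexx _).
- by rewrite len_cat len_cons lerD //=; exact: fam_len f1.
- by rewrite big_cons var_cat /=; move: v1; rewrite -/(TV u v); lra.
Qed.

(** Jordan decomposition: [v] is the total variation of [f] from [a]. *)
Lemma ac_decomp : exists v, [/\ nd_on v a b, nd_on (fun x => v x - f x) a b & ac_list v a b].
Proof.
have vE x y : a <= x -> x <= y -> y <= b -> TV a y - TV a x = TV x y.
  by move=> ax xy yb; rewrite (TV_split (lexx a) ax xy yb); ring.
exists (TV a); split.
- move=> x y ax xy yb; rewrite -subr_ge0 vE //.
  exact: le_trans (normr_ge0 _) (TV_ge ax xy yb).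
- move=> x y ax xy yb /=; have := vE x y ax xy yb; have := TV_ge ax xy yb.
  by have := ler_norm (f y - f x); lra.
- move=> e e0; have e2 : 0 < e / 2 by rewrite divr_gt0.
  have [d d0 Hd] := acf e2; exists d => // l fl ld.
  have [l' [f' n' s']] := TV_approx fl (lexx a) (divr_gt0 e0 (ltr0n _ 4)).
  have := Hd l' f' (le_lt_trans n' ld).
  have -> : var (TV a) l = \sum_(p <- l) TV p.1 p.2.
    rewrite /var; apply: eq_big_seq => p pl; have [h1 h2 h3] := fam_bound fl pl.
    rewrite ger0_norm ?vE //; exact: le_trans (normr_ge0 _) (TV_ge h1 h2 h3).
  by move: s'; lra.
Qed.

End variation.

Lemma ac_listB f g a b : ac_list f a b -> ac_list g a b -> ac_list (fun x => f x - g x) a b.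
Proof.
move=> acf acg e e0; have e2 : 0 < e / 2 by rewrite divr_gt0.
have [d1 d10 H1] := acf _ e2; have [d2 d20 H2] := acg _ e2.
exists (Num.min d1 d2) => [|l fl]; first by rewrite lt_min d10.
rewrite lt_min => /andP[h1 h2]; have := H1 l fl h1; have := H2 l fl h2.
suff : var (fun x => f x - g x) l <= var f l + var g l by lra.
rewrite /var -big_split /=; apply: ler_sum => p _.
have -> : f p.2 - g p.2 - (f p.1 - g p.1) = (f p.2 - f p.1) - (g p.2 - g p.1) by ring.
exact: ler_normB.
Qed.

End interval_families.

(** * Lebesgue-Stieltjes measures on interval families *)

Section stieltjes.
Context {R : realType}.
Implicit Types (h v : R -> R) (l : seq (R * R)).

Lemma stieltjes_ocitv (H : cumulative R R) (x y : R) : x <= y ->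
  lebesgue_stieltjes_measure H `]x, y]%classic = (H y - H x)%:E.
Proof.
rewrite le_eqVlt => /predU1P[->|xy]; first by rewrite set_itv_ge ?bnd_simp ?ltxx // measure0 subrr.
rewrite /lebesgue_stieltjes_measure /measure_extension/= measurable_mu_extE /=; last first.
  by apply: is_ocitv.
by rewrite wlength_itv_bnd // ltW.
Qed.

Definition uset l : set R := \big[setU/set0]_(p <- l) `]p.1, p.2]%classic.

Lemma uset_cons p l : uset (p :: l) = `]p.1, p.2]%classic `|` uset l.
Proof. exact: big_cons. Qed.

Lemma usetP l x : uset l x <-> exists2 p, p \in l & p.1 < x <= p.2.
Proof.
elim: l => [|q l IH]; first by rewrite /uset big_nil; split=> // -[].
rewrite uset_cons; split.
- case=> [|/IH[p pl px]]; first by rewrite /= in_itv /= => qx; exists q => //; rewrite mem_head.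
  by exists p => //; rewrite in_cons pl orbT.
- by move=> [p]; rewrite in_cons => /predU1P[->|pl] px; [left; rewrite /= in_itv|right; apply/IH; exists p].
Qed.

Lemma stieltjes_fam (H : cumulative R R) x l b : fam x l b ->
  [/\ measurable (uset l : set (measurableTypeR R)), uset l `<=` `]x, b]%classic &
      lebesgue_stieltjes_measure H (uset l) = (\sum_(p <- l) (H p.2 - H p.1))%:E].
Proof.
elim: l x => [|p l IH] x.
  by move=> _; rewrite /uset !big_nil; split => //; rewrite measure0.
move=> [xp pp pl]; have [m1 s1 e1] := IH _ pl; rewrite uset_cons; split.
- by apply: measurableU => //; exact: measurable_itv.
- have pb := fam_le pl; move=> z [|/s1]; rewrite /= !in_itv /= => /andP[h1 h2]; apply/andP; split; lra.
- rewrite measureU //.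
  + by rewrite big_cons EFinD -e1; congr (_ + _)%E; exact: stieltjes_ocitv.
  + apply/seteqP; split=> // z [] /=; rewrite in_itv /= => /andP[_ zp] /s1 /=.
    by rewrite in_itv /= ltNge zp.
Qed.

(** Composition with [clip a b] extends a function on [[a, b]] by constants to the line, where
    Stieltjes measures and derivatives are taken. *)
Definition clip (a b x : R) : R := Num.max a (Num.min x b).

Lemma clip_in a b x : a <= b -> a <= clip a b x <= b.
Proof. by move=> ab; rewrite le_max lexx ge_max ab ge_min lexx orbT. Qed.

Lemma clip_id a b x : a <= x -> x <= b -> clip a b x = x.
Proof. by move=> ax xb; rewrite /clip min_l // max_r. Qed.

Lemma clip_mono a b x y : x <= y -> clip a b x <= clip a b y.
Proof. by move=> xy; rewrite /clip ge_max !le_max lexx /= le_min !ge_min xy lexx !orbT. Qed.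

Lemma clip_dist a b x y : `|clip a b x - clip a b y| <= `|x - y|.
Proof.
wlog xy : x y / x <= y => [H|].
  by have [?|/ltW ?] := leP x y; [|rewrite distrC [leRHS]distrC]; exact: H.
have h := clip_mono a b xy; rewrite distrC [leRHS]distrC !ger0_norm ?subr_ge0 //.
rewrite /clip /Num.max /Num.min; repeat case: ifP; lra.
Qed.

Lemma ac_list_dist f a b (e : R) : ac_list f a b -> 0 < e -> exists2 d : R, 0 < d &
  forall x y, a <= x <= b -> a <= y <= b -> `|x - y| < d -> `|f x - f y| < e.
Proof.
move=> acf e0; have [d d0 H] := acf e e0; exists d => // x y.
wlog xy : x y / x <= y => [W hx hy|].
  by have [?|/ltW ?] := leP x y; [|rewrite distrC [X in _ -> X < _]distrC]; exact: W.
move=> /andP[ax xb] /andP[ay yb] xyd; have : fam a [:: (x, y)] b by split.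
move/H; rewrite len_cons len_nil var_cons var_nil !addr0 /= [X in _ -> X < _]distrC; apply.
by move: xyd; rewrite distrC ger0_norm // subr_ge0.
Qed.

Lemma ac_list_clip_continuous f a b : a <= b -> ac_list f a b -> continuous (fun x => f (clip a b x)).
Proof.
move=> ab acf x; apply/cvgrPdist_lt => e e0; have [d d0 H] := ac_list_dist acf e0.
apply/nbhs_ballP; exists d => // y xy; apply: H; try exact: clip_in.
exact: le_lt_trans (clip_dist _ _ _ _) xy.
Qed.

Lemma mk_cumulE h : {homo h : x y / x <= y} -> continuous h -> (mk_cumul h : R -> R) = h.
Proof. by move=> hm hc; rewrite /mk_cumul; case: pselect => // -[]. Qed.

End stieltjes.

(** * Density of a monotone absolutely continuous function *)

Section monotone_density.
Context {R : realType} (v : R -> R) (a b : R).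
Hypotheses (ab : a < b) (ndv : nd_on v a b) (acv : ac_list v a b).

Let V x := v (clip a b x).
Let ab' := ltW ab.

Let V_homo : {homo V : x y / x <= y}.
Proof.
move=> x y xy; have /andP[h1 h2] := clip_in x ab'; have /andP[h3 h4] := clip_in y ab'.
by apply: ndv => //; exact: clip_mono.
Qed.

Let V_cont : continuous V. Proof. exact: ac_list_clip_continuous. Qed.

Let H := mk_cumul V.
Let HE : (H : R -> R) = V. Proof. exact: mk_cumulE. Qed.
Let nu := lebesgue_stieltjes_measure H.

Let t (n k : nat) : R := a + (b - a) * k%:R / n.+1%:R.

Let t0 n : t n 0 = a. Proof. by rewrite /t mulr0 mul0r addr0. Qed.
Let tn n : t n n.+1 = b. Proof. by rewrite /t mulfK // subrKC. Qed.
Let tS n k : t n k.+1 = t n k + (b - a) / n.+1%:R.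
Proof. by rewrite /t -natr1; ring. Qed.
Let t_le n k : t n k <= t n k.+1.
Proof. by rewrite tS lerDl divr_ge0 // subr_ge0. Qed.

(** Cells of an equal subdivision of [[a, b]] that lie in [U]: a finite family, to which absolute
    continuity applies directly, whereas [U] may have infinitely many components. *)
Let grid (U : set R) n := [seq (t n k, t n k.+1) | k <- iota 0 n.+1 &
  `[< `]t n k, t n k.+1]%classic `<=` U >]].

Let grid_fam U n : fam a (grid U n) b.
Proof.
rewrite -(t0 n) -(tn n) -[in t n n.+1](add0n n.+1) /grid.
elim: n.+1 0%N => [|j IH] m /=; first by rewrite addn0.
have := IH m.+1; rewrite addSnnS => fm; case: ifP => _ /=.
- by split.
- exact: fam_weaken fm (t_le n m) (lexx _).
Qed.

(** A null set has an open neighbourhood [U] of length less than [d]. The grid families inside [U]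
    have Stieltjes mass at most [e], and each point of [U] in []a, b]] is covered by all
    sufficiently fine ones. Hence the lower limit of these unions, of mass at most [e], contains the
    null set within []a, b]]. *)
Lemma stieltjes_null (N : set (measurableTypeR R)) : measurable N -> lebesgue_measure N = 0%E ->
  nu (N `&` `]a, b]%classic) = 0%E.
Proof.
move=> mN N0; apply/eqP; rewrite eq_le measure_ge0 andbT.
apply/lee_addgt0Pr => e e0; rewrite add0e.
have [d d0 Hd] := acv e0.
have Noo : (lebesgue_measure N < +oo)%E by rewrite N0 ltry.
have [U [oU NU UN]] := lebesgue_regularity_outer mN Noo d0.
have mU : measurable (U : set (measurableTypeR R)) by exact: open_measurable.
have Ud : (lebesgue_measure U < d%:E)%E.
  apply: le_lt_trans UN; rewrite -[leRHS]adde0 -N0.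
  have mUN : measurable (U `\` N : set (measurableTypeR R)) by exact: measurableD.
  apply: (@le_trans _ _ (lebesgue_measure ((U `\` N) `|` N))); last exact: measureU2.
  apply: le_measure; rewrite ?inE //; first exact: measurableU.
  by move=> x Ux; have [Nx|nN] := pselect (N x); [right|left].
have [mg sg vg] : [/\ forall n, measurable (uset (grid U n) : set (measurableTypeR R)),
    forall n, uset (grid U n) `<=` U & forall n, (nu (uset (grid U n)) <= e%:E)%E].
  have mg n : measurable (uset (grid U n) : set (measurableTypeR R)).
    by have [] := stieltjes_fam H (grid_fam U n).
  have sg n : uset (grid U n) `<=` U.
    move=> x /usetP[p /mapP[k]]; rewrite mem_filter => /andP[/asboolP kU _] -> /= xk.
    by apply: kU; rewrite /= in_itv.
  split=> // n; have [_ _ e1] := stieltjes_fam H (grid_fam U n); rewrite [X in (X <= _)%E]e1 lee_fin.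
  have [_ _ ll] := stieltjes_fam (@idfun R) (grid_fam U n).
  have ld : len (grid U n) < d.
    rewrite -lte_fin; apply: le_lt_trans Ud; rewrite -[X in (X <= _)%E]ll.
    by apply: le_measure; rewrite ?inE.
  apply: ltW; apply: le_lt_trans (Hd _ (grid_fam U n) ld); rewrite /var.
  rewrite big_seq [leRHS]big_seq; apply: ler_sum => p pl.
  have [h1 h2 h3] := fam_bound (grid_fam U n) pl; rewrite HE /V !clip_id ?ler_norm //; lra.
pose W n := \bigcap_(m in [set m | (n <= m)%N]) uset (grid U m).
have mW n : measurable (W n : set (measurableTypeR R)) by apply: bigcap_measurable => //; exists n => /=.
have mUW : measurable (\bigcup_n W n : set (measurableTypeR R)) by exact: bigcup_measurable.
have ndW : nondecreasing_seq W.
  by move=> n m nm; apply/subsetPset => x Wx k /= mk; apply: Wx; exact: leq_trans mk.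
apply: (@le_trans _ _ (nu (\bigcup_n W n))).
  apply: le_measure; rewrite ?inE //; first by apply: measurableI => //; exact: measurable_itv.
  move=> x [/NU Ux /=]; rewrite in_itv /= => /andP[ax xb].
  move: oU; rewrite openE => /(_ x Ux) /nbhs_ballP[r /= r0 rU].
  have ba0 : 0 < b - a by rewrite subr_gt0.
  have [M _ HM] := (cvgrPdist_lt _ _).1 (@cvg_harmonic R) _ (divr_gt0 r0 ba0).
  exists M => // n /= Mn; apply/usetP.
  have ex : exists k, x <= t n k.+1 by exists n; rewrite tn.
  have /ex_minnP[k xk kmin] : exists k, x <= t n k.+1 by [].
  have kn : (k <= n)%N by apply: kmin; rewrite tn.
  have tk : t n k < x.
    case: k xk kmin kn => [|k] xk kmin kn; first by rewrite t0.
    by rewrite ltNge; apply/negP => /kmin; rewrite ltnn.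
  exists (t n k, t n k.+1); last by rewrite /= tk.
  apply/mapP; exists k => //; rewrite mem_filter mem_iota /= add0n ltnS kn andbT.
  apply/asboolP => z /=; rewrite in_itv /= => /andP[kz zk]; apply: rU; rewrite /ball /=.
  have : (b - a) / n.+1%:R < r.
    have := HM n Mn; rewrite /= sub0r normrN ger0_norm ?invr_ge0 // ltr_pdivlMr //.
    by rewrite mulrC.
  move: xk zk kz tk; rewrite tS ltr_norml; move: (_ / n.+1%:R) (t n k) => i T0 xk zk kz tk ir.
  by apply/andP; split; lra.
have C : (nu \o W) n @[n --> \oo] --> nu (\bigcup_n W n) by exact: nondecreasing_cvg_mu.
rewrite -(cvg_lim _ C) //.
apply: lime_le; first by apply/cvg_ex; eexists; exact: C.
apply: nearW => n /=; apply: le_trans (vg n); apply: le_measure; rewrite ?inE //.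
by move=> x; apply => /=.
Qed.

(** Radon-Nikodym for the Stieltjes measure restricted to []a, b]], which Lebesgue measure dominates
    by [stieltjes_null]. *)
Lemma monotone_density : exists rho : R -> R,
  [/\ lebesgue_measure.-integrable setT (EFin \o rho) &
      forall x y, a <= x -> x <= y -> y <= b ->
        ((v y - v x)%:E = \int[lebesgue_measure]_(z in `]x, y]%classic) (rho z)%:E)%E].
Proof.
have mD : measurable (`]a, b]%classic : set (measurableTypeR R)) by exact: measurable_itv.
have Doo : (nu `]a, b]%classic < +oo)%E by rewrite /nu stieltjes_ocitv ?ltry.
pose nuD := mfrestr mD Doo.
have dom : nuD `<< (@lebesgue_measure R).
  apply/null_content_dominatesP => A mA A0; exact: stieltjes_null.
have [f [f0 ffin fint fE]] := radon_nikodym_sigma_finite dom.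
exists (fine \o f); split.
  by apply: eq_integrable fint => // x _ /=; rewrite fineK.
move=> x y ax xy yb; have mxy : measurable (`]x, y]%classic : set (measurableTypeR R)) by exact: measurable_itv.
have e1 : nuD `]x, y]%classic = (v y - v x)%:E.
  rewrite /nuD /mfrestr /mrestr (_ : _ `&` _ = `]x, y]%classic); last first.
    apply/seteqP; split=> z; first by case.
    by move=> h; split=> //; move: h; rewrite /= !in_itv /= => /andP[h1 h2]; apply/andP; split; lra.
  apply: (eq_trans (stieltjes_ocitv H xy)); rewrite HE /V !clip_id //; lra.
rewrite -e1; apply: (eq_trans (fE _ mxy)).
by apply: eq_integral => z _ /=; rewrite fineK.
Qed.

End monotone_density.

(** * Difference quotients and measurability of the derivative *)

Section derivative.
Context {R : realType}.
Implicit Types (f g : R -> R).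

Definition quot f (h x : R) : R := h^-1 * (f (h + x) - f x).

Lemma derivable_quot f x : derivable f x 1 = cvg (quot f h x @[h --> 0^']).
Proof.
rewrite /derivable (_ : (fun h => _) = quot f ^~ x) //.
by apply/funext => h /=; rewrite /quot [_%:A]mulr1.
Qed.

Lemma cvg_derive1 f x : derivable f x 1 -> quot f h x @[h --> 0^'] --> derive1 f x.
Proof. by rewrite derivable_quot. Qed.

Lemma derive1_ndv f x : ~ derivable f x 1 -> derive1 f x = 0.
Proof. by rewrite derivable_quot => /dvgP; apply. Qed.

Lemma near_derive1 f g x : (\forall y \near x, f y = g y) ->
  (derivable f x 1 <-> derivable g x 1) /\ derive1 f x = derive1 g x.
Proof.
move=> fg; have gf : \forall y \near x, g y = f y by apply: filterS fg.
split; last by rewrite !derive1E; exact: near_eq_derive.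
by split; apply: near_eq_derivable.
Qed.

Lemma cvg_quot_seq f x : derivable f x 1 -> quot f n.+1%:R^-1 x @[n --> \oo] --> derive1 f x.
Proof.
move=> dx; apply: (cvgr_dnbhsP _ _ _).1 (cvg_derive1 dx) _ _.
by split; [move=> n; rewrite gt_eqF|exact: cvg_harmonic].
Qed.

Section measurability.
Variable f : R -> R.
Hypothesis cf : continuous f.

(** Enumeration of the rationals as test increments: for continuous [f] the Cauchy criterion for
    difference quotients can be tested on them, and so becomes a countable condition. *)
Let H (n : nat) : R := if unpickle n is Some q then ratr q else 1.

Let small (N i : nat) := 0 < `|H i| < N.+1%:R^-1.

Let D := \bigcap_k \bigcup_N \bigcap_(i in small N) \bigcap_(j in small N)
  [set x | `|quot f (H i) x - quot f (H j) x| <= k.+1%:R^-1].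

Let cquot h : continuous (quot f h).
Proof.
move=> x; apply: cvgM; first exact: cvg_cst.
apply: cvgB; last exact: cf.
apply: continuous_comp; last exact: cf.
by apply: cvgD; [exact: cvg_cst|exact: cvg_id].
Qed.

Let mD : measurable (D : set (measurableTypeR R)).
Proof.
apply: bigcap_measurable => [|k _]; first by exists 0%N.
apply: bigcup_measurable => N _; apply: closed_measurable.
apply: closed_bigI => i _; apply: closed_bigI => j _.
pose F x := `|quot f (H i) x - quot f (H j) x|.
have cF : continuous F.
  by move=> x; apply: cvg_norm; apply: cvgB; exact: cquot.
rewrite (_ : [set _ | _] = F @^-1` [set y | y <= k.+1%:R^-1]) //.
by apply: preimage_closed => // y _; exact: cF.
Qed.

(** From rational to real increments: a violation of the Cauchy bound at [h] is an open condition
    and would persist at a nearby rational. *)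
Let derivableD x : derivable f x 1 <-> D x.
Proof.
rewrite derivable_quot; split.
- move/cvg_ex => [l Hl] k _.
  have k0 : 0 < k.+1%:R^-1 / 2 :> R by rewrite divr_gt0.
  have /cvgrPdist_le/(_ _ k0) := Hl.
  rewrite near_withinE => /nbhs_ballP[e /= e0 He].
  have [N _ HN] := (cvgrPdist_lt _ _).1 (@cvg_harmonic R) _ e0.
  have Ne := HN N (leqnn N); rewrite /= sub0r normrN ger0_norm // in Ne.
  have P i : small N i -> `|l - quot f (H i) x| <= k.+1%:R^-1 / 2.
    move=> /andP[i0 iN]; apply: He; last by rewrite -normr_gt0.
    by rewrite /ball /= sub0r normrN (lt_trans iN).
  exists N => // i Ni j Nj /=.
  have -> : quot f (H i) x - quot f (H j) x = (l - quot f (H j) x) - (l - quot f (H i) x) by ring.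
  apply: le_trans (ler_normB _ _) _; have := P i Ni; have := P j Nj.
  move: `|_ - _| `|_ - _| (_^-1) => p q r; lra.
- move=> Dx; apply/cauchy_cvgP/cauchyP => e e0.
  have [k _ Hk] := (cvgrPdist_lt _ _).1 (@cvg_harmonic R) _ e0.
  have ke := Hk k (leqnn k); rewrite /= sub0r normrN ger0_norm // in ke.
  have [N _ HN] := Dx k I.
  have rat_near (h : R) A : nbhs h A -> exists i, A (H i).
    move=> /nbhs_ballP[r /= r0 rA]; have [q] := rat_in_itvoo (ltr_pwDr r0 (lexx h)).
    rewrite in_itv /= => /andP[h1 h2]; exists (pickle q); apply: rA.
    by rewrite /ball /= /H pickleK ltr_norml; apply/andP; split; lra.
  have near_small (h r : R) : 0 < `|h| -> `|h| < r -> \forall t \near h, 0 < `|t| < r.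
    have cn : {for h, continuous (fun t : R => `|t|)} by exact: norm_continuous.
    move=> h0 hr; near=> t; apply/andP; split; near: t.
    - exact: cvgr_gt cn _ h0.
    - exact: cvgr_lt cn _ hr.
  have N0 : 0 < N.+1%:R^-1 :> R by [].
  have [i Ni] : exists i, small N i.
    apply: (rat_near (N.+1%:R^-1 / 2) (fun t => 0 < `|t| < N.+1%:R^-1)); apply: near_small.
      by rewrite gtr0_norm // divr_gt0.
    by rewrite gtr0_norm ?divr_gt0 //; move: N0; move: (N.+1%:R^-1) => r; lra.
  exists (quot f (H i) x); suff : \forall h \near nbhs (0 : R), h != 0 ->
    ball (quot f (H i) x) e (quot f h x) by [].
  near=> h => h0.
  apply: le_lt_trans ke; rewrite leNgt; apply/negP => bad.
  have hN : `|h| < N.+1%:R^-1 by near: h; exact: (@nbhs0_lt R R).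
  have ch : {for h, continuous (fun h => `|quot f (H i) x - quot f h x|)}.
    apply: cvg_norm; apply: cvgB; first exact: cvg_cst.
    apply: cvgM; first exact: cvgV.
    apply: cvgB; last exact: cvg_cst.
    apply: continuous_comp; last exact: cf.
    by apply: cvgD; [exact: cvg_id|exact: cvg_cst].
  have [j [jN jbad]] : exists j, small N j /\ k.+1%:R^-1 < `|quot f (H i) x - quot f (H j) x|.
    apply: (rat_near h (fun t => 0 < `|t| < N.+1%:R^-1 /\
      k.+1%:R^-1 < `|quot f (H i) x - quot f t x|)).
    have h0' : 0 < `|h| by rewrite normr_gt0.
    near=> t; split; near: t; first exact: near_small.
    exact: cvgr_gt ch _ bad.
  by have := HN i Ni j jN; rewrite /= leNgt jbad.
Unshelve. all: by end_near. Qed.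

Lemma measurable_quot h : measurable_fun setT (quot f h : measurableTypeR R -> R).
Proof. by apply: continuous_measurable_fun => x; exact: cquot. Qed.

(** On [D] the derivative is the limit of difference quotients; off [D] it is 0, the default value
    of a divergent limit, hence the indicator in [u]. *)
Lemma measurable_derive1 : measurable_fun setT (derive1 f : measurableTypeR R -> R).
Proof.
pose u n x := quot f n.+1%:R^-1 x * \1_D x.
apply: (@measurable_fun_cvg _ _ _ _ u) => [n|x _].
  apply: measurable_funM; last exact: measurable_indic.
  exact: measurable_quot.
rewrite /u indicE; have [/set_mem/derivableD dx|nD] := boolP (x \in D); last first.
  rewrite derive1_ndv; first by rewrite mulr0n; under eq_fun do rewrite mulr0; exact: cvg_cst.
  by move=> /derivableD/mem_set; apply/negP.
under eq_fun do rewrite mulr1.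
exact: cvg_quot_seq.
Qed.
End measurability.

End derivative.

(** * Absolutely continuous functions as integrals *)

Section absolute_continuity.
Context {R : realType}.
Implicit Types (f g rho : R -> R).
Local Notation leb := (@lebesgue_measure R).

Lemma ae_integrable d (T : measurableType d) (nu : {measure set T -> \bar R}) (D : set T)
    (f g : T -> \bar R) : measurable D -> measurable_fun D f -> nu.-integrable D g ->
  ae_eq nu D f g -> nu.-integrable D f /\ (\int[nu]_(x in D) f x = \int[nu]_(x in D) g x)%E.
Proof.
move=> mD mf /integrableP[mg gi] fg; split; last exact: ae_eq_integral.
apply/integrableP; split=> //; apply: le_lt_trans gi.
rewrite (ae_eq_integral (abse \o g)) //; [exact: measurableT_comp|exact: measurableT_comp|].
by apply: aeS fg => x H /H /= ->.
Qed.

(** The density is the difference of those of the two monotone parts; by Lebesgue differentiation it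
    is the derivative almost everywhere. *)
Lemma ac_density f a b : a < b -> ac_list f a b -> exists rho : R -> R,
  [/\ leb.-integrable setT (EFin \o rho),
      forall x y, a <= x -> x <= y -> y <= b ->
        ((f y - f x)%:E = \int[leb]_(z in `]x, y]%classic) (rho z)%:E)%E &
      {ae leb, forall x, a < x < b -> derivable f x 1 /\ derive1 f x = rho x}].
Proof.
move=> ab acf; have [v [ndv ndw acv]] := ac_decomp acf.
have [r [ri rE]] := monotone_density ab ndv acv.
have [q [qi qE]] := monotone_density ab ndw (ac_listB acv acf).
pose rho x := r x - q x.
have rhoi : leb.-integrable setT (EFin \o rho) by apply: eq_integrable (integrableB measurableT ri qi).
have FE x y : a <= x -> x <= y -> y <= b ->
    ((f y - f x)%:E = \int[leb]_(z in `]x, y]%classic) (rho z)%:E)%E.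
  move=> ax xy yb; have mxy : measurable (`]x, y]%classic : set (measurableTypeR R)).
    exact: measurable_itv.
  have s := @subsetT _ (`]x, y]%classic : set R).
  rewrite /rho; under eq_integral do rewrite EFinB.
  rewrite integralB_EFin //; [|exact: integrableS ri|exact: integrableS qi].
  by rewrite -rE // -qE // -EFinB; congr EFin; ring.
exists rho; split=> //.
have lrho : locally_integrable setT rho.
  by have := integrable_locally measurableT rhoi; rewrite patch_setT.
apply: aeS (lebesgue_differentiation lrho) => x px /andP[ax xb].
have ib : leb.-integrable [set` Interval (BRight a) (BRight b)] (EFin \o rho).
  by apply: integrableS rhoi => //; exact: measurable_itv.
have ax' : (BRight a < BRight x)%O by rewrite bnd_simp.
have [dF FF] := FTC1_lebesgue_pt xb ib ax' px.
set F := (fun y => _) in dF FF.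
have H : \forall y \near x, f y = (F \+ cst (f a)) y.
  near=> y; rewrite /F /Rintegral /= -FE //=; first by rewrite subrK.
    by apply/ltW; near: y; exact: lt_nbhsr.
  by apply/ltW; near: y; exact: lt_nbhsl.
have [fG EG] := near_derive1 H; rewrite EG -FF; split.
- exact: (fG.2 (derivableD dF (derivable_cst (f a) x 1))).
- by rewrite !derive1E (deriveD dF (derivable_cst (f a) x 1)) derive_cst addr0.
Unshelve. all: by end_near. Qed.

Lemma ac_derivable f a b : a <= b -> ac_list f a b ->
  {ae leb, forall x, a < x < b -> derivable f x 1}.
Proof.
rewrite le_eqVlt => /predU1P[->|ab] acf; first by apply: aeW => x /andP[/lt_trans h /h]; rewrite ltxx.
by have [r [_ _]] := ac_density ab acf; apply: aeS => x H /H [].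
Qed.

Lemma ac_measurable f a b : a <= b -> ac_list f a b ->
  measurable_fun (`]a, b[%classic : set (measurableTypeR R)) (derive1 f).
Proof.
move=> ab acf; have mI : measurable (`]a, b[%classic : set (measurableTypeR R)) by exact: measurable_itv.
have := measurable_derive1 (ac_list_clip_continuous ab acf).
move/(measurable_funS measurableT (@subsetT _ `]a, b[%classic)).
apply: eq_measurable_fun => x; rewrite inE /= in_itv /= => /andP[ax xb].
apply: (near_derive1 _).2; near=> y; rewrite clip_id //; apply: ltW; near: y.
- exact: lt_nbhsr.
- exact: lt_nbhsl.
Unshelve. all: by end_near. Qed.

Lemma ac_ftc f a b : a <= b -> ac_list f a b ->
  leb.-integrable `]a, b[%classic (fun x => (derive1 f x)%:E) /\
  (\int[leb]_(x in `]a, b[%classic) (derive1 f x)%:E = (f b - f a)%:E)%E.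
Proof.
rewrite le_eqVlt => /predU1P[->|ab] acf.
  rewrite set_itv_ge ?bnd_simp ?ltxx // integral_set0 subrr; split=> //; exact: integrable_set0.
have mI : measurable (`]a, b[%classic : set (measurableTypeR R)) by exact: measurable_itv.
have mf := ac_measurable (ltW ab) acf.
have [r [ri rE rD]] := ac_density ab acf.
have ri' : leb.-integrable `]a, b[%classic (EFin \o r) by exact: integrableS ri.
have E : ae_eq leb `]a, b[%classic (fun x => (derive1 f x)%:E) (EFin \o r).
  by apply: aeS rD => x H; rewrite /= in_itv /= => /H [_ ->].
have mfE : measurable_fun (`]a, b[%classic : set (measurableTypeR R)) (fun x => (derive1 f x)%:E).
  exact/measurable_EFinP.
have [fi ->] := ae_integrable mI mfE ri' E; split=> //.
by rewrite (rE a b (lexx _) (ltW ab) (lexx _)) integral_itv_bndo_bndc //; case/integrableP : ri'.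
Qed.

(** With [m] the mean slope, [f' ^ 2 >= 2 m f' - m ^ 2] is integrated; if the right-hand side is
    infinite there is nothing to prove. *)
Lemma ac_slope f a b : a < b -> ac_list f a b ->
  (((f b - f a) ^+ 2 / (b - a))%:E <= \int[leb]_(x in `]a, b[%classic) ((derive1 f x) ^+ 2)%:E)%E.
Proof.
move=> ab acf; have ba : 0 < b - a by rewrite subr_gt0.
have mI : measurable (`]a, b[%classic : set (measurableTypeR R)) by exact: measurable_itv.
have mf := ac_measurable (ltW ab) acf; have [fi fE] := ac_ftc (ltW ab) acf.
have mf2 : measurable_fun (`]a, b[%classic : set (measurableTypeR R)) (fun x => ((derive1 f x) ^+ 2)%:E).
  by apply/measurable_EFinP; exact: measurable_funX.
have [fin|inf] := ltP (\int[leb]_(x in `]a, b[%classic) ((derive1 f x) ^+ 2)%:E)%E +oo%E; last first.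
  by apply: le_trans inf; exact: leey.
have lab : leb (`]a, b[%classic : set R) = (b - a)%:E by rewrite lebesgue_measure_itv /= lte_fin ab.
pose m := (f b - f a) / (b - a).
have f2i : leb.-integrable `]a, b[%classic (fun x => ((derive1 f x) ^+ 2)%:E).
  by apply/integrableP; split=> //; under eq_integral do rewrite /= ger0_norm ?sqr_ge0 //.
have ci : leb.-integrable `]a, b[%classic (fun x => (m ^+ 2)%:E).
  apply/integrableP; split; first exact: measurable_cst.
  by rewrite /= integral_cst // [X in (_ * X)%E]lab -EFinM ltry.
have li := integrableB mI (integrableZl mI (2 * m) fi) ci.
apply: le_trans (le_integral mI li f2i _); last first.
  move=> x _ /=; rewrite -EFinM -EFinB lee_fin -subr_ge0.
  by have := sqr_ge0 (derive1 f x - m); congr (0 <= _); ring.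
rewrite integralB //; last exact: integrableZl.
rewrite integralZl // fE integral_cst // [X in (_ - _ * X)%E]lab -!EFinM -EFinB lee_fin.
by rewrite /m le_eqVlt; apply/orP; left; apply/eqP; field; rewrite gt_eqF.
Qed.

End absolute_continuity.

(** * Control of a function by a monotone one *)

Section energy_control.
Context {R : realType}.
Local Notation leb := (@lebesgue_measure R).
Implicit Types (f q : R -> R).

Section image_measure.
Variables (H : cumulative R R) (J : set (measurableTypeR R)) (phi : measurableTypeR R -> measurableTypeR R).
Hypotheses (mJ : measurable J) (mphi : measurable_fun setT phi).
Hypothesis phiH : forall a b : R, a <= b ->
  leb (phi @^-1` `]a, b]%classic `&` J) = (H b - H a)%:E.

Let mixin := isMeasurableFun.Build _ _ _ _ _ mphi.
Let phi' : {mfun _ >-> _} := HB.pack phi mixin.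
Let nu := pushforward (mrestr leb mJ) phi'.

(** The image under [phi] of Lebesgue measure on [J] agrees with the Stieltjes measure on half-open
    intervals, which determine it. This serves for translations, with [H] the identity, and for the
    inverse of an extended scale. *)
Lemma stieltjes_image (A : set (measurableTypeR R)) : measurable A ->
  lebesgue_stieltjes_measure H A = leb (phi @^-1` A `&` J).
Proof.
move=> mA; apply: (@lebesgue_stieltjes_measure_unique R H nu) => // _ [[a b] /= _ <-].
have [ab|ba] := leP a b; first by rewrite (stieltjes_ocitv H ab); exact/esym/phiH.
by rewrite set_itv_ge ?bnd_simp -?leNgt ?(ltW ba) // !measure0.
Qed.

Lemma integral_stieltjes_image (D : set (measurableTypeR R)) (g : R -> \bar R) : measurable D ->
  measurable_fun D g -> (forall x, D x -> 0 <= g x)%E ->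
  (\int[lebesgue_stieltjes_measure H]_(x in D) g x = \int[leb]_(x in phi @^-1` D `&` J) g (phi x))%E.
Proof.
move=> mD mg g0.
have -> : (\int[lebesgue_stieltjes_measure H]_(x in D) g x = \int[nu]_(x in D) g x)%E.
  by apply: eq_measure_integral => A mA _; exact: stieltjes_image.
rewrite /nu (ge0_integral_pushforward (measurable_funP phi')) //; last by move=> x; rewrite inE; exact: g0.
have mP : measurable (phi @^-1` D) by rewrite -[X in measurable X]setTI; exact: mphi.
have [Lg Lg0] : measurable_fun (phi @^-1` D) (g \o phi) /\ forall x, (phi @^-1` D) x -> (0 <= g (phi x))%E.
  split=> [|x /g0 //]; apply: (measurable_comp mD _ mg) => [_ [x Dx <-] //|].
  by apply: (measurable_funS measurableT _ mphi).
rewrite (@ge0_negligible_integral _ _ _ _ _ (~` J)) //; last 2 first.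
- exact: measurableC.
- by rewrite /= /mrestr setICl measure0.
rewrite setDE setCK; apply: eq_measure_integral => A mA AJ; rewrite /= /mrestr.
by congr (leb _); apply/setIidl => x /AJ [].
Qed.

End image_measure.

Lemma integral_shift (h a b : R) (g : R -> \bar R) :
  measurable_fun (`]a + h, b + h[%classic : set (measurableTypeR R)) g ->
  (forall x, (a + h < x < b + h)%R -> (0 <= g x)%E) ->
  (\int[leb]_(x in `]a, b[%classic) g (x + h)%R = \int[leb]_(x in `](a + h)%R, (b + h)%R[%classic) g x)%E.
Proof.
move=> mg g0; have mt : measurable_fun setT (fun x : measurableTypeR R => (x + h : measurableTypeR R)).
  exact: measurable_funD.
have mD : measurable (`]a + h, b + h[%classic : set (measurableTypeR R)) by exact: measurable_itv.
apply/esym; apply: (eq_trans (integral_stieltjes_image (H := idfun) measurableT mt _ mD mg _)).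
- move=> c d cd; rewrite setIT (_ : _ @^-1` _ = `]c - h, d - h]%classic); last first.
    by apply/seteqP; split=> x /=; rewrite !in_itv /= ltrBlDr lerBrDr.
  rewrite lebesgue_measure_itv /= lte_fin ltrD2r; case: ltgtP cd => // [cd|->] _.
    by rewrite -EFinB; congr EFin; ring.
  by rewrite subrr.
- by move=> x; rewrite /= in_itv /= => /g0.
- by congr (integral _ _ _); apply/seteqP; split=> x /=; rewrite !in_itv /= !ltrD2r => // -[].
Qed.

Variables (f q : R -> R) (a b : R).
Hypotheses (ab : a < b) (ndq : nd_on q a b).
Hypothesis fq : forall x y, a <= x -> x <= y -> y <= b -> (f y - f x) ^+ 2 <= (q y - q x) * (y - x).

Let ab' := ltW ab.

Lemma control_ac : ac_list f a b.
Proof.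
move=> e e0; set Q := q b - q a.
have Q0 : 0 <= Q by rewrite subr_ge0; exact: ndq.
(* By the arithmetic-geometric mean the variation over a family is at most
   [(t * Q + len l / t) / 2]; this [t], with the bound [t * e] on the length, makes each summand
   less than [e]. *)
pose t := e / (Q + 1); have Q1 : 0 < Q + 1 by rewrite ltr_wpDl.
have t0 : 0 < t by rewrite divr_gt0.
exists (t * e) => [|l fl ll]; first exact: mulr_gt0.
have step x y : a <= x -> x <= y -> y <= b -> `|f y - f x| <= (t * (q y - q x) + (y - x) / t) / 2.
  move=> ax xy yb; have qxy : 0 <= q y - q x by rewrite subr_ge0 ndq.
  have A : 0 <= (t * (q y - q x) + (y - x) / t) / 2.
    have yx : 0 <= y - x by rewrite subr_ge0.
    by apply: divr_ge0 => //; apply: addr_ge0; [apply: mulr_ge0|apply: divr_ge0] => //; exact: ltW.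
  rewrite -ler_sqr ?nnegrE // real_normK ?num_real //; apply: le_trans (fq ax xy yb) _.
  rewrite -subr_ge0.
  have -> : ((t * (q y - q x) + (y - x) / t) / 2) ^+ 2 - (q y - q x) * (y - x) =
    ((t * (q y - q x) - (y - x) / t) / 2) ^+ 2 by field; rewrite gt_eqF.
  exact: sqr_ge0.
have H x : a <= x -> fam x l b -> var f l <= (t * (q b - q x) + len l / t) / 2.
  elim: l x {fl ll} => [|p l IH] x ax /=.
    move=> xb; rewrite var_nil len_nil mul0r addr0 divr_ge0 // mulr_ge0 ?(ltW t0) // subr_ge0.
    exact: ndq.
  move=> [xp pp pl]; have pb := fam_le pl; rewrite var_cons len_cons.
  have := IH p.2 (le_trans (le_trans ax xp) pp) pl.
  have := step p.1 p.2 (le_trans ax xp) pp pb.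
  have : t * q x <= t * q p.1 by rewrite ler_pM2l // ndq // (le_trans pp pb).
  rewrite mulrDl; lra.
apply: le_lt_trans (H a (lexx _) fl) _; rewrite -/Q.
have : len l / t < e by rewrite ltr_pdivrMr // mulrC.
have : t * Q < e.
  by rewrite /t mulrAC ltr_pdivrMr // ltr_pM2l // ltrDl.
lra.
Qed.

Let F x := f (clip a b x).
Let V x := q (clip a b x) - q a.

Let V_mono x y : x <= y -> V x <= V y.
Proof.
move=> xy; have /andP[h1 h2] := clip_in x ab'; have /andP[h3 h4] := clip_in y ab'.
by rewrite lerB // ndq // clip_mono.
Qed.

Let V0 x : 0 <= V x.
Proof. by have /andP[h1 h2] := clip_in x ab'; rewrite subr_ge0 ndq. Qed.

Let VQ x : V x <= q b - q a.
Proof. by have /andP[h1 h2] := clip_in x ab'; rewrite lerB // ndq. Qed.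

Let FV (h x : R) : 0 < h -> quot F h x ^+ 2 <= h^-1 * (V (h + x) - V x).
Proof.
move=> h0; rewrite /quot exprMn.
have xh : x <= h + x by rewrite lerDr ltW.
have /andP[h1 h2] := clip_in x ab'; have /andP[h3 h4] := clip_in (h + x) ab'.
have D : clip a b (h + x) - clip a b x <= h.
  have := clip_dist a b (h + x) x; rewrite addrK (ger0_norm (ltW h0)).
  exact: le_trans (ler_norm _).
have := fq h1 (clip_mono a b xh) h4; rewrite -/(F _) -/(F x) => le1.
have le2 : (F (h + x) - F x) ^+ 2 <= (V (h + x) - V x) * h.
  apply: le_trans le1 _; rewrite /V opprB addrA subrK ler_wpM2l // subr_ge0 ndq // clip_mono //.
rewrite expr2 -mulrA ler_wpM2l ?invr_ge0 ?(ltW h0) // mulrC ler_pdivrMr //.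
Qed.

(** Squared difference quotients are at most [h^-1 * (V (h + x) - V x)], whose integral over []a,
    b[] is at most [q b - q a] by a translation; Fatou's lemma passes to the derivative. *)
Lemma control_energy : (\int[leb]_(x in `]a, b[%classic) ((derive1 f x) ^+ 2)%:E <= (q b - q a)%:E)%E.
Proof.
set I := (`]a, b[%classic : set (measurableTypeR R)).
have mI : measurable I by exact: measurable_itv.
have acf := control_ac; have cF := ac_list_clip_continuous ab' acf.
have mV : measurable_fun setT (V : measurableTypeR R -> R).
  by apply: nondecreasing_measurable => // x y _ _; exact: V_mono.
pose g n x := ((quot F n.+1%:R^-1 x) ^+ 2)%:E.
have mg n : measurable_fun I (g n).
  by apply/measurable_EFinP/measurable_funX; apply: measurable_funS (measurable_quot cF _).
have mVE (D : set (measurableTypeR R)) : measurable_fun D (fun x => (V x)%:E).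
  by apply/measurable_EFinP; apply: measurable_funS mV.
have mVh (h : R) : measurable_fun setT ((fun x => V (x + h)) : measurableTypeR R -> R).
  by apply: measurableT_comp mV _; exact: measurable_funD.
have mVhE (h : R) : measurable_fun I (fun x => (V (x + h) - V x)%:E).
  by apply/measurable_EFinP; apply: measurable_funB; [apply: measurable_funS (mVh h)|apply: measurable_funS mV].
have VE0 x : (0 <= (V x)%:E)%E by rewrite lee_fin.
have Vint (c d : R) : c <= d -> (\int[leb]_(x in `[c, d[%classic) (V x)%:E <= ((q b - q a) * (d - c))%:E)%E.
  move=> cd; have m1 : measurable (`[c, d[%classic : set (measurableTypeR R)) by exact: measurable_itv.
  apply: (@le_trans _ _ (\int[leb]_(x in `[c, d[%classic) (cst (q b - q a)%:E) x)%E).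
    by apply: ge0_le_integral => // x _ /=; rewrite lee_fin // subr_ge0 ndq.
  rewrite integral_cst // EFinM; apply: lee_wpmul2l; first by rewrite lee_fin subr_ge0 ndq.
  rewrite [X in (X <= _)%E]lebesgue_measure_itv /= lte_fin -EFinB; case: ifP => // _.
  by rewrite lee_fin subr_ge0.
have gQ n : (\int[leb]_(x in I) g n x <= (q b - q a)%:E)%E.
  pose h : R := n.+1%:R^-1; have h0 : 0 < h by rewrite invr_gt0.
  pose A := (\int[leb]_(x in I) (V (x + h) - V x)%:E)%E.
  have V_h x : 0 <= V (x + h) - V x by rewrite subr_ge0 V_mono // lerDl ltW.
  apply: (@le_trans _ _ (h^-1%:E * A)%E).
    rewrite /A -ge0_integralZl_EFin //; last 2 first.
    - by move=> x _; rewrite lee_fin.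
    - by rewrite invr_ge0 ltW.
    apply: ge0_le_integral => //.
    - by move=> x _; rewrite lee_fin sqr_ge0.
    - exact: measurable_funeM.
    - by move=> x _; rewrite -EFinM lee_fin [x + h]addrC; exact: FV.
  rewrite lee_pdivrMl // -EFinM.
  have e1 : (A + \int[leb]_(x in I) (V x)%:E = \int[leb]_(x in I) (V (x + h))%:E)%E.
    rewrite /A -ge0_integralD //; last by move=> x _; rewrite lee_fin.
    by apply: eq_integral => x _; rewrite -EFinD subrK.
  have e2 : (\int[leb]_(x in I) (V (x + h))%:E <= \int[leb]_(x in I) (V x)%:E + (h * (q b - q a))%:E)%E.
    rewrite (@integral_shift h a b (EFin \o V)) //; last by move=> x _; rewrite lee_fin.
    have m1 : measurable (`[b, b + h[%classic : set (measurableTypeR R)) by exact: measurable_itv.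
    have m2 : measurable (`](a + h)%R, (b + h)%R[%classic : set (measurableTypeR R)) by exact: measurable_itv.
    apply: (@le_trans _ _ (\int[leb]_(x in I `|` `[b, (b + h)%R[%classic) (V x)%:E)%E).
      apply: ge0_subset_integral => //; [exact: measurableU|by move=> y _; exact: VE0|].
      move=> x xI; have /andP[h1 h2] : a + h < x < b + h by move: xI; rewrite /= in_itv.
      have [xb|bx] := ltP x b; [left|right].
        by rewrite /I /= in_itv /= xb andbT; lra.
      by rewrite /= in_itv /= bx h2.
    rewrite ge0_integral_setU //; last first.
      apply/disj_setPS => x; rewrite /I => -[] /=; rewrite !in_itv /= => /andP[_ xb] /andP[bx _].
      by rewrite ltNge bx in xb.
    rewrite leeD2l //; apply: le_trans (Vint _ _ _) _; first by lra.
    by rewrite addrAC subrr add0r mulrC.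
  have fin : (\int[leb]_(x in I) (V x)%:E)%E \is a fin_num.
    rewrite ge0_fin_numE ?integral_ge0 //.
    rewrite (integral_itv_obnd_cbnd (mVE _)).
    by apply: le_lt_trans (Vint _ _ ab') _; rewrite ltry.
  by move: e2; rewrite -e1 addeC leeD2lE.
have [N [mN N0 sN]] := ac_derivable ab' acf.
pose D := I `\` N; have mD : measurable (D : set (measurableTypeR R)) by exact: measurableD.
have mgE n : measurable_fun I (quot F n.+1%:R^-1 : measurableTypeR R -> R).
  by apply: measurable_funS (measurable_quot cF _).
have gD n : (\int[leb]_(x in D) ((quot F n.+1%:R^-1 x) ^+ 2)%:E <= (q b - q a)%:E)%E.
  apply: le_trans (gQ n); apply: ge0_subset_integral => //; [|by move=> x _; rewrite lee_fin sqr_ge0|exact: subDsetl].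
  exact: mg.
have mf2 : measurable_fun I (fun x => ((derive1 f x) ^+ 2)%:E).
  by apply/measurable_EFinP; apply: measurable_funX; exact: ac_measurable.
have Lg n : L2 leb D (quot F n.+1%:R^-1).
  split; first by apply: (measurable_funS mI _ (mgE n)); exact: subDsetl.
  by apply: le_lt_trans (gD n) _; rewrite ltry.
have [] := @nrm2_fatou _ leb D mD _ (derive1 f) (q b - q a) Lg.
- apply: nearW => n; rewrite -lee_fin -nrm2E //; exact: Lg.
- move=> x [Ix nNx]; have dx : derivable f x 1.
    apply: contrapT => nd; apply: nNx; apply: sN => /= H; apply: nd; apply: H.
    by move: Ix; rewrite /I /= in_itv.
  have H : \forall y \near x, f y = F y.
    move: Ix; rewrite /I /= in_itv /= => /andP[ax xb].
    near=> y; rewrite /F clip_id //; apply: ltW; near: y.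
    - exact: lt_nbhsr.
    - exact: lt_nbhsl.
  by have [dF ->] := near_derive1 H; exact: cvg_quot_seq (dF.1 dx).
move=> Lf nf; rewrite (ge0_negligible_integral (N := N)) //; last by move=> x _; rewrite lee_fin sqr_ge0.
by rewrite -/D nrm2E // lee_fin.
Unshelve. all: by end_near. Qed.

End energy_control.

(** * Energy of the interpolation across gaps *)

Section interpolation.
Context {R : realType} {T : set R} (gT : gapped T).
Implicit Types (f g q : R -> R).

Lemma oitvP x : oitv T x <-> exists a b, [/\ T a, T b, a < x & x < b].
Proof.
split.
- rewrite /oitv /= /lend /rend => /andP[lx xr].
  have [_ [a Ta <-] ax] := ereal_inf_lt lx; have [_ [b Tb <-] xb] := ereal_sup_gt xr.
  by exists a, b; rewrite !lte_fin in ax xb.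
- move=> [a [b [Ta Tb ax xb]]]; rewrite /oitv /=; apply/andP; split.
  + apply: (@le_lt_trans _ _ a%:E); last by rewrite lte_fin.
    by apply: ereal_inf_lbound; exists a.
  + apply: (@lt_le_trans _ _ b%:E); first by rewrite lte_fin.
    by apply: ereal_sup_ubound; exists b.
Qed.

Lemma sub_Itv : T `<=` Itv T. Proof. by move=> x; right. Qed.

Lemma oitv_Itv : oitv T `<=` Itv T. Proof. by move=> x; left. Qed.

Lemma Itv_cases x : Itv T x -> T x \/ exists c d, [/\ gaps T (c, d), c < x & x < d].
Proof.
move=> [/oitvP[a [b [Ta Tb ax xb]]]|]; last by left.
by have [Tx|nTx] := pselect (T x); [left|right; exact: gT.2 Ta Tb ax xb nTx].
Qed.

Lemma Itv_between a b x : Itv T a -> Itv T b -> a <= x -> x <= b -> Itv T x.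
Proof.
have lower a' : Itv T a' -> exists2 a0, T a0 & a0 <= a'.
  by move=> [/oitvP[a0 [_ [Ta0 _ /ltW ? _]]]|Ta]; [exists a0|exists a'].
have upper b' : Itv T b' -> exists2 b0, T b0 & b' <= b0.
  by move=> [/oitvP[_ [b0 [_ Tb0 _ /ltW ?]]]|Tb]; [exists b0|exists b'].
move=> /lower[a0 Ta a0a] /upper[b0 Tb bb0] ax xb.
have [Tx|nTx] := pselect (T x); [by right|left; apply/oitvP; exists a0, b0; split=> //].
- rewrite lt_neqAle (le_trans a0a ax) andbT; apply/eqP => H; apply: nTx; by rewrite -H.
- rewrite lt_neqAle (le_trans xb bb0) andbT; apply/eqP => H; apply: nTx; by rewrite H.
Qed.

Lemma oitv_between a b x : Itv T a -> Itv T b -> a < x -> x < b -> oitv T x.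
Proof.
move=> Ia Ib ax xb; apply/oitvP.
have [a0 Ta a0x] : exists2 a0, T a0 & a0 < x.
  by case: Ia => [/oitvP[a0 [_ [Ta0 _ h _]]]|Ta]; [exists a0 => //; exact: lt_trans ax|exists a].
have [b0 Tb xb0] : exists2 b0, T b0 & x < b0.
  by case: Ib => [/oitvP[_ [b0 [_ Tb0 _ h]]]|Tb]; [exists b0 => //; exact: lt_trans h|exists b].
by exists a0, b0.
Qed.

Lemma sbar_in f x : T x -> sbar T f x = f x.
Proof. by rewrite /sbar; case: pselect. Qed.

Lemma gap_oitv c d x : gaps T (c, d) -> c < x -> x < d -> oitv T x.
Proof. by move=> [/= Tc [Td _]] cx xd; apply/oitvP; exists c, d. Qed.

Lemma sbar_gap f c d x : gaps T (c, d) -> c <= x -> x <= d ->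
  sbar T f x = f c + (f d - f c) / (d - c) * (x - c).
Proof.
move=> G; have [/= Tc [Td [cd nT]]] := G.
rewrite le_eqVlt => /predU1P[<- _|cx]; first by rewrite sbar_in // subrr mulr0 addr0.
rewrite le_eqVlt => /predU1P[->|xd].
  by rewrite sbar_in // divfK ?subrKC // subr_eq0 gt_eqF.
rewrite /sbar; case: pselect => [Tx|_]; first by case: (nT x) => //; rewrite cx.
case: pselect => [_|[]]; last exact: gap_oitv G _ _.
by rewrite (gap_sup G) // (gap_inf G).
Qed.

Lemma sbar_ext f g x : (forall y, T y -> f y = g y) -> Itv T x -> sbar T f x = sbar T g x.
Proof.
move=> fg /Itv_cases[Tx|[c [d [G cx xd]]]]; first by rewrite !sbar_in // fg.
have [/= Tc [Td _]] := G.
by rewrite !(sbar_gap _ G (ltW cx) (ltW xd)) !fg.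
Qed.

Lemma sbar_linear (a : R) f g x : Itv T x ->
  sbar T (fun y => a * f y + g y) x = a * sbar T f x + sbar T g x.
Proof.
move=> /Itv_cases[Tx|[c [d [G cx xd]]]]; first by rewrite !sbar_in.
by rewrite !(sbar_gap _ G (ltW cx) (ltW xd)); ring.
Qed.

Lemma sbar_id x : Itv T x -> sbar T id x = x.
Proof.
move=> /Itv_cases[Tx|[c [d [G cx xd]]]]; first by rewrite sbar_in.
have [/= Tc [Td [cd nT]]] := G.
by rewrite (sbar_gap _ G (ltW cx) (ltW xd)) divff ?mul1r ?subrKC // subr_eq0 gt_eqF.
Qed.

Lemma Itv_split x y : Itv T x -> Itv T y -> x < y ->
  (exists z, [/\ T z, x <= z & z <= y]) \/ exists c d, [/\ gaps T (c, d), c < x & y < d].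
Proof.
move=> Ix Iy xy; have [Tx|[c [d [G cx xd]]]] := Itv_cases Ix.
  by left; exists x; rewrite lexx ltW.
have [dy|yd] := leP d y; [left|by right; exists c, d].
by exists d; have [_ [Td _]] := G; rewrite ltW.
Qed.

Lemma sbar_lb f z y : {in T &, {homo f : x y / x <= y}} -> T z -> Itv T y -> z <= y -> f z <= sbar T f y.
Proof.
move=> nf Tz /Itv_cases[Ty|[c [d [G cy yd]]]] zy; first by rewrite sbar_in // nf ?inE.
have [/= Tc [Td [cd nT]]] := G.
have zc : z <= c.
  by rewrite leNgt; apply/negP => cz; apply: (nT z) => //; rewrite cz (le_lt_trans zy).
rewrite (sbar_gap _ G (ltW cy) (ltW yd)); apply: (@le_trans _ _ (f c)); first by rewrite nf ?inE.
rewrite lerDl mulr_ge0 // ?subr_ge0 ?(ltW cy) // divr_ge0 // subr_ge0 ?(ltW cd) //.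
by rewrite nf ?inE // ltW.
Qed.

Lemma sbar_ub f z x : {in T &, {homo f : x y / x <= y}} -> T z -> Itv T x -> x <= z -> sbar T f x <= f z.
Proof.
move=> nf Tz /Itv_cases[Tx|[c [d [G cx xd]]]] xz; first by rewrite sbar_in // nf ?inE.
have [/= Tc [Td [cd nT]]] := G.
have dz : d <= z.
  by rewrite leNgt; apply/negP => zd; apply: (nT z) => //; rewrite zd (lt_le_trans cx).
rewrite (sbar_gap _ G (ltW cx) (ltW xd)); apply: (@le_trans _ _ (f d)); last by rewrite nf ?inE.
have fcd : 0 <= f d - f c by rewrite subr_ge0 nf ?inE // ltW.
by rewrite -lerBrDl mulrAC ler_pdivrMr ?subr_gt0 // ler_wpM2l // lerB // (ltW xd).
Qed.

Lemma sbar_homo f : {in T &, {homo f : x y / x <= y}} ->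
  forall x y, Itv T x -> Itv T y -> x <= y -> sbar T f x <= sbar T f y.
Proof.
move=> nf x y Ix Iy; rewrite le_eqVlt => /predU1P[->//|xy].
have [[z [Tz xz zy]]|[c [d [G cx yd]]]] := Itv_split Ix Iy xy.
  exact: le_trans (sbar_ub nf Tz Ix xz) (sbar_lb nf Tz Iy zy).
have [/= Tc [Td [cd nT]]] := G.
rewrite !(sbar_gap _ G) ?(ltW cx) ?(ltW yd) ?(ltW (lt_trans cx xy)) ?(ltW (lt_trans xy yd)) //.
rewrite lerD2l ler_wpM2l ?lerB ?(ltW xy) // divr_ge0 ?subr_ge0 ?(ltW cd) //.
by rewrite nf ?inE // ltW.
Qed.

(** The inequality for all pairs means that [q - 2 t f + t ^ 2 id] is nondecreasing for each real
    [t]. This condition is linear in the functions, and interpolation is linear and preserves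
    monotonicity; the best [t] gives the inequality back. *)
Lemma sbar_control f q : (forall x y, T x -> T y -> x <= y -> (f y - f x) ^+ 2 <= (q y - q x) * (y - x)) ->
  {in T &, {homo q : x y / x <= y}} ->
  forall x y, Itv T x -> Itv T y -> x <= y ->
    (sbar T f y - sbar T f x) ^+ 2 <= (sbar T q y - sbar T q x) * (y - x).
Proof.
move=> fq nq x y Ix Iy; rewrite le_eqVlt => /predU1P[->|xy]; first by rewrite !subrr mulr0 expr0n.
have H (t : R) : 0 <= (sbar T q y - sbar T q x) - 2 * t * (sbar T f y - sbar T f x) + t ^+ 2 * (y - x).
  pose p z := (- 2 * t) * f z + (t ^+ 2 * id z + q z).
  have np : {in T &, {homo p : x y / x <= y}}.
    move=> u v /set_mem Tu /set_mem Tv; rewrite le_eqVlt => /predU1P[->//|uv].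
    have uv0 : 0 < v - u by rewrite subr_gt0.
    have := fq u v Tu Tv (ltW uv); rewrite -ler_pdivrMr // /p /= -subr_ge0 => h.
    rewrite -subr_ge0; apply: (@le_trans _ _ ((v - u) * (t - (f v - f u) / (v - u)) ^+ 2)).
      by rewrite mulr_ge0 ?sqr_ge0 // ltW.
    rewrite -subr_ge0; apply: (le_trans h); rewrite le_eqVlt; apply/orP; left; apply/eqP.
    by field; rewrite gt_eqF.
  have := sbar_homo np Ix Iy (ltW xy); rewrite /p !sbar_linear // !sbar_id // -subr_ge0.
  by congr (0 <= _); ring.
have xy0 : 0 < y - x by rewrite subr_gt0.
have h := mulr_ge0 (H ((sbar T f y - sbar T f x) / (y - x))) (ltW xy0).
rewrite -subr_ge0; apply: (le_trans h); rewrite le_eqVlt; apply/orP; left; apply/eqP.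
by field; rewrite gt_eqF.
Qed.

End interpolation.

(** * Absolutely continuous representatives *)

Section ac_representatives.
Context {R : realType} {T : set R} (gT : gapped T).
Implicit Types (f g q : R -> R).
Local Notation leb := (@lebesgue_measure R).

Lemma open_oitv : open (oitv T).
Proof.
rewrite openE => x /oitvP[a [b [Ta Tb ax xb]]]; rewrite /interior.
near=> y; apply/oitvP; exists a, b; split=> //; near: y; [exact: lt_nbhsr|exact: lt_nbhsl].
Unshelve. all: by end_near. Qed.

Lemma measurable_oitv : measurable (oitv T : set (measurableTypeR R)).
Proof. exact: open_measurable open_oitv. Qed.

Lemma measurable_Itv : measurable (Itv T : set (measurableTypeR R)).
Proof. apply: measurableU; [exact: measurable_oitv|exact: gapped_measurable]. Qed.

Lemma oitv_exhaust : exists a b : nat -> R,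
  [/\ forall n, oitv T (a n) /\ oitv T (b n), forall n, a n <= b n,
      {homo a : m n / (m <= n)%N >-> n <= m}, {homo b : m n / (m <= n)%N >-> m <= n} &
      oitv T = \bigcup_n `]a n, b n[%classic].
Proof.
have [a [b [Iab ab a_ni b_nd abT]]] : exists a b : nat -> R,
  [/\ forall n, oitv T (a n) /\ oitv T (b n), forall n, a n <= b n,
      {homo a : m n / (m <= n)%N >-> n <= m}, {homo b : m n / (m <= n)%N >-> m <= n} &
      forall x, oitv T x -> \forall n \near \oo, a n <= x <= b n].
  apply: exhaust_seq; have [[p [q [Tp Tq pq]]] _] := gT.
  by exists ((p + q) / 2); apply/oitvP; exists p, q; split=> //; lra.
exists a, b; split=> //; apply/seteqP; split=> x.
- move=> Ix; have [p [q [Tp Tq px xq]]] := (oitvP x).1 Ix.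
  have Iu : oitv T ((p + x) / 2) by apply/oitvP; exists p, q; split=> //; lra.
  have Iv : oitv T ((x + q) / 2) by apply/oitvP; exists p, q; split=> //; lra.
  have [N _ HN] := filterI (abT _ Iu) (abT _ Iv).
  have [/andP[h1 h2] /andP[h3 h4]] := HN N (leqnn N).
  by exists N => //=; rewrite in_itv /=; apply/andP; split; lra.
- move=> [n _ /=]; rewrite in_itv /= => /andP[ax xb].
  have [Ia Ib] := Iab n.
  by apply: (oitv_between (or_introl Ia) (or_introl Ib)).
Qed.

Lemma oitv_ac_list g x y : abs_cont_on (oitv T) g -> oitv T x -> oitv T y -> x <= y -> ac_list g x y.
Proof.
move=> /abs_cont_onP acg Ix Iy xy; apply: acg => // z; rewrite /= in_itv /= => /andP[].
rewrite le_eqVlt => /predU1P[<-//|xz]; rewrite le_eqVlt => /predU1P[->//|zy].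
exact: (oitv_between (or_introl Ix) (or_introl Iy)).
Qed.

Lemma oitv_ac_measurable g : abs_cont_on (oitv T) g ->
  measurable_fun (oitv T : set (measurableTypeR R)) (derive1 g).
Proof.
move=> acg; have [a [b [Iab ab _ _ ->]]] := oitv_exhaust.
apply/measurable_fun_bigcup => n; first exact: measurable_itv.
apply: ac_measurable => //; have [Ia Ib] := Iab n; exact: oitv_ac_list.
Qed.

Lemma oitv_ac_derivable g : abs_cont_on (oitv T) g ->
  {ae leb, forall x, oitv T x -> derivable g x 1}.
Proof.
move=> acg; have [a [b [Iab ab _ _ ->]]] := oitv_exhaust.
have H n : {ae leb, forall x, a n < x < b n -> derivable g x 1}.
  by apply: ac_derivable => //; have [Ia Ib] := Iab n; exact: oitv_ac_list.
apply: aeS (ae_foralln H) => x Hx [n _ /=]; rewrite in_itv /=; exact: Hx.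
Qed.

(** The regularity common to the representatives of both forms: absolute continuity on the open
    interval, supplemented by continuity at an end that belongs to [T]. *)
Definition ac_rep g := [/\ {within Itv T, continuous g}, abs_cont_on (oitv T) g &
  (\int[leb]_(x in oitv T) ((derive1 g x) ^+ 2)%:E < +oo)%E].

(** Inside the open interval this is [ac_slope]; continuity at [x] and [y] extends the bound to an
    interval that reaches an end. *)
Lemma ac_rep_slope g x y : ac_rep g -> Itv T x -> Itv T y -> x < y ->
  (((g y - g x) ^+ 2 / (y - x))%:E <= \int[leb]_(z in `]x, y[%classic) ((derive1 g z) ^+ 2)%:E)%E.
Proof.
move=> [/continuous_onP cg acg gi] Ix Iy xy; have yx : 0 < y - x by rewrite subr_gt0.
have sub : `]x, y[%classic `<=` oitv T.
  by move=> z; rewrite /= in_itv /= => /andP[xz zy]; exact: (oitv_between Ix Iy).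
have mg : measurable_fun (oitv T : set (measurableTypeR R)) (fun x => ((derive1 g x) ^+ 2)%:E).
  by apply/measurable_EFinP/measurable_funX; exact: oitv_ac_measurable.
have mxy : measurable (`]x, y[%classic : set (measurableTypeR R)) by exact: measurable_itv.
have g0 z : (0 <= ((derive1 g z) ^+ 2)%:E)%E by rewrite lee_fin sqr_ge0.
set M := (\int[leb]_(z in _) _)%E.
have M0 : (0 <= M)%E by exact: integral_ge0.
have Mf : M \is a fin_num.
  rewrite ge0_fin_numE //; apply: le_lt_trans gi; apply: ge0_subset_integral => //.
  exact: measurable_oitv.
rewrite -(fineK Mf) lee_fin ler_pdivrMr //; set m := fine M.
have m0 : 0 <= m by exact: fine_ge0.
have inner u v : x < u -> u < v -> v < y -> `|g v - g u| <= Num.sqrt (m * (y - x)).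
  move=> xu uv vy; have Iu := oitv_between Ix Iy xu (lt_trans uv vy).
  have Iv := oitv_between Ix Iy (lt_trans xu uv) vy.
  have acuv := oitv_ac_list acg Iu Iv (ltW uv).
  rewrite -sqrtr_sqr ler_wsqrtr //.
  have : (((g v - g u) ^+ 2 / (v - u))%:E <= M)%E.
    apply: le_trans (ac_slope uv acuv) _; apply: ge0_subset_integral => //.
    - by apply: (measurable_funS _ _ mg) => //; exact: measurable_oitv.
    - move=> z; rewrite /= !in_itv /= => /andP[uz zv]; apply/andP; split; lra.
  rewrite -(fineK Mf) lee_fin ler_pdivrMr ?subr_gt0 // => h; apply: le_trans h _.
  by rewrite ler_wpM2l //; lra.
have : `|g y - g x| <= Num.sqrt (m * (y - x)).
  apply/ler_addgt0Pr => e e0; have e2 : 0 < e / 2 by rewrite divr_gt0.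
  have [d1 d10 H1] := cg x Ix _ e2; have [d2 d20 H2] := cg y Iy _ e2.
  pose k := Num.min (Num.min d1 d2) (y - x).
  have [k0 kd1 kd2 kxy] : [/\ 0 < k, k <= d1, k <= d2 & k <= y - x].
    by rewrite /k !lt_min !ge_min d10 d20 yx !lexx !orbT.
  have h1 : x < x + k / 3 by lra.
  have h2 : x + k / 3 < y - k / 3 by lra.
  have h3 : y - k / 3 < y by lra.
  have Iu := oitv_Itv (oitv_between Ix Iy h1 (lt_trans h2 h3)).
  have Iv := oitv_Itv (oitv_between Ix Iy (lt_trans h1 h2) h3).
  have A : `|g x - g (x + k / 3)| < e / 2.
    by apply: H1 => //; rewrite opprD addrA subrr sub0r normrN gtr0_norm //; lra.
  have B : `|g y - g (y - k / 3)| < e / 2.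
    by apply: H2 => //; rewrite opprB addrC subrK gtr0_norm //; lra.
  have C := inner _ _ h1 h2 h3.
  have -> : g y - g x = (g y - g (y - k / 3)) + (g (y - k / 3) - g (x + k / 3)) - (g x - g (x + k / 3)) by ring.
  apply: le_trans (ler_normB _ _) _; rewrite [in leRHS](splitr e) [leRHS]addrA; apply: lerD _ (ltW A).
  by apply: le_trans (ler_normD _ _) _; rewrite [leLHS]addrC; exact: (lerD C (ltW B)).
rewrite -[X in X ^+ 2 <= _]subr0 -real_normK ?num_real // subr0.
move=> /(lerXn2r 2 (normr_ge0 _) (sqrtr_ge0 _)); rewrite sqr_sqrtr // mulr_ge0 // ltW //.
Qed.

(** The links of a chain occupy disjoint intervals; [tail x] is the part of the open interval left
    to the links after [x]. *)
Lemma ac_rep_csum g c : ac_rep g -> chain T c ->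
  ((csum id g g c)%:E <= \int[leb]_(x in oitv T) ((derive1 g x) ^+ 2)%:E)%E.
Proof.
move=> rg; have [_ acg gi] := rg.
have mg : measurable_fun (oitv T : set (measurableTypeR R)) (fun x => ((derive1 g x) ^+ 2)%:E).
  by apply/measurable_EFinP/measurable_funX; exact: oitv_ac_measurable.
have g0 z : (0 <= ((derive1 g z) ^+ 2)%:E)%E by rewrite lee_fin sqr_ge0.
pose tail x : set (measurableTypeR R) := oitv T `&` `]x, +oo[%classic.
have mtail x : measurable (tail x) by apply: measurableI; [exact: measurable_oitv|exact: measurable_itv].
have mgt x : measurable_fun (tail x) (fun x => ((derive1 g x) ^+ 2)%:E).
  exact: (measurable_funS measurable_oitv (@subIsetl _ _ _) mg).
suff H x p : chain T (x :: p) ->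
    ((csum id g g (x :: p))%:E <= \int[leb]_(x in tail x) ((derive1 g x) ^+ 2)%:E)%E.
  case: c => [_|x p /H h]; first exact: integral_ge0.
  apply: le_trans h _; apply: ge0_subset_integral => //; [exact: measurable_oitv|exact: subIsetl].
elim: p x => [|y p IH] x; first by move=> _; exact: integral_ge0.
move=> /chain_cons[Tx cp xp]; have xy : x < y by apply: xp; rewrite mem_head.
have Ty : T y by case/chain_cons : cp.
have sub : `]x, y[%classic `<=` oitv T.
  by move=> z; rewrite /= in_itv /= => /andP[xz zy]; exact: (oitv_between (or_intror Tx) (or_intror Ty)).
rewrite csum_cons2 EFinD -expr2.
have mxy : measurable (`]x, y[%classic : set (measurableTypeR R)) by exact: measurable_itv.
apply: le_trans (leeD (ac_rep_slope rg (or_intror Tx) (or_intror Ty) xy) (IH _ cp)) _.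
rewrite -ge0_integral_setU //.
- apply: ge0_subset_integral => //; first exact: measurableU.
  move=> z [|[Iz]] /=; rewrite !in_itv /= => /andP[xz zy].
    by split; [apply: sub; rewrite /= in_itv /= xz|rewrite /= in_itv /= xz].
  by split=> //=; rewrite in_itv /= (lt_trans xy).
- by apply: (measurable_funS measurable_oitv _ mg) => z [/sub//|[]].
- apply/disj_setPS => z [/=]; rewrite in_itv /= => /andP[_ zy] [_ /=].
  by rewrite in_itv /= => /andP[yz _]; have := lt_trans zy yz; rewrite ltxx.
Qed.

Lemma ac_rep_fin_energy g : ac_rep g -> fin_energy id T g /\
  ((energy id T g g)%:E <= \int[leb]_(x in oitv T) ((derive1 g x) ^+ 2)%:E)%E.
Proof.
move=> rg; have [_ _ gi] := rg; set M := (\int[leb]_(x in _) _)%E in gi *.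
have Mf : M \is a fin_num.
  by rewrite ge0_fin_numE //; apply: integral_ge0 => x _; rewrite lee_fin sqr_ge0.
have H c : chain T c -> csum id g g c <= fine M.
  by move=> cc; rewrite -lee_fin fineK //; exact: ac_rep_csum.
split; first by exists (fine M).
by rewrite -[leRHS]fineK // lee_fin; apply: energy_le => // x y.
Qed.

End ac_representatives.

(** * Energy as the integral of the squared derivative *)

Section interpolated_energy.
Context {R : realType} {T : set R} (gT : gapped T).
Implicit Types (f g q : R -> R).
Local Notation leb := (@lebesgue_measure R).

Let id_incr (A : set R) : increasing_on A id. Proof. by []. Qed.

Section finite_energy.
Variable f : R -> R.
Hypothesis ff : fin_energy id T f.

(** Energy of [f] up to [x]: the monotone function that controls [f] in the sense of
    [sbar_control]. *)
Let q x := energy id (lo T x) f f.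
Let Q := energy id T f f.

Let q_cut x y : T x -> x <= y -> q y = q x + energy id (cut T x y) f f.
Proof.
move=> Tx xy; have fl := fin_energy_sub (@lo_sub R T y) ff.
have Tlx : lo T y x by [].
rewrite /q (energy_split (@id_incr _) Tlx fl fl) hi_lo; congr (energy id _ f f + _).
apply/seteqP; split=> z; first by move=> [[Tz _] zx].
by move=> [Tz zx]; split=> //; split=> //=; exact: le_trans zx xy.
Qed.

Let q_homo : {in T &, {homo q : x y / x <= y}}.
Proof.
move=> x y /set_mem Tx _ xy; rewrite (q_cut Tx xy) lerDl; apply: energy_ge0 => //.
exact: fin_energy_sub (@cut_sub R T x y) ff.
Qed.

Let fq x y : T x -> T y -> x <= y -> (f y - f x) ^+ 2 <= (q y - q x) * (y - x).
Proof.
move=> Tx Ty xy; rewrite (q_cut Tx xy) addrAC subrr add0r mulrC.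
by apply: (@increment_le _ T id) => //; exact: fin_energy_sub (@cut_sub R T x y) ff.
Qed.

Let q_ge0 x : 0 <= q x.
Proof. by apply: energy_ge0 => //; exact: fin_energy_sub (@lo_sub R T x) ff. Qed.

Let q_le x : q x <= Q.
Proof. by apply: energy_sub => //; exact: lo_sub. Qed.

Let sq_bound x : Itv T x -> 0 <= sbar T q x <= Q.
Proof.
have Q0 : 0 <= Q by exact: energy_ge0.
move=> /(Itv_cases gT)[Tx|[c [d [G cx xd]]]]; first by rewrite sbar_in // q_ge0 q_le.
have [/= Tc [Td [cd nT]]] := G; rewrite (sbar_gap q G (ltW cx) (ltW xd)).
have qcd : 0 <= q d - q c by rewrite subr_ge0 q_homo ?inE // ltW.
apply/andP; split.
- by rewrite addr_ge0 // mulr_ge0 ?subr_ge0 ?(ltW cx) // divr_ge0 // subr_ge0 ltW.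
- apply: le_trans (q_le d); rewrite -lerBrDl mulrAC ler_pdivrMr ?subr_gt0 //.
  by rewrite ler_wpM2l // lerB // (ltW xd).
Qed.

Let control x y : Itv T x -> Itv T y -> x <= y ->
  (sbar T f y - sbar T f x) ^+ 2 <= (sbar T q y - sbar T q x) * (y - x).
Proof. exact: (sbar_control gT fq q_homo). Qed.

Let sub_itv x y z : Itv T x -> Itv T y -> x <= z -> z <= y -> Itv T z.
Proof. exact: Itv_between. Qed.

Lemma sbar_holder x y : Itv T x -> Itv T y ->
  (sbar T f y - sbar T f x) ^+ 2 <= Q * `|y - x|.
Proof.
wlog xy : x y / x <= y => [H Ix Iy|Ix Iy].
  by have [xy|/ltW yx] := leP x y; [|rewrite -sqrrN opprB distrC]; exact: H.
rewrite ger0_norm ?subr_ge0 //; apply: le_trans (control Ix Iy xy) _.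
rewrite ler_wpM2r ?subr_ge0 //.
by have /andP[_ h1] := sq_bound Iy; have /andP[h2 _] := sq_bound Ix; lra.
Qed.

Lemma sbar_abs_cont : abs_cont_on (Itv T) (sbar T f).
Proof.
apply/abs_cont_onP => a b; rewrite le_eqVlt => /predU1P[-> _|ab sub].
  move=> e e0; exists 1 => // l fl _; rewrite (_ : var _ l = 0) //.
  rewrite /var big_seq big1 // => p pl; have [h1 h2 h3] := fam_bound fl pl.
  have -> : p.2 = p.1 by lra.
  by rewrite subrr normr0.
have I z : a <= z -> z <= b -> Itv T z.
  by move=> az zb; apply: sub; rewrite /= in_itv /= az.
apply: (@control_ac _ _ (sbar T q) a b) => //.
- by move=> x y ax xy yb; apply: (sbar_homo gT q_homo) => //; apply: I; lra.
- by move=> x y ax xy yb; apply: control => //; apply: I; lra.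
Qed.

Lemma sbar_continuous : {within Itv T, continuous (sbar T f)}.
Proof.
have Q0 : 0 <= Q by exact: energy_ge0.
apply/continuous_onP => x Ix e e0; exists (e ^+ 2 / (Q + 1)) => [|y Iy xy].
  by rewrite divr_gt0 ?exprn_gt0 // ltr_wpDl.
rewrite -ltr_sqr ?nnegrE // ?(ltW e0) // real_normK ?num_real //.
apply: le_lt_trans (sbar_holder Iy Ix) _.
move: xy; rewrite ltr_pdivlMr ?ltr_wpDl // mulrC => h; apply: le_lt_trans h.
by rewrite ler_wpM2r // lerDl.
Qed.

Lemma oitv_abs_cont g : abs_cont_on (Itv T) g -> abs_cont_on (oitv T) g.
Proof. by move=> acg a b ab sub; apply: acg => // z /sub; left. Qed.

(** By [control_energy] the integral over an inner interval is at most an increment of the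
    interpolated [q], hence at most [Q]; monotone convergence gives the open interval. *)
Lemma sbar_energy_le :
  (\int[leb]_(x in oitv T) ((derive1 (sbar T f) x) ^+ 2)%:E <= Q%:E)%E.
Proof.
have ac := oitv_abs_cont sbar_abs_cont; have md := oitv_ac_measurable gT ac.
have [a [b [Iab ab a_ni b_nd E]]] := oitv_exhaust gT.
pose h x := ((derive1 (sbar T f) x) ^+ 2)%:E; pose A n := (`]a n, b n[%classic : set (measurableTypeR R)).
have sA n : A n `<=` oitv T by rewrite E => x Ax; exists n.
have mh n : measurable_fun (A n) h.
  by apply/measurable_EFinP/measurable_funX; exact: measurable_funS (measurable_oitv) (sA n) md.
have h0 x : (0 <= h x)%E by rewrite lee_fin sqr_ge0.
have C := @ge0_nondecreasing_set_cvg_integral _ _ _ A h leb.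
have {C}/(cvg_lim (@ereal_hausdorff R)) C : (\int[leb]_(x in A i) h x)%E @[i --> \oo] -->
    (\int[leb]_(x in \bigcup_i A i) h x)%E.
  apply: C => //.
  - move=> m n mn; apply/subsetPset => x; rewrite /A /= !in_itv /= => /andP[ax xb]; apply/andP; split.
    + exact: le_lt_trans (a_ni _ _ mn) ax.
    + exact: lt_le_trans xb (b_nd _ _ mn).
  - by move=> i; exact: measurable_itv.
rewrite E -C; apply: lime_le.
  apply/ereal_nondecreasing_is_cvgn => m n mn; apply: ge0_subset_integral => //; try exact: measurable_itv.
  move=> x; rewrite /A /= !in_itv /= => /andP[ax xb]; apply/andP; split.
    exact: le_lt_trans (a_ni _ _ mn) ax.
  exact: lt_le_trans xb (b_nd _ _ mn).
apply: nearW => n; have [Ia Ib] := Iab n.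
have := ab n; rewrite le_eqVlt => /predU1P[e|abn].
  by rewrite /A e set_itv_ge ?bnd_simp ?ltxx // integral_set0 lee_fin; exact: energy_ge0.
apply: le_trans (@control_energy _ (sbar T f) (sbar T q) _ _ abn _ _) _.
- move=> x y ax xy yb; apply: (sbar_homo gT q_homo) => //; apply: sub_itv (or_introl Ia) (or_introl Ib) _ _; lra.
- move=> x y ax xy yb; apply: control => //; apply: sub_itv (or_introl Ia) (or_introl Ib) _ _; lra.
rewrite lee_fin; have /andP[_ h1] := sq_bound (or_introl Ib); have /andP[h2 _] := sq_bound (or_introl Ia); lra.
Qed.

Lemma sbar_ac_rep : ac_rep (T := T) (sbar T f).
Proof.
split; [exact: sbar_continuous|exact: oitv_abs_cont sbar_abs_cont|].
by apply: le_lt_trans sbar_energy_le _; rewrite ltry.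
Qed.

End finite_energy.

Lemma energy_integral f : fin_energy id T f ->
  ((energy id T f f)%:E = \int[leb]_(x in oitv T) ((derive1 (sbar T f) x) ^+ 2)%:E)%E.
Proof.
move=> ff; apply/eqP; rewrite eq_le sbar_energy_le // andbT.
have [_ h] := ac_rep_fin_energy gT (sbar_ac_rep ff); apply: le_trans h.
by rewrite lee_fin le_eqVlt; apply/orP; left; apply/eqP/eq_energy => x Tx; rewrite sbar_in.
Qed.

End interpolated_energy.

(** * Contribution of the gaps *)

Section gap_decomposition.
Context {R : realType} {T : set R} (gT : gapped T).
Implicit Types (f g : R -> R) (p : R * R).
Local Notation leb := (@lebesgue_measure R).

Lemma gap_unique p p' x : gaps T p -> gaps T p' -> p.1 < x < p.2 -> p'.1 < x < p'.2 -> p = p'.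
Proof.
case: p p' => [c d] [c' d'] G G' /= /andP[cx xd] /andP[cx' xd'].
by rewrite -(gap_sup G cx xd) -(gap_inf G cx xd) (gap_sup G' cx' xd') (gap_inf G' cx' xd').
Qed.

Let code_ex : exists code : R * R -> nat, {in gaps T &, injective code}.
Proof.
pose r p : rat := xget 0 [set r : rat | p.1 < ratr r < p.2].
have rP p : gaps T p -> p.1 < ratr (r p) < p.2.
  move=> [_ [_ [pp _]]]; rewrite /r; case: xgetP => // H.
  by have [q] := rat_in_itvoo pp; rewrite in_itv /= => /H.
exists (fun p => pickle (r p)) => p p' /set_mem G /set_mem G' /(pcan_inj pickleK) e.
apply: (gap_unique G G' (rP _ G)); rewrite e; exact: rP.
Qed.

Lemma countable_gaps : countable (gaps T).
Proof. exact/countable_injP/code_ex. Qed.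

Lemma integral_gaps (w : R -> R) (c : R * R -> R) :
  measurable_fun (oitv T `\` T : set (measurableTypeR R)) w -> (forall x, 0 <= w x) ->
  (forall p x, gaps T p -> p.1 < x < p.2 -> w x = c p) ->
  (\int[leb]_(x in oitv T `\` T) (w x)%:E = \esum_(p in gaps T) (c p * (p.2 - p.1))%:E)%E.
Proof.
move=> mw w0 wc; have [code inj] := code_ex.
pose F n : set (measurableTypeR R) := [set x | exists p, [/\ gaps T p, code p = n & p.1 < x < p.2]].
have FE p : gaps T p -> F (code p) = `]p.1, p.2[%classic.
  move=> G; apply/seteqP; split=> x; rewrite /= in_itv /=.
    by move=> [p' [G' e xp']]; rewrite -(inj p' p _ _ e) // inE.
  by move=> xp; exists p.
have F0 n : ~ (code @` gaps T) n -> F n = set0.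
  by move=> nn; apply/seteqP; split=> // x [p [G e _]]; apply: nn; exists p.
have mF n : measurable (F n).
  have [[p G <-]|/F0 ->//] := pselect ((code @` gaps T) n).
  by rewrite FE //; exact: measurable_itv.
have UF : oitv T `\` T = \bigcup_n F n.
  apply/seteqP; split=> x.
  - move=> [Ix nTx]; have [//|[p1 [p2 [G h1 h2]]]] := Itv_cases gT (or_introl Ix).
    by exists (code (p1, p2)) => //; exists (p1, p2); rewrite /= h1 h2.
  - move=> [n _ [[p1 p2] [G _ /= /andP[h1 h2]]]]; split; first exact: gap_oitv G h1 h2.
    by have [_ [_ [_ nT]]] := G; apply: nT; rewrite /= h1 h2.
have w0' x : (0 <= (w x)%:E)%E by rewrite lee_fin.
rewrite UF ge0_integral_bigcup //; last 2 first.
- by apply/measurable_EFinP; rewrite -UF.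
- move=> m n _ _ [x [[p [G <- xp]] [p' [G' <- xp']]]].
  by rewrite (gap_unique G G' xp xp').
rewrite nneseries_esumT; last by move=> n; exact: integral_ge0.
have -> : (\esum_(i in [set: nat]) \int[leb]_(x in F i) (w x)%:E =
           \esum_(i in code @` gaps T) \int[leb]_(x in F i) (w x)%:E)%E.
  rewrite [RHS]esum_mkcond; apply: eq_esum => n _; case: ifPn => // /negP nn.
  by rewrite F0 ?integral_set0 // => H; apply: nn; rewrite inE.
rewrite (reindex_esum (gaps T) (code @` gaps T) code); last exact: inj_bij.
apply: eq_esum => p G; rewrite FE //; have [_ [_ [pp _]]] := G.
rewrite (@eq_integral _ _ _ leb _ (cst (c p)%:E)); last first.
  by move=> x; rewrite inE /= in_itv /= => /(wc _ _ G) ->.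
rewrite integral_cst; last exact: measurable_itv.
by rewrite [X in (_ * X)%E]lebesgue_measure_itv /= lte_fin pp EFinM EFinB.
Qed.

Lemma derive1_gap f c d x : gaps T (c, d) -> c < x -> x < d ->
  derivable (sbar T f) x 1 /\ derive1 (sbar T f) x = (f d - f c) / (d - c).
Proof.
move=> G cx xd; set m := _ / _.
have H : \forall y \near x, sbar T f y = (f c + m * (y - c)).
  near=> y; apply: (sbar_gap f G); apply: ltW; near: y; [exact: lt_nbhsr|exact: lt_nbhsl].
have L : is_derive x (1 : R) (fun y => f c + m * (y - c)) m.
  by apply: is_derive_eq; rewrite subr0 [_ *: _]mulr1 add0r mul1r.
have [D E] := near_derive1 H; rewrite E derive1E; split; last exact: derive_val.
by apply/D; exact: ex_derive.
Unshelve. all: by end_near. Qed.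

Lemma right_accumulation x : T x -> oitv T x -> ~ (fst @` gaps T) x ->
  forall e : R, 0 < e -> exists t, [/\ T t, x < t & t < x + e].
Proof.
move=> Tx /(oitvP _)[_ [b [_ Tb _ xb]]] nL e e0; apply: contrapT => H.
pose y := x + Num.min e (b - x) / 2; pose k := Num.min e (b - x).
have [k0 ke kb] : [/\ 0 < k, k <= e & k <= b - x] by rewrite /k lt_min !ge_min e0 subr_gt0 xb !lexx orbT.
have xy : x < x + k / 2 by lra.
have yb : x + k / 2 < b by lra.
have nTy : ~ T (x + k / 2) by move=> Ty; apply: H; exists (x + k / 2); split=> //; lra.
have [c [d [G cy yd]]] := gT.2 _ _ _ Tx Tb xy yb nTy.
apply: nL; exists (c, d) => //=; have [/= Tc [Td [cd nT]]] := G.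
apply/eqP; rewrite eq_le; apply/andP; split; rewrite leNgt; apply/negP => h.
- by apply: H; exists c; split=> //; lra.
- by apply: (nT x) => //; rewrite h (lt_trans xy).
Qed.

(** At a point approached from the right by points of [T] the difference quotients of [f] and [g]
    coincide for arbitrarily small increments. The other points of [T] in the open interval are left
    endpoints of gaps, countably many. *)
Lemma derive1_agree f g : (forall x, T x -> f x = g x) ->
  {ae leb, forall x, oitv T x -> derivable f x 1} ->
  {ae leb, forall x, oitv T x -> derivable g x 1} ->
  {ae leb, forall x, T x -> oitv T x -> derive1 f x = derive1 g x}.
Proof.
move=> fg df dg.
have nL : {ae leb, forall x, ~ (fst @` gaps T) x}.
  have cL : countable (fst @` gaps T) := sub_countable (card_image_le _ _) countable_gaps.
  exists (fst @` gaps T); split; [|exact: countable_lebesgue_measure0|by move=> x /= /contrapT].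
  by apply: countable_measurable => // t; exact: measurable_set1.
have dfg : {ae leb, forall x, oitv T x -> derivable f x 1 /\ derivable g x 1}.
  by apply: aeS2 df dg => x dfx dgx Ix; split; [exact: dfx|exact: dgx].
apply: aeS2 dfg nL => x dx nLx Tx Ix; have [/cvg_derive1 + /cvg_derive1] := dx Ix.
move=> cf cg; have C : quot f h x - quot g h x @[h --> 0^'] --> derive1 f x - derive1 g x by exact: cvgB.
apply/eqP; rewrite -subr_eq0 -normr_le0; apply/ler_addgt0Pr => e e0; rewrite add0r.
have /nbhs_ballP[r /= r0 Hr] : \forall h \near nbhs (0 : R), h != 0 ->
  `|derive1 f x - derive1 g x - (quot f h x - quot g h x)| < e by exact: ((cvgrPdist_lt _ _).1 C e e0).
have [t [Tt xt tr]] := right_accumulation Tx Ix nLx r0.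
have := Hr (t - x); rewrite /ball /= sub0r normrN gtr0_norm ?subr_gt0 // ltrBlDl => /(_ tr).
rewrite subr_eq0 gt_eqF // => /(_ isT).
by rewrite /quot subrK !fg // subrr subr0 => /ltW.
Qed.

End gap_decomposition.

(** * The energy formula for representatives *)

Section energy_formula.
Context {R : realType} {T : set R} (gT : gapped T).
Implicit Types (f g h : R -> R).
Local Notation leb := (@lebesgue_measure R).
Let mO : measurable (oitv T : set (measurableTypeR R)) := measurable_oitv.
Let mT : measurable (T : set (measurableTypeR R)) := gapped_measurable gT.

Lemma Itv_ends x : Itv T x -> ~ oitv T x -> x = fine (lend T) \/ x = fine (rend T).
Proof.
move=> [//|Tx]; rewrite /oitv /= => nO.
have l : (lend T <= x%:E)%E by apply: ereal_inf_lbound; exists x.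
have r : (x%:E <= rend T)%E by apply: ereal_sup_ubound; exists x.
move: l; rewrite le_eqVlt => /predU1P[->|lx]; first by left.
move: r; rewrite le_eqVlt => /predU1P[<-|xr]; first by right.
by case: nO; rewrite lx xr.
Qed.

Section ends.
Variables (A : set (measurableTypeR R)) (w : R -> \bar R).
Hypotheses (mA : measurable A) (AI : A `<=` Itv T).
Hypothesis mw : measurable_fun (A `&` oitv T) w.

Let countable_ends : countable (A `\` oitv T).
Proof.
apply: (@sub_countable _ _ _ [set fine (lend T); fine (rend T)]); last first.
  exact/finite_set_countable/finite_set2.
by apply: subset_card_le => x [/AI Ix nO]; exact: Itv_ends.
Qed.

Let AE : A = (A `&` oitv T) `|` (A `\` oitv T).
Proof. by rewrite setUIDK. Qed.

Let m1 := measurableI _ _ mA mO.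
Let m2 := measurableD mA mO.

Lemma measurable_fun_Itv : measurable_fun A w.
Proof.
rewrite AE; apply/measurable_funU => //; split=> // mB Y mY.
apply: countable_measurable => [t|]; first exact: measurable_set1.
by apply: sub_countable countable_ends; apply: subset_card_le => x [].
Qed.

(** At most the two ends of the interval are removed, and they form a null set. *)
Lemma integral_Itv : (\int[leb]_(x in A) w x = \int[leb]_(x in A `&` oitv T) w x)%E.
Proof.
rewrite [in LHS]AE integral_setU //.
- rewrite [X in (_ + X)%E]null_set_integral ?adde0 //; last exact: countable_lebesgue_measure0.
  apply: measurable_funS mA _ measurable_fun_Itv; exact: subDsetl.
- by rewrite -AE; exact: measurable_fun_Itv.
- by apply/disj_setPS => x [[_ ?] []].
Qed.

End ends.

Lemma ac_rep_product g h : ac_rep (T := T) g -> ac_rep (T := T) h ->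
  leb.-integrable (oitv T) (fun x => (derive1 g x * derive1 h x)%:E).
Proof.
move=> [cg ag ig] [ch ah ih].
have mg := oitv_ac_measurable gT ag; have mh := oitv_ac_measurable gT ah.
have sq0 f x : (0 <= ((derive1 f x) ^+ 2)%:E)%E by rewrite lee_fin sqr_ge0.
apply/integrableP; split; first by apply/measurable_EFinP; exact: measurable_funM.
apply: (@le_lt_trans _ _ (\int[leb]_(x in oitv T) (((derive1 g x) ^+ 2)%:E + ((derive1 h x) ^+ 2)%:E))%E).
  apply: ge0_le_integral => //.
  - by apply: measurableT_comp => //; apply/measurable_EFinP; exact: measurable_funM.
  - by apply: emeasurable_funD; apply/measurable_EFinP; exact: measurable_funX.
  - move=> x _; rewrite -EFinD lee_fin; move: (derive1 g x) (derive1 h x) => p q.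
    rewrite ler_norml; apply/andP; split; have := sqr_ge0 (p + q); have := sqr_ge0 (p - q);
    have := sqr_ge0 p; have := sqr_ge0 q; nra.
rewrite ge0_integralD //; try by apply/measurable_EFinP; exact: measurable_funX.
by apply: lte_add_pinfty; [exact: ig|exact: ih].
Qed.

(** Polarisation of [energy_integral]: the interpolation of a sum is the sum of the interpolations,
    and derivatives are additive where both exist, that is almost everywhere. *)
Lemma energy_integral2 g h : fin_energy id T g -> fin_energy id T h ->
  ((energy id T g h)%:E =
   \int[leb]_(x in oitv T) (derive1 (sbar T g) x * derive1 (sbar T h) x)%:E)%E.
Proof.
move=> fg fh; pose gg := sbar T g; pose hh := sbar T h; pose kk := sbar T (fun x => g x + h x).
have [[_ ag _] rh] := (sbar_ac_rep gT fg, sbar_ac_rep gT fh); have [_ ah _] := rh.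
have rg := sbar_ac_rep gT fg.
have fk := fin_energyD (fun (x y : R) (_ : T x) (_ : T y) H => H) fg fh.
have rk := sbar_ac_rep gT fk; have [_ ak _] := rk.
have igg := ac_rep_product rg rg; have igh := ac_rep_product rg rh; have ihh := ac_rep_product rh rh.
set I := (\int[leb]_(x in oitv T) (derive1 gg x * derive1 hh x)%:E)%E.
have If : I \is a fin_num by exact: integrable_fin_num.
have mgg := oitv_ac_measurable gT ag; have mhh := oitv_ac_measurable gT ah.
have mkk := oitv_ac_measurable gT ak.
have sq f : fin_energy id T f ->
    (\int[leb]_(x in oitv T) (derive1 (sbar T f) x * derive1 (sbar T f) x)%:E = (energy id T f f)%:E)%E.
  by move=> ff; rewrite energy_integral //; apply: eq_integral => x _; rewrite expr2.
have : (energy id T (fun x => (g x + h x)%R) (fun x => (g x + h x)%R))%:E =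
    ((energy id T g g)%:E + (2%:E * I + (energy id T h h)%:E))%E.
  rewrite -!sq // -/gg -/hh -/kk -integralZl //.
  have i2 := integrableZl mO 2 igh.
  rewrite -integralD // -integralD //; last exact: integrableD.
  apply: ae_eq_integral => //.
  - by apply/measurable_EFinP; exact: measurable_funM.
  - have m1 := (measurable_EFinP _ _).2 (measurable_funM mgg mgg).
    have m2 := (measurable_EFinP _ _).2 (measurable_funM mhh mhh).
    have m3 := (measurable_EFinP _ _).2 (measurable_funM mgg mhh).
    exact: (emeasurable_funD m1 (emeasurable_funD (measurable_funeM 2%:E m3) m2)).
  - have dgh : {ae leb, forall x, oitv T x -> derivable gg x 1 /\ derivable hh x 1}.
      apply: aeS2 (oitv_ac_derivable gT ag) (oitv_ac_derivable gT ah) => x a b Ix.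
      by split; [exact: a|exact: b].
    apply: aeS dgh => x dx Ix; have [dg dh] := dx Ix.
    have N : \forall y \near x, kk y = (gg \+ hh) y.
      near=> y; rewrite /kk /= (_ : (fun x => g x + h x) = (fun x => 1 * g x + h x)).
        rewrite sbar_linear ?mul1r //; left; near: y; exact: open_nbhs_nbhs (conj open_oitv Ix).
      by apply/funext => z; rewrite mul1r.
    rewrite (near_derive1 N).2 !derive1E (deriveD dg dh) -!EFinM -!EFinD; congr EFin; ring.
rewrite energyD // -(fineK If) -EFinM -!EFinD => -[e]; congr EFin; lra.
Unshelve. all: by end_near. Qed.

(** The integral of [energy_integral2] splits into [T] and the gaps. On [T] the derivatives of the
    representatives replace those of the interpolations ([derive1_agree]); on a gap the
    interpolation is affine and yields the term of the sum. *)
Lemma energy_formula g h : ac_rep (T := T) g -> ac_rep (T := T) h ->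
  energy id T g h = fine (\int[leb]_(x in T) (derive1 g x * derive1 h x)%:E)
    + gap_sum T (fun p => (g p.2 - g p.1) * (h p.2 - h p.1) / (p.2 - p.1)).
Proof.
move=> rg rh; have [fg _] := ac_rep_fin_energy gT rg; have [fh _] := ac_rep_fin_energy gT rh.
have [_ ag _] := rg; have [_ ah _] := rh.
have [_ agg _] := sbar_ac_rep gT fg; have [_ ahh _] := sbar_ac_rep gT fh.
have ii := ac_rep_product (sbar_ac_rep gT fg) (sbar_ac_rep gT fh).
pose w x := derive1 (sbar T g) x * derive1 (sbar T h) x.
have mw : measurable_fun (oitv T : set (measurableTypeR R)) w.
  by apply: measurable_funM; exact: oitv_ac_measurable.
have mw' : measurable_fun (oitv T : set (measurableTypeR R)) (fun x => derive1 g x * derive1 h x).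
  by apply: measurable_funM; exact: oitv_ac_measurable.
have mD := measurableD mO mT; have mI := measurableI _ _ mO mT; have mI' := measurableI _ _ mT mO.
have iD : leb.-integrable (oitv T `\` T) (EFin \o w) by apply: integrableS ii => //; exact: subDsetl.
have iI : leb.-integrable (oitv T `&` T) (EFin \o w) by apply: integrableS ii => //; exact: subIsetl.
have E1 : (energy id T g h)%:E = (\int[leb]_(x in oitv T `&` T) (w x)%:E + \int[leb]_(x in oitv T `\` T) (w x)%:E)%E.
  rewrite energy_integral2 // -[in LHS](setUIDK (oitv T) T) integral_setU //.
  - by rewrite setUIDK; exact/measurable_EFinP.
  - by apply/disj_setPS => x [[_ ?] []].
have E2 : (\int[leb]_(x in T) (derive1 g x * derive1 h x)%:E = \int[leb]_(x in oitv T `&` T) (w x)%:E)%E.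
  have mTO : measurable_fun (T `&` oitv T : set (measurableTypeR R)) (fun x => (derive1 g x * derive1 h x)%:E).
    by apply/measurable_EFinP; apply: (measurable_funS mO (@subIsetr _ _ _) mw').
  rewrite (integral_Itv mT (@sub_Itv _ T) mTO) setIC; apply: ae_eq_integral => //.
  - by apply/measurable_EFinP; apply: (measurable_funS mO (@subIsetl _ _ _) mw').
  - by apply/measurable_EFinP; apply: (measurable_funS mO (@subIsetl _ _ _) mw).
  - have dg := derive1_agree gT (fun x Tx => esym (sbar_in g Tx)) (oitv_ac_derivable gT ag) (oitv_ac_derivable gT agg).
    have dh := derive1_agree gT (fun x Tx => esym (sbar_in h Tx)) (oitv_ac_derivable gT ah) (oitv_ac_derivable gT ahh).
    by apply: aeS2 dg dh => x eg eh [Ox Tx]; rewrite /w eg // eh.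
(* For [s = 1] and [s = -1] these are the positive and negative parts that [gap_sum] subtracts. *)
have gapE (s : R) : (\int[leb]_(x in oitv T `\` T) (Num.max (s * w x) 0)%:E =
    \esum_(p in gaps T) (Num.max (s * ((g p.2 - g p.1) * (h p.2 - h p.1) / (p.2 - p.1))) 0)%:E)%E.
  pose c p := Num.max (s * ((g p.2 - g p.1) / (p.2 - p.1) * ((h p.2 - h p.1) / (p.2 - p.1)))) 0.
  rewrite (integral_gaps gT (c := c)).
  - apply: eq_esum => p [_ [_ [pp _]]]; have pp0 : 0 < p.2 - p.1 by rewrite subr_gt0.
    have M (a : R) : Num.max a 0 * (p.2 - p.1) = Num.max (a * (p.2 - p.1)) 0.
      by rewrite (maxr_pMl _ _ (ltW pp0)) mul0r.
    rewrite /c M; congr (Num.max _ 0)%:E.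
    move: (g p.2 - g p.1) (h p.2 - h p.1) (p.2 - p.1) pp0 => a b l l0.
    by field; rewrite gt_eqF.
  - apply: measurable_maxr; [apply: measurable_funM; [exact: measurable_cst|]|exact: measurable_cst].
    exact: (measurable_funS mO (@subDsetl _ _ _) mw).
  - by move=> x; rewrite le_max lexx orbT.
  - move=> [p1 p2] x G /= /andP[h1 h2].
    by rewrite /w (derive1_gap g G h1 h2).2 (derive1_gap h G h1 h2).2.
have E3 : fine (\int[leb]_(x in oitv T `\` T) (w x)%:E)%E =
    gap_sum T (fun p => (g p.2 - g p.1) * (h p.2 - h p.1) / (p.2 - p.1)).
  rewrite integralE fineB; [|exact: integrable_pos_fin_num|exact: integrable_neg_fin_num].
  rewrite /gap_sum; congr (fine _ - fine _).
  - transitivity (\int[leb]_(x in oitv T `\` T) (Num.max (1 * w x) 0)%:E)%E.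
      by apply: eq_integral => x _; rewrite funeposE EFin_max mul1r.
    by rewrite gapE; apply: eq_esum => p _; rewrite mul1r.
  - transitivity (\int[leb]_(x in oitv T `\` T) (Num.max (-1 * w x) 0)%:E)%E.
      by apply: eq_integral => x _; rewrite funenegE EFin_max mulN1r EFinN.
    by rewrite gapE; apply: eq_esum => p _; rewrite mulN1r.
have -> : energy id T g h = fine (energy id T g h)%:E by [].
rewrite E1 fineD; [|exact: integrable_fin_num|exact: integrable_fin_num].
by rewrite E2 E3.
Qed.

End energy_formula.

(** * Quasidiffusions and scale functions *)

Section boundary.
Context {R : realType} {E : set R} (gE : gapped E).
Implicit Types (f s : R -> R) (b : bool).

(** [true] is the left end and [false] the right one, in agreement with the sign [(-1) ^+ b]. *)
Definition end_point b : \bar R := if b then lend E else rend E.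
Definition end_filter b : set_system R := if b then lfilter (lend E) else rfilter (rend E).
Definition end_value s b : \bar R := if b then sbar_l E s else sbar_r E s.

Lemma no_endP b : ~ ebar_in E (end_point b) <->
  forall x, E x -> exists2 y, E y & (-1) ^+ b * x < (-1) ^+ b * y.
Proof.
case: b; rewrite /end_point ?expr1 ?expr0.
- split=> [nE x Ex|H [a [la Ea]]]; last first.
    have [y Ey] := H a Ea; rewrite !mulN1r ltrN2 => ya.
    have : (lend E <= y%:E)%E by apply: ereal_inf_lbound; exists y.
    by rewrite la lee_fin leNgt ya.
  apply: contrapT => nH; apply: nE; exists x; split=> //; apply/eqP; rewrite eq_le; apply/andP; split.
    by apply: ereal_inf_lbound; exists x.
  apply: le_ereal_inf_tmp => _ [y Ey <-]; rewrite lee_fin leNgt; apply/negP => yx; apply: nH.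
  by exists y => //; rewrite !mulN1r ltrN2.
- split=> [nE x Ex|H [a [la Ea]]]; last first.
    have [y Ey] := H a Ea; rewrite !mul1r => ya.
    have : (y%:E <= rend E)%E by apply: ereal_sup_ubound; exists y.
    by rewrite la lee_fin leNgt ya.
  apply: contrapT => nH; apply: nE; exists x; split=> //; apply/eqP; rewrite eq_le; apply/andP; split.
    apply: ge_ereal_sup => _ [y Ey <-]; rewrite lee_fin leNgt; apply/negP => yx; apply: nH.
    by exists y => //; rewrite !mul1r.
  by apply: ereal_sup_ubound; exists x.
Qed.

Lemma end_boundedP s b : end_bounded ((-1) ^+ b) E s <->
  ~ ebar_in E (end_point b) /\ end_value s b \is a fin_num.
Proof.
rewrite /end_bounded -no_endP; have [x0 Ex0] := gapped_ex gE.
suff -> : (exists M : R, forall x, E x -> (-1) ^+ b * s x <= M) <-> end_value s b \is a fin_num by [].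
case: b; rewrite /end_value ?expr1 ?expr0.
- have le x : E x -> (sbar_l E s <= (s x)%:E)%E by move=> Ex; apply: ereal_inf_lbound; exists x.
  split=> [[M HM]|fin].
    rewrite fin_numE; apply/andP; split; last first.
      by apply/eqP => e; have := le x0 Ex0; rewrite e.
    rewrite -ltNye; apply: (@lt_le_trans _ _ (- M)%:E); first exact: ltNyr.
    apply: le_ereal_inf_tmp => _ [y Ey <-]; rewrite lee_fin lerNl -mulN1r; exact: HM.
  exists (- fine (sbar_l E s)) => x /le; rewrite -{1}(fineK fin) lee_fin mulN1r lerN2 //.
- have le x : E x -> ((s x)%:E <= sbar_r E s)%E by move=> Ex; apply: ereal_sup_ubound; exists x.
  split=> [[M HM]|fin].
    rewrite fin_numE; apply/andP; split.
      by apply/eqP => e; have := le x0 Ex0; rewrite e.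
    rewrite -ltey; apply: (@le_lt_trans _ _ M%:E); last exact: ltry.
    apply: ge_ereal_sup => _ [y Ey <-]; rewrite lee_fin -[s y]mul1r; exact: HM.
  exists (fine (sbar_r E s)) => x /le; rewrite -{1}(fineK fin) lee_fin mul1r //.
Qed.

Lemma lfilterP (l : \bar R) (A : set R) : (l < +oo)%E ->
  lfilter l A <-> exists2 m : R, (l < m%:E)%E & forall x, (l < x%:E)%E -> x < m -> A x.
Proof.
case: l => [a _||_] //=; split.
- move=> /nbhs_ballP[e /= e0 He]; exists (a + e) => [|x]; first by rewrite lte_fin ltrDl.
  rewrite lte_fin => ax xe; apply: He => //=; rewrite /ball /= distrC gtr0_norm ?subr_gt0 //; lra.
- move=> [m am H]; rewrite lte_fin in am; near=> x; apply: H; [rewrite lte_fin|].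
    by near: x; exact: nbhs_right_gt.
  by near: x; exact: nbhs_right_lt.
- by move=> [m [_ H]]; exists m => [|x _]; [rewrite ltNyr|exact: H].
- by move=> [m _ H]; exists m; split; [exact: num_real|move=> x; apply: H; rewrite ltNyr].
Unshelve. all: by end_near. Qed.

Lemma rfilterP (r : \bar R) (A : set R) : (-oo < r)%E ->
  rfilter r A <-> exists2 m : R, (m%:E < r)%E & forall x, (x%:E < r)%E -> m < x -> A x.
Proof.
case: r => [a _|_|] //=; split.
- move=> /nbhs_ballP[e /= e0 He]; exists (a - e) => [|x]; first by rewrite lte_fin gtrBl.
  rewrite lte_fin => ax xe; apply: He => //=; rewrite /ball /= gtr0_norm ?subr_gt0 //; lra.
- move=> [m am H]; rewrite lte_fin in am; near=> x; apply: H; [rewrite lte_fin|].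
    by near: x; exact: nbhs_left_lt.
  by near: x; exact: nbhs_left_gt.
- by move=> [m [_ H]]; exists m => [|x _]; [rewrite ltry|exact: H].
- by move=> [m _ H]; exists m; split; [exact: num_real|move=> x; apply: H; rewrite ltry].
Unshelve. all: by end_near. Qed.

(** Points of [E] accumulate at a missing end, so its neighbourhoods are generated by rays that
    start at points of [E]; in this form limits at the end compare with [vanish]. *)
Lemma end_filterP b (A : set R) : ~ ebar_in E (end_point b) ->
  end_filter b A <-> exists2 p, E p & forall x, Itv E x -> (-1) ^+ b * p <= (-1) ^+ b * x -> A x.
Proof.
have [x0 Ex0] := gapped_ex gE.
case: b; rewrite /end_point /end_filter ?expr1 ?expr0 => nE.
- have low x : Itv E x -> (lend E < x%:E)%E.
    case=> [/andP[]//|Ex]; have : (lend E <= x%:E)%E by apply: ereal_inf_lbound; exists x.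
    by rewrite le_eqVlt => /predU1P[e|//]; case: nE; exists x.
  have near_p (y : \bar R) : (lend E < y)%E -> exists2 p, E p & (p%:E < y)%E.
    by move=> /ereal_inf_lt[_ [p Ep <-]]; exists p.
  apply: (iff_trans (lfilterP _ _)); first exact: lt_trans (low x0 (sub_Itv Ex0)) (ltry _).
  split=> [[m lm H]|[p Ep H]].
    have [p Ep pm] := near_p _ lm; exists p => // x Ix; rewrite !mulN1r lerN2 => xp.
    by apply: H; [exact: low|exact: le_lt_trans xp pm].
  exists p; first exact: low (sub_Itv Ep).
  move=> x lx /ltW xp; apply: H; last by rewrite !mulN1r lerN2.
  have [q Eq] := near_p _ lx; rewrite lte_fin => qx.
  exact: (Itv_between (sub_Itv Eq) (sub_Itv Ep) (ltW qx) xp).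
- have low x : Itv E x -> (x%:E < rend E)%E.
    case=> [/andP[]//|Ex]; have : (x%:E <= rend E)%E by apply: ereal_sup_ubound; exists x.
    by rewrite le_eqVlt => /predU1P[e|//]; case: nE; exists x.
  have near_p (y : \bar R) : (y < rend E)%E -> exists2 p, E p & (y < p%:E)%E.
    by move=> /ereal_sup_gt[_ [p Ep <-]]; exists p.
  apply: (iff_trans (rfilterP _ _)); first exact: lt_trans (ltNyr _) (low x0 (sub_Itv Ex0)).
  split=> [[m lm H]|[p Ep H]].
    have [p Ep pm] := near_p _ lm; exists p => // x Ix; rewrite !mul1r => xp.
    by rewrite lte_fin in pm; apply: H; [exact: low|exact: lt_le_trans pm xp].
  exists p; first exact: low (sub_Itv Ep).
  move=> x lx /ltW xp; apply: H; last by rewrite !mul1r.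
  have [q Eq] := near_p _ lx; rewrite lte_fin => qx.
  exact: (Itv_between (sub_Itv Ep) (sub_Itv Eq) xp (ltW qx)).
Qed.

Instance end_filter_filter b : Filter (end_filter b).
Proof.
rewrite /end_filter; case: b; [case: (lend E) => [?||]|case: (rend E) => [?||]]; rewrite /=; typeclasses eauto.
Qed.

Lemma end_cvgP b f : ~ ebar_in E (end_point b) ->
  f @ end_filter b --> 0 <-> forall e : R, 0 < e ->
    exists2 p, E p & forall x, Itv E x -> (-1) ^+ b * p <= (-1) ^+ b * x -> `|f x| < e.
Proof.
move=> nE; split=> [C e e0|H].
- apply/(@end_filterP b [set x | `|f x| < e] nE); have h := (cvgrPdist_lt _ _).1 C e e0.
  by apply: filterS (h (end_filter_filter b)) => x /=; rewrite sub0r normrN.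
- apply/cvgrPdist_lt => e e0; have h := (@end_filterP b [set x | `|f x| < e] nE).2 (H e e0).
  by apply: (@filterS _ (end_filter b) _ _ _ _ h) => x /=; rewrite sub0r normrN.
Qed.

Definition end_cvg s f := forall b, ~ ebar_in E (end_point b) ->
  end_value s b \is a fin_num -> f @ end_filter b --> 0.

Lemma end_cvg_cond s f : end_cvg s f -> end_cond E s f.
Proof.
move=> H b /end_boundedP[nE fin] e e0.
have [p Ep pf] := (end_cvgP _ nE).1 (H b nE fin) e e0.
by exists p => // x Ex; apply: pf; right.
Qed.

(** In a gap the interpolation is a convex combination of two values on [E], and if a point of the
    gap lies beyond [p], so do both endpoints. *)
Lemma sbar_end_cvg s f : end_cond E s f -> end_cvg s (sbar E f).
Proof.
move=> H b nE fin; apply/end_cvgP => // e e0.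
have [p Ep pf] := H b ((end_boundedP s b).2 (conj nE fin)) e e0.
exists p => // x /(Itv_cases gE)[Ex|[c [d [G cx xd]]]]; first by rewrite sbar_in //; exact: pf.
have [/= Ec [Ed [cd nT]]] := G => px.
have [pc pd] : (-1) ^+ b * p <= (-1) ^+ b * c /\ (-1) ^+ b * p <= (-1) ^+ b * d.
  move: px; case: b {H nE fin pf}; rewrite ?(expr1, expr0, mulN1r, lerN2, mul1r).
  - move=> xp; have dp : d <= p; last by split=> //; lra.
    by rewrite leNgt; apply/negP => pd; apply: (nT p) => //; rewrite (lt_le_trans cx).
  - move=> px; have pc : p <= c; last by split=> //; lra.
    by rewrite leNgt; apply/negP => cp; apply: (nT p) => //; rewrite cp (le_lt_trans px).
rewrite (sbar_gap f G (ltW cx) (ltW xd)).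
have := pf c Ec pc; have := pf d Ed pd; rewrite !ltr_norml => /andP[d1 d2] /andP[c1 c2].
have dc : 0 < d - c by rewrite subr_gt0.
have -> : f c + (f d - f c) / (d - c) * (x - c) = ((d - x) * f c + (x - c) * f d) / (d - c).
  by field; rewrite gt_eqF.
by rewrite ltr_pdivlMr // ltr_pdivrMr //; apply/andP; split; nra.
Qed.

End boundary.

(** * The quasidiffusion in terms of energies *)

Section quasidiffusion.
Context {R : realType} {mu : {measure set (measurableTypeR R) -> \bar R}} {E : set R}.
Context (gE : gapped E) (Hmu : radon_full_support E mu).
Implicit Types (f g h s : R -> R).
Let mE : measurable (E : set (measurableTypeR R)) := gapped_measurable gE.

(** Measurability on the whole line is part of [L2] over [setT]. Off [Itv E] the extension has one
    value on the left and one on the right, so there it is an affine function of a monotone step. *)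
Lemma sbar_measurable f : {within Itv E, continuous (sbar E f)} ->
  measurable_fun setT (sbar E f : measurableTypeR R -> R).
Proof.
move=> cf; have mI := measurable_Itv gE.
have step : measurable_fun setT ((fun x => if pselect (x%:E <= lend E)%E is left _ then 0 else 1) : measurableTypeR R -> R).
  apply: nondecreasing_measurable => // x y xy; case: pselect => hx; case: pselect => hy //.
  by case: hx; apply: le_trans hy; rewrite lee_fin.
rewrite -(setUv (Itv E)); apply/measurable_funU => //; first exact: measurableC.
split; first exact: continuous_on_measurable.
pose c1 := fine (sbar_l E f); pose c2 := fine (sbar_r E f).
pose st x : R := if pselect (x%:E <= lend E)%E is left _ then 0 else 1.
have eq : {in ~` Itv E, (fun x => c1 + (c2 - c1) * st x) =1 sbar E f}.
  move=> x /set_mem nI; rewrite /sbar; case: pselect => [Ex|_]; first by case: nI; right.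
  case: pselect => [Ox|_]; first by case: nI; left.
  by rewrite /st; case: pselect => _; rewrite ?mulr0 ?addr0 // mulr1 subrKC.
apply: (eq_measurable_fun _ eq).
apply: measurable_funD; first exact: measurable_cst.
apply: measurable_funM; first exact: measurable_cst.
exact: measurable_funS step.
Qed.

Lemma L2_E_setT f : measurable_fun setT (f : measurableTypeR R -> R) -> L2 mu E f -> L2 mu setT f.
Proof.
move=> mf Lf; exact: (L2_ae mf (L2_on_E gE Lf) (aeq_on_E gE Hmu f)).
Qed.

(** Common to both forms, whose values are computed from representatives selected by [xget]. Full
    support makes two continuous representatives equal on [E], so the choice does not affect the
    energy. [val] extracts the function from the selected data, which for a scale is a pair. *)
Lemma represents_pick (X : choiceType) (x0 : X) (P : X -> Prop) (val : X -> R -> R)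
    (formula : X -> X -> R) s : slow E s ->
  (forall p, P p -> form_dom mu s E (val p)) ->
  (forall f, form_dom mu s E f -> exists2 p, P p & forall x, E x -> val p x = f x) ->
  (forall p q, P p -> P q -> formula p q = 2^-1 * energy s E (val p) (val q)) ->
  let pick h := xget x0 [set p | P p /\ Defs.ae_eq mu h (val p)] in
  represents (mu := mu) (E := E) s [set h | L2 mu setT h /\ exists p, P p /\ Defs.ae_eq mu h (val p)]
    (fun h k => formula (pick h) (pick k)).
Proof.
move=> sE Pdom domP PE pick; split.
- apply/seteqP; split=> h [Lh [p [Pp hp]]]; split=> //.
    by exists (val p); split=> //; exact: Pdom.
  have [q Pq qp] := domP _ Pp; exists q; split=> //.
  by apply: aeq_trans hp _; apply: (aeq_E gE Hmu) => x Ex; rewrite qp.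
- have pickP h : (exists p, P p /\ Defs.ae_eq mu h (val p)) -> P (pick h) /\ Defs.ae_eq mu h (val (pick h)).
    by move=> [p H]; rewrite /pick; case: xgetP => [q _ //|/(_ p)].
  move=> h k f g [_ /pickP[Ph hh]] [_ /pickP[Pk kk]] df dg hf kg; rewrite PE //; congr (_ * _).
  have cont u : form_dom mu s E u -> {within E, continuous u} by move=> [fu _ _]; exact: (fin_energy_continuous sE fu).
  apply: eq_energy; apply: (aeq_continuous gE Hmu); try exact: cont; try exact/cont/Pdom.
  + exact: aeq_trans (aeq_sym hh) hf.
  + exact: aeq_trans (aeq_sym kk) kg.
Qed.

Lemma qd_rep_ac f : qd_rep E mu f -> ac_rep (T := E) f.
Proof.
move=> [cf [af [/integrableP[_ fi] _]]]; split=> //.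
by apply: le_lt_trans fi; under [leRHS]eq_integral do rewrite /= ger0_norm ?sqr_ge0 //.
Qed.

Lemma qd_rep_form_dom f : qd_rep E mu f -> form_dom mu id E f.
Proof.
move=> rf; have [ff _] := ac_rep_fin_energy gE (qd_rep_ac rf); split=> //.
- by case: rf => _ [_ [_ [Lf _]]]; exact: L2_setT_E.
- by case: rf => _ [_ [_ [_ [bl br]]]]; apply: (end_cvg_cond gE) => -[]; [exact: bl|exact: br].
Qed.

Lemma form_dom_qd_rep f : form_dom mu id E f -> qd_rep E mu (sbar E f).
Proof.
move=> [ff Lf ef]; have [cf af fi] := sbar_ac_rep gE ff; have bf := sbar_end_cvg gE ef.
split=> //; split=> //; split.
  apply/integrableP; split.
    by apply/measurable_EFinP/measurable_funX; exact: oitv_ac_measurable.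
  by under eq_integral do rewrite /= ger0_norm ?sqr_ge0 //.
split; last by split; [exact: (bf true)|exact: (bf false)].
apply: L2_E_setT; first exact: sbar_measurable.
by apply: eq_L2 Lf => x /set_mem Ex; rewrite sbar_in.
Qed.

Theorem quasidiffusion_represents : represents (mu := mu) (E := E) id (qdF E mu) (qdE E mu).
Proof.
apply: (@represents_pick _ (fun=> 0) (qd_rep E mu) (fun f => f) (qd_formula E) id (@slow_id R E)) => /=.
- by move=> f; exact: qd_rep_form_dom.
- by move=> f df; exists (sbar E f) => [|x Ex]; [exact: form_dom_qd_rep|rewrite /= sbar_in].
- move=> f g rf rg; rewrite /qd_formula -mulrDr; congr (_ * _).
  by rewrite (energy_formula gE (qd_rep_ac rf) (qd_rep_ac rg)).
Qed.

End quasidiffusion.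

(** * Interpolation under a change of scale *)

Section scale_change.
Context {R : realType}.
Implicit Types (E T : set R) (f s t : R -> R).

Lemma gap_image E s c d : increasing_on E s -> gaps E (c, d) -> gaps (s @` E) (s c, s d).
Proof.
move=> si [/= Ec [Ed [cd nE]]]; split=> /=; first by exists c.
split; first by exists d.
split; first exact: si.
move=> z zI [y Ey ye]; move: zI; rewrite -ye => /andP[cy yd].
have cy' : c < y.
  rewrite ltNge le_eqVlt; apply/negP => /predU1P[e|/(si _ _ Ey Ec)]; first by rewrite e ltxx in cy.
  by rewrite ltNge (ltW cy).
have yd' : y < d.
  rewrite ltNge le_eqVlt; apply/negP => /predU1P[e|/(si _ _ Ed Ey)]; first by rewrite e ltxx in yd.
  by rewrite ltNge (ltW yd).
by apply: (nE y) => //; rewrite cy'.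
Qed.

(** An affine function of an affine function is affine, and [s] maps gaps of [E] to gaps of its
    image, so interpolation commutes with the relabelling of points. *)
Lemma sbar_comp E s f x : gapped E -> increasing_on E s -> Itv E x ->
  Itv (s @` E) (sbar E s x) /\ sbar (s @` E) f (sbar E s x) = sbar E (f \o s) x.
Proof.
move=> gE si /(Itv_cases gE)[Ex|[c [d [G cx xd]]]].
  have Tx : (s @` E) (s x) by exists x.
  by rewrite sbar_in //; split; [right|rewrite !sbar_in].
have [/= Ec [Ed [cd nE]]] := G; have scd := si _ _ Ec Ed cd.
have G' := gap_image si G; rewrite (sbar_gap s G (ltW cx) (ltW xd)) (sbar_gap _ G (ltW cx) (ltW xd)) /=.
have dc : 0 < d - c by rewrite subr_gt0.
set y := (X in Itv _ X).
have cy : s c < y by rewrite ltrDl mulr_gt0 ?divr_gt0 ?subr_gt0.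
have yd : y < s d.
  by rewrite /y -ltrBrDl mulrAC ltr_pdivrMr // ltr_pM2l ?subr_gt0 // ltrD2r.
split; first by left; exact: gap_oitv G' cy yd.
rewrite (sbar_gap _ G' (ltW cy) (ltW yd)) /y; field.
by rewrite !subr_eq0 !gt_eqF.
Qed.

End scale_change.

(** * The extended scale on the whole line *)

Section slow_scale.
Context {R : realType} {E : set R} (gE : gapped E) {s : R -> R} (sE : slow E s).
Let S := sbar E s.
Let T := s @` E.
Let si : increasing_on E s := slow_increasing sE.

Let s_homo : {in E &, {homo s : x y / x <= y}}.
Proof.
move=> x y /set_mem Ex /set_mem Ey; rewrite le_eqVlt => /predU1P[->//|xy].
exact/ltW/si.
Qed.

Let S_in z : E z -> S z = s z. Proof. exact: sbar_in. Qed.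

Lemma sbar_slow_le x y : Itv E x -> Itv E y -> x <= y -> 0 <= S y - S x <= y - x.
Proof.
move=> Ix Iy xy; rewrite subr_ge0 (sbar_homo gE s_homo) //=.
have r_homo : {in E &, {homo (fun x => -1 * s x + id x) : x y / x <= y}}.
  move=> u v /set_mem Eu /set_mem Ev; rewrite le_eqVlt => /predU1P[->//|uv].
  by have /andP[_] := sE Eu Ev uv; rewrite /=; lra.
have := sbar_homo gE r_homo Ix Iy xy; rewrite !(sbar_linear gE) // !(sbar_id gE) // -/S; lra.
Qed.

Let left_end x : ~ Itv E x -> (x%:E <= lend E)%E -> S x = fine (sbar_l E s).
Proof.
move=> nI xl; rewrite /S /sbar; case: pselect => [?|_]; first by case: nI; right.
by case: pselect => [?|_]; [case: nI; left|case: pselect].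
Qed.

Let right_end x : ~ Itv E x -> ~ (x%:E <= lend E)%E -> S x = fine (sbar_r E s).
Proof.
move=> nI xl; rewrite /S /sbar; case: pselect => [?|_]; first by case: nI; right.
by case: pselect => [?|_]; [case: nI; left|case: pselect].
Qed.

Let right_of x : ~ Itv E x -> ~ (x%:E <= lend E)%E -> (rend E <= x%:E)%E.
Proof.
by move=> nI xl; rewrite leNgt; apply/negP => xr; apply: nI; left; apply/andP; split=> //; rewrite ltNge; apply/negP.
Qed.

Let lend_le x : Itv E x -> (lend E <= x%:E)%E.
Proof.
by move=> [/andP[/ltW]//|Ex]; apply: ereal_inf_lbound; exists x.
Qed.

Let rend_ge x : Itv E x -> (x%:E <= rend E)%E.
Proof.
by move=> [/andP[_ /ltW]//|Ex]; apply: ereal_sup_ubound; exists x.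
Qed.

(** A real point not above [lend E] bounds the set from below, so slowness bounds [s] from below too
    and the infimum that serves as value at [x] is finite. *)
Let inf_bounds x y : ~ Itv E x -> (x%:E <= lend E)%E -> Itv E y ->
  0 <= S y - S x <= y - x.
Proof.
move=> nI xl Iy; rewrite (left_end nI xl); set L := sbar_l E s.
have lo z : E z -> ((S y - (y - x))%:E <= (s z)%:E)%E.
  move=> Ez; rewrite lee_fin; have xz : x <= z by rewrite -lee_fin; exact: le_trans xl (lend_le (sub_Itv Ez)).
  have xy : x <= y by rewrite -lee_fin; exact: le_trans xl (lend_le Iy).
  have [zy|/ltW yz] := leP z y.
    by have := sbar_slow_le (sub_Itv Ez) Iy zy; rewrite (S_in Ez); lra.
  by have := sbar_slow_le Iy (sub_Itv Ez) yz; rewrite (S_in Ez); lra.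
have [z [Ez zy]] : exists z, E z /\ z <= y.
  case: (Iy) => [/(oitvP _)[z [_ [Ez _ /ltW zy _]]]|Ey]; first by exists z.
  by exists y.
have Lz : (L <= (s z)%:E)%E by apply: ereal_inf_lbound; exists z.
have Llo : ((S y - (y - x))%:E <= L)%E by apply: le_ereal_inf_tmp => _ [w Ew <-]; exact: lo.
have Lf : L \is a fin_num.
  rewrite fin_numE -ltNye -ltey; apply/andP; split.
    exact: lt_le_trans (ltNyr _) Llo.
  exact: le_lt_trans Lz (ltry _).
rewrite -(fineK Lf) !lee_fin in Lz Llo.
have := sbar_slow_le (sub_Itv Ez) Iy zy; rewrite (S_in Ez); lra.
Qed.

Let sup_bounds x y : ~ Itv E y -> ~ (y%:E <= lend E)%E -> Itv E x ->
  0 <= S y - S x <= y - x.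
Proof.
move=> nI yl Ix; rewrite (right_end nI yl); set L := sbar_r E s.
have ry := right_of nI yl.
have hi z : E z -> ((s z)%:E <= (S x + (y - x))%:E)%E.
  move=> Ez; rewrite lee_fin; have zy : z <= y by rewrite -lee_fin; exact: le_trans (rend_ge (sub_Itv Ez)) ry.
  have xy : x <= y by rewrite -lee_fin; exact: le_trans (rend_ge Ix) ry.
  have [zx|/ltW xz] := leP z x.
    by have := sbar_slow_le (sub_Itv Ez) Ix zx; rewrite (S_in Ez); lra.
  by have := sbar_slow_le Ix (sub_Itv Ez) xz; rewrite (S_in Ez); lra.
have [z [Ez xz]] : exists z, E z /\ x <= z.
  case: (Ix) => [/(oitvP _)[_ [z [_ Ez _ /ltW xz]]]|Ex]; first by exists z.
  by exists x.
have Lz : ((s z)%:E <= L)%E by apply: ereal_sup_ubound; exists z.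
have Lhi : (L <= (S x + (y - x))%:E)%E by apply: ge_ereal_sup => _ [w Ew <-]; exact: hi.
have Lf : L \is a fin_num.
  rewrite fin_numE -ltNye -ltey; apply/andP; split.
    exact: lt_le_trans (ltNyr _) Lz.
  exact: le_lt_trans Lhi (ltry _).
rewrite -(fineK Lf) !lee_fin in Lz Lhi.
have := sbar_slow_le Ix (sub_Itv Ez) xz; rewrite (S_in Ez); lra.
Qed.

(** The Stieltjes measure is built from a function that is monotone and continuous on the whole
    line, hence the comparison with the constant values outside [Itv E]. *)
Lemma sbar_slow_R x y : x <= y -> 0 <= S y - S x <= y - x.
Proof.
move=> xy; have [Ix|nIx] := pselect (Itv E x); have [Iy|nIy] := pselect (Itv E y).
- exact: sbar_slow_le.
- apply: sup_bounds => // yl; apply: nIy; rewrite (_ : y = x) //.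
  by apply/eqP; rewrite eq_le xy andbT -lee_fin; exact: le_trans yl (lend_le Ix).
- have [xl|xl] := pselect (x%:E <= lend E)%E; first exact: inf_bounds.
  case: (nIx); rewrite (_ : x = y) //.
  by apply/eqP; rewrite eq_le xy /= -lee_fin; exact: le_trans (rend_ge Iy) (right_of nIx xl).
- have [p Ep] := gapped_ex gE; have Ip := sub_Itv Ep.
  have [xl|xl] := pselect (x%:E <= lend E)%E; have [yl|yl] := pselect (y%:E <= lend E)%E.
  + by rewrite (left_end nIx xl) (left_end nIy yl) subrr lexx subr_ge0.
  + by have := inf_bounds nIx xl Ip; have := sup_bounds nIy yl Ip; lra.
  + by case: xl; apply: le_trans yl; rewrite lee_fin.
  + by rewrite (right_end nIx xl) (right_end nIy yl) subrr lexx subr_ge0.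
Qed.

Lemma sbar_out x : ~ Itv E x ->
  (forall y, y <= x -> S y = S x) \/ (forall y, x <= y -> S y = S x).
Proof.
move=> nI; have [xl|xl] := pselect (x%:E <= lend E)%E; [left|right] => y.
- rewrite le_eqVlt => /predU1P[->//|yx].
  have yl : (y%:E < lend E)%E by apply: lt_le_trans xl; rewrite lte_fin.
  rewrite (left_end nI xl) (left_end _ (ltW yl)) // => /lend_le.
  by rewrite leNgt yl.
- rewrite le_eqVlt => /predU1P[->//|xy]; have rx := right_of nI xl.
  have ry : (rend E < y%:E)%E by apply: le_lt_trans rx _; rewrite lte_fin.
  rewrite (right_end nI xl) right_end //; first by move=> /rend_ge; rewrite leNgt ry.
  by move=> yl; apply: xl; apply: le_trans yl; rewrite lee_fin ltW.
Qed.

Lemma sbar_slow_homo : {homo S : x y / x <= y}.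
Proof. by move=> x y /sbar_slow_R; rewrite subr_ge0 => /andP[]. Qed.

Lemma sbar_slow_continuous : continuous S.
Proof.
move=> x; apply/cvgrPdist_lt => e e0; apply/nbhs_ballP; exists e => // y; apply: le_lt_trans.
have [xy|/ltW yx] := leP x y.
- by have /andP[h1 h2] := sbar_slow_R xy; rewrite distrC [leRHS]distrC !ger0_norm // subr_ge0.
- by have /andP[h1 h2] := sbar_slow_R yx; rewrite !ger0_norm // subr_ge0.
Qed.

(** Intermediate values: a value between two values of [s] but missing from the image is taken by
    the extended scale at a point that must lie in a gap of [E], and gaps are mapped to gaps. *)
Lemma gapped_image : gapped T.
Proof.
have [[p [q [Ep Eq pq]]] _] := gE; split; first by exists (s p), (s q); split; [exists p|exists q|exact: si].
move=> _ x _ [a Ea <-] [b Eb <-] ax xb nTx.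
have ab : a <= b by rewrite leNgt; apply/negP => /(si Eb Ea); rewrite ltNge (ltW (lt_trans ax xb)).
have [||w] := @IVT _ S a b x ab.
- by apply: continuous_subspaceT => z; exact: sbar_slow_continuous.
- by rewrite /S !sbar_in // ge_min (ltW ax) le_max (ltW xb) orbT.
rewrite in_itv /= => /andP[aw wb] Sw.
have [Ew|[c [d [G cw wd]]]] := Itv_cases gE (Itv_between (sub_Itv Ea) (sub_Itv Eb) aw wb).
  by case: nTx; exists w => //; rewrite -Sw /S sbar_in.
have [/= Ec [Ed [cd nE]]] := G; exists (s c), (s d); split; first exact: gap_image.
- rewrite -Sw /S (sbar_gap _ G (ltW cw) (ltW wd)) ltrDl mulr_gt0 ?divr_gt0 ?subr_gt0 //.
  exact: si.
- rewrite -Sw /S (sbar_gap _ G (ltW cw) (ltW wd)) -ltrBrDl mulrAC ltr_pdivrMr ?subr_gt0 //.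
  by rewrite ltr_pM2l ?subr_gt0 ?ltrD2r //; exact: si.
Qed.

End slow_scale.

(** * The inverse of the extended scale *)

Section scale_inverse.
Context {R : realType} {E : set R} (gE : gapped E) {s : R -> R} (sE : slow E s).
Let S := sbar E s.
Let T := s @` E.
Let si : increasing_on E s := slow_increasing sE.
Let gT : gapped T := gapped_image gE sE.
Local Notation leb := (@lebesgue_measure R).

Definition scale_inv (y : R) : R := xget 0 [set x | E x /\ s x = y].
Let t := scale_inv.

Lemma scale_inj x y : E x -> E y -> s x = s y -> x = y.
Proof.
move=> Ex Ey e; have [xy|yx|//] := ltgtP x y.
- by have := si Ex Ey xy; rewrite e ltxx.
- by have := si Ey Ex yx; rewrite e ltxx.
Qed.

Lemma scale_invP y : T y -> E (t y) /\ s (t y) = y.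
Proof. by move=> [x Ex xy]; rewrite /t /scale_inv; case: xgetP => [z _ []|/(_ x)] //; case. Qed.

Lemma scale_invK x : E x -> t (s x) = x.
Proof. by move=> Ex; have [|? ?] := @scale_invP (s x); [exists x|exact: scale_inj]. Qed.

Let tT : t @` T = E.
Proof.
apply/seteqP; split=> x; first by move=> [y Ty <-]; have [] := scale_invP Ty.
by move=> Ex; exists (s x); [exists x|exact: scale_invK].
Qed.

Let ti : increasing_on T t.
Proof.
move=> _ _ [x Ex <-] [y Ey <-]; rewrite !scale_invK // => sxy.
rewrite ltNge le_eqVlt; apply/negP => /predU1P[e|/(si Ey Ex)]; first by rewrite e ltxx in sxy.
by rewrite ltNge (ltW sxy).
Qed.

Definition sbar_inv := sbar T t.

Lemma sbar_Itv x : Itv E x -> Itv T (S x).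
Proof. by move=> Ix; have [] := sbar_comp id gE si Ix. Qed.

Lemma sbar_scale f x : Itv E x -> sbar T f (S x) = sbar E (f \o s) x.
Proof. by move=> Ix; have [] := sbar_comp f gE si Ix. Qed.

Lemma sbar_invK x : Itv E x -> sbar_inv (S x) = x.
Proof.
move=> Ix; rewrite /sbar_inv sbar_scale // -[RHS](sbar_id gE Ix).
by apply: (sbar_ext gE) => // y Ey /=; exact: scale_invK.
Qed.

Lemma sbar_inv_Itv y : Itv T y -> Itv E (sbar_inv y).
Proof. by move=> Iy; have [+ _] := sbar_comp id gT ti Iy; rewrite tT. Qed.

Lemma sbarK y : Itv T y -> S (sbar_inv y) = y.
Proof.
move=> Iy; have [_] := sbar_comp s gT ti Iy; rewrite tT /S /sbar_inv => ->; rewrite -[RHS](sbar_id gT Iy).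
by apply: (sbar_ext gT) => // z Tz /=; have [_] := scale_invP Tz.
Qed.

Lemma sbar_image : S @` Itv E = Itv T.
Proof.
apply/seteqP; split=> y; first by move=> [x Ix <-]; exact: sbar_Itv.
by move=> Iy; exists (sbar_inv y); [exact: sbar_inv_Itv|exact: sbarK].
Qed.

Lemma sbar_lt x y : Itv E x -> Itv E y -> x < y -> S x < S y.
Proof.
move=> Ix Iy xy; rewrite lt_neqAle (sbar_slow_homo gE sE (ltW xy)) andbT.
apply/eqP => /(congr1 sbar_inv); rewrite !sbar_invK // => e; by rewrite e ltxx in xy.
Qed.

Lemma sbar_inv_E y : Itv T y -> E (sbar_inv y) <-> T y.
Proof.
move=> Iy; split=> [Ey|Ty]; last by rewrite /sbar_inv sbar_in //; have [] := scale_invP Ty.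
by rewrite -(sbarK Iy) /S sbar_in //; exists (sbar_inv y).
Qed.

(** The inverse scale extended by 0: the lemmas on image measures take a measurable map of the whole
    line. *)
Let phi : measurableTypeR R -> measurableTypeR R := sbar_inv \_ (Itv T).

Let phi_in y : Itv T y -> phi y = sbar_inv y.
Proof. by move=> Iy; rewrite /phi patchE mem_set. Qed.

Let mphi : measurable_fun setT phi.
Proof.
apply/(measurable_restrictT _ (measurable_Itv gT)).
have [a [b [Tab ab _ _ abT]]] : exists a b : nat -> R,
  [/\ forall n, Itv T (a n) /\ Itv T (b n), forall n, a n <= b n,
      {homo a : m n / (m <= n)%N >-> n <= m}, {homo b : m n / (m <= n)%N >-> m <= n} &
      forall x, Itv T x -> \forall n \near \oo, a n <= x <= b n].
  by apply: exhaust_seq; have [x Tx] := gapped_ex gT; exists x; right.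
have -> : Itv T = \bigcup_n `[a n, b n]%classic.
  apply/seteqP; split=> x.
  - by move=> /abT[n _ /(_ n (leqnn _)) xn]; exists n => //=; rewrite in_itv.
  - by move=> [n _ /=]; rewrite in_itv /= => /andP[]; have [] := Tab n; exact: Itv_between.
apply/measurable_fun_bigcup => n; first exact: measurable_itv.
have t_homo : {in T &, {homo t : x y / x <= y}}.
  by move=> x y /set_mem Tx /set_mem Ty; rewrite le_eqVlt => /predU1P[->//|xy]; exact/ltW/ti.
have I z : Itv T (clip (a n) (b n) z).
  by have /andP[h1 h2] := clip_in z (ab n); exact: Itv_between (Tab n).1 (Tab n).2 h1 h2.
have h : {homo (fun z => sbar_inv (clip (a n) (b n) z)) : x y / x <= y}.
  by move=> x y xy; apply: (sbar_homo gT t_homo) => //; exact: clip_mono.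
apply: (eq_measurable_fun (fun z => sbar_inv (clip (a n) (b n) z))).
  by move=> x; rewrite inE /= in_itv /= => /andP[ax xb]; rewrite clip_id.
exact: nondecreasing_measurable.
Qed.

Let Shomo := sbar_slow_homo gE sE.
Let Scont := sbar_slow_continuous gE sE.
Let H := mk_cumul S.
Let HS : (H : R -> R) = S. Proof. exact: mk_cumulE. Qed.

(** The set lies between the open and the closed interval from [S a] to [S b]. Values strictly
    between [S a] and [S b] are taken only in [Itv E], because outside it [S] is constant from the
    point outwards. *)
Let phiH (a b : R) : a <= b -> leb (phi @^-1` `]a, b]%classic `&` Itv T) = (H b - H a)%:E.
Proof.
move=> ab; rewrite HS; set A := _ `&` _.
have mA : measurable (A : set (measurableTypeR R)).
  apply: measurableI; last exact: measurable_Itv.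
  by rewrite -[X in measurable X]setTI; apply: mphi => //; exact: measurable_itv.
have up : A `<=` `[S a, S b]%classic.
  move=> y [+ Iy]; rewrite /= in_itv /= phi_in // in_itv /= => /andP[/ltW /Shomo h1 /Shomo h2].
  by rewrite -/S sbarK // in h1 h2; rewrite h1.
have down : `]S a, S b[%classic `<=` A.
  move=> y; rewrite /= in_itv /= => /andP[ay yb].
  have [||x] := @IVT _ S a b y ab.
  - by apply: continuous_subspaceT => z; exact: Scont.
  - by rewrite ge_min (ltW ay) le_max (ltW yb) orbT.
  rewrite in_itv /= => /andP[ax xb] Sx.
  have ax' : a < x.
    by rewrite lt_neqAle ax andbT; apply/eqP => e; move: ay; rewrite e Sx ltxx.
  have Ix : Itv E x.
    apply: contrapT => /(@sbar_out _ _ s)[/(_ _ (ltW ax'))|/(_ _ xb)] e.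
      by move: ay; rewrite -Sx /S e ltxx.
    by move: yb; rewrite -Sx /S e ltxx.
  have Iy : Itv T y by rewrite -Sx; exact: sbar_Itv.
  by split=> //=; rewrite in_itv /= phi_in // -Sx sbar_invK // ax'.
have Sab := Shomo ab.
apply/eqP; rewrite eq_le; apply/andP; split.
- apply: (@le_trans _ _ (leb `[S a, S b]%classic)).
    by apply: le_measure; rewrite ?inE //; exact: measurable_itv.
  rewrite [X in (X <= _)%E]lebesgue_measure_itv /= lte_fin; case: ifP => // _.
  by rewrite lee_fin subr_ge0.
- apply: (@le_trans _ _ (leb `]S a, S b[%classic)).
    rewrite [X in (_ <= X)%E]lebesgue_measure_itv /= lte_fin; case: ltgtP Sab => // ->.
    by rewrite subrr.
  by apply: le_measure; rewrite ?inE //; exact: measurable_itv.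
Qed.

Lemma integral_dsbar (D : set (measurableTypeR R)) (w : R -> R) : measurable D -> D `<=` Itv E ->
  measurable_fun (Itv T : set (measurableTypeR R)) w -> (forall y, 0 <= w y) ->
  (\int[dsbar E s]_(x in D) (w (S x))%:E = \int[leb]_(y in sbar_inv @^-1` D `&` Itv T) (w y)%:E)%E.
Proof.
move=> mD DI mw w0.
have mS : measurable_fun D (S : measurableTypeR R -> measurableTypeR R).
  apply: (measurable_funS measurableT) => //; exact: continuous_measurable_fun.
have mwS : measurable_fun D (fun x => (w (S x))%:E).
  apply/measurable_EFinP; apply: (measurable_comp (measurable_Itv gT)) mw mS.
  by move=> _ [x Dx <-]; exact/sbar_Itv/DI.
rewrite /dsbar (integral_stieltjes_image (measurable_Itv gT) mphi phiH mD mwS); last first.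
  by move=> x _; rewrite lee_fin.
have -> : phi @^-1` D `&` Itv T = sbar_inv @^-1` D `&` Itv T.
  by apply/seteqP; split=> y [/= Dy Iy]; split=> //=; move: Dy; rewrite phi_in.
by apply: eq_integral => y /set_mem[_ Iy]; rewrite phi_in // sbarK.
Qed.

End scale_inverse.

(** * Isometric scales and the class of scale functions *)

Section scale_class.
Context {R : realType} {E : set R} (gE : gapped E).
Implicit Types (f g h s : R -> R).
Local Notation leb := (@lebesgue_measure R).

Lemma gapped_cut p q : E p -> E q -> p < q -> gapped (cut E p q).
Proof.
move=> Ep Eq pq; split.
  by exists p, q; split=> //; split=> //=; rewrite lexx ltW.
move=> a x b [Ea /= /andP[pa aq]] [Eb /= /andP[pb bq]] ax xb nC.
have nEx : ~ E x by move=> Ex; apply: nC; split=> //=; apply/andP; split; lra.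
have [c [d [G cx xd]]] := gE.2 _ _ _ Ea Eb ax xb nEx.
have [/= Ec [Ed [cd nE]]] := G.
have ac : a <= c by rewrite leNgt; apply/negP => ca; apply: (nE a) => //; rewrite ca (lt_trans ax).
have db : d <= b by rewrite leNgt; apply/negP => bd; apply: (nE b) => //; rewrite bd (lt_trans _ xb).
exists c, d; split=> //; split; [|split; [|split=> //]].
- by split=> //=; apply/andP; split; lra.
- by split=> //=; apply/andP; split; lra.
- by move=> y /nE nEy [].
Qed.

Lemma sbar_cut f p q x : E p -> E q -> p < q -> p < x -> x < q -> sbar (cut E p q) f x = sbar E f x.
Proof.
move=> Ep Eq pq px xq; have gC := gapped_cut Ep Eq pq.
have Cp : cut E p q p by split=> //=; rewrite lexx ltW.
have Cq : cut E p q q by split=> //=; rewrite lexx ltW.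
have Ix := Itv_between (sub_Itv Cp) (sub_Itv Cq) (ltW px) (ltW xq).
have [Cx|[c [d [G cx xd]]]] := Itv_cases gC Ix; first by rewrite !sbar_in //; case: Cx.
have [/= Cc [Cd [cd nC]]] := G.
have G' : gaps E (c, d).
  split; [by case: Cc|split; [by case: Cd|split=> //= y cyd Ey]].
  apply: (nC y cyd); split=> //=; case: Cc => _ /= /andP[pc _]; case: Cd => _ /= /andP[_ dq].
  by case/andP: cyd => cy yd; apply/andP; split; lra.
by rewrite (sbar_gap f G (ltW cx) (ltW xd)) (sbar_gap f G' (ltW cx) (ltW xd)).
Qed.

Lemma oitv_cut p q : E p -> E q -> p < q -> oitv (cut E p q) = `]p, q[%classic.
Proof.
move=> Ep Eq pq; apply/seteqP; split=> x; rewrite /= in_itv /=.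
- move=> /(oitvP _)[a [b [[_ /= /andP[pa _]] [_ /= /andP[_ bq]] ax xb]]]; apply/andP; split; lra.
- move=> /andP[px xq]; apply/oitvP; exists p, q; split=> //; split=> //=; rewrite lexx ltW //.
Qed.

Lemma energy_cut_integral f p q : E p -> E q -> p < q -> fin_energy id (cut E p q) f ->
  ((energy id (cut E p q) f f)%:E = \int[leb]_(x in `]p, q[%classic) ((derive1 (sbar E f) x) ^+ 2)%:E)%E.
Proof.
move=> Ep Eq pq ff; have gC := gapped_cut Ep Eq pq.
rewrite (energy_integral gC ff) (oitv_cut Ep Eq pq); apply: eq_integral => x.
rewrite inE /= in_itv /= => /andP[px xq]; congr (_ ^+ 2)%:E.
apply: (near_derive1 _).2; near=> y; apply: sbar_cut => //; near: y; [exact: lt_nbhsr|exact: lt_nbhsl].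
Unshelve. all: by end_near. Qed.

Lemma slow_fin_energy s p q : slow E s -> E p -> E q -> p < q -> fin_energy id (cut E p q) s.
Proof.
move=> sE Ep Eq pq; have sC := slow_sub (@cut_sub _ E p q) sE.
apply: (energy_id_le sC _).1; exact: fin_energy_scale (slow_increasing sC) Ep Eq (ltW pq).
Qed.

Lemma lipschitz_ac_list f a b : (forall x y, a <= x -> x <= y -> y <= b -> `|f y - f x| <= y - x) -> ac_list f a b.
Proof.
move=> lip e e0; exists e => // l fl; apply: le_lt_trans.
rewrite /var /len big_seq [leRHS]big_seq; apply: ler_sum => p pl.
by have [h1 h2 h3] := fam_bound fl pl; exact: lip.
Qed.

Lemma sbar_slow_ac s : slow E s -> abs_cont_on (Itv E) (sbar E s).
Proof.
move=> sE; apply/abs_cont_onP => a b ab _; apply: lipschitz_ac_list => x y _ xy _.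
by have /andP[h1 h2] := sbar_slow_R gE sE xy; rewrite ger0_norm.
Qed.

Lemma sbar_slow_derive s x : slow E s -> derivable (sbar E s) x 1 -> 0 <= derive1 (sbar E s) x <= 1.
Proof.
move=> sE /cvg_quot_seq C.
have q01 n : 0 <= quot (sbar E s) n.+1%:R^-1 x <= 1.
  have i0 : 0 < n.+1%:R^-1 :> R by [].
  rewrite /quot; move: (n.+1%:R^-1) i0 => i i0.
  have xi : x <= i + x by lra.
  have /andP[h1 h2] := sbar_slow_R gE sE xi.
  by rewrite mulr_ge0 ?invr_ge0 ?(ltW i0) //= mulrC ler_pdivrMr // mul1r; lra.
rewrite -(cvg_lim _ C) //; apply/andP; split.
- by apply: limr_ge (cvgP _ C) _; apply: nearW => n; have /andP[] := q01 n.
- by apply: limr_le (cvgP _ C) _; apply: nearW => n; have /andP[] := q01 n.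
Qed.

Lemma segment_Itv p q : E p -> E q -> `[p, q]%classic `<=` Itv E.
Proof.
move=> Ep Eq x; rewrite /= in_itv /= => /andP[px xq].
exact: Itv_between (sub_Itv Ep) (sub_Itv Eq) px xq.
Qed.

(** The derivative is 0 or 1 almost everywhere, hence equal to its square, and its integral is the
    increment. *)
Lemma in_S_integral s p q : in_S E s -> E p -> E q -> p < q ->
  ac_list (sbar E s) p q /\
  (\int[leb]_(x in `]p, q[%classic) ((derive1 (sbar E s) x) ^+ 2)%:E = (s q - s p)%:E)%E.
Proof.
move=> [_ [_ [_ [/abs_cont_onP acS [ae01 _]]]]] Ep Eq pq.
have ac := acS p q (ltW pq) (segment_Itv Ep Eq); split=> //.
have [_ e] := ac_ftc (ltW pq) ac; rewrite !sbar_in // in e; rewrite -e.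
have mS := ac_measurable (ltW pq) ac.
apply: ae_eq_integral; first exact: measurable_itv.
- by apply/measurable_EFinP; exact: measurable_funX.
- exact/measurable_EFinP.
- apply: aeS ae01 => x H xpq; have [_ e01] : derivable (sbar E s) x 1 /\
      (derive1 (sbar E s) x = 0 \/ derive1 (sbar E s) x = 1).
    by apply/H/(segment_Itv Ep Eq); move: xpq; rewrite /= !in_itv /= => /andP[/ltW -> /ltW ->].
  by case: e01 => ->; rewrite ?expr0n ?expr1n.
Qed.

(** The integral of the squared derivative and [ac_slope] give
    [(s y - s x) ^+ 2 / (y - x) <= s y - s x]. *)
Lemma in_S_slow s : in_S E s -> slow E s.
Proof.
move=> sS x y Ex Ey xy; have [_ [ms _]] := sS.
have sxy : 0 < s y - s x by rewrite subr_gt0 ms ?inE.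
rewrite sxy /=; have [ac e] := in_S_integral sS Ex Ey xy.
have := ac_slope xy ac; rewrite e !sbar_in // lee_fin ler_pdivrMr ?subr_gt0 //.
by rewrite expr2 ler_pM2l.
Qed.

Lemma in_S_isometric s : in_S E s -> isometric_scale (E := E) s.
Proof.
move=> sS; have sE := in_S_slow sS; split=> // p q Ep Eq pq.
have [_ e] := in_S_integral sS Ep Eq pq.
have := energy_cut_integral Ep Eq pq (slow_fin_energy sE Ep Eq pq).
by rewrite e => -[].
Qed.

Section isometric_in_S.
Variable s : R -> R.
Hypothesis iso : isometric_scale (E := E) s.
Let S := sbar E s.
Let sE : slow E s := iso.1.
Let si : increasing_on E s := slow_increasing sE.

Let S_integral p q : E p -> E q -> p < q ->
  (\int[leb]_(x in `]p, q[%classic) ((derive1 S x) ^+ 2)%:E = (s q - s p)%:E)%E.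
Proof.
move=> Ep Eq pq; rewrite -(iso.2 p q Ep Eq pq).
by rewrite (energy_cut_integral Ep Eq pq (slow_fin_energy sE Ep Eq pq)).
Qed.

Let ac_S p q : E p -> E q -> p < q -> ac_list S p q.
Proof.
move=> Ep Eq pq; have /abs_cont_onP H := sbar_slow_ac sE.
exact: H _ _ (ltW pq) (segment_Itv Ep Eq).
Qed.

(** The function [D - D ^ 2] is nonnegative almost everywhere because [0 <= D <= 1], and its
    integral is 0 by the energy identity. *)
Let ae01 p q : E p -> E q -> p < q ->
  {ae leb, forall x, p < x < q -> derivable S x 1 /\ (derive1 S x = 0 \/ derive1 S x = 1)}.
Proof.
move=> Ep Eq pq; have ac := ac_S Ep Eq pq; have dS := ac_derivable (ltW pq) ac.
have [iS eS] := ac_ftc (ltW pq) ac; have mS := ac_measurable (ltW pq) ac.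
have mI : measurable (`]p, q[%classic : set (measurableTypeR R)) by exact: measurable_itv.
set D := derive1 S in iS eS mS *.
have mD2 : measurable_fun (`]p, q[%classic : set (measurableTypeR R)) (fun x => (D x ^+ 2)%:E).
  by apply/measurable_EFinP; exact: measurable_funX.
have iS2 : leb.-integrable `]p, q[%classic (fun x => (D x ^+ 2)%:E).
  apply/integrableP; split=> //; under eq_integral do rewrite /= ger0_norm ?sqr_ge0 //.
  by rewrite S_integral // ltry.
have mdiff : measurable_fun (`]p, q[%classic : set (measurableTypeR R)) (fun x => (D x - D x ^+ 2)%:E).
  by apply/measurable_EFinP; apply: measurable_funB => //; exact: measurable_funX.
have Z : (\int[leb]_(x in `]p, q[%classic) `|(D x - D x ^+ 2)%:E| = 0)%E.
  transitivity (\int[leb]_(x in `]p, q[%classic) ((D x)%:E - (D x ^+ 2)%:E))%E.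
    apply: ae_eq_integral => //.
    - exact: measurableT_comp.
    - apply: aeS dS => x dx xpq; have dx' : derivable S x 1 by apply: dx; move: xpq; rewrite /= in_itv.
      have /andP[h0 h1] := sbar_slow_derive sE dx'.
      rewrite /= -EFinB ger0_norm // expr2 -[X in X - _]mulr1 -mulrBr mulr_ge0 // subr_ge0 //.
  rewrite integralB_EFin // eS S_integral // /S !sbar_in // -EFinB subrr //.
have /ae_eq_integral_abs AE := Z.
apply: aeS2 dS (AE mI mdiff) => x dx D0 xpq; have dx' := dx xpq; split=> //.
have : (D x - D x ^+ 2)%:E = 0%E by apply: D0; rewrite /= in_itv.
move=> [] /eqP; rewrite expr2 -[X in X - _]mulr1 -mulrBr mulf_eq0 subr_eq0 => /orP[/eqP ->|/eqP <-].
  by left.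
by right.
Qed.

Lemma isometric_in_S : in_S E s.
Proof.
split; [|split; [|split; [|split; [|split]]]].
- apply/continuous_onP => x Ex e e0; exists e => // y Ey; apply: le_lt_trans; exact: slow_dist sE Ex Ey.
- move=> x y /set_mem Ex /set_mem Ey; apply/idP/idP => [|xy]; last exact: si.
  by rewrite !ltNge; apply: contraNN; rewrite le_eqVlt => /predU1P[->//|/(si Ey Ex)/ltW].
- move=> x y /set_mem Ix /set_mem Iy; apply/idP/idP => [|xy]; last exact: (sbar_lt gE sE).
  by rewrite !ltNge; apply: contraNN => /(sbar_slow_homo gE sE).
- exact: sbar_slow_ac.
- have [a [b [Eab ab a_ni b_nd abE]]] := exhaust_seq (gapped_ex gE).
  have H n : {ae leb, forall x, a n < x < b n -> derivable S x 1 /\ (derive1 S x = 0 \/ derive1 S x = 1)}.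
    have [Ea Eb] := Eab n; have := ab n; rewrite le_eqVlt => /predU1P[->|]; last exact: ae01.
    by apply: aeW => x /andP[h1 h2]; have := lt_trans h1 h2; rewrite ltxx.
  have nE : {ae leb, forall x, Itv E x -> oitv E x}.
    exists [set fine (lend E); fine (rend E)]; split.
    + by apply: measurableU; exact: measurable_set1.
    + by apply: countable_lebesgue_measure0; exact/finite_set_countable/finite_set2.
    + by move=> x /= /not_implyP[Ix nO]; exact: Itv_ends.
  apply: aeS2 (ae_foralln H) nE => x Hx Ox /Ox/(oitvP _)[p [q [Ep Eq px xq]]].
  have [N _ HN] := filterI (abE p Ep) (abE q Eq).
  have [/andP[h1 h2] /andP[h3 h4]] := HN N (leqnn N).
  by apply: (Hx N); rewrite (le_lt_trans h1 px) (lt_le_trans xq h4).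
(* On a gap the derivative is the constant slope [m], and the energy identity over the gap reads
   [m ^ 2 = m] with [m > 0]. *)
- move=> x Ix nEx; have [//|[c [d [G cx xd]]]] := Itv_cases gE Ix.
  have [/= Ec [Ed [cd nE]]] := G; have [D e] := derive1_gap s G cx xd; split=> //; rewrite e.
  have dc : 0 < d - c by rewrite subr_gt0.
  set m := _ / _; have := S_integral Ec Ed cd.
  rewrite (@eq_integral _ _ _ leb _ (cst (m ^+ 2)%:E)); last first.
    by move=> y; rewrite inE /= in_itv /= => /andP[cy yd]; rewrite /S (derive1_gap s G cy yd).2.
  rewrite integral_cst; last exact: measurable_itv.
  rewrite [X in (_ * X)%E]lebesgue_measure_itv /= lte_fin cd -EFinB -EFinM => -[].
  have sdc : s d - s c = m * (d - c) by rewrite /m divfK // gt_eqF.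
  have m0 : 0 < m by rewrite divr_gt0 // subr_gt0 si.
  rewrite sdc => /(mulIf (lt0r_neq0 dc)); rewrite expr2 -[RHS]mulr1 => /(mulfI (lt0r_neq0 m0)).
  by [].
Qed.

End isometric_in_S.

End scale_class.

(** * Transfer of energies to the image of the scale *)

Section energy_transfer.
Context {R : realType} {E : set R} {s : R -> R} (si : increasing_on E s).
Implicit Types (g h : R -> R).
Let T := s @` E.

Lemma csum_image g c : csum s (g \o s) (g \o s) c = csum id g g (map s c).
Proof. by case: c => //= x c; elim: c x => //= y c IH x; rewrite IH. Qed.

Lemma chain_image c : chain E c -> chain T (map s c).
Proof.
move: c; apply: (@chain_ind R E) => [|x Ex|x y p Ex xy cc IH].
- by split.
- by apply: chain1; exists x.
- apply/chain_cons; split; [by exists x|exact: IH|].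
  rewrite -[_ :: map s p]/(map s (y :: p)) => _ /mapP[z zp ->]; have Ez : E z by case: cc => _; apply.
  apply: si => //; have /andP[yz _] := chain_last_ge cc zp; exact: lt_le_trans yz.
Qed.

Lemma chain_preimage c : chain T c -> exists2 c', chain E c' & c = map s c'.
Proof.
move: c; apply: (@chain_ind R T) => [|_ [x Ex <-]|_ y p [x Ex <-] xy cc [c' cc' e]].
- by exists [::].
- by exists [:: x] => //; exact: chain1.
- exists (x :: c'); last by rewrite /= -e.
  case: c' cc' e => // z c' cc' [e _]; apply/chain_cons; split=> // w wc.
  have Ez : E z by case/chain_cons : cc'.
  have xz : x < z.
    rewrite ltNge le_eqVlt; apply/negP => /predU1P[ez|/(si Ez Ex)].
      by move: xy; rewrite e ez ltxx.
    by rewrite -e ltNge (ltW xy).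
  have /andP[zw _] := chain_last_ge cc' wc; exact: lt_le_trans zw.
Qed.

Lemma fin_energy_image g : fin_energy s E (g \o s) <-> fin_energy id T g.
Proof.
split=> -[M HM]; exists M => c.
- by move=> /chain_preimage[c' cc' ->]; rewrite -csum_image; exact: HM.
- by move=> /chain_image cc; rewrite csum_image; exact: HM.
Qed.

(** The scale is an order isomorphism onto its image, so chains correspond and diagonal energies
    agree; polarisation gives the rest. *)
Lemma energy_image g h : fin_energy id T g -> fin_energy id T h ->
  energy s E (g \o s) (h \o s) = energy id T g h.
Proof.
have idT : increasing_on T id by [].
have diag u : fin_energy id T u -> energy s E (u \o s) (u \o s) = energy id T u u.
  move=> fu; rewrite !energyE //; last exact/fin_energy_image.
  congr (sup _); apply/seteqP; split=> _ [c cc <-].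
  - by exists (map s c); [exact: chain_image|rewrite csum_image].
  - by have [c' cc' ->] := chain_preimage cc; exists c' => //; rewrite csum_image.
move=> fg fh; have := diag _ (fin_energyD idT fg fh).
rewrite (energyD idT fg fh) /comp.
rewrite (energyD si ((fin_energy_image g).2 fg) ((fin_energy_image h).2 fh)).
have := diag _ fg; have := diag _ fh; rewrite /comp => -> ->; lra.
Qed.

End energy_transfer.

(** Absolute continuity speaks of compact subintervals; around each point one is found that is a
    neighbourhood within [Itv T], one-sided if the point is an end. *)
Lemma abs_cont_continuous {R : realType} {T : set R} (gT : gapped T) (g : R -> R) :
  abs_cont_on (Itv T) g -> {within Itv T, continuous g}.
Proof.
move=> /abs_cont_onP acg; apply/continuous_onP => x Ix e e0.
have [a [Ia ax [d1 d10 H1]]] : exists a, [/\ Itv T a, a <= x &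
    exists2 d : R, 0 < d & forall y, Itv T y -> `|x - y| < d -> a <= y].
  have [[a [Ia ax]]|nex] := pselect (exists a, Itv T a /\ a < x).
    exists a; split=> //; first exact: ltW.
    exists (x - a) => [|y _]; first by rewrite subr_gt0.
    by rewrite ltr_norml => /andP[]; lra.
  exists x; split=> //; exists 1 => // y Iy _.
  by rewrite leNgt; apply/negP => yx; apply: nex; exists y.
have [b [Ib xb [d2 d20 H2]]] : exists b, [/\ Itv T b, x <= b &
    exists2 d : R, 0 < d & forall y, Itv T y -> `|x - y| < d -> y <= b].
  have [[b [Ib xb]]|nex] := pselect (exists b, Itv T b /\ x < b).
    exists b; split=> //; first exact: ltW.
    exists (b - x) => [|y _]; first by rewrite subr_gt0.
    by rewrite ltr_norml => /andP[]; lra.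
  exists x; split=> //; exists 1 => // y Iy _.
  by rewrite leNgt; apply/negP => xy; apply: nex; exists y.
have sub : `[a, b]%classic `<=` Itv T.
  by move=> z; rewrite /= in_itv /= => /andP[]; exact: Itv_between.
have [d d0 H] := ac_list_dist (acg a b (le_trans ax xb) sub) e0.
exists (Num.min d (Num.min d1 d2)) => [|y Iy]; first by rewrite !lt_min d0 d10.
rewrite !lt_min => /and3P[yd yd1 yd2]; apply: H => //; first by rewrite ax.
by rewrite H1 // H2.
Qed.

(** * The form of a scale in terms of energies *)

Section scale_representation.
Context {R : realType} {mu : {measure set (measurableTypeR R) -> \bar R}} {E : set R}.
Context (gE : gapped E) (Hmu : radon_full_support E mu) {s : R -> R} (sE : slow E s).
Implicit Types (f g h : R -> R).
Local Notation leb := (@lebesgue_measure R).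
Let S := sbar E s.
Let T := s @` E.
Let si : increasing_on E s := slow_increasing sE.
Let gT : gapped T := gapped_image gE sE.
Let mE : measurable (E : set (measurableTypeR R)) := gapped_measurable gE.

Let preimage_Itv : sbar_inv (E := E) (s := s) @^-1` Itv E `&` Itv T = Itv T.
Proof.
apply/seteqP; split=> y; first by case.
by move=> Iy; split=> //; exact: (sbar_inv_Itv gE sE).
Qed.

Let preimage_E : sbar_inv (E := E) (s := s) @^-1` E `&` Itv T = T.
Proof.
apply/seteqP; split=> y; first by move=> [/= Ey Iy]; exact/(sbar_inv_E gE sE Iy).
by move=> Ty; split; [exact/(sbar_inv_E gE sE (sub_Itv Ty))|right].
Qed.

Let mdI g : abs_cont_on (oitv T) g ->
  measurable_fun (Itv T : set (measurableTypeR R)) (derive1 g).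
Proof.
move=> ag; apply/measurable_EFinP; apply: (measurable_fun_Itv (measurable_Itv gT) (@subset_refl _ _)).
apply/measurable_EFinP; apply: (measurable_funS (@measurable_oitv _ T) (@subIsetr _ _ _)).
exact: oitv_ac_measurable.
Qed.

Let integral_sqr_Itv g : abs_cont_on (oitv T) g ->
  (\int[dsbar E s]_(x in Itv E) ((derive1 g (S x)) ^+ 2)%:E = \int[leb]_(y in oitv T) ((derive1 g y) ^+ 2)%:E)%E.
Proof.
move=> ag; have m2 : measurable_fun (Itv T : set (measurableTypeR R)) (fun y => (derive1 g y) ^+ 2).
  by apply: measurable_funX; exact: mdI.
rewrite (integral_dsbar gE sE (measurable_Itv gE) (@subset_refl _ _) m2 (fun y => sqr_ge0 _)).
rewrite preimage_Itv (integral_Itv (measurable_Itv gT) (@subset_refl _ _)).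
  by rewrite (_ : Itv T `&` oitv T = oitv T) //; apply/setIidr; exact: oitv_Itv.
by apply/measurable_EFinP; apply: (measurable_funS (measurable_Itv gT) (@subIsetl _ _ _) m2).
Qed.

Lemma s_rep_ac p : s_rep E mu s p -> ac_rep (T := T) p.2.
Proof.
move=> [_ [ag [_ [/integrableP[_ gi] _]]]].
have agI : abs_cont_on (Itv T) p.2 by rewrite -(sbar_image gE sE).
have ago := oitv_abs_cont agI.
split; [exact: (abs_cont_continuous gT agI)|exact: ago|].
rewrite -(integral_sqr_Itv ago); apply: le_lt_trans gi.
rewrite le_eqVlt; apply/orP; left; apply/eqP/eq_integral => x _.
by rewrite /= ger0_norm // sqr_ge0.
Qed.

Lemma s_rep_in p x : s_rep E mu s p -> E x -> p.1 x = (p.2 \o s) x.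
Proof. by move=> [_ [_ [H _]]] Ex; rewrite H; [rewrite sbar_in|right]. Qed.

Lemma s_rep_form_dom p : s_rep E mu s p -> form_dom mu s E p.1.
Proof.
move=> rp; have [fg _] := ac_rep_fin_energy gT (s_rep_ac rp).
have [_ [_ [_ [_ [Lf [bl br]]]]]] := rp; split.
- have h := (fin_energy_image si _).2 fg.
  by apply: (eq_fin_energy si _ h) => x Ex; rewrite (s_rep_in rp Ex).
- exact: L2_setT_E.
- by apply: (end_cvg_cond gE) => -[]; [exact: bl|exact: br].
Qed.

(** The second component interpolates, in the image of [E], the function [f] transported by the
    inverse scale; composed with the extended scale it is the interpolation of [f]. *)
Lemma form_dom_s_rep f : form_dom mu s E f ->
  s_rep E mu s (sbar E f, sbar T (f \o scale_inv (E := E) (s := s))).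
Proof.
move=> [ff Lf ef]; set k := f \o _.
have fk x : E x -> f x = (k \o s) x by move=> Ex; rewrite /k /= (scale_invK sE).
have fg : fin_energy id T k by apply/(fin_energy_image si); exact: eq_fin_energy fk ff.
have [cg ag gi] := sbar_ac_rep gT fg; have bf := sbar_end_cvg gE ef.
have comp x : Itv E x -> sbar E f x = sbar T k (S x).
  by move=> Ix; rewrite (sbar_scale gE sE) //; apply: (sbar_ext gE).
have cf : {within Itv E, continuous (sbar E f)}.
  apply/continuous_onP => x Ix e e0; have Sx := sbar_Itv gE sE Ix.
  have /continuous_onP /(_ _ Sx e e0) [d d0 H] := cg.
  exists d => // y Iy xy; rewrite !comp //; apply: H; first exact: sbar_Itv.
  apply: le_lt_trans xy.
  have [xy|/ltW yx] := leP x y.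
  - by have /andP[h1 h2] := sbar_slow_R gE sE xy; rewrite distrC [leRHS]distrC !ger0_norm // subr_ge0.
  - by have /andP[h1 h2] := sbar_slow_R gE sE yx; rewrite !ger0_norm // subr_ge0.
split=> //=; split; first by rewrite (sbar_image gE sE); exact: (sbar_abs_cont gT fg).
split; first exact: comp.
split.
  have mg := mdI ag.
  have m2 : measurable_fun (Itv T : set (measurableTypeR R)) (fun y => (derive1 (sbar T k) y) ^+ 2).
    exact: measurable_funX.
  apply/integrableP; split.
    apply/measurable_EFinP; apply: (measurable_comp (measurable_Itv gT) _ m2).
      by move=> _ [x Ix <-]; exact: (sbar_Itv gE sE).
    apply: (measurable_funS measurableT) => //; exact: (continuous_measurable_fun (sbar_slow_continuous gE sE)).
  apply: le_lt_trans gi; rewrite -(integral_sqr_Itv ag).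
  rewrite le_eqVlt; apply/orP; left; apply/eqP/eq_integral => x _.
  by rewrite /= ger0_norm // sqr_ge0.
split; last by split; [exact: (bf true)|exact: (bf false)].
apply: (L2_E_setT gE Hmu); first exact: sbar_measurable.
by apply: eq_L2 Lf => x /set_mem Ex; rewrite sbar_in.
Qed.

(** The change of variables [integral_dsbar] is for nonnegative integrands; positive and negative
    parts are obtained with [c = 1] and [c = -1]. *)
Let integral_E (w : R -> R) : measurable_fun (Itv T : set (measurableTypeR R)) w ->
  (\int[dsbar E s]_(x in E) (w (S x))%:E = \int[leb]_(y in T) (w y)%:E)%E.
Proof.
move=> mw.
have P (c : R) : (\int[dsbar E s]_(x in E) (Num.max (c * w (S x)) 0)%:E = \int[leb]_(y in T) (Num.max (c * w y) 0)%:E)%E.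
  rewrite (integral_dsbar gE sE mE (@sub_Itv _ E) (w := fun y => Num.max (c * w y) 0)).
  - by rewrite preimage_E.
  - by apply: measurable_maxr; [apply: measurable_funM; [exact: measurable_cst|exact: mw]|exact: measurable_cst].
  - by move=> y; rewrite le_max lexx orbT.
have pos : (\int[dsbar E s]_(x in E) (fun x => (w (S x))%:E)^\+ x = \int[leb]_(y in T) (fun y => (w y)%:E)^\+ y)%E.
  transitivity (\int[dsbar E s]_(x in E) (Num.max (1 * w (S x)) 0)%:E)%E.
    by apply: eq_integral => x _; rewrite funeposE EFin_max mul1r.
  by rewrite P; apply: eq_integral => x _; rewrite funeposE EFin_max mul1r.
have neg : (\int[dsbar E s]_(x in E) (fun x => (w (S x))%:E)^\- x = \int[leb]_(y in T) (fun y => (w y)%:E)^\- y)%E.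
  transitivity (\int[dsbar E s]_(x in E) (Num.max (-1 * w (S x)) 0)%:E)%E.
    by apply: eq_integral => x _; rewrite funenegE EFin_max mulN1r EFinN.
  by rewrite P; apply: eq_integral => x _; rewrite funenegE EFin_max mulN1r EFinN.
rewrite [LHS]integralE [RHS]integralE pos neg.
reflexivity.
Qed.

Let gap_sum_image (c : R * R -> R) : gap_sum E (fun p => c (s p.1, s p.2)) = gap_sum T c.
Proof.
pose e (p : R * R) := (s p.1, s p.2).
have bij : set_bij (gaps E) (gaps T) e.
  split.
  - by move=> [p q] G; exact: gap_image.
  - move=> [p q] [p' q'] /set_mem[/= Ep [Eq _]] /set_mem[/= Ep' [Eq' _]] [e1 e2].
    by rewrite (scale_inj sE Ep Ep' e1) (scale_inj sE Eq Eq' e2).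
  - move=> [_ _] [/= [p Ep <-] [[q Eq <-] [pq nT]]]; exists (p, q) => //; split=> //=; split=> //.
    have pq' : p < q.
      rewrite ltNge le_eqVlt; apply/negP => /predU1P[h|/(si Eq Ep)]; first by rewrite h ltxx in pq.
      by rewrite ltNge (ltW pq).
    split=> // x /andP[px xq] Ex; apply: (nT (s x)); last by exists x.
    by rewrite !si.
by rewrite /gap_sum; congr (fine _ - fine _); rewrite (reindex_esum (gaps E) (gaps T) e).
Qed.

(** Integral and gap sum are carried to the image of [E] under [s], where they form the expression
    of [energy_formula] for the identity scale; the energy returns to [E] by [energy_image]. *)
Theorem scale_represents : represents (mu := mu) (E := E) s (sF E mu s) (Defs.sE E mu s).
Proof.
apply: (@represents_pick _ mu E gE Hmu _ (fun=> 0, fun=> 0) (s_rep E mu s) fst (s_formula E s) s sE) => /=.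
- by move=> p; exact: s_rep_form_dom.
- move=> f df; exists (sbar E f, sbar T (f \o scale_inv (E := E) (s := s))); first exact: form_dom_s_rep.
  by move=> x Ex; rewrite /= sbar_in.
- move=> p q rp rq; rewrite /s_formula -mulrDr; congr (_ * _).
  have ap := s_rep_ac rp; have aq := s_rep_ac rq; have [_ ap' _] := ap; have [_ aq' _] := aq.
  have [fp _] := ac_rep_fin_energy gT ap; have [fq _] := ac_rep_fin_energy gT aq.
  rewrite (eq_energy (f' := p.2 \o s) (g' := q.2 \o s)); last 2 first.
  - by move=> x Ex; exact: s_rep_in.
  - by move=> x Ex; exact: s_rep_in.
  rewrite (energy_image si fp fq) (energy_formula gT ap aq); apply: f_equal2.
    apply: f_equal; apply: (integral_E (w := fun y => derive1 p.2 y * derive1 q.2 y)).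
    exact: (measurable_funM (mdI ap') (mdI aq')).
  rewrite -gap_sum_image /gap_sum; apply: f_equal2; [|apply: f_equal]; apply: f_equal;
  apply: eq_esum => -[a b] [/= Ea [Eb _]]; by rewrite !(s_rep_in rp) // !(s_rep_in rq).
Qed.

End scale_representation.

Theorem theorem3p2 (R : realType) (E : set R)
    (mu : {measure set (measurableTypeR R) -> \bar R})
    (HE : in_K E) (Hmu : radon_full_support E mu)
    (F' : set (R -> R)) (Ef' : (R -> R) -> (R -> R) -> R) :
  fukushima_subspace E mu (qdF E mu) (qdE E mu) F' Ef' <->
  exists s : R -> R, in_S E s /\ F' = sF E mu s /\
    (forall f g, F' f -> F' g -> Ef' f g = sE E mu s f g).
Proof.
have gE := in_K_gapped HE.
have rep0 := quasidiffusion_represents gE Hmu.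
split.
- move=> /(fukushima_scale gE Hmu rep0)[s [iso [-> EP]]].
  have inS := isometric_in_S gE iso; have [sFE sEP] := scale_represents gE Hmu iso.1.
  exists s; split=> //; split=> // f g Ff Fg.
  (* Both forms are evaluated on the same members of the form domain, each being half the energy for
     [s]. *)
  have [_ [f' [df ff]]] := Ff; have [_ [g' [dg gg]]] := Fg.
  by rewrite (EP f g f' g') // (sEP f g f' g') // sFE.
- move=> [s [inS [-> EP]]]; have iso := in_S_isometric gE inS.
  have [sFE sEP] := scale_represents gE Hmu iso.1.
  apply: (scale_fukushima gE Hmu rep0 iso); split=> // h k f g Fh Fk df dg hf kg.
  by rewrite EP //; exact: sEP Fh Fk df dg hf kg.
Qed.
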